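(* Let $p>3$ be prime and suppose $0\le m\le p-1$. Then: (i) $\mathcal K_{p,0}(z)$ is a weakly holomorphic modular form of weight $1$ on $\Gamma_1(p)$. (ii) If $1\le m\le p-1$ then $\mathcal K_{p,m}(z)$ is a weakly holomorphic modular form of weight $1$ on $\Gamma(p)$. In particular, $$\mathcal K_{p,m}(z)\big|[A]_1=\exp\left(\frac{2\pi ibm}p\right)\mathcal K_{p,m}(z)$$ for $A=\begin{pmatrix}a&b\\c&d\end{pmatrix}\in\Gamma_1(p)$.
   Context: Notation: $z$ is in the upper half plane, $q=\exp(2\pi iz)$, $q^r=\exp(2\pi irz)$, $(q;q)_\infty=\prod_{n\ge1}(1-q^n)$, $\eta(z)=q^{1/24}(q;q)_\infty$, and $(F|[A]_1)(z)=(cz+d)^{-1}F\left(\frac{az+b}{cz+d}\right)$. $\chi_{12}(n)=1$ if $n\equiv\pm1\pmod{12}$, $-1$ if $n\equiv\pm5\pmod{12}$, $0$ otherwise. For $p>3$ prime and $1\le\ell\le\frac12(p-1)$ set $$\mathcal N\left(\tfrac1p;z\right)=\csc\left(\tfrac\pi p\right)\frac{q^{-1/24}}{(q;q)_\infty}\left(1+\sum_{n=1}^\infty\frac{(-1)^n(1+q^n)(2-2\cos(2\pi/p))}{1-2\cos(2\pi/p)q^n+q^{2n}}q^{\frac12n(3n+1)}\right),$$ $$\mathcal M\left(\tfrac\ell p;z\right)=\frac{2q^{\frac{3\ell}{2p}(1-\frac\ell p)-\frac1{24}}}{(q;q)_\infty}\sum_{n\in\mathbb Z}\frac{(-1)^nq^{n+\ell/p}}{1-q^{n+\ell/p}}q^{\frac32n(n+1)},$$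 $$\varepsilon_2\left(\tfrac\ell p;z\right)=\begin{cases}2\exp\left(-3\pi iz(\frac\ell p-\frac16)^2\right)&0<\frac\ell p<\frac16,\\0&\frac16<\frac\ell p<\frac56,\end{cases}$$ $$\mathcal J\left(\tfrac1p;z\right)=\eta(p^2z)\left(\mathcal N\left(\tfrac1p;z\right)-2\chi_{12}(p)\sum_{\ell=1}^{\frac12(p-1)}(-1)^\ell\sin\left(\tfrac{6\ell\pi}p\right)\left(\mathcal M\left(\tfrac\ell p;p^2z\right)+\varepsilon_2\left(\tfrac\ell p;p^2z\right)\right)\right).$$ For $0\le m\le p-1$, $$\mathcal K_{p,m}(z):=\sin\left(\tfrac\pi p\right)\cdot\frac1p\sum_{r=0}^{p-1}\exp\left(-\tfrac{2\pi irm}p\right)\mathcal J\left(\tfrac1p;\tfrac{z+r}p\right).$$ A weakly holomorphic modular form is holomorphic on the upper half plane, transforms as a modular form, and is allowed poles at the cusps. *)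

(* Defs.v *)
From Stdlib Require Export Reals ZArith Znumtheory.
From Coquelicot Require Export Coquelicot.

Open Scope C_scope.

Definition Cexp (w : C) : C :=
  (exp (Re w) * cos (Im w), exp (Re w) * sin (Im w))%R.

(* The unique sum, or limit, when there is one; unspecified otherwise. *)
Definition Cseries (a : nat -> C) : C :=
  iota (T := C_CompleteNormedModule)
    (fun s => is_series (K := C_AbsRing) (V := C_NormedModule) a s).

Definition Climit (u : nat -> C) : C :=
  iota (T := C_CompleteNormedModule)
    (fun l => filterlim u eventually (locally l)).

(* Sum over all integers, as [n >= 0] plus [n <= -1]; used only for absolutely
   convergent series. *)
Definition CseriesZ (a : Z -> C) : C :=
  Cseries (fun n => a (Z.of_nat n)) + Cseries (fun n => a (- Z.of_nat (S n))%Z).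

Fixpoint Cprod_1n (f : nat -> C) (n : nat) : C :=
  match n with
  | O => 1
  | S k => Cprod_1n f k * f (S k)
  end.

Definition upper_half (z : C) : Prop := (0 < Im z)%R.

(* [qpow r z] is [q^r] with [q = exp (2 pi i z)]; it is not a power of the
   complex number [q] when [r] is not an integer. *)
Definition qpow (r : R) (z : C) : C := Cexp (RtoC (2 * PI * r) * Ci * z).

Definition qpoch (z : C) : C :=
  Climit (Cprod_1n (fun n => 1 - qpow (INR n) z)).

Definition eta (z : C) : C := qpow (1 / 24) z * qpoch z.

Definition m1pow (n : Z) : C := if Z.even n then 1 else - (1).

Definition chi12 (n : Z) : R :=
  match (n mod 12)%Z with
  | 1%Z | 11%Z => 1%R
  | 5%Z | 7%Z => (-1)%R
  | _ => 0%R
  end.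

Record SL2Z := mkSL2Z {
  ma : Z; mb : Z; mc : Z; md : Z;
  det1 : (ma * md - mb * mc = 1)%Z }.

Definition moebius (A : SL2Z) (z : C) : C :=
  (RtoC (IZR (ma A)) * z + RtoC (IZR (mb A)))
  / (RtoC (IZR (mc A)) * z + RtoC (IZR (md A))).

Definition slash (k : nat) (F : C -> C) (A : SL2Z) (z : C) : C :=
  / ((RtoC (IZR (mc A)) * z + RtoC (IZR (md A))) ^ k) * F (moebius A z).

Definition congr (N a b : Z) : Prop := (N | a - b)%Z.

Definition Gamma1 (N : Z) (A : SL2Z) : Prop :=
  congr N (ma A) 1 /\ congr N (mc A) 0 /\ congr N (md A) 1.

Definition Gamma (N : Z) (A : SL2Z) : Prop :=
  congr N (ma A) 1 /\ congr N (mb A) 0 /\ congr N (mc A) 0 /\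
  congr N (md A) 1.

Definition holomorphic_on_H (F : C -> C) : Prop :=
  forall z : C, upper_half z ->
    ex_derive (K := C_AbsRing) (V := C_NormedModule) F z.

(* [F] has an expansion in integral powers of [q^(1/N)], for some [N >= 1],
   with only finitely many negative powers. *)
Definition meromorphic_at_infinity (F : C -> C) : Prop :=
  exists (N : nat) (n0 : Z) (c : nat -> C), (1 <= N)%nat /\
    forall z : C, upper_half z ->
      is_series (K := C_AbsRing) (V := C_NormedModule)
        (fun n => c n * qpow (IZR (n0 + Z.of_nat n) / INR N) z) (F z).

(* The last clause is the condition at the cusp [A(i oo)]; every cusp is of this
   form. *)
Definition weakly_holomorphic_modular_form
    (k : nat) (G : SL2Z -> Prop) (F : C -> C) : Prop :=
  holomorphic_on_H F /\
  (forall A : SL2Z, G A ->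
     forall z : C, upper_half z -> slash k F A z = F z) /\
  (forall A : SL2Z, meromorphic_at_infinity (slash k F A)).

Definition Nfun (p : nat) (z : C) : C :=
  let c := (2 * cos (2 * PI / INR p))%R in
  RtoC (/ sin (PI / INR p)) * (qpow (- (1 / 24)) z / qpoch z) *
  (1 + Cseries (fun k =>
         let n := S k in
         (m1pow (Z.of_nat n) * (1 + qpow (INR n) z) * RtoC (2 - c))
         / (1 - RtoC c * qpow (INR n) z + qpow (2 * INR n) z)
         * qpow (1 / 2 * INR n * (3 * INR n + 1)) z)).

(* In [Mfun] and [epsilon2], [x] stands for [l/p]. *)
Definition Mfun (x : R) (z : C) : C :=
  (2 * qpow (3 * x / 2 * (1 - x) - 1 / 24) z) / qpoch z *
  CseriesZ (fun n =>
    (m1pow n * qpow (IZR n + x) z) / (1 - qpow (IZR n + x) z)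
    * qpow (3 / 2 * IZR n * (IZR n + 1)) z).

(* Only evaluated at [0 < x < 5/6], [x <> 1/6]. *)
Definition epsilon2 (x : R) (z : C) : C :=
  if Rlt_dec x (1 / 6) then
    2 * Cexp (- (RtoC (3 * PI) * Ci * z * RtoC ((x - 1 / 6) ^ 2)%R))
  else 0.

Definition Jfun (p : nat) (z : C) : C :=
  let w := RtoC (INR p ^ 2)%R * z in
  eta w *
  (Nfun p z
   - RtoC (2 * chi12 (Z.of_nat p)) *
     sum_n_m (G := C_AbelianGroup)
       (fun l => m1pow (Z.of_nat l) * RtoC (sin (6 * INR l * PI / INR p))
                 * (Mfun (INR l / INR p) w + epsilon2 (INR l / INR p) w))
       1 ((p - 1) / 2)).

Definition Kfun (p m : nat) (z : C) : C :=
  RtoC (sin (PI / INR p)) * RtoC (1 / INR p) *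
  sum_n (G := C_AbelianGroup)
    (fun r => Cexp (- (RtoC (2 * PI * INR r * INR m / INR p) * Ci))
              * Jfun p ((z + RtoC (INR r)) / RtoC (INR p)))
    (p - 1).

(* Main.v *)
Require Import Defs.
From Stdlib Require Import Lra Lia Psatz Classical ClassicalEpsilon.

(** Write e(w) = exp(2 pi i w) and q = e(tau). The proof is about one function of
    two variables, the Appell function

      B(u; tau) = e(u/2) Sum_n (-1)^n q^(n(3n+1)/2) / (1 - e(u) q^n),

    which is odd in u, changes sign under u -> u + 1, and is quasi-periodic of
    index -3/2 under u -> u + tau up to two exponentials multiplied by
    P(tau) = (q;q)_oo ([appell_add_tau]; Euler's pentagonal number theorem is what
    turns the theta constant that arises there into the product). Up to elementary
    factors N(1/p; tau) is B(1/p; tau), and M(l/p; pz) + eps_2(l/p; pz) is B(lz; pz)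
    minus the single exponential that belongs to 6l > p ([Nfun_appell],
    [Mfun_appell], [M_eps]). So J(1/p; z/p) is made of values of Appell functions
    at torsion points, but J itself carries no elliptic variable. The idea of the
    proof is to put one back. With r(z) = eta(pz) / eta(z/p) put

      E(u; z) = r(z) Sum_(j < p) (-1)^j B((u+j)/p; z/p) - p chi12(p) B(u; pz).

    Translation of u by l z + m acts through operators of index -3/2 / p. Summation
    over j kills all the exponentials in the quasi-period of the first term except
    the two that the second term has as well, and the constant p chi12(p) is the
    one for which they cancel. Hence E is invariant, without any correction, under
    the translations by p z and by 1 ([lattice_form_inv]).

    Let gamma be in Gamma(p) and let E' be E(.; gamma z) acted on by gamma as a
    Jacobi form of weight 1 and index -3/2 / p. Then E' is invariant under the same
    translations as E, and both have simple poles, with computable residues, at the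
    points of Z z + Z. The function h = E' - E - (r(gamma z) - r(z)) G, with G the
    sum over j above, has all its residues equal to 0. It extends to an entire
    function that is quasi-periodic of negative index, up to an explicit
    inhomogeneous term proportional to r(gamma z) - r(z). Its Fourier coefficients
    satisfy a three-step recursion along which they grow without bound unless they
    vanish; the inhomogeneous term is thereby forced to be 0 as well ([liouville]).
    Therefore r is invariant under gamma, and E' = E ([lattice_form_transform]).

    To return to J, translate E by l z, average over u and -u, which removes the
    pole at 0, and let u tend to 0. The result, weighted by sin(6 pi l / p) and
    summed over 1 <= l <= (p-1)/2, is (p/4) J(1/p; z/p): the values B(lz; pz) are
    those of M, and the finite sine sum inverts the Fourier transform in j and
    isolates B(1/p; z/p) ([sine_inversion], [sine_comb_reg_0]). The law of E now
    gives weight 1 under Gamma(p) for z |-> J(1/p; z/p) ([Jp_transform]).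

    K_(p,m) is the component of that function on which z -> z + 1 acts by
    e(m/p). For A in Gamma_1(p) the matrix T^r A T^(-r-b) lies in Gamma(p), so A
    permutes the translates and multiplies K_(p,m) by e(bm/p) ([slash_gamma1]).
    At a cusp, K_(p,m) | A has period p because Gamma(p) is normal. A crude bound
    |J(1/p; z/p)| <= exp(C (1 + y + 1/y)) shows that K_(p,m) | A is O(exp(kappa y))
    high up in the half plane, and so only finitely many of its Fourier
    coefficients of negative index are nonzero ([meromorphic_of_growth]).

    The function theory behind this is that of functions whose complex derivative
    exists and is continuous. For a periodic function of this kind the integral
    over a horizontal period does not depend on the height; the convergence of
    Fourier expansions, Cauchy's estimate for a derivative, and from it the
    holomorphy of locally uniformly convergent series, all follow from this. *)

Open Scope C_scope.

(** * Complex differentiability *)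

Definition cnear (s : C) (P : C -> Prop) : Prop :=
  exists d : R, (0 < d)%R /\ forall w, (Cmod (w - s) < d)%R -> P w.

Definition ccont (f : C -> C) (s : C) : Prop :=
  forall eps : R, (0 < eps)%R -> cnear s (fun w => (Cmod (f w - f s) < eps)%R).

(** The error bound is multiplied out by |w - s|, so that it makes sense at w = s as well;
    [cderiv_is_derive] identifies this with the usual notion. *)
Definition cderiv (f : C -> C) (s l : C) : Prop :=
  forall eps : R, (0 < eps)%R ->
    cnear s (fun w => (Cmod (f w - f s - l * (w - s)) <= eps * Cmod (w - s))%R).

(** Continuity of the derivative is included so that one may differentiate under the
    integral sign; Cauchy's theorem over a horizontal period is then a computation. *)
Definition chol (f : C -> C) (s : C) : Prop :=
  exists f' : C -> C, cnear s (fun w => cderiv f w (f' w) /\ ccont f' w).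

Lemma Cmod_minus_sym x y : Cmod (x - y) = Cmod (y - x).
Proof. rewrite <- Cmod_opp. f_equal. ring. Qed.

Lemma Cmod_triangle_sub x y : (Cmod x - Cmod y <= Cmod (x - y))%R.
Proof.
  assert (H := Cmod_triangle (x - y) y).
  replace (x - y + y) with x in H by ring. lra.
Qed.

Lemma Cmod_triangle3 x y z : (Cmod (x - z) <= Cmod (x - y) + Cmod (y - z))%R.
Proof.
  replace (x - z) with ((x - y) + (y - z)) by ring. apply Cmod_triangle.
Qed.

Lemma cnear_point s P : cnear s P -> P s.
Proof.
  intros [d [Hd H]]. apply H. replace (s - s) with (RtoC 0) by ring.
  rewrite Cmod_0. exact Hd.
Qed.

Lemma cnear_and s P Q : cnear s P -> cnear s Q -> cnear s (fun w => P w /\ Q w).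
Proof.
  intros [d [Hd H]] [e [He K]]. exists (Rmin d e). split.
  - apply Rmin_glb_lt; assumption.
  - intros w Hw. assert (A := Rmin_l d e). assert (B := Rmin_r d e).
    split; [apply H | apply K]; lra.
Qed.

Lemma cnear_imp s (P Q : C -> Prop) : (forall w, P w -> Q w) -> cnear s P -> cnear s Q.
Proof. intros H [d [Hd K]]. exists d. split; auto. Qed.

Lemma cnear_near s P : cnear s P -> cnear s (fun w => cnear w P).
Proof.
  intros [d [Hd H]]. exists d. split; [exact Hd|].
  intros w Hw. exists (d - Cmod (w - s))%R. split; [lra|].
  intros v Hv. apply H. assert (A := Cmod_triangle3 v w s). lra.
Qed.

Lemma cnear_ball s r : (0 < r)%R -> cnear s (fun w => (Cmod (w - s) < r)%R).
Proof. intros H. exists r. split; auto. Qed.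

Lemma cderiv_is_derive f s l :
  cderiv f s l <-> is_derive (K := C_AbsRing) (V := C_NormedModule) f s l.
Proof.
  split.
  - intros H. split.
    + apply is_linear_scal_l.
    + intros x Hx.
      apply (is_filter_lim_locally_unique (V := AbsRing_NormedModule C_AbsRing)) in Hx.
      subst x.
      intros eps. destruct (H eps (cond_pos eps)) as [d [Hd K]].
      exists (mkposreal d Hd). intros y Hy.
      specialize (K y Hy).
      unfold minus, plus, opp, scal, norm; simpl. unfold mult; simpl.
      replace (f y + - f s + - ((y + - s) * l)) with (f y - f s - l * (y - s)) by ring.
      exact K.
  - intros [_ H] eps Heps.
    specialize (H s (fun P HP => HP) (mkposreal eps Heps)).
    destruct H as [d K]. exists d. split; [apply cond_pos|].
    intros w Hw. specialize (K w Hw).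
    unfold minus, plus, opp, scal, norm in K; simpl in K. unfold mult in K; simpl in K.
    replace (f w - f s - l * (w - s)) with (f w + - f s + - ((w + - s) * l)) by ring.
    exact K.
Qed.

Lemma cderiv_is_derive_ring f s l :
  cderiv f s l <-> is_derive (K := C_AbsRing) (V := AbsRing_NormedModule C_AbsRing) f s l.
Proof.
  split.
  - intros H. split.
    + apply is_linear_scal_l.
    + intros x Hx.
      apply (is_filter_lim_locally_unique (V := AbsRing_NormedModule C_AbsRing)) in Hx.
      subst x.
      intros eps. destruct (H eps (cond_pos eps)) as [d [Hd K]].
      exists (mkposreal d Hd). intros y Hy.
      specialize (K y Hy).
      unfold minus, plus, opp, scal, norm; simpl. unfold mult; simpl.
      replace (f y + - f s + - ((y + - s) * l)) with (f y - f s - l * (y - s)) by ring.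
      exact K.
  - intros [_ H] eps Heps.
    specialize (H s (fun P HP => HP) (mkposreal eps Heps)).
    destruct H as [d K]. exists d. split; [apply cond_pos|].
    intros w Hw. specialize (K w Hw).
    unfold minus, plus, opp, scal, norm in K; simpl in K. unfold mult in K; simpl in K.
    replace (f w - f s - l * (w - s)) with (f w + - f s + - ((w + - s) * l)) by ring.
    exact K.
Qed.

Lemma cderiv_plus f g s a b :
  cderiv f s a -> cderiv g s b -> cderiv (fun w => f w + g w) s (a + b).
Proof.
  intros H K. apply cderiv_is_derive in H, K. apply cderiv_is_derive.
  exact (is_derive_plus (K := C_AbsRing) (V := C_NormedModule) f g s a b H K).
Qed.

Lemma cderiv_mult f g s a b :
  cderiv f s a -> cderiv g s b -> cderiv (fun w => f w * g w) s (a * g s + f s * b).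
Proof.
  intros H K. apply cderiv_is_derive_ring in H, K. apply cderiv_is_derive_ring.
  exact (is_derive_mult (K := C_AbsRing) f g s a b H K Cmult_comm).
Qed.

Lemma cderiv_comp f g s a b :
  cderiv f (g s) a -> cderiv g s b -> cderiv (fun w => f (g w)) s (b * a).
Proof.
  intros H K. apply cderiv_is_derive in H. apply cderiv_is_derive_ring in K. apply cderiv_is_derive.
  exact (is_derive_comp (K := C_AbsRing) (V := C_NormedModule) f g s a b H K).
Qed.

Lemma cderiv_const c s : cderiv (fun _ => c) s 0.
Proof.
  intros eps He. exists 1%R. split; [lra|]. intros w _.
  replace (c - c - 0 * (w - s)) with (RtoC 0) by ring. rewrite Cmod_0.
  apply Rmult_le_pos; [lra|apply Cmod_ge_0].
Qed.

Lemma cderiv_id s : cderiv (fun w => w) s 1.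
Proof.
  intros eps He. exists 1%R. split; [lra|]. intros w _.
  replace (w - s - 1 * (w - s)) with (RtoC 0) by ring. rewrite Cmod_0.
  apply Rmult_le_pos; [lra|apply Cmod_ge_0].
Qed.

Lemma cderiv_affine a b s : cderiv (fun w => a * w + b) s a.
Proof.
  intros eps He. exists 1%R. split; [lra|]. intros w _.
  replace (a * w + b - (a * s + b) - a * (w - s)) with (RtoC 0) by ring. rewrite Cmod_0.
  apply Rmult_le_pos; [lra|apply Cmod_ge_0].
Qed.

Lemma cderiv_eq f s a b : cderiv f s a -> a = b -> cderiv f s b.
Proof. intros H <-. exact H. Qed.

Lemma cderiv_ext f g s a : cnear s (fun w => f w = g w) -> cderiv f s a -> cderiv g s a.
Proof.
  intros E H eps He. assert (E0 := cnear_point _ _ E).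
  refine (cnear_imp _ _ _ _ (cnear_and _ _ _ E (H eps He))).
  intros w [A B]. rewrite <- E0, <- A. exact B.
Qed.

Lemma cderiv_lip f s a :
  cderiv f s a ->
  cnear s (fun w => (Cmod (f w - f s) <= (Cmod a + 1) * Cmod (w - s))%R).
Proof.
  intros H. refine (cnear_imp _ _ _ _ (H 1%R Rlt_0_1)). intros w Hw.
  replace (f w - f s) with ((f w - f s - a * (w - s)) + a * (w - s)) by ring.
  eapply Rle_trans; [apply Cmod_triangle|]. rewrite Cmod_mult. lra.
Qed.

Lemma cderiv_cont f s a : cderiv f s a -> ccont f s.
Proof.
  intros H eps He. destruct (cderiv_lip _ _ _ H) as [d [Hd K]].
  assert (P : (0 < Cmod a + 1)%R) by (assert (X := Cmod_ge_0 a); lra).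
  assert (Q : (0 < eps / (Cmod a + 1))%R) by (apply Rdiv_lt_0_compat; lra).
  exists (Rmin d (eps / (Cmod a + 1))). split; [apply Rmin_glb_lt; lra|].
  intros w Hw. assert (A := Rmin_l d (eps / (Cmod a + 1))).
  assert (B := Rmin_r d (eps / (Cmod a + 1))).
  eapply Rle_lt_trans; [apply K; lra|].
  apply Rlt_le_trans with ((Cmod a + 1) * (eps / (Cmod a + 1)))%R.
  - apply Rmult_lt_compat_l; lra.
  - right. field. lra.
Qed.

Lemma ccont_ext f g s : cnear s (fun w => f w = g w) -> ccont f s -> ccont g s.
Proof.
  intros E H eps He. assert (E0 := cnear_point _ _ E).
  refine (cnear_imp _ _ _ _ (cnear_and _ _ _ E (H eps He))).
  intros w [A B]. rewrite <- E0, <- A. exact B.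
Qed.

Lemma ccont_const c s : ccont (fun _ => c) s.
Proof. eapply cderiv_cont, cderiv_const. Qed.

Lemma ccont_plus f g s : ccont f s -> ccont g s -> ccont (fun w => f w + g w) s.
Proof.
  intros H K eps He.
  assert (P : (0 < eps / 2)%R) by lra.
  refine (cnear_imp _ _ _ _ (cnear_and _ _ _ (H _ P) (K _ P))).
  intros w [A B].
  replace (f w + g w - (f s + g s)) with ((f w - f s) + (g w - g s)) by ring.
  eapply Rle_lt_trans; [apply Cmod_triangle|]. lra.
Qed.

Lemma ccont_mult f g s : ccont f s -> ccont g s -> ccont (fun w => f w * g w) s.
Proof.
  intros H K eps He.
  set (a := Cmod (f s)). set (b := Cmod (g s)).
  assert (Ha : (0 <= a)%R) by apply Cmod_ge_0.
  assert (Hb : (0 <= b)%R) by apply Cmod_ge_0.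
  set (e := Rmin 1 (eps / (2 * (a + b + 1)))).
  assert (P : (0 < e)%R).
  { apply Rmin_glb_lt; [lra|]. apply Rdiv_lt_0_compat; lra. }
  refine (cnear_imp _ _ _ _ (cnear_and _ _ _ (H _ P) (K _ P))).
  intros w [A B].
  replace (f w * g w - f s * g s)
    with ((f w - f s) * (g w - g s) + ((f w - f s) * g s + f s * (g w - g s))) by ring.
  eapply Rle_lt_trans; [apply Cmod_triangle|].
  eapply Rle_lt_trans; [apply Rplus_le_compat_l, Cmod_triangle|].
  rewrite !Cmod_mult. fold a. fold b.
  set (x := Cmod (f w - f s)) in *. set (y := Cmod (g w - g s)) in *.
  assert (0 <= x)%R by apply Cmod_ge_0. assert (0 <= y)%R by apply Cmod_ge_0.
  assert (e <= 1)%R by apply Rmin_l.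
  assert (E2 : (e <= eps / (2 * (a + b + 1)))%R) by apply Rmin_r.
  assert (E3 : (e * (a + b + 1) <= eps / 2)%R).
  { apply Rle_trans with (eps / (2 * (a + b + 1)) * (a + b + 1))%R.
    - apply Rmult_le_compat_r; lra.
    - right. field. lra. }
  nra.
Qed.

Lemma ccont_comp f g s : ccont f (g s) -> ccont g s -> ccont (fun w => f (g w)) s.
Proof.
  intros H K eps He. destruct (H eps He) as [d [Hd A]].
  refine (cnear_imp _ _ _ _ (K d Hd)). intros w Hw. apply A. exact Hw.
Qed.

Lemma ccont_neq0 f s : ccont f s -> f s <> 0 -> cnear s (fun w => f w <> 0).
Proof.
  intros H N. assert (P := proj1 (Cmod_gt_0 _) N).
  refine (cnear_imp _ _ _ _ (H _ P)). intros w Hw E. rewrite E in Hw.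
  replace (0 - f s) with (- f s) in Hw by ring. rewrite Cmod_opp in Hw. lra.
Qed.

Lemma ccont_lower f s : ccont f s -> f s <> 0 ->
  cnear s (fun w => (Cmod (f s) / 2 < Cmod (f w))%R).
Proof.
  intros H N. assert (P := proj1 (Cmod_gt_0 _) N).
  refine (cnear_imp _ _ _ _ (H (Cmod (f s) / 2)%R ltac:(lra))). intros w Hw.
  assert (A := Cmod_triangle_sub (f s) (f w)). rewrite Cmod_minus_sym in A. lra.
Qed.

Lemma ccont_inv f s : ccont f s -> f s <> 0 -> ccont (fun w => / f w) s.
Proof.
  intros H N eps He. assert (P := proj1 (Cmod_gt_0 _) N).
  set (a := Cmod (f s)) in *.
  assert (Q : (0 < eps * (a * a / 2))%R).
  { apply Rmult_lt_0_compat; [lra|]. assert (0 < a * a)%R by (apply Rmult_lt_0_compat; lra). lra. }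
  refine (cnear_imp _ _ _ _ (cnear_and _ _ _ (ccont_lower f s H N) (H _ Q))).
  intros w [A B]. fold a in A.
  assert (N' : f w <> 0) by (apply Cmod_gt_0; lra).
  replace (/ f w - / f s) with ((f s - f w) * (/ f w * / f s)) by (field; auto).
  rewrite !Cmod_mult, !Cmod_inv by auto. fold a. rewrite (Cmod_minus_sym (f s)).
  set (x := Cmod (f w - f s)) in *. set (y := Cmod (f w)) in *.
  apply Rmult_lt_reg_r with (y * a)%R; [nra|].
  replace (x * (/ y * / a) * (y * a))%R with x by (field; lra). nra.
Qed.

Lemma cderiv_inv f s a : cderiv f s a -> f s <> 0 ->
  cderiv (fun w => / f w) s (- a * (/ f s * / f s)).
Proof.
  intros H N.
  assert (I : cderiv Cinv (f s) (- (/ f s * / f s))).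
  { set (c := f s) in *. intros eps He.
    assert (P := proj1 (Cmod_gt_0 _) N).
    assert (Q : (0 < eps * (Cmod c * Cmod c))%R) by (repeat apply Rmult_lt_0_compat; lra).
    assert (Cc : ccont Cinv c).
    { apply (ccont_inv (fun w => w)); auto. eapply cderiv_cont, cderiv_id. }
    refine (cnear_imp _ _ _ _ (cnear_and _ _ _
             (ccont_neq0 _ _ (cderiv_cont _ _ _ (cderiv_id c)) N)
             (Cc (eps * Cmod c)%R ltac:(apply Rmult_lt_0_compat; lra)))).
    intros w [A B].
    replace (/ w - / c - - (/ c * / c) * (w - c)) with ((w - c) * / c * - (/ w - / c))
      by (field; auto).
    rewrite !Cmod_mult, Cmod_opp, Cmod_inv by auto.
    assert (X := Cmod_ge_0 (w - c)).
    replace (eps * Cmod (w - c))%R with (Cmod (w - c) * / Cmod c * (eps * Cmod c))%R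
      by (field; lra).
    apply Rmult_le_compat_l; [|lra]. apply Rmult_le_pos; [lra|].
    left. apply Rinv_0_lt_compat. lra. }
  eapply cderiv_eq; [exact (cderiv_comp Cinv f s _ a I H)|]. ring.
Qed.

Lemma chol_here f s : chol f s -> exists l, cderiv f s l.
Proof. intros [f' H]. exists (f' s). apply (cnear_point _ _ H). Qed.

Lemma chol_cont f s : chol f s -> ccont f s.
Proof. intros H. destruct (chol_here _ _ H) as [l K]. eapply cderiv_cont; eauto. Qed.

Lemma chol_near f s : chol f s -> cnear s (chol f).
Proof.
  intros [f' H]. apply cnear_near in H.
  refine (cnear_imp _ _ _ _ H). intros w K. exists f'. exact K.
Qed.

(** Derivatives are unique, so the witness of [chol] may be taken to be the
    canonical derivative. *)
Lemma chol_C_derive f s : chol f s -> cderiv f s (C_derive f s) /\ ccont (C_derive f) s.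
Proof.
  intros [f' H].
  assert (E : cnear s (fun w => f' w = C_derive f w)).
  { refine (cnear_imp _ _ _ _ H). intros w [A _]. apply cderiv_is_derive in A.
    symmetry. exact (is_C_derive_unique _ _ _ A). }
  destruct (cnear_point _ _ H) as [A B]. split.
  - rewrite <- (cnear_point _ _ E). exact A.
  - exact (ccont_ext _ _ _ E B).
Qed.

Lemma chol_ext f g s : cnear s (fun w => f w = g w) -> chol f s -> chol g s.
Proof.
  intros E [f' H]. exists f'. apply cnear_near in E.
  refine (cnear_imp _ _ _ _ (cnear_and _ _ _ E H)). intros w [A [B D]].
  split; [|exact D]. exact (cderiv_ext _ _ _ _ A B).
Qed.

Lemma chol_affine a b s : chol (fun w => a * w + b) s.
Proof.
  exists (fun _ => a). exists 1%R. split; [lra|]. intros w _. split.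
  - apply cderiv_affine.
  - apply ccont_const.
Qed.

Lemma chol_const c s : chol (fun _ => c) s.
Proof.
  exists (fun _ => 0). exists 1%R. split; [lra|]. intros w _. split.
  - apply cderiv_const.
  - apply ccont_const.
Qed.

Lemma chol_id s : chol (fun w => w) s.
Proof.
  exists (fun _ => 1). exists 1%R. split; [lra|]. intros w _. split.
  - apply cderiv_id.
  - apply ccont_const.
Qed.

Lemma chol_plus f g s : chol f s -> chol g s -> chol (fun w => f w + g w) s.
Proof.
  intros [f' H] [g' K]. exists (fun w => f' w + g' w).
  refine (cnear_imp _ _ _ _ (cnear_and _ _ _ H K)). intros w [[A B] [D E]].
  split; [apply cderiv_plus | apply ccont_plus]; assumption.
Qed.

Lemma chol_mult f g s : chol f s -> chol g s -> chol (fun w => f w * g w) s.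
Proof.
  intros [f' H] [g' K]. exists (fun w => f' w * g w + f w * g' w).
  refine (cnear_imp _ _ _ _ (cnear_and _ _ _ H K)). intros w [[A B] [D E]].
  split; [apply cderiv_mult; assumption|].
  apply ccont_plus; apply ccont_mult; try assumption; eapply cderiv_cont; eassumption.
Qed.

Lemma chol_scal c f s : chol f s -> chol (fun w => c * f w) s.
Proof. intros H. apply chol_mult; [apply chol_const | exact H]. Qed.

Lemma chol_opp f s : chol f s -> chol (fun w => - f w) s.
Proof.
  intros H. eapply chol_ext; [|exact (chol_scal (- (1)) f s H)].
  exists 1%R. split; [lra|]. intros w _. ring.
Qed.

Lemma chol_minus f g s : chol f s -> chol g s -> chol (fun w => f w - g w) s.
Proof. intros H K. apply chol_plus; [exact H | apply chol_opp, K]. Qed.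

Lemma chol_inv f s : chol f s -> f s <> 0 -> chol (fun w => / f w) s.
Proof.
  intros H N. assert (Z := ccont_neq0 f s (chol_cont _ _ H) N).
  destruct H as [f' H]. exists (fun w => - f' w * (/ f w * / f w)).
  refine (cnear_imp _ _ _ _ (cnear_and _ _ _ Z H)). intros w [A [B D]].
  split; [apply cderiv_inv; assumption|].
  assert (Q : ccont (fun v => / f v) w).
  { apply ccont_inv; [eapply cderiv_cont; eassumption|exact A]. }
  apply ccont_mult; [|apply ccont_mult; exact Q].
  apply (ccont_ext (fun v => - (1) * f' v)).
  - exists 1%R. split; [lra|]. intros v _. ring.
  - apply ccont_mult; [apply ccont_const|exact D].
Qed.

Lemma chol_div f g s : chol f s -> chol g s -> g s <> 0 -> chol (fun w => f w / g w) s.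
Proof. intros H K N. apply chol_mult; [exact H | apply chol_inv; assumption]. Qed.

Lemma chol_comp f g s : chol f (g s) -> chol g s -> chol (fun w => f (g w)) s.
Proof.
  intros [f' H] K. assert (Kc := chol_cont _ _ K). destruct K as [g' K].
  exists (fun w => g' w * f' (g w)).
  destruct H as [d [Hd H]].
  refine (cnear_imp _ _ _ _ (cnear_and _ _ _ (Kc d Hd) K)). intros w [A [B D]].
  destruct (H _ A) as [E F].
  split; [apply cderiv_comp; assumption|].
  apply ccont_mult; [exact D|]. apply ccont_comp; [exact F|].
  eapply cderiv_cont; eassumption.
Qed.

(** * The normalised exponential *)

(** e(w) = exp(2 pi i w); all powers of q are written with it, since fractional
    exponents then cause no choice of a branch. *)
Definition ce (w : C) : C := Cexp (RtoC (2 * PI) * Ci * w).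

Lemma Cexp_plus a b : Cexp (a + b) = Cexp a * Cexp b.
Proof.
  destruct a as [a1 a2], b as [b1 b2]. unfold Cexp, Cmult, Cplus, Re, Im; simpl.
  rewrite exp_plus, cos_plus, sin_plus. f_equal; ring.
Qed.

Lemma Cmod_Cexp a : Cmod (Cexp a) = exp (Re a).
Proof.
  unfold Cmod, Cexp; simpl.
  replace (exp (Re a) * cos (Im a) * (exp (Re a) * cos (Im a) * 1) +
           exp (Re a) * sin (Im a) * (exp (Re a) * sin (Im a) * 1))%R
    with (exp (Re a) * exp (Re a) * (Rsqr (sin (Im a)) + Rsqr (cos (Im a))))%R
    by (unfold Rsqr; ring).
  rewrite sin2_cos2, Rmult_1_r. apply sqrt_square. left. apply exp_pos.
Qed.

Lemma Cexp_0 : Cexp 0 = 1.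
Proof. unfold Cexp, Re, Im; simpl. rewrite exp_0, cos_0, sin_0. unfold RtoC. f_equal; ring. Qed.

Lemma ce_plus a b : ce (a + b) = ce a * ce b.
Proof. unfold ce. rewrite <- Cexp_plus. f_equal. ring. Qed.

Lemma ce_0 : ce 0 = 1.
Proof. unfold ce. rewrite <- Cexp_0. f_equal. ring. Qed.

Lemma ce_neq0 a : ce a <> 0.
Proof.
  intros H. assert (K : ce a * ce (- a) = 1).
  { rewrite <- ce_plus, <- ce_0. f_equal. ring. }
  rewrite H, Cmult_0_l in K. apply C1_nz. symmetry. exact K.
Qed.

Lemma ce_opp a : ce (- a) = / ce a.
Proof.
  assert (K : ce a * ce (- a) = 1).
  { rewrite <- ce_plus, <- ce_0. f_equal. ring. }
  assert (N := ce_neq0 a).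
  replace (ce (- a)) with (/ ce a * (ce a * ce (- a))) by (field; exact N).
  rewrite K. ring.
Qed.

Lemma Cmod_ce w : Cmod (ce w) = exp (- (2 * PI * Im w)).
Proof.
  unfold ce. rewrite Cmod_Cexp. f_equal. destruct w as [x y]. simpl. ring.
Qed.

Lemma ce_IZR n : ce (RtoC (IZR n)) = 1.
Proof.
  assert (P : forall k : nat, ce (RtoC (INR k)) = 1).
  { induction k as [|k IH].
    - exact ce_0.
    - rewrite S_INR, RtoC_plus, ce_plus, IH.
      unfold ce, Cexp, Re, Im; simpl.
      replace (((2 * PI) * 0 - 0 * 1) * 1 - (2 * PI * 1 + 0 * 0) * 0)%R with 0%R by ring.
      replace (((2 * PI) * 0 - 0 * 1) * 0 + (2 * PI * 1 + 0 * 0) * 1)%R with (2 * PI)%R by ring.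
      rewrite exp_0, cos_2PI, sin_2PI. unfold Cmult, RtoC; simpl. f_equal; ring. }
  destruct (Z.le_gt_cases 0 n) as [H|H].
  - rewrite <- (Z2Nat.id n H), <- INR_IZR_INZ. apply P.
  - replace (RtoC (IZR n)) with (- RtoC (INR (Z.to_nat (- n)))).
    + rewrite ce_opp, P. field.
    + rewrite INR_IZR_INZ, Z2Nat.id by lia. rewrite opp_IZR, RtoC_opp. ring.
Qed.

Lemma ce_period w n : ce (w + RtoC (IZR n)) = ce w.
Proof. rewrite ce_plus, ce_IZR. ring. Qed.

Lemma ce_half : ce (RtoC (1 / 2)) = - (1).
Proof.
  unfold ce, Cexp, Re, Im; simpl.
  replace (((2 * PI) * 0 - 0 * 1) * (1 / 2) - (2 * PI * 1 + 0 * 0) * 0)%R with 0%R by ring.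
  replace (((2 * PI) * 0 - 0 * 1) * 0 + (2 * PI * 1 + 0 * 0) * (1 / 2))%R with PI by field.
  rewrite exp_0, cos_PI, sin_PI. unfold Copp, RtoC; simpl. f_equal; ring.
Qed.

(** The modulus forces the imaginary part to vanish, and on the real line the
    cosine takes the value 1 only at the integers. *)
Lemma ce_eq_1 w : ce w = 1 -> exists n, w = RtoC (IZR n).
Proof.
  intros H.
  assert (M : Cmod (ce w) = 1%R) by (rewrite H; apply Cmod_1).
  rewrite Cmod_ce in M. rewrite <- exp_0 in M. apply exp_inv in M.
  assert (PP := PI_RGT_0).
  assert (Iw : Im w = 0%R) by nra.
  destruct w as [x y]. simpl in Iw. subst y.
  unfold ce, Cexp, Re, Im in H; simpl in H.
  replace (((2 * PI) * 0 - 0 * 1) * x - (2 * PI * 1 + 0 * 0) * 0)%R with 0%R in H by ring.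
  replace (((2 * PI) * 0 - 0 * 1) * 0 + (2 * PI * 1 + 0 * 0) * x)%R with (2 * (PI * x))%R in H by ring.
  rewrite exp_0 in H. apply (f_equal fst) in H. simpl in H.
  rewrite cos_2a_sin in H.
  assert (S : sin (PI * x) = 0%R).
  { apply Rsqr_0_uniq. unfold Rsqr. lra. }
  apply sin_eq_0_0 in S. destruct S as [k Hk]. exists k.
  unfold RtoC. f_equal. apply Rmult_eq_reg_l with PI; lra.
Qed.

Lemma real_deriv_small (f : R -> R) (l : R) : is_derive f 0%R l ->
  forall eps, (0 < eps)%R -> exists d, (0 < d)%R /\ forall a, (Rabs a < d)%R ->
    (Rabs (f a - f 0 - l * a) <= eps * Rabs a)%R.
Proof.
  intros [_ H] eps He.
  destruct (H 0%R (fun P HP => HP) (mkposreal eps He)) as [d K].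
  exists d. split; [apply cond_pos|]. intros a Ha.
  assert (B : ball (M := R_UniformSpace) 0%R d a).
  { unfold ball; simpl. unfold AbsRing_ball, abs, minus, plus, opp; simpl.
    replace (a + - 0)%R with a by ring. exact Ha. }
  specialize (K a B). unfold norm, minus, plus, opp, scal in K; simpl in K.
  unfold abs, mult in K; simpl in K.
  replace (f a - f 0 - l * a)%R with (f a + - f 0 + - ((a + - 0) * l))%R by ring.
  eapply Rle_trans; [exact K|]. right. f_equal. f_equal. ring.
Qed.

Lemma Cmod_le_sum (x : C) : (Cmod x <= Rabs (Re x) + Rabs (Im x))%R.
Proof.
  destruct x as [a b]. simpl.
  replace (a, b) with (RtoC a + RtoC b * Ci).
  - eapply Rle_trans; [apply Cmod_triangle|].
    rewrite Cmod_mult, Cmod_Ci, !Cmod_R. lra.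
  - unfold Cplus, Cmult, RtoC; simpl. f_equal; ring.
Qed.

Lemma im_le_Cmod (c : C) : (Rabs (Im c) <= Cmod c)%R.
Proof.
  eapply Rle_trans; [|apply Rmax_Cmod]. apply Rmax_r.
Qed.

(** By the functional equation only the derivative at 0 matters, and there the real
    derivatives of exp, cos and sin give it. *)
Lemma cderiv_Cexp s : cderiv Cexp s (Cexp s).
Proof.
  assert (Z : forall eps, (0 < eps)%R -> exists d, (0 < d)%R /\ forall h, (Cmod h < d)%R ->
     (Cmod (Cexp h - 1 - h) <= eps * Cmod h)%R).
  { intros eps He.
    set (e := (eps / 16)%R). assert (Pe : (0 < e)%R) by (unfold e; lra).
    destruct (real_deriv_small exp 1 ltac:(auto_derive; [exact I|rewrite exp_0; ring]) e Pe)
      as [d1 [D1 H1]].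
    destruct (real_deriv_small cos 0 ltac:(auto_derive; [exact I|rewrite sin_0; ring]) e Pe)
      as [d2 [D2 H2]].
    destruct (real_deriv_small sin 1 ltac:(auto_derive; [exact I|rewrite cos_0; ring]) e Pe)
      as [d3 [D3 H3]].
    set (d := Rmin (Rmin d1 d2) (Rmin d3 (Rmin 1 e))).
    exists d. split; [repeat apply Rmin_glb_lt; lra|].
    intros h Hh.
    assert (Q : (d <= d1 /\ d <= d2 /\ d <= d3 /\ d <= 1 /\ d <= e)%R).
    { unfold d.
      assert (X1 := Rmin_l (Rmin d1 d2) (Rmin d3 (Rmin 1 e))).
      assert (X2 := Rmin_r (Rmin d1 d2) (Rmin d3 (Rmin 1 e))).
      assert (X3 := Rmin_l d1 d2). assert (X4 := Rmin_r d1 d2).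
      assert (X5 := Rmin_l d3 (Rmin 1 e)). assert (X6 := Rmin_r d3 (Rmin 1 e)).
      assert (X7 := Rmin_l 1 e). assert (X8 := Rmin_r 1 e). lra. }
    destruct h as [a b].
    assert (Ha := re_le_Cmod (a, b)). assert (Hb := im_le_Cmod (a, b)).
    simpl in Ha, Hb. set (m := Cmod (a, b)) in *.
    assert (K1 := H1 a ltac:(lra)). assert (K2 := H2 b ltac:(lra)).
    assert (K3 := H3 b ltac:(lra)).
    rewrite exp_0 in K1. rewrite cos_0 in K2. rewrite sin_0 in K3.
    assert (E3 : (0 < exp a <= 3)%R).
    { split; [apply exp_pos|]. apply Rle_trans with (exp 1); [|apply exp_le_3].
      assert (a <= 1)%R by (assert (T := Rle_abs a); lra).
      destruct (Req_dec a 1) as [->|N]; [lra|]. left. apply exp_increasing. lra. }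
    eapply Rle_trans; [apply Cmod_le_sum|]. unfold Cexp, Re, Im; simpl.
    assert (A1 : (Rabs (exp a * cos b + - (1) + - a) <= 4 * e * m)%R).
    { replace (exp a * cos b + - (1) + - a)%R
        with ((exp a - 1 - 1 * a) + exp a * (cos b - 1 - 0 * b))%R by ring.
      eapply Rle_trans; [apply Rabs_triang|].
      rewrite Rabs_mult, (Rabs_right (exp a)) by lra.
      assert (T := Rabs_pos (cos b - 1 - 0 * b)). nra. }
    assert (A2 : (Rabs (exp a * sin b + - 0 + - b) <= 6 * e * m)%R).
    { replace (exp a * sin b + - 0 + - b)%R
        with (exp a * (sin b - 0 - 1 * b) + ((exp a - 1 - 1 * a) + a) * b)%R by ring.
      eapply Rle_trans; [apply Rabs_triang|].
      rewrite !Rabs_mult, (Rabs_right (exp a)) by lra.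
      assert (T := Rabs_pos (sin b - 0 - 1 * b)).
      assert (T2 := Rabs_triang (exp a - 1 - 1 * a) a).
      assert (T3 := Rabs_pos b). assert (T4 := Rabs_pos a).
      assert (T5 : (Rabs (exp a - 1 - 1 * a + a) <= 2 * e)%R) by nra.
      nra. }
    assert (Hm : (0 <= m)%R) by apply Cmod_ge_0.
    assert (Hem : (0 <= eps * m)%R) by (apply Rmult_le_pos; lra).
    apply Rle_trans with (4 * e * m + 6 * e * m)%R.
    - apply Rplus_le_compat; assumption.
    - unfold e. lra. }
  intros eps He. assert (P : (0 < Cmod (Cexp s))%R) by (rewrite Cmod_Cexp; apply exp_pos).
  destruct (Z (eps / Cmod (Cexp s))%R ltac:(apply Rdiv_lt_0_compat; lra)) as [d [Hd H]].
  exists d. split; [exact Hd|]. intros w Hw.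
  replace (Cexp w) with (Cexp s * Cexp (w - s)) by (rewrite <- Cexp_plus; f_equal; ring).
  replace (Cexp s * Cexp (w - s) - Cexp s - Cexp s * (w - s))
    with (Cexp s * (Cexp (w - s) - 1 - (w - s))) by ring.
  rewrite Cmod_mult. specialize (H _ Hw).
  apply Rle_trans with (Cmod (Cexp s) * (eps / Cmod (Cexp s) * Cmod (w - s)))%R.
  - apply Rmult_le_compat_l; lra.
  - right. field. lra.
Qed.

Lemma cderiv_ce s : cderiv ce s (RtoC (2 * PI) * Ci * ce s).
Proof.
  unfold ce.
  apply (cderiv_comp Cexp (fun w => RtoC (2 * PI) * Ci * w)).
  - apply cderiv_Cexp.
  - eapply cderiv_ext; [|apply (cderiv_affine _ 0)].
    exists 1%R. split; [lra|]. intros w _. simpl. ring.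
Qed.

Lemma chol_ce s : chol ce s.
Proof.
  exists (fun s => RtoC (2 * PI) * Ci * ce s). exists 1%R. split; [lra|]. intros w _.
  split; [apply cderiv_ce|]. apply ccont_mult; [apply ccont_const|].
  eapply cderiv_cont, cderiv_ce.
Qed.

Lemma chol_ce_comp f s : chol f s -> chol (fun w => ce (f w)) s.
Proof. intros H. apply (chol_comp ce f); [apply chol_ce|exact H]. Qed.

(** * Integrals over a horizontal period *)

(** The integral over a horizontal segment of length 1, that is, the constant Fourier
    coefficient at height y. *)
Definition cint (F : C -> C) (y : R) : C :=
  (RInt (fun x => Re (F (x, y))) 0 1, RInt (fun x => Im (F (x, y))) 0 1).

Lemma is_derive_eps (f : R -> R) (t l : R) :
  (forall eps, (0 < eps)%R -> exists d, (0 < d)%R /\ forall h, (Rabs (h - t) < d)%R ->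
    (Rabs (f h - f t - l * (h - t)) <= eps * Rabs (h - t))%R) ->
  is_derive f t l.
Proof.
  intros H. split; [apply is_linear_scal_l|].
  intros x Hx. apply (is_filter_lim_locally_unique (V := R_NormedModule)) in Hx.
  subst x. intros eps. destruct (H eps (cond_pos eps)) as [d [Hd K]].
  exists (mkposreal d Hd). intros y Hy.
  specialize (K y Hy).
  unfold minus, plus, opp, scal, norm; simpl. unfold abs, mult; simpl.
  replace (f y + - f t + - ((y + - t) * l))%R with (f y - f t - l * (y - t))%R by ring.
  exact K.
Qed.

Lemma cderiv_path F a v t l : cderiv F (a + RtoC t * v) l ->
  is_derive (fun t => Re (F (a + RtoC t * v))) t (Re (l * v)).
Proof.
  intros H. apply is_derive_eps. intros eps He.
  assert (P : (0 < Cmod v + 1)%R) by (assert (X := Cmod_ge_0 v); lra).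
  destruct (H (eps / (Cmod v + 1))%R ltac:(apply Rdiv_lt_0_compat; lra)) as [d [Hd K]].
  exists (d / (Cmod v + 1))%R. split; [apply Rdiv_lt_0_compat; lra|].
  intros h Hh.
  assert (E : a + RtoC h * v - (a + RtoC t * v) = RtoC (h - t) * v)
    by (rewrite RtoC_minus; ring).
  assert (M : Cmod (RtoC (h - t) * v) = (Rabs (h - t) * Cmod v)%R)
    by (rewrite Cmod_mult, Cmod_R; reflexivity).
  assert (Q := Rabs_pos (h - t)). assert (V := Cmod_ge_0 v).
  specialize (K (a + RtoC h * v)). rewrite E, M in K.
  assert (L : (Rabs (h - t) * Cmod v < d)%R).
  { apply Rle_lt_trans with (Rabs (h - t) * (Cmod v + 1))%R.
    - apply Rmult_le_compat_l; lra.
    - apply Rmult_lt_reg_r with (/ (Cmod v + 1))%R; [apply Rinv_0_lt_compat; lra|].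
      replace (Rabs (h - t) * (Cmod v + 1) * / (Cmod v + 1))%R with (Rabs (h - t))%R
        by (field; lra). exact Hh. }
  specialize (K L).
  eapply Rle_trans; [|eapply Rle_trans; [exact K|]].
  - eapply Rle_trans; [|apply re_le_Cmod]. right. f_equal.
    replace (l * (RtoC (h - t) * v)) with (RtoC (h - t) * (l * v)) by ring.
    destruct (F (a + RtoC h * v)) as [p1 p2], (F (a + RtoC t * v)) as [q1 q2], (l * v) as [r1 r2].
    unfold Re, Cminus, Cplus, Copp, Cmult, RtoC; simpl. ring.
  - replace (eps / (Cmod v + 1) * (Rabs (h - t) * Cmod v))%R
      with (eps * Rabs (h - t) * (Cmod v / (Cmod v + 1)))%R by (field; lra).
    rewrite <- (Rmult_1_r (eps * Rabs (h - t))) at 2.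
    apply Rmult_le_compat_l; [apply Rmult_le_pos; lra|].
    apply Rmult_le_reg_r with (Cmod v + 1)%R; [lra|].
    replace (Cmod v / (Cmod v + 1) * (Cmod v + 1))%R with (Cmod v) by (field; lra). lra.
Qed.

Lemma pair_x x y : (0%R, y) + RtoC x * 1 = (x, y).
Proof. unfold Cplus, Cmult, RtoC; simpl. f_equal; ring. Qed.

Lemma pair_y x y : (x, 0%R) + RtoC y * Ci = (x, y).
Proof. unfold Cplus, Cmult, RtoC; simpl. f_equal; ring. Qed.

Lemma Im_as_Re w : Im w = Re (- Ci * w).
Proof. destruct w as [x y]. simpl. ring. Qed.

Lemma cderiv_re_x F x y l : cderiv F (x, y) l ->
  is_derive (fun x => Re (F (x, y))) x (Re l).
Proof.
  intros H. rewrite <- (pair_x x y) in H. apply cderiv_path in H.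
  rewrite Cmult_1_r in H. eapply is_derive_ext; [|exact H].
  intros t. simpl. rewrite pair_x. reflexivity.
Qed.

Lemma cderiv_re_y F x y l : cderiv F (x, y) l ->
  is_derive (fun y => Re (F (x, y))) y (Re (l * Ci)).
Proof.
  intros H. rewrite <- (pair_y x y) in H. apply cderiv_path in H.
  eapply is_derive_ext; [|exact H].
  intros t. simpl. rewrite pair_y. reflexivity.
Qed.

Lemma ccont_2d F x y : ccont F (x, y) ->
  continuity_2d_pt (fun u v => Re (F (u, v))) x y.
Proof.
  intros H eps. destruct (H eps (cond_pos eps)) as [d [Hd K]].
  exists (mkposreal (d / 2) ltac:(lra)). intros u v Hu Hv. simpl in Hu, Hv.
  replace (Re (F (u, v)) - Re (F (x, y)))%R with (Re (F (u, v) - F (x, y))).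
  - eapply Rle_lt_trans; [apply re_le_Cmod|]. apply K.
    eapply Rle_lt_trans; [apply Cmod_le_sum|]. simpl.
    replace (u + - x)%R with (u - x)%R by ring. replace (v + - y)%R with (v - y)%R by ring. lra.
  - destruct (F (u, v)), (F (x, y)). simpl. ring.
Qed.

Lemma ccont_line F x y : ccont F (x, y) -> continuous (fun x => Re (F (x, y))) x.
Proof.
  intros H P [eps HP]. destruct (H eps (cond_pos eps)) as [d [Hd K]].
  exists (mkposreal d Hd). intros u Hu. apply HP.
  change (Rabs (Re (F (u, y)) - Re (F (x, y))) < eps)%R.
  change (Rabs (u - x) < d)%R in Hu.
  replace (Re (F (u, y)) - Re (F (x, y)))%R with (Re (F (u, y) - F (x, y))).
  - eapply Rle_lt_trans; [apply re_le_Cmod|]. apply K.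
    eapply Rle_lt_trans; [apply Cmod_le_sum|]. simpl.
    replace (u + - x)%R with (u - x)%R by ring. replace (y + - y)%R with 0%R by ring.
    rewrite Rabs_R0. lra.
  - destruct (F (u, y)), (F (x, y)). simpl. ring.
Qed.

Definition lcont (F : C -> C) (y : R) : Prop := forall x, (0 <= x <= 1)%R -> ccont F (x, y).

Lemma lcont_ex_re F y : lcont F y -> ex_RInt (fun x => Re (F (x, y))) 0 1.
Proof.
  intros H. apply (ex_RInt_continuous (V := R_CompleteNormedModule)).
  rewrite Rmin_left, Rmax_right by lra. intros x Hx. apply ccont_line, H, Hx.
Qed.

Lemma lcont_scal c F y : lcont F y -> lcont (fun w => c * F w) y.
Proof. intros H x Hx. apply ccont_mult; [apply ccont_const | apply H, Hx]. Qed.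

Lemma lcont_ex_im F y : lcont F y -> ex_RInt (fun x => Im (F (x, y))) 0 1.
Proof.
  intros H. eapply ex_RInt_ext; [|apply (lcont_ex_re _ y (lcont_scal (- Ci) F y H))].
  intros x _. simpl. rewrite (Im_as_Re (F (x, y))). reflexivity.
Qed.

Lemma cint_ext F G y : (forall x, (0 <= x <= 1)%R -> F (x, y) = G (x, y)) -> cint F y = cint G y.
Proof.
  intros H. unfold cint. f_equal; apply RInt_ext; rewrite Rmin_left, Rmax_right by lra;
    intros x Hx; rewrite H by lra; reflexivity.
Qed.

Lemma cint_plus F G y : lcont F y -> lcont G y ->
  cint (fun w => F w + G w) y = cint F y + cint G y.
Proof.
  intros H K. unfold cint, Cplus; simpl. f_equal.
  - exact (RInt_plus (V := R_CompleteNormedModule) _ _ 0 1 (lcont_ex_re _ _ H) (lcont_ex_re _ _ K)).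
  - exact (RInt_plus (V := R_CompleteNormedModule) _ _ 0 1 (lcont_ex_im _ _ H) (lcont_ex_im _ _ K)).
Qed.

Lemma cint_scal c F y : lcont F y -> cint (fun w => c * F w) y = c * cint F y.
Proof.
  intros H. destruct c as [a b].
  assert (X := lcont_ex_re _ _ H). assert (Y := lcont_ex_im _ _ H).
  assert (S : forall (k : R) (f : R -> R), ex_RInt f 0 1 ->
     ex_RInt (fun x => k * f x)%R 0 1 /\ RInt (fun x => k * f x)%R 0 1 = (k * RInt f 0 1)%R).
  { intros k f E. split; [exact (ex_RInt_scal (V := R_NormedModule) f 0 1 k E)|].
    exact (RInt_scal (V := R_CompleteNormedModule) f 0 1 k E). }
  unfold cint, Cmult; simpl. f_equal.
  - destruct (S a _ X) as [Ea Ra]. destruct (S b _ Y) as [Eb Rb].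
    rewrite <- Ra, <- Rb.
    exact (RInt_minus (V := R_CompleteNormedModule) _ _ 0 1 Ea Eb).
  - destruct (S a _ Y) as [Ea Ra]. destruct (S b _ X) as [Eb Rb].
    rewrite <- Ra, <- Rb.
    exact (RInt_plus (V := R_CompleteNormedModule) _ _ 0 1 Ea Eb).
Qed.

Lemma cint_const c y : cint (fun _ => c) y = c.
Proof.
  destruct c as [a b]. unfold cint; simpl. rewrite !RInt_const.
  unfold scal; simpl. unfold mult; simpl. f_equal; ring.
Qed.

Lemma RInt_abs_le (f : R -> R) M : ex_RInt f 0 1 ->
  (forall x, (0 <= x <= 1)%R -> (Rabs (f x) <= M)%R) -> (Rabs (RInt f 0 1) <= M)%R.
Proof.
  intros E H. eapply Rle_trans; [apply (abs_RInt_le_const f 0 1 M)|]; auto; lra.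
Qed.

(** The factor 2 comes from estimating real and imaginary parts separately; only the
    shape of the bound matters later. *)
Lemma cint_bound F y M : lcont F y ->
  (forall x, (0 <= x <= 1)%R -> (Cmod (F (x, y)) <= M)%R) -> (Cmod (cint F y) <= 2 * M)%R.
Proof.
  intros L H. eapply Rle_trans; [apply Cmod_le_sum|]. simpl.
  assert (A : (Rabs (RInt (fun x => Re (F (x, y))) 0 1) <= M)%R).
  { apply RInt_abs_le; [apply lcont_ex_re, L|]. intros x Hx.
    eapply Rle_trans; [apply re_le_Cmod|]. auto. }
  assert (B : (Rabs (RInt (fun x => Im (F (x, y))) 0 1) <= M)%R).
  { apply RInt_abs_le; [apply lcont_ex_im, L|]. intros x Hx.
    eapply Rle_trans; [apply im_le_Cmod|]. auto. }
  lra.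
Qed.

(** Multiplication by -i turns statements about real parts into statements about
    imaginary parts; most facts on [cint] are proved for real parts only. *)
Lemma cint_Re_Im F y : lcont F y -> Im (cint F y) = Re (cint (fun w => - Ci * F w) y).
Proof.
  intros H. rewrite cint_scal by exact H. apply Im_as_Re.
Qed.

Lemma cint_deriv_re F F' y :
  (forall x, cderiv F (x, y) (F' (x, y)) /\ ccont F' (x, y)) ->
  RInt (fun x => Re (F' (x, y))) 0 1 = (Re (F (1%R, y)) - Re (F (0%R, y)))%R.
Proof.
  intros H. apply is_RInt_unique.
  apply (is_RInt_derive (V := R_CompleteNormedModule) (fun x => Re (F (x, y)))).
  - intros x _. apply cderiv_re_x, H.
  - intros x _. apply ccont_line, H.
Qed.

(** The fundamental theorem of calculus on a full period. *)
Lemma cint_deriv_period F F' y :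
  (forall x, cderiv F (x, y) (F' (x, y)) /\ ccont F' (x, y)) ->
  F (1%R, y) = F (0%R, y) -> cint F' y = 0.
Proof.
  intros H P.
  assert (A : forall c, Re (c * cint F' y) = 0%R).
  { intros c. rewrite <- cint_scal by (intros x _; apply H). unfold cint. simpl.
    change (RInt (fun x => Re ((fun w => c * F' w) (x, y))) 0 1 = 0%R).
    rewrite (cint_deriv_re (fun w => c * F w)).
    - rewrite P. apply Rminus_diag.
    - intros x. split.
      + eapply cderiv_eq; [apply cderiv_mult; [apply cderiv_const|apply H]|]. cbv beta; ring.
      + apply ccont_mult; [apply ccont_const|apply H]. }
  assert (A1 := A 1). assert (A2 := A (- Ci)). rewrite <- Im_as_Re in A2.
  rewrite Cmult_1_l in A1. destruct (cint F' y) as [a b]. simpl in A1, A2.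
  subst. reflexivity.
Qed.

(** The derivative in y of the integral is i times the integral over a period of the
    complex derivative, which is 0 by periodicity. *)
Lemma cint_shift_deriv_re F y0 d :
  (0 < d)%R -> (forall x y, (Rabs (y - y0) < d)%R -> chol F (x, y)) ->
  F (1%R, y0) = F (0%R, y0) ->
  is_derive (fun y => RInt (fun x => Re (F (x, y))) 0 1) y0 0%R.
Proof.
  intros Hd H P.
  set (F' := C_derive F).
  assert (D : forall x y, (Rabs (y - y0) < d)%R ->
            cderiv F (x, y) (F' (x, y)) /\ ccont F' (x, y)).
  { intros x y Hy. apply chol_C_derive. auto. }
  assert (Dv : forall x y, (Rabs (y - y0) < d)%R ->
     Derive (fun y => Re (F (x, y))) y = Re (F' (x, y) * Ci)).
  { intros x y Hy. apply is_derive_unique, cderiv_re_y, D, Hy. }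
  assert (Hy0 : (Rabs (y0 - y0) < d)%R) by (rewrite Rminus_diag, Rabs_R0; exact Hd).
  assert (Z : RInt (fun x => Derive (fun y => Re (F (x, y))) y0) 0 1 = 0%R).
  { rewrite (RInt_ext _ (fun x => Re ((fun w => F' w * Ci) (x, y0)))).
    2:{ intros x _. apply Dv, Hy0. }
    etransitivity; [apply (cint_deriv_re (fun w => F w * Ci) (fun w => F' w * Ci) y0)|].
    2:{ rewrite P. apply Rminus_diag. }
    intros x. destruct (D x y0 Hy0) as [A B]. split.
      + eapply cderiv_eq; [apply cderiv_mult; [apply A|apply cderiv_const]|]. cbv beta; ring.
      + apply ccont_mult; [exact B|apply ccont_const]. }
  cut (is_derive (fun y => RInt (fun x => Re (F (x, y))) 0 1) y0
         (RInt (fun x => Derive (fun y => Re (F (x, y))) y0) 0 1)).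
  { intros Q. rewrite Z in Q. exact Q. }
  apply (is_derive_RInt_param (fun y x => Re (F (x, y)))).
  - exists (mkposreal d Hd). intros y Hy t _. exists (Re (F' (t, y) * Ci)).
    apply cderiv_re_y, D, Hy.
  - intros t _.
    apply (continuity_2d_pt_ext_loc (fun u v => Re (F' (v, u) * Ci))).
    + exists (mkposreal d Hd). intros u v Hu _. symmetry. apply Dv, Hu.
    + intros eps.
      assert (K : ccont (fun w => F' w * Ci) (t, y0)).
      { apply ccont_mult; [apply D, Hy0|apply ccont_const]. }
      destruct (ccont_2d _ _ _ K eps) as [e He]. exists e. intros u v Hu Hv.
      apply (He v u Hv Hu).
  - exists (mkposreal d Hd). intros y Hy.
    apply (lcont_ex_re F y). intros x _. apply chol_cont. apply H, Hy.
Qed.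

Lemma cint_cont_re F y0 d :
  (0 < d)%R -> (forall x y, (Rabs (y - y0) < d)%R -> ccont F (x, y)) ->
  continuity_pt (fun y => RInt (fun x => Re (F (x, y))) 0 1) y0.
Proof.
  intros Hd H. apply continuity_pt_locally. intros eps.
  assert (Hy0 : (Rabs (y0 - y0) < d)%R) by (rewrite Rminus_diag, Rabs_R0; exact Hd).
  destruct (uniform_continuity_2d_1d (fun x y => Re (F (x, y))) 0 1 y0
     (fun x _ => ccont_2d F x y0 (H x y0 Hy0))
     (mkposreal (eps / 2) ltac:(assert (X := cond_pos eps); lra))) as [e He].
  exists (mkposreal (Rmin d e) (Rmin_pos _ _ Hd (cond_pos e))). intros y Hy.
  change (Rabs (y - y0) < Rmin d e)%R in Hy.
  assert (M1 := Rmin_l d e). assert (M2 := Rmin_r d e).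
  assert (I : forall y, (Rabs (y - y0) < d)%R -> ex_RInt (fun x => Re (F (x, y))) 0 1).
  { intros v Hv. apply (lcont_ex_re F v). intros x _. apply H, Hv. }
  assert (Iy := I y ltac:(lra)). assert (I0 := I y0 Hy0).
  change (Rabs (minus (RInt (fun x => Re (F (x, y))) 0 1) (RInt (fun x => Re (F (x, y0))) 0 1)) < eps)%R.
  rewrite <- RInt_minus by assumption.
  apply Rle_lt_trans with (eps / 2)%R; [|assert (X := cond_pos eps); lra].
  apply RInt_abs_le; [apply (ex_RInt_minus (V := R_NormedModule)); assumption|].
  intros x Hx. left.
  destruct (Rabs_def2 (y - y0) e ltac:(lra)) as [B1 B2]. assert (E0 := cond_pos e).
  apply (He x y0 x y); try lra.
  rewrite Rminus_diag, Rabs_R0. exact E0.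
Qed.

(** The heights at which a function may fail to be holomorphic; T may be infinite, as it
    is for the lines through a lattice. *)
Definition isolated (T : R -> Prop) : Prop :=
  forall y, exists d, (0 < d)%R /\ forall v, (0 < Rabs (v - y) < d)%R -> ~ T v.

Section Shift.
Variables (T : R -> Prop) (F : C -> C) (a b : R).
Hypothesis T_isolated : isolated T.
Hypothesis F_cont : forall w, (a < Im w < b)%R -> ccont F w.
Hypothesis F_hol : forall w, (a < Im w < b)%R -> ~ T (Im w) -> chol F w.
Hypothesis F_period : forall w, (a < Im w < b)%R -> ~ T (Im w) -> F (w + 1) = F w.

Let c y := RInt (fun x => Re (F (x, y))) 0 1.

Lemma shift_cont y : (a < y < b)%R -> continuity_pt c y.
Proof.
  intros H. apply (cint_cont_re F y (Rmin (y - a) (b - y))).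
  - apply Rmin_glb_lt; lra.
  - intros x v Hv. apply F_cont. simpl.
    assert (A := Rmin_l (y - a) (b - y)). assert (B := Rmin_r (y - a) (b - y)).
    destruct (Rabs_def2 (v - y) (Rmin (y - a) (b - y)) Hv). lra.
Qed.

Lemma shift_deriv y : (a < y < b)%R -> ~ T y -> is_derive c y 0%R.
Proof.
  intros H N. destruct (T_isolated y) as [e [He K]].
  apply (cint_shift_deriv_re F y (Rmin e (Rmin (y - a) (b - y)))).
  - repeat apply Rmin_glb_lt; lra.
  - intros x v Hv.
    assert (A := Rmin_l (y - a) (b - y)). assert (B := Rmin_r (y - a) (b - y)).
    assert (D := Rmin_l e (Rmin (y - a) (b - y))). assert (E := Rmin_r e (Rmin (y - a) (b - y))).
    destruct (Rabs_def2 (v - y) (Rmin e (Rmin (y - a) (b - y))) Hv).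
    apply F_hol; simpl; [lra|].
    destruct (Req_dec v y) as [->|Nv]; [exact N|]. apply K. split; [|lra].
    apply Rabs_pos_lt. lra.
  - rewrite <- (F_period (0%R, y)); [|simpl; lra|exact N].
    f_equal. unfold Cplus, RtoC; simpl. f_equal; ring.
Qed.

(** At an exceptional height continuity and the mean value theorem on either side
    still give derivative 0. *)
Lemma shift_local y : (a < y < b)%R -> is_derive c y 0%R.
Proof.
  intros H. destruct (T_isolated y) as [e [He K]].
  apply is_derive_eps. intros eps Heps.
  exists (Rmin e (Rmin (y - a) (b - y))). split; [repeat apply Rmin_glb_lt; lra|].
  intros v Hv.
  assert (A := Rmin_l (y - a) (b - y)). assert (B := Rmin_r (y - a) (b - y)).
  assert (D := Rmin_l e (Rmin (y - a) (b - y))). assert (E := Rmin_r e (Rmin (y - a) (b - y))).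
  destruct (Rabs_def2 (v - y) (Rmin e (Rmin (y - a) (b - y))) Hv) as [V1 V2].
  destruct (MVT_gen c y v (fun _ => 0%R)) as [z [_ Hz]].
  - intros x Hx. apply shift_deriv.
    + unfold Rmin, Rmax in Hx. destruct (Rle_dec y v); lra.
    + apply K. unfold Rmin, Rmax in Hx. unfold Rabs.
      destruct (Rle_dec y v), (Rcase_abs (x - y)); lra.
  - intros x Hx. apply shift_cont. unfold Rmin, Rmax in Hx. destruct (Rle_dec y v); lra.
  - replace (c v - c y - 0 * (v - y))%R with 0%R by lra. rewrite Rabs_R0.
    apply Rmult_le_pos; [lra|apply Rabs_pos].
Qed.

Lemma shift_const_re y1 y2 : (a < y1 < b)%R -> (a < y2 < b)%R -> c y1 = c y2.
Proof.
  intros H1 H2. destruct (MVT_gen c y1 y2 (fun _ => 0%R)) as [z [_ Hz]].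
  - intros x Hx. apply shift_local. unfold Rmin, Rmax in Hx. destruct (Rle_dec y1 y2); lra.
  - intros x Hx. apply shift_cont. unfold Rmin, Rmax in Hx. destruct (Rle_dec y1 y2); lra.
  - lra.
Qed.
End Shift.

(** Cauchy's theorem in the only form used below. Finitely many exceptional heights
    in each bounded strip are harmless, as long as the function is continuous there. *)
Lemma cint_shift T F a b y1 y2 :
  isolated T ->
  (forall w, (a < Im w < b)%R -> ccont F w) ->
  (forall w, (a < Im w < b)%R -> ~ T (Im w) -> chol F w) ->
  (forall w, (a < Im w < b)%R -> ~ T (Im w) -> F (w + 1) = F w) ->
  (a < y1 < b)%R -> (a < y2 < b)%R -> cint F y1 = cint F y2.
Proof.
  intros I Hc Hh Hp H1 H2.
  assert (L : forall y, (a < y < b)%R -> lcont F y) by (intros y Hy x _; apply Hc; exact Hy).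
  assert (A : Re (cint F y1) = Re (cint F y2)).
  { apply (shift_const_re T F a b I Hc Hh Hp); assumption. }
  assert (B : Im (cint F y1) = Im (cint F y2)).
  { rewrite !cint_Re_Im by auto.
    apply (shift_const_re T (fun w => - Ci * F w) a b I); try assumption.
    - intros w Hw. apply ccont_mult; [apply ccont_const|auto].
    - intros w Hw N. apply chol_scal; auto.
    - intros w Hw N. rewrite Hp; auto. }
  destruct (cint F y1), (cint F y2). simpl in A, B. subst. reflexivity.
Qed.

(** * Fourier expansions of periodic functions *)

(** The difference quotient of a function with f s = 0, completed by its limit. *)
Definition slope (f : C -> C) (s a : C) (w : C) : C :=
  if excluded_middle_informative (w = s) then a else f w / (w - s).

Lemma slope_cont f s a : cderiv f s a -> f s = 0 -> ccont (slope f s a) s.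
Proof.
  intros H Z eps He. destruct (H (eps / 2)%R ltac:(lra)) as [d [Hd K]].
  exists d. split; [exact Hd|]. intros w Hw. unfold slope.
  destruct (excluded_middle_informative (s = s)) as [_|N]; [|now elim N].
  destruct (excluded_middle_informative (w = s)) as [->|N].
  - replace (a - a) with (RtoC 0) by ring. rewrite Cmod_0. exact He.
  - assert (N' : w - s <> 0) by (apply Cminus_eq_contra, N).
    specialize (K w Hw). rewrite Z in K.
    replace (f w / (w - s) - a) with ((f w - 0 - a * (w - s)) / (w - s)) by (field; exact N').
    assert (P := proj1 (Cmod_gt_0 _) N').
    rewrite Cmod_div by exact N'.
    apply Rmult_lt_reg_r with (Cmod (w - s)); [exact P|].
    replace (Cmod (f w - 0 - a * (w - s)) / Cmod (w - s) * Cmod (w - s))%R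
      with (Cmod (f w - 0 - a * (w - s))) by (field; lra).
    nra.
Qed.

Lemma RtoC_neq0 x : x <> 0%R -> RtoC x <> 0.
Proof. intros H K. apply H. apply RtoC_inj. exact K. Qed.

Lemma two_pi_i_neq0 : RtoC (2 * PI) * Ci <> 0.
Proof.
  apply Cmult_neq_0; [|exact Ci_nz]. apply RtoC_neq0. assert (P := PI_RGT_0). lra.
Qed.

Lemma isolated_add T y0 : isolated T -> isolated (fun y => T y \/ y = y0).
Proof.
  intros H y. destruct (H y) as [d [Hd K]].
  destruct (Req_dec y y0) as [->|N].
  - exists d. split; [exact Hd|]. intros v Hv [A|A].
    + exact (K v Hv A).
    + subst. rewrite Rminus_diag, Rabs_R0 in Hv. lra.
  - assert (P : (0 < Rabs (y0 - y))%R) by (apply Rabs_pos_lt; lra).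
    exists (Rmin d (Rabs (y0 - y))). split; [apply Rmin_glb_lt; lra|].
    intros v Hv [A|A].
    + apply (K v); [|exact A]. assert (X := Rmin_l d (Rabs (y0 - y))). lra.
    + subst. assert (X := Rmin_r d (Rabs (y0 - y))). lra.
Qed.

Lemma isolated_none : isolated (fun _ => False).
Proof. intros y. exists 1%R. split; [lra|]. auto. Qed.

Lemma lcont_bounded F y : lcont F y ->
  exists M, (0 <= M)%R /\ forall x, (0 <= x <= 1)%R -> (Cmod (F (x, y)) <= M)%R.
Proof.
  intros H.
  assert (B : forall G, lcont G y ->
    exists M, forall x, (0 <= x <= 1)%R -> (Rabs (Re (G (x, y))) <= M)%R).
  { intros G K.
    destruct (continuity_ab_maj (fun x => Rabs (Re (G (x, y)))) 0 1 ltac:(lra)) as [m [Hm _]].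
    - intros x Hx. apply (continuity_pt_comp (fun x => Re (G (x, y))) Rabs).
      + apply continuity_pt_filterlim, ccont_line, K, Hx.
      + apply Rcontinuity_abs.
    - eexists. exact Hm. }
  destruct (B F H) as [M1 H1]. destruct (B _ (lcont_scal (- Ci) F y H)) as [M2 H2].
  assert (Q : forall x, (0 <= x <= 1)%R -> (Cmod (F (x, y)) <= M1 + M2)%R).
  { intros x Hx. eapply Rle_trans; [apply Cmod_le_sum|].
    specialize (H1 x Hx). specialize (H2 x Hx). cbv beta in H2. rewrite <- Im_as_Re in H2. lra. }
  exists (M1 + M2)%R. split; [|exact Q].
  eapply Rle_trans; [apply Cmod_ge_0|apply (Q 0%R); lra].
Qed.

Definition cz (n : Z) : C := RtoC (IZR n).

Lemma cz_plus m n : cz (m + n) = cz m + cz n.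
Proof. unfold cz. rewrite plus_IZR. apply RtoC_plus. Qed.
Lemma cz_opp n : cz (- n) = - cz n.
Proof. unfold cz. rewrite opp_IZR. apply RtoC_opp. Qed.
Lemma cz_mult m n : cz (m * n) = cz m * cz n.
Proof. unfold cz. rewrite mult_IZR. apply RtoC_mult. Qed.
Lemma cz_sub m n : cz (m - n) = cz m - cz n.
Proof. unfold cz. rewrite minus_IZR. apply RtoC_minus. Qed.
Lemma cz_neq0 n : n <> 0%Z -> cz n <> 0.
Proof. intros H. apply RtoC_neq0. intros K. apply H. apply eq_IZR. exact K. Qed.
Lemma Im_add_cz w n : Im (w + cz n) = Im w.
Proof. destruct w. simpl. ring. Qed.
Lemma ce_cz n : ce (cz n) = 1.
Proof. apply ce_IZR. Qed.
Lemma ce_add_cz w n : ce (w + cz n) = ce w.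
Proof. apply ce_period. Qed.

Lemma chol_lin a s : chol (fun w => a * w) s.
Proof. apply chol_scal, chol_id. Qed.

Lemma cint_ce k y : k <> 0%Z -> cint (fun w => ce (cz k * w)) y = 0.
Proof.
  intros N. assert (N' := cz_neq0 k N). assert (T := two_pi_i_neq0).
  set (c := RtoC (2 * PI) * Ci * cz k).
  assert (Nc : c <> 0) by (apply Cmult_neq_0; assumption).
  apply (cint_deriv_period (fun w => / c * ce (cz k * w))).
  - intros x. split.
    + eapply cderiv_eq.
      * apply cderiv_mult; [apply cderiv_const|].
        apply (cderiv_comp ce (fun w => cz k * w)); [apply cderiv_ce|].
        eapply cderiv_ext; [|apply (cderiv_affine (cz k) 0)].
        exists 1%R. split; [lra|]. intros w _. simpl. ring.
      * cbv beta. fold (Cdiv 1 c).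
        replace (0 * ce (cz k * (x, y)) + / c * (cz k * (RtoC (2 * PI) * Ci * ce (cz k * (x, y)))))
          with (/ c * c * ce (cz k * (x, y))) by (unfold c; ring).
        rewrite Cinv_l by exact Nc. ring.
    + apply chol_cont, chol_ce_comp, chol_lin.
  - f_equal. rewrite <- (ce_add_cz (cz k * (0%R, y)) k). f_equal.
    unfold cz, Cplus, Cmult, RtoC; simpl. f_equal; ring.
Qed.

(** The symmetric partial sum over -K < k <= K; the asymmetry by one term makes
    telescoping sums come out as g(K) - g(-K). *)
Fixpoint fsum (c : Z -> C) (K : nat) : C :=
  match K with
  | O => 0
  | S K' => fsum c K' + (c (Z.of_nat (S K')) + c (- Z.of_nat K')%Z)
  end.

(** The coefficient of e(k w) with w complex, so that it does not depend on y. *)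
Definition coef (F : C -> C) (k : Z) (y : R) : C := cint (fun w => F w * ce (- cz k * w)) y.

Lemma fsum_telescope (c g : Z -> C) K :
  (forall k, c k = g k - g (k - 1)%Z) ->
  fsum c K = g (Z.of_nat K) - g (- Z.of_nat K)%Z.
Proof.
  intros H. induction K as [|K IH].
  - simpl. ring.
  - cbn [fsum]. rewrite IH, !H.
    replace (Z.of_nat (S K) - 1)%Z with (Z.of_nat K) by lia.
    replace (- Z.of_nat K - 1)%Z with (- Z.of_nat (S K))%Z by lia. ring.
Qed.

Lemma exp_pow_nat x (n : nat) : (exp x ^ n = exp (INR n * x))%R.
Proof.
  induction n as [|n IH].
  - simpl. rewrite Rmult_0_l, exp_0. reflexivity.
  - rewrite S_INR. simpl. rewrite IH, <- exp_plus. f_equal. ring.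
Qed.

Lemma isolated_ball T y : isolated T -> ~ T y ->
  exists d, (0 < d)%R /\ forall v, (Rabs (v - y) < d)%R -> ~ T v.
Proof.
  intros H N. destruct (H y) as [d [Hd K]]. exists d. split; [exact Hd|].
  intros v Hv. destruct (Req_dec v y) as [->|M]; [exact N|].
  apply K. split; [|exact Hv]. apply Rabs_pos_lt. lra.
Qed.

Section Fourier.
Variables (T : R -> Prop) (a b : R).
Hypothesis T_isolated : isolated T.

(** Periodic functions on a strip, continuous everywhere and holomorphic off the
    exceptional heights T. *)
Definition strip_fun (F : C -> C) : Prop :=
  (forall w, (a < Im w < b)%R -> ccont F w) /\
  (forall w, (a < Im w < b)%R -> ~ T (Im w) -> chol F w) /\
  (forall w, (a < Im w < b)%R -> ~ T (Im w) -> F (w + 1) = F w).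

Lemma strip_period F w n : strip_fun F -> (a < Im w < b)%R -> ~ T (Im w) -> F (w + cz n) = F w.
Proof.
  intros [_ [_ H]] Hw N.
  assert (P : forall k : nat, F (w + cz (Z.of_nat k)) = F w /\
                    F (w + cz (- Z.of_nat k)) = F w).
  { induction k as [|k [IH1 IH2]].
    - simpl. split; f_equal; unfold cz; ring.
    - split.
      + rewrite <- IH1, <- (H (w + cz (Z.of_nat k))).
        * f_equal. replace (Z.of_nat (S k)) with (Z.of_nat k + 1)%Z by lia.
          rewrite cz_plus. change (cz 1) with (RtoC 1). ring.
        * rewrite Im_add_cz. exact Hw.
        * rewrite Im_add_cz. exact N.
      + rewrite <- IH2, <- (H (w + cz (- Z.of_nat (S k)))).
        * f_equal. replace (- Z.of_nat k)%Z with (- Z.of_nat (S k) + 1)%Z by lia.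
          rewrite cz_plus. change (cz 1) with (RtoC 1). ring.
        * rewrite Im_add_cz. exact Hw.
        * rewrite Im_add_cz. exact N. }
  destruct (Z.le_gt_cases 0 n) as [L|L].
  - rewrite <- (Z2Nat.id n L). apply P.
  - replace n with (- Z.of_nat (Z.to_nat (- n)))%Z by lia. apply P.
Qed.

Lemma strip_mult_ce F k : strip_fun F -> strip_fun (fun w => F w * ce (- cz k * w)).
Proof.
  intros [H1 [H2 H3]]. repeat split.
  - intros w Hw. apply ccont_mult; [auto|]. apply chol_cont, chol_ce_comp, chol_lin.
  - intros w Hw N. apply chol_mult; [auto|]. apply chol_ce_comp, chol_lin.
  - intros w Hw N. rewrite H3 by auto. f_equal.
    rewrite <- (ce_add_cz (- cz k * w) (- k)). f_equal. rewrite cz_opp. ring.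
Qed.

Lemma strip_lcont F y : strip_fun F -> (a < y < b)%R -> lcont F y.
Proof. intros [H _] Hy x _. apply H. exact Hy. Qed.

Lemma strip_cint F y1 y2 : strip_fun F -> (a < y1 < b)%R -> (a < y2 < b)%R ->
  cint F y1 = cint F y2.
Proof. intros [H1 [H2 H3]]. apply (cint_shift T F a b); assumption. Qed.

Lemma coef_const F k y1 y2 : strip_fun F -> (a < y1 < b)%R -> (a < y2 < b)%R ->
  coef F k y1 = coef F k y2.
Proof. intros H. apply strip_cint, strip_mult_ce, H. Qed.

Lemma strip_plus_const F c : strip_fun F -> strip_fun (fun w => F w + c).
Proof.
  intros [H1 [H2 H3]]. repeat split.
  - intros w Hw. apply ccont_plus; [auto|apply ccont_const].
  - intros w Hw N. apply chol_plus; [auto|apply chol_const].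
  - intros w Hw N. rewrite H3; auto.
Qed.

Lemma coef_plus_const F c k y : strip_fun F -> (a < y < b)%R ->
  coef (fun w => F w + c) k y = coef F k y + (if Z.eqb k 0 then c else 0).
Proof.
  intros H Hy. unfold coef.
  assert (L : lcont (fun w => ce (- cz k * w)) y).
  { intros x _. apply chol_cont, chol_ce_comp, chol_lin. }
  rewrite (cint_ext _ (fun w => F w * ce (- cz k * w) + c * ce (- cz k * w)))
    by (intros x _; ring).
  rewrite cint_plus.
  - f_equal. rewrite cint_scal by exact L.
    destruct (Z.eqb_spec k 0) as [->|N].
    + rewrite (cint_ext _ (fun _ => 1)).
      * rewrite cint_const. ring.
      * intros x _. rewrite <- ce_0. f_equal. unfold cz. ring.
    + rewrite (cint_ext _ (fun w => ce (cz (- k) * w))).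
      * rewrite cint_ce by lia. ring.
      * intros x _. rewrite cz_opp. reflexivity.
  - apply (strip_lcont _ y (strip_mult_ce F k H) Hy).
  - apply lcont_scal, L.
Qed.

Section Vanish.
Variables (F : C -> C) (w0 : C).
Hypothesis HF : strip_fun F.
Hypothesis w0_in : (a < Im w0 < b)%R.
Hypothesis w0_T : ~ T (Im w0).
Hypothesis F_zero : F w0 = 0.

Let l := C_derive F w0.
Let G (w : C) : C :=
  if excluded_middle_informative (ce (w - w0) = 1)
  then l / (- (RtoC (2 * PI) * Ci)) else F w / (1 - ce (w - w0)).

Lemma F_zero_coset w : ce (w - w0) = 1 -> F w = 0.
Proof.
  intros H. destruct (ce_eq_1 _ H) as [n Hn].
  replace w with (w0 + cz n) by (unfold cz; rewrite <- Hn; ring).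
  rewrite strip_period; auto.
Qed.

Lemma G_mult w : G w * (1 - ce (w - w0)) = F w.
Proof.
  unfold G. destruct (excluded_middle_informative (ce (w - w0) = 1)) as [E|N].
  - rewrite E, (F_zero_coset w E). ring.
  - field. intros K. apply N. symmetry. apply Ceq_minus. exact K.
Qed.

(** Numerator and denominator of G both vanish to first order at w0, and G is the
    quotient of their completed difference quotients. *)
Lemma G_cont_w0 : ccont G w0.
Proof.
  assert (Hc : chol F w0) by (apply HF; assumption).
  destruct (chol_C_derive _ _ Hc) as [D _]. fold l in D.
  assert (T0 := two_pi_i_neq0).
  assert (D2 : cderiv (fun w => 1 - ce (w - w0)) w0 (- (RtoC (2 * PI) * Ci))).
  { eapply cderiv_eq.
    - apply cderiv_plus; [apply cderiv_const|].
      eapply cderiv_ext.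
      2:{ apply (cderiv_mult (fun _ => - (1)) (fun w => ce (w - w0))); [apply cderiv_const|].
          apply (cderiv_comp ce (fun w => w - w0)); [apply cderiv_ce|].
          eapply cderiv_ext; [|apply (cderiv_affine 1 (- w0))].
          exists 1%R. split; [lra|]. intros w _. ring. }
      exists 1%R. split; [lra|]. intros w _. ring.
    - replace (w0 - w0) with (RtoC 0) by ring. rewrite ce_0. ring. }
  assert (Z2 : 1 - ce (w0 - w0) = 0).
  { replace (w0 - w0) with (RtoC 0) by ring. rewrite ce_0. ring. }
  assert (S1 := slope_cont _ _ _ D F_zero).
  assert (S2 := slope_cont _ _ _ D2 Z2).
  set (s1 := slope F w0 l) in *.
  set (s2 := slope (fun w => 1 - ce (w - w0)) w0 (- (RtoC (2 * PI) * Ci))) in *.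
  assert (V2 : s2 w0 = - (RtoC (2 * PI) * Ci)).
  { unfold s2, slope. destruct (excluded_middle_informative (w0 = w0)) as [_|N]; [reflexivity|now elim N]. }
  assert (N2 : s2 w0 <> 0).
  { rewrite V2. intros K. apply T0. replace (RtoC (2 * PI) * Ci) with (- - (RtoC (2 * PI) * Ci)) by ring.
    rewrite K. ring. }
  apply (ccont_ext (fun w => s1 w * / s2 w)).
  2:{ apply ccont_mult; [exact S1|]. apply ccont_inv; assumption. }
  refine (cnear_imp _ _ _ _ (cnear_ball w0 1 Rlt_0_1)). intros w Hw.
  unfold G. destruct (excluded_middle_informative (ce (w - w0) = 1)) as [E|N].
  - assert (E0 : w = w0).
    { destruct (ce_eq_1 _ E) as [n Hn]. rewrite Hn, Cmod_R in Hw.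
      destruct (Rabs_def2 _ _ Hw) as [A B]. apply lt_IZR in A.
      assert (B' : (-1 < n)%Z) by (apply lt_IZR; exact B).
      assert (n = 0)%Z by lia. subst n.
      replace w with ((w - w0) + w0) by ring. rewrite Hn. ring. }
    subst w. rewrite V2. unfold s1, slope.
    destruct (excluded_middle_informative (w0 = w0)) as [_|K]; [reflexivity|now elim K].
  - unfold s1, s2, slope.
    destruct (excluded_middle_informative (w = w0)) as [->|K].
    + elim N. replace (w0 - w0) with (RtoC 0) by ring. apply ce_0.
    + field. split; [|apply Cminus_eq_contra, K].
      intros J. apply N. symmetry. apply Ceq_minus. exact J.
Qed.

Lemma ce_shift_w0 w n : ce (w + cz n - w0) = ce (w - w0).
Proof. rewrite <- (ce_add_cz (w - w0) n). f_equal. ring. Qed.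

Lemma F_shift_back w : ~ T (Im w) -> (a < Im w < b)%R -> forall n, F (w + cz n) = F w.
Proof. intros. apply strip_period; auto. Qed.

Lemma G_regular w : ce (w - w0) <> 1 -> chol F w -> chol G w.
Proof.
  intros N H.
  assert (P : cnear w (fun v => 1 - ce (v - w0) <> 0)).
  { apply (ccont_neq0 (fun v => 1 - ce (v - w0))).
    - apply chol_cont. apply chol_minus; [apply chol_const|]. apply chol_ce_comp.
      apply chol_minus; [apply chol_id|apply chol_const].
    - intros K. apply N. symmetry. apply Ceq_minus. exact K. }
  apply (chol_ext (fun w => F w / (1 - ce (w - w0)))).
  - refine (cnear_imp _ _ _ _ P). intros v Hv. unfold G.
    destruct (excluded_middle_informative (ce (v - w0) = 1)) as [E|_]; [|reflexivity].
    elim Hv. rewrite E. ring.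
  - apply chol_div; [exact H| |exact (cnear_point _ _ P)].
    apply chol_minus; [apply chol_const|]. apply chol_ce_comp.
    apply chol_minus; [apply chol_id|apply chol_const].
Qed.

Lemma G_cont_regular w : ce (w - w0) <> 1 -> ccont F w -> ccont G w.
Proof.
  intros N H.
  assert (Q : ccont (fun v => 1 - ce (v - w0)) w).
  { apply chol_cont. apply chol_minus; [apply chol_const|]. apply chol_ce_comp.
    apply chol_minus; [apply chol_id|apply chol_const]. }
  assert (N0 : 1 - ce (w - w0) <> 0).
  { intros K. apply N. symmetry. apply Ceq_minus. exact K. }
  apply (ccont_ext (fun w => F w * / (1 - ce (w - w0)))).
  - refine (cnear_imp _ _ _ _ (ccont_neq0 _ _ Q N0)). intros v Hv. unfold G.
    destruct (excluded_middle_informative (ce (v - w0) = 1)) as [E|_]; [|reflexivity].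
    elim Hv. rewrite E. ring.
  - apply ccont_mult; [exact H|]. apply (ccont_inv (fun v => 1 - ce (v - w0))); assumption.
Qed.

(** The zeros of 1 - e(w - w0) are the translates of w0, all on one line. The quotient is
    continuous there and holomorphic elsewhere, so the height of w0 joins the exceptional
    set. *)
Lemma G_strip : 
  (forall w, (a < Im w < b)%R -> ccont G w) /\
  (forall w, (a < Im w < b)%R -> ~ (T (Im w) \/ Im w = Im w0) -> chol G w) /\
  (forall w, (a < Im w < b)%R -> ~ (T (Im w) \/ Im w = Im w0) -> G (w + 1) = G w).
Proof.
  destruct HF as [H1 [H2 H3]]. split; [|split].
  - intros w Hw. destruct (classic (ce (w - w0) = 1)) as [E|N].
    + destruct (ce_eq_1 _ E) as [n Hn].
      assert (Ew : w = w0 + cz n) by (unfold cz; rewrite <- Hn; ring).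
      assert (Q : ccont (fun v => G (v + cz (- n))) w).
      { apply (ccont_comp G (fun v => v + cz (- n))).
        - replace (w + cz (- n)) with w0; [apply G_cont_w0|]. rewrite Ew, cz_opp. ring.
        - apply ccont_plus; [eapply cderiv_cont, cderiv_id|apply ccont_const]. }
      refine (ccont_ext _ _ _ _ Q).
      destruct (isolated_ball T (Im w0) T_isolated w0_T) as [d [Hd K]].
      set (e := Rmin d (Rmin (Im w0 - a) (b - Im w0))).
      assert (He : (0 < e)%R) by (repeat apply Rmin_glb_lt; lra).
      exists e. split; [exact He|]. intros v Hv.
      assert (I0 : Im w = Im w0) by (rewrite Ew; apply Im_add_cz).
      assert (X := Rmin_l d (Rmin (Im w0 - a) (b - Im w0))).
      assert (X2 := Rmin_r d (Rmin (Im w0 - a) (b - Im w0))).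
      assert (X3 := Rmin_l (Im w0 - a) (b - Im w0)).
      assert (X4 := Rmin_r (Im w0 - a) (b - Im w0)). fold e in X, X2.
      assert (Y : (Rabs (Im v - Im w0) < e)%R).
      { eapply Rle_lt_trans; [|exact Hv]. rewrite <- I0.
        replace (Im v - Im w)%R with (Im (v - w)); [apply im_le_Cmod|].
        destruct v, w. simpl. ring. }
      destruct (Rabs_def2 _ _ Y) as [Y1 Y2].
      unfold G. rewrite ce_shift_w0.
      destruct (excluded_middle_informative (ce (v - w0) = 1)); [reflexivity|].
      f_equal. apply F_shift_back; [apply K; lra|lra].
    + apply G_cont_regular; [exact N|]. apply H1, Hw.
  - intros w Hw N. apply G_regular; [|apply H2; tauto].
    intros E. destruct (ce_eq_1 _ E) as [n Hn]. apply N. right.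
    assert (Ew : w = w0 + cz n) by (unfold cz; rewrite <- Hn; ring).
    rewrite Ew. apply Im_add_cz.
  - intros w Hw N. change (RtoC 1) with (cz 1). unfold G. rewrite ce_shift_w0.
    destruct (excluded_middle_informative (ce (w - w0) = 1)); [reflexivity|].
    f_equal. apply F_shift_back; tauto.
Qed.

Let g (k : Z) (y : R) := cint (fun w => G w * ce (- cz k * (w - w0))) y.

Lemma Gk_cont k w : (a < Im w < b)%R -> ccont (fun w => G w * ce (- cz k * (w - w0))) w.
Proof.
  intros Hw. apply ccont_mult; [apply G_strip, Hw|]. apply chol_cont, chol_ce_comp.
  apply chol_scal, chol_minus; [apply chol_id|apply chol_const].
Qed.

Lemma g_const k y1 y2 : (a < y1 < b)%R -> (a < y2 < b)%R -> g k y1 = g k y2.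
Proof.
  intros K1 K2. destruct G_strip as [H1 [H2 H3]].
  apply (cint_shift (fun y => T y \/ y = Im w0) _ a b).
  - apply isolated_add, T_isolated.
  - intros w Hw. apply Gk_cont, Hw.
  - intros w Hw N. apply chol_mult; [auto|]. apply chol_ce_comp.
    apply chol_scal, chol_minus; [apply chol_id|apply chol_const].
  - intros w Hw N. rewrite H3 by auto. f_equal.
    rewrite <- (ce_add_cz (- cz k * (w - w0)) (- k)). f_equal. rewrite cz_opp. ring.
  - exact K1.
  - exact K2.
Qed.

(** Since F = G (1 - e(w - w0)), the Fourier coefficients of F are differences of
    consecutive coefficients of G, and the Fourier series of F at w0 telescopes. *)
Lemma coef_g k y : (a < y < b)%R -> coef F k y * ce (cz k * w0) = g k y - g (k - 1) y.
Proof.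
  intros Hy. unfold coef, g.
  assert (L : forall k, lcont (fun w => G w * ce (- cz k * (w - w0))) y)
    by (intros j x _; apply Gk_cont; exact Hy).
  rewrite (Cmult_comm (cint _ _)).
  rewrite <- cint_scal by (apply strip_lcont; [apply strip_mult_ce, HF|exact Hy]).
  unfold Cminus at 1.
  replace (- cint (fun w => G w * ce (- cz (k - 1) * (w - w0))) y)
    with (- (1) * cint (fun w => G w * ce (- cz (k - 1) * (w - w0))) y) by ring.
  rewrite <- cint_scal by apply L.
  rewrite <- cint_plus; [|apply L|apply lcont_scal, L].
  apply cint_ext. intros x _. set (w := (x, y)).
  rewrite <- (G_mult w) at 1.
  replace (ce (- cz k * (w - w0))) with (ce (cz k * w0) * ce (- cz k * w))
    by (rewrite <- ce_plus; f_equal; ring).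
  replace (ce (- cz (k - 1) * (w - w0)))
    with (ce (cz k * w0) * ce (- cz k * w) * ce (w - w0)).
  - ring.
  - rewrite <- !ce_plus. f_equal. rewrite cz_sub. change (cz 1) with (RtoC 1). ring.
Qed.

(** After telescoping, the partial sum is the difference of two coefficients of G, with
    indices K and -K. The first is integrated below w0 and the second above it,
    where the exponential decays geometrically. *)
Lemma fourier_vanish y : (a < y < b)%R ->
  exists M rho, (0 < rho < 1)%R /\ forall K : nat,
    (Cmod (fsum (fun k => (coef F k y * ce (cz k * w0))%C) K) <= M * rho ^ K)%R.
Proof.
  intros Hy.
  (* one height below w0 and one above it, inside the strip *)
  set (yA := ((a + Im w0) / 2)%R). set (yB := ((Im w0 + b) / 2)%R).
  assert (HA : (a < yA < Im w0)%R) by (unfold yA; lra).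
  assert (HB : (Im w0 < yB < b)%R) by (unfold yB; lra).
  assert (CG := proj1 G_strip).
  destruct (lcont_bounded G yA) as [MA [PA BA]]; [intros x _; apply CG; simpl; lra|].
  destruct (lcont_bounded G yB) as [MB [PB BB]]; [intros x _; apply CG; simpl; lra|].
  assert (P := PI_RGT_0).
  set (rA := exp (2 * PI * (yA - Im w0))). set (rB := exp (2 * PI * (Im w0 - yB))).
  assert (RA : (0 < rA < 1)%R).
  { split; [apply exp_pos|]. rewrite <- exp_0. apply exp_increasing. nra. }
  assert (RB : (0 < rB < 1)%R).
  { split; [apply exp_pos|]. rewrite <- exp_0. apply exp_increasing. nra. }
  exists (2 * MA + 2 * MB)%R, (Rmax rA rB).
  split. { unfold Rmax; destruct (Rle_dec rA rB); lra. }
  intros K.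
  rewrite (fsum_telescope _ (fun k => g k y)) by (intros k; apply coef_g, Hy).
  rewrite (g_const _ y yA) by lra. rewrite (g_const (- Z.of_nat K) y yB) by lra.
  eapply Rle_trans; [unfold Cminus; apply Cmod_triangle|]. rewrite Cmod_opp.
  rewrite !Rmult_plus_distr_r. apply Rplus_le_compat.
  - eapply Rle_trans.
    { apply (cint_bound _ _ (MA * rA ^ K)); [intros x _; apply Gk_cont; simpl; lra|].
      intros x Hx. rewrite Cmod_mult. apply Rmult_le_compat; try apply Cmod_ge_0; auto.
      rewrite Cmod_ce. unfold rA. rewrite exp_pow_nat. right. f_equal.
      unfold cz. rewrite <- INR_IZR_INZ. destruct w0. simpl. ring. }
    rewrite Rmult_assoc. apply Rmult_le_compat_l; [lra|]. apply Rmult_le_compat_l; [lra|].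
    apply pow_incr. split; [lra|apply Rmax_l].
  - eapply Rle_trans.
    { apply (cint_bound _ _ (MB * rB ^ K)); [intros x _; apply Gk_cont; simpl; lra|].
      intros x Hx. rewrite Cmod_mult. apply Rmult_le_compat; try apply Cmod_ge_0; auto.
      rewrite Cmod_ce. unfold rB. rewrite exp_pow_nat. right. f_equal.
      rewrite cz_opp. unfold cz. rewrite <- INR_IZR_INZ. destruct w0. simpl. ring. }
    rewrite Rmult_assoc. apply Rmult_le_compat_l; [lra|]. apply Rmult_le_compat_l; [lra|].
    apply pow_incr. split; [lra|apply Rmax_r].
Qed.
End Vanish.

Lemma fsum_ext c d K : (forall k, c k = d k) -> fsum c K = fsum d K.
Proof. intros H. induction K as [|K IH]; cbn [fsum]; [reflexivity|]. rewrite IH, !H. reflexivity. Qed.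

Lemma fsum_add c d K : fsum (fun k => c k + d k) K = fsum c K + fsum d K.
Proof. induction K as [|K IH]; cbn [fsum]; [ring|]. rewrite IH. ring. Qed.

Lemma fsum_delta v K : fsum (fun k => if Z.eqb k 0 then v else 0) (S K) = v.
Proof.
  induction K as [|K IH].
  - simpl. ring.
  - cbn [fsum] in *. rewrite IH.
    replace (Z.eqb (Z.of_nat (S (S K))) 0) with false by (symmetry; apply Z.eqb_neq; lia).
    replace (Z.eqb (- Z.of_nat (S K)) 0) with false by (symmetry; apply Z.eqb_neq; lia). ring.
Qed.

(** Subtracting the constant F w0 reduces this to the expansion of a function at one of
    its zeros. *)
Lemma fourier_expansion F w0 y : strip_fun F -> (a < Im w0 < b)%R -> ~ T (Im w0) ->
  (a < y < b)%R ->
  exists M rho, (0 < rho < 1)%R /\ forall K : nat,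
    (Cmod (fsum (fun k => (coef F k y * ce (cz k * w0))%C) (S K) - F w0) <= M * rho ^ S K)%R.
Proof.
  intros HF H0 N Hy.
  destruct (fourier_vanish (fun w => F w + - F w0) w0
              (strip_plus_const F _ HF) H0 N ltac:(cbv beta; ring) y Hy) as [M [rho [Hr B]]].
  exists M, rho. split; [exact Hr|]. intros K. specialize (B (S K)).
  rewrite (fsum_ext _ (fun k => coef F k y * ce (cz k * w0) + (if Z.eqb k 0 then - F w0 else 0))) in B.
  - rewrite fsum_add, fsum_delta in B. exact B.
  - intros k. rewrite coef_plus_const by assumption.
    destruct (Z.eqb_spec k 0) as [->|_]; [|ring].
    replace (cz 0 * w0) with (RtoC 0) by (unfold cz; ring). rewrite ce_0. ring.
Qed.

Lemma fourier_unique F w0 y : strip_fun F -> (a < Im w0 < b)%R -> ~ T (Im w0) ->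
  (a < y < b)%R -> (forall k, coef F k y = 0) -> F w0 = 0.
Proof.
  intros HF H0 N Hy Z. destruct (fourier_expansion F w0 y HF H0 N Hy) as [M [rho [Hr B]]].
  apply Cmod_eq_0. apply Rle_antisym; [|apply Cmod_ge_0].
  apply le_epsilon. intros eps He. rewrite Rplus_0_l.
  assert (L := pow_lt_1_zero rho ltac:(rewrite Rabs_right; lra)).
  destruct (L (eps / (Rabs M + 1))%R) as [n Hn].
  { apply Rdiv_lt_0_compat; [lra|]. assert (X := Rabs_pos M). lra. }
  specialize (Hn (S n) ltac:(lia)). specialize (B n).
  rewrite (fsum_ext _ (fun _ => 0)) in B by (intros k; rewrite Z; ring).
  assert (Z0 : fsum (fun _ => 0) (S n) = 0).
  { clear. induction (S n) as [|k IH]; cbn [fsum]; [reflexivity|]. rewrite IH. ring. }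
  rewrite Z0 in B. replace (0 - F w0) with (- F w0) in B by ring. rewrite Cmod_opp in B.
  eapply Rle_trans; [exact B|]. rewrite Rabs_right in Hn by (apply Rle_ge, pow_le; lra).
  assert (X := Rabs_pos M). assert (X2 := Rle_abs M).
  assert (Q : (0 <= rho ^ S n)%R) by (apply pow_le; lra).
  apply Rle_trans with ((Rabs M + 1) * rho ^ S n)%R; [apply Rmult_le_compat_r; lra|].
  apply Rle_trans with ((Rabs M + 1) * (eps / (Rabs M + 1)))%R.
  - apply Rmult_le_compat_l; lra.
  - right. field. lra.
Qed.
End Fourier.

(** * Cauchy's estimate and series of holomorphic functions *)

(** Put w |-> s0 + r e(w): the circle of radius r becomes a horizontal period, and
    circles shrinking to s0 become periods moving to i oo. The integral of
    (f - f s0) e(-w) over a period does not depend on the height, tends to r l at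
    i oo, and is at most 4M at height 0. *)
Lemma cauchy_estimate f s0 l R0 M : (0 < R0)%R ->
  (forall w, (Cmod (w - s0) < R0)%R -> chol f w) ->
  (forall w, (Cmod (w - s0) < R0)%R -> (Cmod (f w) <= M)%R) ->
  cderiv f s0 l -> (Cmod l <= 8 * M / R0)%R.
Proof.
  intros HR Hh HM Hd.
  set (r := (R0 / 2)%R). assert (Hr : (0 < r)%R) by (unfold r; lra).
  (* |e(w)| < 2 above the height -b, so r e(w) stays in the disc of radius R0 = 2 r *)
  set (b := (ln 2 / (2 * PI))%R). assert (P := PI_RGT_0).
  assert (Hb : (0 < b)%R).
  { apply Rdiv_lt_0_compat; [|lra]. rewrite <- ln_1. apply ln_increasing; lra. }
  assert (Hce : forall w, (- b < Im w)%R -> (Cmod (RtoC r * ce w) < R0)%R).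
  { intros w Hw. rewrite Cmod_mult, Cmod_R, Rabs_right, Cmod_ce by lra.
    apply Rlt_le_trans with (r * 2)%R; [|unfold r; lra].
    apply Rmult_lt_compat_l; [exact Hr|]. rewrite <- (exp_ln 2) at 2 by lra.
    apply exp_increasing. apply Rle_lt_trans with (2 * PI * - Im w)%R; [lra|].
    apply Rlt_le_trans with (2 * PI * b)%R; [apply Rmult_lt_compat_l; lra|].
    unfold b. right. field. lra. }
  assert (Hin : forall w, (- b < Im w)%R -> (Cmod (s0 + RtoC r * ce w - s0) < R0)%R).
  { intros w Hw. replace (s0 + RtoC r * ce w - s0) with (RtoC r * ce w) by ring. auto. }
  set (F := fun w => (f (s0 + RtoC r * ce w) - f s0) * ce (- w)).
  assert (FH : forall w, (- b < Im w)%R -> chol F w).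
  { intros w Hw. apply chol_mult.
    - apply chol_minus; [|apply chol_const].
      apply (chol_comp f (fun w => s0 + RtoC r * ce w)); [apply Hh, Hin, Hw|].
      apply chol_plus; [apply chol_const|]. apply chol_scal, chol_ce.
    - apply chol_ce_comp, chol_opp, chol_id. }
  assert (FP : forall w, F (w + 1) = F w).
  { intros w. unfold F. change (RtoC 1) with (cz 1). rewrite ce_add_cz.
    replace (- (w + cz 1)) with (- w + cz (-1))
      by (change (cz (-1)) with (cz (Z.opp 1)); rewrite cz_opp; ring).
    rewrite ce_add_cz. reflexivity. }
  assert (S : forall Y, (0 <= Y)%R -> cint F 0 = cint F Y).
  { intros Y HY. apply (cint_shift (fun _ => False) F (- b) (Y + 1)); try lra.
    - apply isolated_none.
    - intros w Hw. apply chol_cont, FH. lra.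
    - intros w Hw _. apply FH. lra.
    - intros w Hw _. apply FP. }
  assert (LC : forall Y, (0 <= Y)%R -> lcont F Y).
  { intros Y HY x _. apply chol_cont, FH. simpl. lra. }
  assert (B0 : (Cmod (cint F 0) <= 4 * M)%R).
  { eapply Rle_trans; [apply (cint_bound F 0 (2 * M)); [apply LC; lra|]|lra].
    intros x Hx. unfold F. rewrite Cmod_mult, Cmod_ce.
    replace (- (2 * PI * Im (- (x, 0%R))))%R with 0%R by (simpl; ring).
    rewrite exp_0, Rmult_1_r. eapply Rle_trans; [apply Cmod_triangle|]. rewrite Cmod_opp.
    assert (Q1 := HM (s0 + RtoC r * ce (x, 0%R)) (Hin (x, 0%R) ltac:(simpl; lra))).
    assert (Q2 := HM s0). replace (s0 - s0) with (RtoC 0) in Q2 by ring.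
    rewrite Cmod_0 in Q2. specialize (Q2 HR). lra. }
  assert (E : forall eps, (0 < eps)%R -> (Cmod (cint F 0 - RtoC r * l) <= 2 * (eps * r))%R).
  { intros eps He. destruct (Hd eps He) as [d [Hd0 K]].
    (* high enough for the circle of radius r |e(w)| to lie in the disc of radius d *)
    set (Y := Rmax 0 (ln (2 * r / d) / (2 * PI))).
    assert (HY : (0 <= Y)%R) by apply Rmax_l.
    assert (HY2 : (r * exp (- (2 * PI * Y)) < d)%R).
    { assert (Q : (ln (2 * r / d) <= 2 * PI * Y)%R).
      { apply Rle_trans with (2 * PI * (ln (2 * r / d) / (2 * PI)))%R.
        - right. field. lra.
        - apply Rmult_le_compat_l; [lra|]. apply Rmax_r. }
      assert (Q2 : (exp (- (2 * PI * Y)) <= exp (- ln (2 * r / d)))%R).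
      { destruct Q as [Q|Q]; [left; apply exp_increasing; lra|right; f_equal; lra]. }
      rewrite (exp_Ropp (ln _)), exp_ln in Q2 by (apply Rdiv_lt_0_compat; lra).
      apply Rle_lt_trans with (r * / (2 * r / d))%R; [apply Rmult_le_compat_l; lra|].
      replace (r * / (2 * r / d))%R with (d / 2)%R by (field; lra). lra. }
    rewrite (S Y HY).
    replace (cint F Y - RtoC r * l) with (cint (fun w => F w + - (RtoC r * l)) Y).
    2:{ rewrite cint_plus by (try apply LC; try exact HY; intros x _; apply ccont_const).
        rewrite cint_const. ring. }
    apply cint_bound.
    { intros x Hx. apply ccont_plus; [apply LC; auto|apply ccont_const]. }
    intros x Hx. set (w := (x, Y)).
    assert (Mw : Cmod (RtoC r * ce w) = (r * exp (- (2 * PI * Y)))%R).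
    { rewrite Cmod_mult, Cmod_R, Rabs_right, Cmod_ce by lra. reflexivity. }
    specialize (K (s0 + RtoC r * ce w)).
    replace (s0 + RtoC r * ce w - s0) with (RtoC r * ce w) in K by ring.
    rewrite Mw in K. specialize (K HY2). unfold F.
    replace ((f (s0 + RtoC r * ce w) - f s0) * ce (- w) + - (RtoC r * l))
      with ((f (s0 + RtoC r * ce w) - f s0 - l * (RtoC r * ce w)) * ce (- w)).
    - rewrite Cmod_mult, Cmod_ce.
      replace (- (2 * PI * Im (- w)))%R with (2 * PI * Y)%R by (unfold w; simpl; ring).
      apply Rle_trans with (eps * (r * exp (- (2 * PI * Y))) * exp (2 * PI * Y))%R.
      + apply Rmult_le_compat_r; [left; apply exp_pos|exact K].
      + rewrite exp_Ropp. right. field. apply Rgt_not_eq, exp_pos.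
    - rewrite ce_opp. field. apply ce_neq0. }
  assert (EE : (Cmod (RtoC r * l) <= 4 * M)%R).
  { apply le_epsilon. intros e He.
    assert (Q := E (e / (2 * r))%R ltac:(apply Rdiv_lt_0_compat; lra)).
    replace (2 * (e / (2 * r) * r))%R with e in Q by (field; lra).
    replace (RtoC r * l) with (cint F 0 - (cint F 0 - RtoC r * l)) by ring.
    eapply Rle_trans; [apply Cmod_triangle|]. rewrite Cmod_opp. lra. }
  rewrite Cmod_mult, Cmod_R, Rabs_right in EE by lra.
  apply Rmult_le_reg_l with r; [exact Hr|].
  replace (r * (8 * M / R0))%R with (4 * M)%R by (unfold r; field; lra). exact EE.
Qed.

(** The real mean value theorem along the segment, for the real and the imaginary
    part; hence the factor 2. *)
Lemma mean_value_bound f a b M :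
  (forall t, (0 <= t <= 1)%R -> exists l, cderiv f (a + RtoC t * (b - a)) l /\ (Cmod l <= M)%R) ->
  (Cmod (f b - f a) <= 2 * M * Cmod (b - a))%R.
Proof.
  intros H.
  assert (K : forall g, (forall t, (0 <= t <= 1)%R ->
       exists l, cderiv g (a + RtoC t * (b - a)) l /\ (Cmod l <= M)%R) ->
       (Rabs (Re (g b - g a)) <= M * Cmod (b - a))%R).
  { intros g Hg.
    set (dg := fun t => C_derive g (a + RtoC t * (b - a))).
    assert (D : forall t, (0 <= t <= 1)%R ->
      cderiv g (a + RtoC t * (b - a)) (dg t) /\ (Cmod (dg t) <= M)%R).
    { intros t Ht. destruct (Hg t Ht) as [l [A B]].
      assert (E : dg t = l) by (apply is_C_derive_unique, cderiv_is_derive, A).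
      rewrite E. auto. }
    destruct (MVT_gen (fun t => Re (g (a + RtoC t * (b - a)))) 0 1
                      (fun t => Re (dg t * (b - a)))) as [c [Hc E]].
    - rewrite Rmin_left, Rmax_right by lra. intros x Hx. apply cderiv_path, D. lra.
    - rewrite Rmin_left, Rmax_right by lra. intros x Hx.
      apply continuity_pt_filterlim. apply (ex_derive_continuous (V := R_NormedModule)).
      eexists. apply cderiv_path, D. lra.
    - rewrite Rmin_left, Rmax_right in Hc by lra.
      replace (a + RtoC 1 * (b - a)) with b in E by ring.
      replace (a + RtoC 0 * (b - a)) with a in E by ring.
      replace (Re (g b - g a)) with (Re (g b) - Re (g a))%R
        by (destruct (g b), (g a); simpl; ring).
      rewrite E. replace (Re (dg c * (b - a)) * (1 - 0))%R with (Re (dg c * (b - a))) by ring.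
      eapply Rle_trans; [apply re_le_Cmod|]. rewrite Cmod_mult.
      apply Rmult_le_compat_r; [apply Cmod_ge_0|]. apply D, Hc. }
  eapply Rle_trans; [apply Cmod_le_sum|].
  assert (K1 := K f H).
  assert (K2 := K (fun w => - Ci * f w)). cbv beta in K2.
  replace (- Ci * f b - - Ci * f a) with (- Ci * (f b - f a)) in K2 by ring.
  rewrite <- Im_as_Re in K2.
  assert (Q : (Rabs (Im (f b - f a)) <= M * Cmod (b - a))%R).
  { apply K2. intros t Ht. destruct (H t Ht) as [l [A B]]. exists (- Ci * l). split.
    - eapply cderiv_eq; [apply cderiv_mult; [apply cderiv_const|exact A]|]. cbv beta. ring.
    - rewrite Cmod_mult, Cmod_opp, Cmod_Ci. lra. }
  lra.
Qed.

Lemma segment_in_ball s R0 a b t : (0 <= t <= 1)%R ->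
  (Cmod (a - s) < R0)%R -> (Cmod (b - s) < R0)%R ->
  (Cmod (a + RtoC t * (b - a) - s) < R0)%R.
Proof.
  intros Ht Ha Hb.
  replace (a + RtoC t * (b - a) - s) with (RtoC (1 - t) * (a - s) + RtoC t * (b - s))
    by (rewrite RtoC_minus; ring).
  eapply Rle_lt_trans; [apply Cmod_triangle|]. rewrite !Cmod_mult, !Cmod_R, !Rabs_right by lra.
  assert (A := Cmod_ge_0 (a - s)). assert (B := Cmod_ge_0 (b - s)).
  destruct (Req_dec t 0) as [->|N]; [lra|]. nra.
Qed.

(** The difference f_N - f_n has a small derivative, so its difference quotients are
    small uniformly, and n may go to infinity. *)
Lemma deriv_limit (f f' : nat -> C -> C) (F G : C -> C) s R0 :
  (forall n w, (Cmod (w - s) < R0)%R -> cderiv (f n) w (f' n w) /\ ccont (f' n) w) ->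
  (forall w, (Cmod (w - s) < R0)%R -> forall eps, (0 < eps)%R ->
     exists N, forall n, (N <= n)%nat -> (Cmod (f n w - F w) < eps)%R) ->
  (forall eps, (0 < eps)%R -> exists N, forall n, (N <= n)%nat ->
     forall w, (Cmod (w - s) < R0)%R -> (Cmod (f' n w - G w) <= eps)%R) ->
  forall w, (Cmod (w - s) < R0)%R -> cderiv F w (G w) /\ ccont G w.
Proof.
  intros HD HF HG w Hw.
  assert (Near : cnear w (fun v => (Cmod (v - s) < R0)%R)).
  { exists (R0 - Cmod (w - s))%R. split; [lra|]. intros v Hv.
    assert (A := Cmod_triangle3 v w s). lra. }
  split.
  - intros eps He.
    destruct (HG (eps / 16)%R ltac:(lra)) as [N HN].
    assert (Key : forall n v, (N <= n)%nat -> (Cmod (v - s) < R0)%R ->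
      (Cmod (f N v - f N w - (F v - F w)) <= eps / 2 * Cmod (v - w))%R).
    { intros _ v _ Hv. apply le_epsilon. intros e Hpe.
      destruct (HF v Hv (e / 2)%R ltac:(lra)) as [N1 H1].
      destruct (HF w Hw (e / 2)%R ltac:(lra)) as [N2 H2].
      set (n := (N + N1 + N2)%nat).
      specialize (H1 n ltac:(unfold n; lia)). specialize (H2 n ltac:(unfold n; lia)).
      assert (MV : (Cmod ((f N v - f n v) - (f N w - f n w)) <= 2 * (eps / 8) * Cmod (v - w))%R).
      { apply (mean_value_bound (fun u => f N u - f n u)). intros t Ht.
        assert (I := segment_in_ball s R0 w v t Ht Hw Hv).
        set (u := w + RtoC t * (v - w)) in *.
        exists (f' N u - f' n u). split.
        - apply cderiv_plus; [apply HD, I|].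
          eapply cderiv_eq.
          + eapply cderiv_ext.
            2:{ apply (cderiv_mult (fun _ => - (1)) (f n)); [apply cderiv_const|apply HD, I]. }
            exists 1%R. split; [lra|]. intros x _. ring.
          + ring.
        - eapply Rle_trans; [apply (Cmod_triangle3 _ (G u))|].
          rewrite (Cmod_minus_sym (G u)).
          assert (A := HN N ltac:(lia) u I). assert (B := HN n ltac:(unfold n; lia) u I). lra. }
      replace (f N v - f N w - (F v - F w))
        with (((f N v - f n v) - (f N w - f n w)) + ((f n v - F v) - (f n w - F w))) by ring.
      eapply Rle_trans; [apply Cmod_triangle|].
      assert (T : (Cmod ((f n v - F v) - (f n w - F w)) <= e)%R).
      { eapply Rle_trans; [apply Cmod_triangle|]. rewrite Cmod_opp. lra. }
      assert (X := Cmod_ge_0 (v - w)). nra. }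
    destruct (HD N w Hw) as [D0 _].
    refine (cnear_imp _ _ _ _ (cnear_and _ _ _ Near (D0 (eps / 4)%R ltac:(lra)))).
    intros v [Hv Dv].
    replace (F v - F w - G w * (v - w))
      with ((f N v - f N w - f' N w * (v - w)) +
            (- (f N v - f N w - (F v - F w)) + (f' N w - G w) * (v - w))) by ring.
    eapply Rle_trans; [apply Cmod_triangle|].
    eapply Rle_trans; [apply Rplus_le_compat_l, Cmod_triangle|].
    rewrite Cmod_opp, Cmod_mult.
    assert (A := Key N v (le_n _) Hv). assert (B := HN N (le_n _) w Hw).
    assert (X := Cmod_ge_0 (v - w)). nra.
  - intros eps He. destruct (HG (eps / 4)%R ltac:(lra)) as [N HN].
    refine (cnear_imp _ _ _ _ (cnear_and _ _ _ Near (proj2 (HD N w Hw) (eps / 4)%R ltac:(lra)))).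
    intros v [Hv Cv].
    replace (G v - G w) with (- (f' N v - G v) + ((f' N v - f' N w) + (f' N w - G w))) by ring.
    eapply Rle_lt_trans; [apply Cmod_triangle|].
    eapply Rle_lt_trans; [apply Rplus_le_compat_l, Cmod_triangle|].
    rewrite Cmod_opp.
    assert (A := HN N (le_n _) v Hv). assert (B := HN N (le_n _) w Hw). lra.
Qed.

Notation cseries := (is_series (K := C_AbsRing) (V := C_NormedModule)).
Notation csum := (sum_n (G := C_AbelianGroup)).

Lemma cseries_eps (a : nat -> C) (l : C) : cseries a l <->
  forall eps, (0 < eps)%R -> exists N, forall n, (N <= n)%nat -> (Cmod (csum a n - l) < eps)%R.
Proof.
  pose proof (filterlim_locally_ball_norm (U := C_NormedModule) (F := eventually) (csum a) l) as B.
  split.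
  - intros H eps He. destruct (proj1 B H (mkposreal eps He)) as [N K]. exists N.
    intros n Hn. exact (K n Hn).
  - intros H. apply (proj2 B). intros eps. destruct (H eps (cond_pos eps)) as [N K]. exists N.
    intros n Hn. exact (K n Hn).
Qed.

Lemma cseries_unique (a : nat -> C) (l m : C) : cseries a l -> cseries a m -> l = m.
Proof.
  intros H K. exact (filterlim_locally_unique (V := C_NormedModule) (F := eventually) _ _ _ H K).
Qed.

Lemma Cseries_unique (a : nat -> C) (l : C) : cseries a l -> Cseries a = l.
Proof.
  intros H. unfold Cseries.
  apply (iota_unique (V := C_CompleteNormedModule) (fun s => cseries a s)).
  - intros y Hy. exact (cseries_unique a y l Hy H).
  - exact H.
Qed.

Lemma cseries_dominated (a : nat -> C) (M : nat -> R) :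
  (forall n, (Cmod (a n) <= M n)%R) -> ex_series M -> exists l : C, cseries a l.
Proof.
  intros H K. exact (ex_series_le (V := C_CompleteNormedModule) a M H K).
Qed.

Lemma Cseries_correct (a : nat -> C) (M : nat -> R) :
  (forall n, (Cmod (a n) <= M n)%R) -> ex_series M -> cseries a (Cseries a).
Proof.
  intros H K. destruct (cseries_dominated a M H K) as [l Hl].
  rewrite (Cseries_unique a l Hl). exact Hl.
Qed.

Lemma csum_S (a : nat -> C) n : csum a (S n) = csum a n + a (S n).
Proof. exact (sum_Sn (G := C_AbelianGroup) a n). Qed.

Lemma csum_diff_le (a : nat -> C) (M : nat -> R) n k :
  (forall n, (Cmod (a n) <= M n)%R) ->
  (Cmod (csum a (n + k) - csum a n) <= sum_n M (n + k) - sum_n M n)%R.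
Proof.
  intros H. induction k as [|k IH].
  - rewrite Nat.add_0_r. replace (csum a n - csum a n) with (RtoC 0) by ring.
    rewrite Cmod_0. lra.
  - rewrite <- plus_n_Sm, csum_S, sum_Sn. unfold plus; simpl.
    replace (csum a (n + k) + a (S (n + k)) - csum a n)
      with ((csum a (n + k) - csum a n) + a (S (n + k))) by ring.
    eapply Rle_trans; [apply Cmod_triangle|]. specialize (H (S (n + k))). lra.
Qed.

Lemma sum_n_le_Series (M : nat -> R) n : (forall n, (0 <= M n)%R) -> ex_series M ->
  (sum_n M n <= Series M)%R.
Proof.
  intros H K. apply Series_correct in K.
  apply (is_lim_seq_incr_compare (sum_n M) (Series M)).
  - exact K.
  - intros m. rewrite sum_Sn. unfold plus; simpl. specialize (H (S m)). lra.
Qed.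

Lemma cseries_tail (a : nat -> C) (M : nat -> R) (l : C) n :
  (forall n, (Cmod (a n) <= M n)%R) -> ex_series M -> cseries a l ->
  (Cmod (csum a n - l) <= Series M - sum_n M n)%R.
Proof.
  intros H K S. apply le_epsilon. intros eps He.
  destruct (proj1 (cseries_eps a l) S eps He) as [N HN].
  specialize (HN (n + N)%nat ltac:(lia)).
  assert (P : forall k, (0 <= M k)%R) by (intros k; eapply Rle_trans; [apply Cmod_ge_0|apply H]).
  assert (A := csum_diff_le a M n N H). assert (B := sum_n_le_Series M (n + N) P K).
  assert (T := Cmod_triangle3 (csum a n) (csum a (n + N)) l).
  rewrite (Cmod_minus_sym (csum a n) (csum a (n + N))) in T. lra.
Qed.

Lemma cseries_norm (a : nat -> C) (M : nat -> R) (l : C) :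
  (forall n, (Cmod (a n) <= M n)%R) -> ex_series M -> cseries a l ->
  (Cmod l <= Series M)%R.
Proof.
  intros H K S. assert (T := cseries_tail a M l 0 H K S).
  rewrite !sum_O in T. specialize (H 0%nat).
  assert (U := Cmod_triangle_sub l (a 0%nat)). rewrite (Cmod_minus_sym l (a 0%nat)) in U. lra.
Qed.

Lemma csum_deriv (a a' : nat -> C -> C) w n :
  (forall k, cderiv (a k) w (a' k w) /\ ccont (a' k) w) ->
  cderiv (fun w => csum (fun k => a k w) n) w (csum (fun k => a' k w) n) /\
  ccont (fun w => csum (fun k => a' k w) n) w.
Proof.
  intros H. induction n as [|n [IH1 IH2]].
  - split.
    + rewrite sum_O. eapply cderiv_ext; [|apply (H 0%nat)].
      exists 1%R. split; [lra|]. intros v _. rewrite sum_O. reflexivity.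
    + eapply ccont_ext; [|apply (H 0%nat)].
      exists 1%R. split; [lra|]. intros v _. rewrite sum_O. reflexivity.
  - split.
    + rewrite csum_S. eapply cderiv_ext; [|apply cderiv_plus; [exact IH1|apply (H (S n))]].
      exists 1%R. split; [lra|]. intros v _. rewrite csum_S. reflexivity.
    + eapply ccont_ext; [|apply ccont_plus; [exact IH2|apply (H (S n))]].
      exists 1%R. split; [lra|]. intros v _. rewrite csum_S. reflexivity.
Qed.

(** Cauchy's estimate bounds the derivatives of the terms on a smaller disc by a multiple
    of M n, so the differentiated series converges uniformly too. *)
Lemma weierstrass_series (a : nat -> C -> C) (M : nat -> R) (F : C -> C) s R0 :
  (0 < R0)%R ->
  (forall n w, (Cmod (w - s) < R0)%R -> chol (a n) w) ->
  (forall n w, (Cmod (w - s) < R0)%R -> (Cmod (a n w) <= M n)%R) ->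
  ex_series M ->
  (forall w, (Cmod (w - s) < R0)%R -> cseries (fun n => a n w) (F w)) ->
  chol F s.
Proof.
  intros HR Hh HM EM HF.
  set (a' := fun n => C_derive (a n)).
  set (M' := fun n => (16 / R0 * M n)%R).
  assert (EM' : ex_series M') by (apply (ex_series_scal (V := R_NormedModule)), EM).
  set (G := fun w => Cseries (fun n => a' n w)).
  assert (D : forall n w, (Cmod (w - s) < R0)%R -> cderiv (a n) w (a' n w) /\ ccont (a' n) w).
  { intros n w Hw. apply chol_C_derive. auto. }
  assert (B : forall n w, (Cmod (w - s) < R0 / 2)%R -> (Cmod (a' n w) <= M' n)%R).
  { intros n w Hw.
    assert (I : forall v, (Cmod (v - w) < R0 / 2)%R -> (Cmod (v - s) < R0)%R).
    { intros v Hv. assert (T := Cmod_triangle3 v w s). lra. }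
    eapply Rle_trans.
    - apply (cauchy_estimate (a n) w (a' n w) (R0 / 2) (M n)); [lra| | |].
      + intros v Hv. auto.
      + intros v Hv. auto.
      + apply D. lra.
    - unfold M'. right. field. lra. }
  assert (U : forall eps, (0 < eps)%R -> exists N, forall n, (N <= n)%nat ->
     (Series M' - sum_n M' n <= eps)%R).
  { intros eps He. assert (S : is_lim_seq (sum_n M') (Series M'))
      by exact (Series_correct _ EM').
    apply is_lim_seq_spec in S. destruct (S (mkposreal eps He)) as [N HN].
    exists N. intros n Hn. specialize (HN n Hn). simpl in HN.
    destruct (Rabs_def2 _ _ HN). lra. }
  exists G. exists (R0 / 2)%R. split; [lra|].
  apply (deriv_limit (fun n w => csum (fun k => a k w) n)
                     (fun n w => csum (fun k => a' k w) n) F G s (R0 / 2)).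
  - intros n w Hw. apply csum_deriv. intros k. apply D. lra.
  - intros w Hw eps He. apply (proj1 (cseries_eps _ _) (HF w ltac:(lra)) eps He).
  - intros eps He. destruct (U eps He) as [N HN]. exists N. intros n Hn w Hw.
    eapply Rle_trans; [|apply (HN n Hn)].
    apply cseries_tail.
    + intros k. apply B, Hw.
    + exact EM'.
    + unfold G. apply (Cseries_correct _ M'); [|exact EM']. intros k. apply B, Hw.
Qed.

(** * Sums over the integers *)

(** Both halves converge separately; this makes reindexing by shifts and by n -> -n
    elementary. *)
Definition zsum (a : Z -> C) (s : C) : Prop :=
  exists s1 s2 : C, cseries (fun n => a (Z.of_nat n)) s1 /\
    cseries (fun n => a (- Z.of_nat (S n))%Z) s2 /\ s = s1 + s2.

Lemma zsum_CseriesZ a s : zsum a s -> CseriesZ a = s.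
Proof.
  intros [s1 [s2 [H1 [H2 ->]]]]. unfold CseriesZ.
  rewrite (Cseries_unique _ _ H1), (Cseries_unique _ _ H2). reflexivity.
Qed.

Lemma zsum_unique a s t : zsum a s -> zsum a t -> s = t.
Proof. intros H K. rewrite <- (zsum_CseriesZ _ _ H). apply zsum_CseriesZ, K. Qed.

Lemma cseries_ext (a b : nat -> C) (l : C) : (forall n, a n = b n) -> cseries a l -> cseries b l.
Proof. intros H. apply (is_series_ext (V := C_NormedModule)). exact H. Qed.

Lemma cseries_plus (a b : nat -> C) (l m : C) : cseries a l -> cseries b m -> cseries (fun n => a n + b n) (l + m).
Proof. intros H K. exact (is_series_plus (V := C_NormedModule) a b l m H K). Qed.

Lemma cseries_scal (c : C) (a : nat -> C) (l : C) : cseries a l -> cseries (fun n => c * a n) (c * l).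
Proof. intros H. exact (is_series_scal (V := C_NormedModule) c a l H). Qed.

Lemma cseries_incr (a : nat -> C) (l : C) : cseries a l -> cseries (fun n => a (S n)) (l - a 0%nat).
Proof.
  intros H. apply (is_series_incr_1 (V := C_NormedModule)).
  refine (eq_ind l (fun x => cseries a x) H _ _).
  change (@eq C l (l - a 0%nat + a 0%nat)). ring.
Qed.

Lemma cseries_decr (a : nat -> C) (l : C) : cseries (fun n => a (S n)) l -> cseries a (l + a 0%nat).
Proof.
  intros H. apply (is_series_decr_1 (V := C_NormedModule)).
  refine (eq_ind l (fun x => cseries (fun n => a (S n)) x) H _ _).
  change (@eq C l (l + a 0%nat + - a 0%nat)). ring.
Qed.

Lemma zsum_ext a b s : (forall n, a n = b n) -> zsum a s -> zsum b s.
Proof.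
  intros H [s1 [s2 [H1 [H2 E]]]]. exists s1, s2. split; [|split]; [| |exact E].
  - eapply cseries_ext; [|exact H1]. intros n. apply H.
  - eapply cseries_ext; [|exact H2]. intros n. apply H.
Qed.

Lemma zsum_plus a b s t : zsum a s -> zsum b t -> zsum (fun n => a n + b n) (s + t).
Proof.
  intros [s1 [s2 [H1 [H2 ->]]]] [t1 [t2 [K1 [K2 ->]]]]. exists (s1 + t1), (s2 + t2).
  split; [|split].
  - apply (cseries_plus _ _ _ _ H1 K1).
  - apply (cseries_plus _ _ _ _ H2 K2).
  - ring.
Qed.

Lemma zsum_scal c a s : zsum a s -> zsum (fun n => c * a n) (c * s).
Proof.
  intros [s1 [s2 [H1 [H2 ->]]]]. exists (c * s1), (c * s2). split; [|split].
  - apply (cseries_scal c _ _ H1).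
  - apply (cseries_scal c _ _ H2).
  - ring.
Qed.

Lemma zsum_refl a s : zsum a s -> zsum (fun n => a (- n)%Z) s.
Proof.
  intros [s1 [s2 [H1 [H2 ->]]]]. exists (s2 + a 0%Z), (s1 - a 0%Z). split; [|split].
  - assert (K := cseries_decr (fun n => a (- Z.of_nat n)%Z) s2 H2). exact K.
  - eapply cseries_ext; [|apply (cseries_incr _ _ H1)]. intros n. cbv beta; f_equal; lia.
  - ring.
Qed.

Lemma zsum_shift a s : zsum a s -> zsum (fun n => a (n + 1)%Z) s.
Proof.
  intros [s1 [s2 [H1 [H2 ->]]]]. exists (s1 - a 0%Z), (s2 + a 0%Z). split; [|split].
  - eapply cseries_ext; [|apply (cseries_incr _ _ H1)]. intros n. cbv beta; f_equal; lia.
  - assert (K := cseries_decr (fun n => a (- Z.of_nat n)%Z) s2 H2).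
    eapply cseries_ext; [|exact K]. intros n. cbv beta; f_equal; lia.
  - ring.
Qed.

Lemma zsum_shift_back a s : zsum a s -> zsum (fun n => a (n - 1)%Z) s.
Proof.
  intros H. apply zsum_refl, zsum_shift, zsum_refl in H. eapply zsum_ext; [|exact H].
  intros n. cbv beta; f_equal; lia.
Qed.

Lemma zsum_dominated a (M : nat -> R) :
  (forall n : nat, (Cmod (a (Z.of_nat n)) <= M n)%R) ->
  (forall n : nat, (Cmod (a (- Z.of_nat n)%Z) <= M n)%R) -> ex_series M -> exists s, zsum a s.
Proof.
  intros H K E.
  destruct (cseries_dominated (fun n => a (Z.of_nat n)) M H E) as [s1 H1].
  destruct (cseries_dominated (fun n => a (- Z.of_nat n)%Z) M K E) as [s2 H2].
  exists (s1 + (s2 - a 0%Z)), s1, (s2 - a 0%Z). split; [exact H1|]. split; [|reflexivity].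
  exact (cseries_incr _ _ H2).
Qed.

Lemma ex_series_geom_scal c q : (0 <= q < 1)%R -> ex_series (fun n => c * q ^ n)%R.
Proof.
  intros H. apply (ex_series_scal (V := R_NormedModule) c).
  exists (/ (1 - q))%R. apply is_series_geom. rewrite Rabs_right; lra.
Qed.

(** The sign is e(n/2), which lets it be absorbed into exponents. *)
Lemma m1pow_ce n : m1pow n = ce (cz n / 2).
Proof.
  unfold m1pow. destruct (Z.even n) eqn:E.
  - apply Z.even_spec in E. destruct E as [k ->].
    replace (cz (2 * k) / 2) with (cz k).
    + symmetry. apply ce_cz.
    + rewrite cz_mult. change (cz 2) with (RtoC 2). field.
  - assert (O : Z.Odd n) by (apply Z.odd_spec; rewrite <- Z.negb_even, E; reflexivity).
    destruct O as [k ->].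
    replace (cz (2 * k + 1) / 2) with (RtoC (1 / 2) + cz k).
    + rewrite ce_add_cz. symmetry. apply ce_half.
    + rewrite cz_plus, cz_mult, RtoC_div. 2: lra.
      change (cz 2) with (RtoC 2). change (cz 1) with (RtoC 1). field.
Qed.

Lemma m1pow_plus m n : m1pow (m + n) = m1pow m * m1pow n.
Proof.
  rewrite !m1pow_ce, <- ce_plus. f_equal. rewrite cz_plus. field.
Qed.

Lemma m1pow_opp n : m1pow (- n) = m1pow n.
Proof. unfold m1pow. rewrite Z.even_opp. reflexivity. Qed.

Lemma m1pow_S n : m1pow (n + 1) = - m1pow n.
Proof. rewrite m1pow_plus. unfold m1pow at 2. simpl. ring. Qed.

Lemma m1pow_sqr n : m1pow n * m1pow n = 1.
Proof. unfold m1pow. destruct (Z.even n); ring. Qed.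

Lemma Cmod_m1pow n : Cmod (m1pow n) = 1%R.
Proof. unfold m1pow. destruct (Z.even n); [apply Cmod_1|apply Cmod_m1]. Qed.

(** * The Appell function and its quasi-periodicity *)

(** The generalised pentagonal numbers. *)
Definition pent (n : Z) : C := cz n * (3 * cz n + 1) / 2.
Definition pentR (n : Z) : R := (IZR n * (3 * IZR n + 1) / 2)%R.

Lemma pent_R n : pent n = RtoC (pentR n).
Proof.
  unfold pent, pentR, cz. rewrite RtoC_div by lra. rewrite RtoC_mult, RtoC_plus, RtoC_mult.
  reflexivity.
Qed.

Lemma pentR_ge n : (IZR (Z.abs n) <= pentR n)%R.
Proof.
  unfold pentR. assert (H : (2 * Z.abs n <= n * (3 * n + 1))%Z) by nia.
  apply IZR_le in H. rewrite !mult_IZR, plus_IZR, mult_IZR in H. lra.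
Qed.

Lemma Im_RtoC_mult r z : Im (RtoC r * z) = (r * Im z)%R.
Proof. apply im_scal_l. Qed.

(** The modulus of q. *)
Definition nome (y : R) : R := exp (- (2 * PI * y)).

Lemma nome_pos y : (0 < nome y)%R.
Proof. apply exp_pos. Qed.

Lemma nome_lt1 y : (0 < y)%R -> (nome y < 1)%R.
Proof.
  intros H. unfold nome. rewrite <- exp_0. apply exp_increasing. assert (P := PI_RGT_0). nra.
Qed.

Lemma exp_le_compat x y : (x <= y)%R -> (exp x <= exp y)%R.
Proof. intros [H| ->]; [left; apply exp_increasing, H|lra]. Qed.

Lemma nome_pow y (n : nat) : (nome y ^ n = exp (- (2 * PI * (INR n * y))))%R.
Proof. unfold nome. rewrite exp_pow_nat. f_equal. ring. Qed.

Lemma Cmod_ce_pent_le tau n y0 : (0 < y0 <= Im tau)%R ->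
  (Cmod (ce (pent n * tau)) <= nome y0 ^ Z.abs_nat n)%R.
Proof.
  intros H. rewrite pent_R, Cmod_ce, Im_RtoC_mult, nome_pow. apply exp_le_compat.
  assert (P := PI_RGT_0). assert (Q := pentR_ge n).
  rewrite INR_IZR_INZ, Zabs2Nat.id_abs.
  assert (A : (0 <= IZR (Z.abs n))%R) by (apply IZR_le; lia).
  apply Ropp_le_contravar. apply Rmult_le_compat_l; [lra|].
  apply Rmult_le_compat; lra.
Qed.

(** The general term of the Appell function, without the factor e(u/2). *)
Definition bterm (u tau : C) (n : Z) : C :=
  m1pow n * ce (pent n * tau) / (1 - ce (u + cz n * tau)).

(** The level-three Appell function. The factor e(u/2) makes it odd. *)
Definition appell (u tau : C) : C := ce (u / 2) * CseriesZ (bterm u tau).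

(** Euler's pentagonal series; it is shown below to equal (q;q)_oo. *)
Definition euler (tau : C) : C := CseriesZ (fun n => m1pow n * ce (pent n * tau)).

(** The complement of the poles of the Appell function. *)
Definition reg (u tau : C) : Prop := forall n, ce (u + cz n * tau) <> 1.

Lemma one_minus_neq0 (x : C) : x <> 1 -> 1 - x <> 0.
Proof. intros H K. apply H. symmetry. apply Ceq_minus. exact K. Qed.

(** Away from the unit circle the denominators of the Appell function are bounded below. *)
Lemma inv_far_small (x : C) : (Cmod x <= 1 / 2)%R -> (Cmod (/ (1 - x)) <= 2)%R.
Proof.
  intros H. assert (T := Cmod_triangle_sub 1 x). rewrite Cmod_1 in T.
  assert (N : 1 - x <> 0) by (apply Cmod_gt_0; lra).
  rewrite Cmod_inv by exact N. rewrite <- (Rinv_inv 2). apply Rinv_le_contravar; lra.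
Qed.

Lemma inv_far_big (x : C) : (2 <= Cmod x)%R -> (Cmod (/ (1 - x)) <= 2)%R.
Proof.
  intros H. assert (T := Cmod_triangle_sub x 1). rewrite Cmod_1, Cmod_minus_sym in T.
  assert (N : 1 - x <> 0) by (apply Cmod_gt_0; lra).
  rewrite Cmod_inv by exact N. apply Rle_trans with (/ 1)%R; [|lra]. apply Rinv_le_contravar; lra.
Qed.

Lemma exp_m1_half : (exp (-1) <= 1 / 2)%R.
Proof.
  assert (H := exp_ineq1_le 1). change (-1)%R with (- (1))%R. rewrite exp_Ropp.
  replace (1 / 2)%R with (/ 2)%R by field. apply Rinv_le_contravar; lra.
Qed.

Lemma exp_1_two : (2 <= exp 1)%R.
Proof. assert (H := exp_ineq1_le 1). lra. Qed.

(** For bounded Im u and Im tau bounded below, all but finitely many terms are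
    dominated by a geometric series, uniformly in u and tau. *)
Lemma bterm_far (y0 U : R) : (0 < y0)%R -> exists N : nat, forall n u tau,
  (N <= Z.abs_nat n)%nat -> (Rabs (Im u) <= U)%R -> (y0 <= Im tau)%R ->
  ce (u + cz n * tau) <> 1 /\ (Cmod (bterm u tau n) <= 2 * nome y0 ^ Z.abs_nat n)%R.
Proof.
  intros Hy. assert (P := PI_RGT_0). assert (P3 := PI2_3_2).
  destruct (INR_unbounded ((U + 1) / y0)%R) as [N HN].
  exists (S N). intros n u tau Hn Hu Ht.
  assert (A : (U + 1 <= IZR (Z.abs n) * Im tau)%R).
  { assert (B : (INR N <= IZR (Z.abs n))%R).
    { rewrite <- Zabs2Nat.id_abs, <- INR_IZR_INZ. apply le_INR. lia. }
    apply Rle_trans with (IZR (Z.abs n) * y0)%R.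
    - apply Rmult_le_reg_r with (/ y0)%R; [apply Rinv_0_lt_compat, Hy|].
      replace (IZR (Z.abs n) * y0 * / y0)%R with (IZR (Z.abs n)) by (field; lra).
      fold (Rdiv (U + 1) y0). lra.
    - apply Rmult_le_compat_l; [apply IZR_le; lia|exact Ht]. }
  assert (Hu2 : (- U <= Im u <= U)%R).
  { split; [|eapply Rle_trans; [apply Rle_abs|exact Hu]].
    assert (Q := Rle_abs (- Im u)). rewrite Rabs_Ropp in Q. lra. }
  assert (E : Im (u + cz n * tau) = (Im u + IZR n * Im tau)%R).
  { unfold cz. destruct u, tau. simpl. ring. }
  assert (D : (Cmod (ce (u + cz n * tau)) <= 1 / 2 \/ 2 <= Cmod (ce (u + cz n * tau)))%R).
  { rewrite Cmod_ce, E. destruct (Z.abs_eq_or_opp n) as [Q|Q].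
    - left. rewrite Q in A. eapply Rle_trans; [|apply exp_m1_half]. apply exp_le_compat. nra.
    - right. rewrite Q, opp_IZR in A. eapply Rle_trans; [apply exp_1_two|]. apply exp_le_compat. nra. }
  assert (I : (Cmod (/ (1 - ce (u + cz n * tau))) <= 2)%R).
  { destruct D; [apply inv_far_small|apply inv_far_big]; assumption. }
  split.
  - intros K. rewrite K, Cmod_1 in D. lra.
  - unfold bterm, Cdiv. rewrite !Cmod_mult, Cmod_m1pow, Rmult_1_l, Rmult_comm.
    apply Rmult_le_compat; try apply Cmod_ge_0; [exact I|].
    apply Cmod_ce_pent_le. lra.
Qed.

Lemma ex_series_eventually (M : nat -> R) (a : nat -> C) (N : nat) :
  (forall n, (N <= n)%nat -> (Cmod (a n) <= M n)%R) -> ex_series M -> exists l : C, cseries a l.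
Proof.
  intros H E.
  destruct N as [|N].
  - apply (cseries_dominated a M); [intros n; apply H; lia|exact E].
  - destruct (cseries_dominated (fun n => a (S N + n)%nat) (fun n => M (S N + n)%nat)) as [l Hl].
    + intros n. apply H. lia.
    + apply (ex_series_incr_n M (S N)). exact E.
    + exists (l + csum a N). apply (is_series_decr_n (V := C_NormedModule) a (S N)); [lia|].
      refine (eq_ind l (fun x => cseries (fun k => a (S N + k)%nat) x) Hl _ _).
      change (@eq C l (l + csum a N + - csum a N)). ring.
Qed.

Lemma bterm_zsum u tau : (0 < Im tau)%R -> exists s, zsum (bterm u tau) s.
Proof.
  intros H. destruct (bterm_far (Im tau) (Rabs (Im u)) H) as [N HN].
  assert (E : ex_series (fun n => 2 * nome (Im tau) ^ n)%R).
  { apply ex_series_geom_scal. split; [left; apply nome_pos|apply nome_lt1, H]. }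
  destruct (ex_series_eventually (fun n => 2 * nome (Im tau) ^ n)%R (fun n => bterm u tau (Z.of_nat n)) N) with (2 := E) as [s1 H1].
  { intros n Hn. destruct (HN (Z.of_nat n) u tau) as [_ B]; try lia; try lra.
    rewrite Zabs2Nat.id in B. exact B. }
  destruct (ex_series_eventually (fun n => 2 * nome (Im tau) ^ n)%R (fun n => bterm u tau (- Z.of_nat n)) N) with (2 := E) as [s2 H2].
  { intros n Hn. destruct (HN (- Z.of_nat n)%Z u tau) as [_ B]; try lia; try lra.
    replace (Z.abs_nat (- Z.of_nat n)) with n in B by lia. exact B. }
  exists (s1 + (s2 - bterm u tau 0%Z)), s1, (s2 - bterm u tau 0%Z).
  split; [exact H1|]. split; [|reflexivity]. exact (cseries_incr _ _ H2).
Qed.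

Lemma bterm_CseriesZ u tau : (0 < Im tau)%R -> zsum (bterm u tau) (CseriesZ (bterm u tau)).
Proof. intros H. destruct (bterm_zsum u tau H) as [s K]. rewrite (zsum_CseriesZ _ _ K). exact K. Qed.

Lemma euler_zsum tau : (0 < Im tau)%R -> zsum (fun n => m1pow n * ce (pent n * tau)) (euler tau).
Proof.
  intros H. destruct (zsum_dominated (fun n => m1pow n * ce (pent n * tau)) (fun n => 1 * nome (Im tau) ^ n)%R)
    as [s K].
  - intros n. rewrite Cmod_mult, Cmod_m1pow, Rmult_1_l, Rmult_1_l.
    eapply Rle_trans; [apply (Cmod_ce_pent_le _ _ (Im tau)); lra|]. rewrite Zabs2Nat.id. lra.
  - intros n. rewrite Cmod_mult, Cmod_m1pow, Rmult_1_l, Rmult_1_l.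
    eapply Rle_trans; [apply (Cmod_ce_pent_le _ _ (Im tau)); lra|].
    replace (Z.abs_nat (- Z.of_nat n)) with n by lia. lra.
  - apply ex_series_geom_scal. split; [left; apply nome_pos|apply nome_lt1, H].
  - unfold euler. rewrite (zsum_CseriesZ _ _ K). exact K.
Qed.

(** Reversing the order of summation, n -> -n, turns each term for -u into
    -e(u) times the term for u. *)
Lemma appell_neg u tau : (0 < Im tau)%R -> reg u tau -> appell (- u) tau = - appell u tau.
Proof.
  intros H Hr. unfold appell.
  assert (K := zsum_refl _ _ (bterm_CseriesZ (- u) tau H)).
  assert (E : zsum (fun n => - ce u * bterm u tau n) (CseriesZ (bterm (- u) tau))).
  { eapply zsum_ext; [|exact K]. intros n. cbv beta. unfold bterm. rewrite m1pow_opp.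
    assert (N := one_minus_neq0 _ (Hr n)).
    replace (- u + cz (- n) * tau) with (- (u + cz n * tau)) by (rewrite cz_opp; ring).
    rewrite (ce_opp (u + cz n * tau)).
    assert (N0 := ce_neq0 (u + cz n * tau)).
    replace (ce (pent (- n) * tau)) with (ce (pent n * tau) * ce (- (cz n * tau)))
      by (rewrite <- ce_plus; f_equal; unfold pent; rewrite cz_opp; field).
    replace (ce (- (cz n * tau))) with (ce u * / ce (u + cz n * tau))
      by (rewrite <- ce_opp, <- ce_plus; f_equal; ring).
    field. repeat split; try assumption.
    intros J. apply (Hr n). apply Ceq_minus. exact J. }
  rewrite (zsum_unique _ _ _ E (zsum_scal (- ce u) _ _ (bterm_CseriesZ u tau H))).
  replace (ce u) with (ce (u / 2) * ce (u / 2)) by (rewrite <- ce_plus; f_equal; field).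
  replace (- u / 2) with (- (u / 2)) by field. rewrite ce_opp. field. apply ce_neq0.
Qed.

Lemma appell_add_one u tau : appell (u + 1) tau = - appell u tau.
Proof.
  unfold appell. replace ((u + 1) / 2) with (u / 2 + RtoC (1 / 2)) by (rewrite RtoC_div by lra; field).
  rewrite ce_plus, ce_half.
  assert (E : forall n, bterm (u + 1) tau n = bterm u tau n).
  { intros n. unfold bterm. replace (u + 1 + cz n * tau) with (u + cz n * tau + cz 1)
      by (change (cz 1) with (RtoC 1); ring). rewrite ce_add_cz. reflexivity. }
  assert (S : CseriesZ (bterm (u + 1) tau) = CseriesZ (bterm u tau)).
  { f_equal. apply FunctionalExtensionality.functional_extensionality, E. }
  rewrite S. ring.
Qed.

Lemma zsum_minus_self a s : zsum a s -> zsum (fun n => - a n) (- s).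
Proof.
  intros H. replace (- s) with (- (1) * s) by ring.
  eapply zsum_ext; [|apply (zsum_scal (- (1)) _ _ H)]. intros n. cbv beta. ring.
Qed.

(** Companions of Euler's series: the exponent differs from the pentagonal number by
    a multiple of n, here by n, by 3 n and by 2 n. Reflection and shift reduce the first
    two to Euler's series. *)
Lemma zsum_pent_neg tau : (0 < Im tau)%R ->
  zsum (fun n => m1pow n * ce ((pent n - cz n) * tau)) (euler tau).
Proof.
  intros H. eapply zsum_ext; [|apply (zsum_refl _ _ (euler_zsum tau H))].
  intros n. cbv beta. rewrite m1pow_opp. f_equal. f_equal. unfold pent. rewrite cz_opp. field.
Qed.

Lemma zsum_pent_shift tau : (0 < Im tau)%R ->
  zsum (fun n => m1pow n * ce ((pent n - 3 * cz n) * tau)) (- ce (- tau) * euler tau).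
Proof.
  intros H. eapply zsum_ext; [|apply (zsum_scal (- ce (- tau)) _ _ (zsum_shift_back _ _ (euler_zsum tau H)))].
  intros n. cbv beta.
  replace (m1pow (n - 1)) with (- m1pow n).
  2:{ replace n with (n - 1 + 1)%Z at 1 by lia. rewrite m1pow_S. ring. }
  replace (ce ((pent n - 3 * cz n) * tau)) with (ce (- tau) * ce (pent (n - 1) * tau)).
  - ring.
  - rewrite <- ce_plus. f_equal. unfold pent. rewrite cz_sub. change (cz 1) with (RtoC 1). field.
Qed.

(** The reflection n -> 1 - n preserves the exponent and changes the sign. *)
Lemma zsum_pent_double tau : (0 < Im tau)%R ->
  zsum (fun n => m1pow n * ce ((pent n - 2 * cz n) * tau)) 0.
Proof.
  intros H.
  assert (P := nome_lt1 _ H). assert (P0 := nome_pos (Im tau)). set (t := nome (Im tau)) in *.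
  assert (B : forall n, (Cmod (m1pow n * ce ((pent n - 2 * cz n) * tau)) <= / t * t ^ Z.abs_nat n)%R).
  { intros n. rewrite Cmod_mult, Cmod_m1pow, Rmult_1_l.
    replace (pent n - 2 * cz n) with (RtoC (pentR n - 2 * IZR n))
      by (rewrite pent_R, RtoC_minus, RtoC_mult; reflexivity).
    rewrite Cmod_ce, Im_RtoC_mult. unfold t. rewrite nome_pow.
    unfold nome. rewrite <- exp_Ropp, <- exp_plus. apply exp_le_compat.
    rewrite INR_IZR_INZ, Zabs2Nat.id_abs.
    assert (Q : (IZR (Z.abs n) - 1 <= pentR n - 2 * IZR n)%R).
    { unfold pentR. assert (Q : (2 * Z.abs n - 2 <= n * (3 * n + 1) - 4 * n)%Z).
      { destruct (Z_le_gt_dec 1 n) as [L|L].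
        - rewrite Z.abs_eq by lia.
          assert (0 <= (n - 1) * (3 * n - 2))%Z by (apply Z.mul_nonneg_nonneg; lia). lia.
        - rewrite Z.abs_neq by lia. nia. }
      apply IZR_le in Q. rewrite !minus_IZR, !mult_IZR, plus_IZR, mult_IZR in Q. lra. }
    assert (Pi := PI_RGT_0).
    replace (- - (2 * PI * Im tau) + - (2 * PI * (IZR (Z.abs n) * Im tau)))%R
      with (- (2 * PI * ((IZR (Z.abs n) - 1) * Im tau)))%R by ring.
    apply Ropp_le_contravar, Rmult_le_compat_l; [lra|]. apply Rmult_le_compat_r; lra. }
  destruct (zsum_dominated (fun n => m1pow n * ce ((pent n - 2 * cz n) * tau))
              (fun n => / t * t ^ n)%R) as [s K].
  - intros n. eapply Rle_trans; [apply B|]. rewrite Zabs2Nat.id. lra.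
  - intros n. eapply Rle_trans; [apply B|].
    replace (Z.abs_nat (- Z.of_nat n)) with n by lia. lra.
  - apply ex_series_geom_scal. lra.
  - (* n -> 1 - n changes the sign of every term *)
    assert (K2 := zsum_refl _ _ (zsum_shift _ _ K)).
    assert (K3 : zsum (fun n => m1pow n * ce ((pent n - 2 * cz n) * tau)) (- s)).
    { eapply zsum_ext; [|apply (zsum_minus_self _ _ K2)]. intros n. cbv beta.
      rewrite m1pow_S, m1pow_opp.
      replace (ce ((pent (- n + 1) - 2 * cz (- n + 1)) * tau)) with (ce ((pent n - 2 * cz n) * tau)).
      - ring.
      - f_equal. unfold pent. rewrite cz_plus, cz_opp. change (cz 1) with (RtoC 1). field. }
    assert (E := zsum_unique _ _ _ K K3).
    replace (RtoC 0) with s; [exact K|].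
    replace s with ((s + s) / 2) by field. rewrite E at 1. field.
Qed.

(** Put X = e(u) q^n. Moving n by one in the series for u + tau multiplies the term for
    u by a multiple of X^(-3), and X^(-3) / (1 - X) is 1 / (1 - X) plus X^(-1) + X^(-2) +
    X^(-3). The last three give Euler's series, 0 and Euler's series once more. *)
Lemma appell_add_tau u tau : (0 < Im tau)%R -> reg u tau ->
  appell (u + tau) tau = - ce (3 / 2 * tau + 3 * u) * appell u tau
     + euler tau * (ce (1 / 2 * tau + 1 / 2 * u) - ce (3 / 2 * tau + 5 / 2 * u)).
Proof.
  intros H Hr. unfold appell.
  set (S := CseriesZ (bterm u tau)).
  assert (E : zsum (fun n => bterm (u + tau) tau (n - 1))
    (- ce (tau + 3 * u) * (S + (ce (- u) * euler tau + (ce (- (2 * u)) * 0 +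
        ce (- (3 * u)) * (- ce (- tau) * euler tau)))))).
  { eapply zsum_ext; [|apply zsum_scal, zsum_plus; [apply (bterm_CseriesZ u tau H)|
      apply zsum_plus; [apply zsum_scal, (zsum_pent_neg tau H)|
      apply zsum_plus; [apply zsum_scal, (zsum_pent_double tau H)|
                      apply zsum_scal, (zsum_pent_shift tau H)]]]].
    intros n. cbv beta. unfold bterm.
    assert (N := one_minus_neq0 _ (Hr n)).
    replace (u + tau + cz (n - 1) * tau) with (u + cz n * tau)
      by (rewrite cz_sub; change (cz 1) with (RtoC 1); ring).
    replace (m1pow (n - 1)) with (- m1pow n).
    2:{ replace n with (n - 1 + 1)%Z at 1 by lia. rewrite m1pow_S. ring. }
    set (X := ce (u + cz n * tau)) in *.
    assert (NX : X <> 0) by apply ce_neq0.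
    set (q := ce (pent n * tau)).
    assert (E1 : ce (pent (n - 1) * tau) = ce (tau + 3 * u) * q * (/ X * / X * / X)).
    { unfold X, q. rewrite <- !ce_opp, <- !ce_plus. f_equal. unfold pent. rewrite cz_sub.
      change (cz 1) with (RtoC 1). field. }
    assert (E2 : ce ((pent n - cz n) * tau) = q * (ce u * / X)).
    { unfold X, q. rewrite <- !ce_opp, <- !ce_plus. f_equal. ring. }
    assert (E3 : ce ((pent n - 2 * cz n) * tau) = q * (ce (2 * u) * (/ X * / X))).
    { unfold X, q. rewrite <- !ce_opp, <- !ce_plus. f_equal. ring. }
    assert (E4 : ce ((pent n - 3 * cz n) * tau) = q * (ce (3 * u) * (/ X * / X * / X))).
    { unfold X, q. rewrite <- !ce_opp, <- !ce_plus. f_equal. ring. }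
    rewrite E1, E2, E3, E4, !ce_opp.
    assert (N1 := ce_neq0 u). assert (N2 := ce_neq0 (2 * u)). assert (N3 := ce_neq0 (3 * u)).
    field. repeat split; assumption. }
  rewrite (zsum_unique _ _ _ (zsum_shift_back _ _ (bterm_CseriesZ (u + tau) tau H)) E).
  replace (ce ((u + tau) / 2)) with (ce (1 / 2 * tau) * ce (u / 2))
    by (rewrite <- ce_plus; f_equal; field).
  replace (ce (3 / 2 * tau + 3 * u)) with (ce (1 / 2 * tau) * ce (tau + 3 * u))
    by (rewrite <- ce_plus; f_equal; field).
  replace (ce (1 / 2 * tau + 1 / 2 * u))
    with (ce (1 / 2 * tau) * ce (u / 2) * (ce (tau + 3 * u) * ce (- (3 * u)) * ce (- tau)))
    by (rewrite <- !ce_plus; f_equal; field).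
  replace (ce (3 / 2 * tau + 5 / 2 * u))
    with (ce (1 / 2 * tau) * ce (u / 2) * (ce (tau + 3 * u) * ce (- u)))
    by (rewrite <- !ce_plus; f_equal; field).
  ring.
Qed.

(** * Euler's pentagonal number theorem *)

Ltac cring := match goal with |- @eq _ ?a ?b => change (@eq C a b) end; ring.

Lemma qpow_ce r z : qpow r z = ce (RtoC r * z).
Proof. unfold qpow, ce. f_equal. rewrite (RtoC_mult (2 * PI) r). ring. Qed.

Lemma RtoC_INR n : RtoC (INR n) = cz (Z.of_nat n).
Proof. unfold cz. rewrite INR_IZR_INZ. reflexivity. Qed.

(** One term of the exponential series, used as a lower bound for the factorial. *)
Lemma exp_ge_term x n : (0 <= x)%R -> (x ^ n / INR (fact n) <= exp x)%R.
Proof.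
  intros H. set (M := fun k => (/ INR (fact k) * x ^ k)%R).
  assert (S : is_series M (exp x)) by (apply is_pseries_R, is_exp_Reals).
  assert (P : forall k, (0 <= M k)%R).
  { intros k. apply Rmult_le_pos; [|apply pow_le, H]. left. apply Rinv_0_lt_compat, INR_fact_lt_0. }
  replace (x ^ n / INR (fact n))%R with (M n) by (unfold M, Rdiv; ring).
  apply Rle_trans with (sum_n M n).
  - destruct n as [|n]; [rewrite sum_O; lra|]. rewrite sum_Sn. unfold plus; simpl.
    assert (0 <= sum_n M n)%R; [|lra].
    clear S. induction n as [|n IH]; [rewrite sum_O; apply P|].
    rewrite sum_Sn. unfold plus; simpl. specialize (P (S n)). lra.
  - rewrite <- (is_series_unique M _ S). apply sum_n_le_Series; [exact P|]. eexists; exact S.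
Qed.

Fixpoint Rprod_1n (f : nat -> R) (n : nat) : R :=
  match n with O => 1%R | S k => (Rprod_1n f k * f (S k))%R end.

(** The geometric sum 1 + t + ... + t^(n-1) has n terms, each at least t^n. *)
Lemma one_minus_pow_lower t n : (0 < t < 1)%R -> (INR n * t ^ n * (1 - t) <= 1 - t ^ n)%R.
Proof.
  intros H. induction n as [|n IH].
  - simpl. lra.
  - rewrite S_INR. simpl. assert (P : (0 <= t ^ n)%R) by (apply pow_le; lra).
    apply Rle_trans with (t * (1 - t ^ n) + (1 - t) * t)%R.
    + replace ((INR n + 1) * (t * t ^ n) * (1 - t))%R
        with (t * (INR n * t ^ n * (1 - t)) + (1 - t) * t * t ^ n)%R by ring.
      assert (Q : (t ^ n <= 1)%R).
      { rewrite <- (pow1 n). apply pow_incr. lra. }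
      apply Rplus_le_compat; [apply Rmult_le_compat_l; lra|].
      rewrite <- (Rmult_1_r ((1 - t) * t)) at 2.
      apply Rmult_le_compat_l; [apply Rmult_le_pos; lra|exact Q].
    + assert (Q : (0 <= (1 - t) * (1 - t))%R) by (apply Rmult_le_pos; lra).
      replace (t * (1 - t ^ n) + (1 - t) * t)%R with (1 - t * t ^ n - (1 - t) * (1 - t))%R by ring.
      lra.
Qed.

Lemma one_minus_exp_lower x : (0 <= x <= 1 / 2)%R -> (exp (- (2 * x)) <= 1 - x)%R.
Proof.
  intros H. rewrite exp_Ropp. assert (E := exp_ineq1_le (2 * x)).
  apply Rle_trans with (/ (1 + 2 * x))%R; [apply Rinv_le_contravar; lra|].
  apply Rmult_le_reg_r with (1 + 2 * x)%R; [lra|]. rewrite Rinv_l by lra. nra.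
Qed.

(** As long as t^j > 1/2 the factor 1 - t^j is at least j (1 - t) / 2, and the product
    of these is a factorial over a power, at least exp(-2 / (1 - t)); the remaining factors
    are at least exp(-2 t^j). The order 1/(1 - t) of the exponent is what the growth
    estimate at the cusps needs. *)
Lemma euler_product_lower t n : (0 < t < 1)%R ->
  (exp (- (4 / (1 - t))) <= Rprod_1n (fun j => 1 - t ^ j) n)%R.
Proof.
  intros H. set (x := (2 / (1 - t))%R).
  assert (Hx : (2 < x)%R).
  { unfold x. apply Rmult_lt_reg_r with (1 - t)%R; [lra|].
    replace (2 / (1 - t) * (1 - t))%R with 2%R by (field; lra). lra. }
  set (F := Rprod_1n (fun j => (1 - t ^ j)%R)).
  (* with 1/x = (1 - t)/2 the bound for the factors with t^j > 1/2 is j/x *)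
  assert (I : (1 / 2 < t ^ n /\ INR (fact n) / x ^ n <= F n)%R \/
              (t ^ n <= 1 / 2 /\ exp (- x - (2 - 2 * t ^ n) / (1 - t)) <= F n)%R).
  { induction n as [|n IH].
    - left. unfold F. simpl. split; lra.
    - assert (Pn : (0 < t ^ n)%R) by (apply pow_lt; lra).
      assert (Px : (0 < x ^ n)%R) by (apply pow_lt; lra).
      assert (Pf := INR_fact_lt_0 n).
      assert (FS : F (S n) = (F n * (1 - t ^ S n))%R) by reflexivity.
      assert (Pd : (t ^ S n < t ^ n)%R) by (simpl; nra).
      assert (PS : (0 < t ^ S n)%R) by (apply pow_lt; lra).
      assert (EF : (exp (- x) <= INR (fact n) / x ^ n)%R).
      { rewrite exp_Ropp. replace (INR (fact n) / x ^ n)%R with (/ (x ^ n / INR (fact n)))%R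
          by (field; lra).
        apply Rinv_le_contravar; [apply Rdiv_lt_0_compat; lra|]. apply exp_ge_term. lra. }
      destruct IH as [[A B]|[A B]].
      + destruct (Rlt_le_dec (1 / 2) (t ^ S n)) as [L|L].
        * left. split; [exact L|]. rewrite FS.
          assert (LB : (INR (S n) / x <= 1 - t ^ S n)%R).
          { eapply Rle_trans; [|apply (one_minus_pow_lower t (S n) H)].
            replace (INR (S n) / x)%R with (INR (S n) * (1 / 2) * (1 - t))%R
              by (unfold x; field; lra).
            apply Rmult_le_compat_r; [lra|]. apply Rmult_le_compat_l; [apply pos_INR|lra]. }
          replace (INR (fact (S n)) / x ^ S n)%R
            with (INR (fact n) / x ^ n * (INR (S n) / x))%R.
          -- apply Rmult_le_compat; try assumption.
             ++ apply Rmult_le_pos; [lra|]. left. apply Rinv_0_lt_compat, Px.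
             ++ apply Rmult_le_pos; [apply pos_INR|]. left. apply Rinv_0_lt_compat. lra.
          -- change (fact (S n)) with (S n * fact n)%nat. rewrite mult_INR. simpl pow. field. lra.
        * right. split; [exact L|]. rewrite FS.
          replace (- x - (2 - 2 * t ^ S n) / (1 - t))%R
            with (- x + - ((2 - 2 * t ^ S n) / (1 - t)))%R by ring.
          rewrite exp_plus. apply Rmult_le_compat; try (left; apply exp_pos).
          -- lra.
          -- eapply Rle_trans; [|apply one_minus_exp_lower; lra]. apply exp_le_compat.
             apply Ropp_le_contravar. apply Rle_trans with 1%R; [lra|].
             apply Rmult_le_reg_r with (1 - t)%R; [lra|].
             replace ((2 - 2 * t ^ S n) / (1 - t) * (1 - t))%R with (2 - 2 * t ^ S n)%R by (field; lra).
             lra.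
      + right. split; [lra|]. rewrite FS.
        replace (- x - (2 - 2 * t ^ S n) / (1 - t))%R
          with ((- x - (2 - 2 * t ^ n) / (1 - t)) + - (2 * t ^ n))%R by (simpl; field; lra).
        rewrite exp_plus. apply Rmult_le_compat; try (left; apply exp_pos); [exact B|].
        eapply Rle_trans; [|apply one_minus_exp_lower; lra]. apply exp_le_compat. lra. }
  assert (E2 : (4 / (1 - t) = x + 2 / (1 - t))%R) by (unfold x; field; lra).
  assert (P2 : (0 < / (1 - t))%R) by (apply Rinv_0_lt_compat; lra).
  destruct I as [[A B]|[A B]].
  - eapply Rle_trans; [|exact B].
    assert (Px : (0 < x ^ n)%R) by (apply pow_lt; lra).
    assert (Pf := INR_fact_lt_0 n).
    apply Rle_trans with (exp (- x)); [apply exp_le_compat; rewrite E2; unfold Rdiv; lra|].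
    rewrite exp_Ropp. replace (INR (fact n) / x ^ n)%R with (/ (x ^ n / INR (fact n)))%R
          by (field; lra).
    apply Rinv_le_contravar; [apply Rdiv_lt_0_compat; lra|]. apply exp_ge_term. lra.
  - eapply Rle_trans; [|exact B]. apply exp_le_compat. rewrite E2. unfold Rdiv.
    assert (Pn : (0 < t ^ n)%R) by (apply pow_lt; lra). nra.
Qed.

Section Pentagonal.
Variable tau : C.
Hypothesis Htau : (0 < Im tau)%R.

Let t := nome (Im tau).
Let Pn := Cprod_1n (fun n => 1 - ce (cz (Z.of_nat n) * tau)).

Lemma t_range : (0 < t < 1)%R.
Proof. split; [apply nome_pos|apply nome_lt1, Htau]. Qed.

Lemma Cmod_ce_nat n : Cmod (ce (cz (Z.of_nat n) * tau)) = (t ^ n)%R.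
Proof.
  unfold t. rewrite nome_pow, Cmod_ce. unfold cz. rewrite Im_RtoC_mult, <- INR_IZR_INZ. reflexivity.
Qed.

Lemma Pn_lower n : (exp (- (4 / (1 - t))) <= Cmod (Pn n))%R.
Proof.
  eapply Rle_trans; [apply (euler_product_lower t n t_range)|].
  induction n as [|n IH].
  - unfold Pn. simpl. rewrite Cmod_1. lra.
  - unfold Pn. cbn [Cprod_1n Rprod_1n]. fold Pn. rewrite Cmod_mult.
    assert (T := t_range).
    assert (Q : (t ^ S n <= 1)%R) by (rewrite <- (pow1 (S n)); apply pow_incr; lra).
    apply Rmult_le_compat; [| |exact IH|].
    + eapply Rle_trans; [left; apply exp_pos|apply (euler_product_lower t n T)].
    + lra.
    + assert (X := Cmod_triangle_sub 1 (ce (cz (Z.of_nat (S n)) * tau))).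
      rewrite Cmod_1, Cmod_ce_nat in X. exact X.
Qed.

Lemma Pn_neq0 n : Pn n <> 0.
Proof.
  apply Cmod_gt_0. eapply Rlt_le_trans; [apply exp_pos|apply Pn_lower].
Qed.

Lemma Pn_S n : Pn (S n) = Pn n * (1 - ce (cz (Z.of_nat (S n)) * tau)).
Proof. reflexivity. Qed.

(** Each further factor is at most 1 + t^j <= exp(t^j), so quotients of partial products
    are bounded independently of k and n. *)
Lemma Pn_ratio k n : (k <= n)%nat -> (Cmod (Pn n / Pn k) <= exp (1 / (1 - t)))%R.
Proof.
  intros H. assert (T := t_range).
  assert (A : (Cmod (Pn n) <= Cmod (Pn k) * exp ((t ^ S k - t ^ S n) / (1 - t)))%R).
  { induction H as [|n H IH].
    - replace ((t ^ S k - t ^ S k) / (1 - t))%R with 0%R by (field; lra). rewrite exp_0. lra.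
    - rewrite Pn_S, Cmod_mult.
      replace ((t ^ S k - t ^ S (S n)) / (1 - t))%R
        with ((t ^ S k - t ^ S n) / (1 - t) + t ^ S n)%R by (simpl; field; lra).
      rewrite exp_plus, <- Rmult_assoc. apply Rmult_le_compat; try apply Cmod_ge_0; [exact IH|].
      eapply Rle_trans; [apply Cmod_triangle|]. rewrite Cmod_opp, Cmod_1, Cmod_ce_nat.
      apply exp_ineq1_le. }
  assert (P := proj1 (Cmod_gt_0 _) (Pn_neq0 k)).
  rewrite Cmod_div by apply Pn_neq0.
  apply Rmult_le_reg_r with (Cmod (Pn k)); [exact P|].
  replace (Cmod (Pn n) / Cmod (Pn k) * Cmod (Pn k))%R with (Cmod (Pn n)) by (field; lra).
  eapply Rle_trans; [exact A|]. rewrite Rmult_comm. apply Rmult_le_compat_r; [lra|].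
  apply exp_le_compat. apply Rmult_le_compat_r; [left; apply Rinv_0_lt_compat; lra|].
  assert (t ^ S k <= 1)%R by (rewrite <- (pow1 (S k)); apply pow_incr; lra).
  assert (0 < t ^ S n)%R by (apply pow_lt; lra). lra.
Qed.

Let st (n k : nat) : C :=
  m1pow (Z.of_nat k) * (Pn n / Pn k) *
  ce ((cz (Z.of_nat k) * cz (Z.of_nat n) + cz (Z.of_nat k) * (cz (Z.of_nat k) + 1) / 2) * tau).

Let U (n k : nat) : C :=
  match k with
  | O => 0
  | S k' => m1pow (Z.of_nat (S k')) * (Pn n / Pn k') *
     ce ((cz (Z.of_nat k') * (cz (Z.of_nat k') + 1) / 2
          + (cz (Z.of_nat k') + 1) * (cz (Z.of_nat n) + 1)) * tau)
  end.

Lemma cz_S n : cz (Z.of_nat (S n)) = cz (Z.of_nat n) + 1.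
Proof. replace (Z.of_nat (S n)) with (Z.of_nat n + 1)%Z by lia. rewrite cz_plus. reflexivity. Qed.

Lemma m1pow_nat_S n : m1pow (Z.of_nat (S n)) = - m1pow (Z.of_nat n).
Proof. replace (Z.of_nat (S n)) with (Z.of_nat n + 1)%Z by lia. apply m1pow_S. Qed.

(** Shanks' proof of the pentagonal number theorem. The k-th terms of two consecutive
    finite sums differ by a telescoping expression U, so that passing from n to n + 1
    adds exactly two new terms of Euler's series. *)
Lemma shanks_telescope n k : st (S n) k - st n k = U n (S k) - U n k.
Proof.
  unfold st. cbn [U]. rewrite Pn_S, !m1pow_nat_S, !cz_S.
  set (K := cz (Z.of_nat k)). set (N := cz (Z.of_nat n)).
  assert (Nk := Pn_neq0 k).
  set (A := ce ((K * (K + 1) / 2 + K * N) * tau)).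
  set (x := ce (K * tau)). set (y := ce ((N + 1) * tau)).
  assert (E1 : ce ((K * (N + 1) + K * (K + 1) / 2) * tau) = A * x)
    by (unfold A, x; rewrite <- ce_plus; f_equal; field).
  assert (E2 : ce ((K * N + K * (K + 1) / 2) * tau) = A)
    by (unfold A; f_equal; field).
  assert (E3 : ce ((K * (K + 1) / 2 + (K + 1) * (N + 1)) * tau) = A * x * y)
    by (unfold A, x, y; rewrite <- !ce_plus; f_equal; field).
  rewrite E1, E2, E3.
  destruct k as [|k'].
  - assert (X : x = 1).
    { unfold x, K. simpl. unfold cz. rewrite <- ce_0. f_equal. ring. }
    rewrite X. cbn [U]. field. exact Nk.
  - cbn [U]. fold N. assert (Nk' := Pn_neq0 k').
    assert (Ek : Pn (S k') = Pn k' * (1 - x)) by reflexivity.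
    assert (E4 : ce ((cz (Z.of_nat k') * (cz (Z.of_nat k') + 1) / 2
          + (cz (Z.of_nat k') + 1) * (N + 1)) * tau) = A).
    { unfold A, K. rewrite cz_S. f_equal. field. }
    rewrite E4, Ek. rewrite Ek in Nk. rewrite !m1pow_nat_S.
    assert (N1 : 1 - x <> 0) by (intros J; apply Nk; rewrite J; ring).
    field. split; assumption.
Qed.

Lemma csum_telescope (f g u : nat -> C) n :
  (forall k, f k - g k = u (S k) - u k) -> csum f n - csum g n = u (S n) - u 0%nat.
Proof.
  intros H. induction n as [|n IH].
  - rewrite !sum_O. apply H.
  - rewrite !csum_S. replace (csum f n + f (S n) - (csum g n + g (S n)))
      with ((csum f n - csum g n) + (f (S n) - g (S n))) by ring.
    rewrite IH, H. ring.
Qed.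

Let pt (n : Z) : C := m1pow n * ce (pent n * tau).

Lemma shanks_step n : csum (st (S n)) (S n) = csum (st n) n + (pt (Z.of_nat (S n)) + pt (- Z.of_nat (S n))).
Proof.
  rewrite csum_S.
  assert (T := csum_telescope (st (S n)) (st n) (U n) n (shanks_telescope n)).
  replace (csum (st (S n)) n) with (csum (st n) n + (csum (st (S n)) n - csum (st n) n)) by ring.
  rewrite T. cbn [U]. unfold st at 2, pt. rewrite m1pow_opp.
  assert (E1 : Pn n / Pn n = 1) by (field; apply Pn_neq0).
  assert (E2 : Pn (S n) / Pn (S n) = 1) by (field; apply Pn_neq0).
  rewrite E1, E2.
  replace (ce (pent (- Z.of_nat (S n)) * tau)) with
    (ce ((cz (Z.of_nat n) * (cz (Z.of_nat n) + 1) / 2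
         + (cz (Z.of_nat n) + 1) * (cz (Z.of_nat n) + 1)) * tau)).
  - replace (ce (pent (Z.of_nat (S n)) * tau)) with
      (ce ((cz (Z.of_nat (S n)) * cz (Z.of_nat (S n))
            + cz (Z.of_nat (S n)) * (cz (Z.of_nat (S n)) + 1) / 2) * tau)).
    + cring.
    + f_equal. unfold pent. field.
  - f_equal. unfold pent. rewrite cz_opp, cz_S. field.
Qed.

(** Shanks' finite identity: a weighted sum of quotients of partial products equals a
    partial sum of Euler's series. *)
Lemma shanks n : csum (st (S n)) (S n)
  = csum (fun k => pt (Z.of_nat k)) (S n) + csum (fun k => pt (- Z.of_nat (S k))) n.
Proof.
  induction n as [|n IH].
  - rewrite shanks_step, !csum_S, !sum_O.
    assert (E : st 0 0 = pt (Z.of_nat 0)).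
    { unfold st, pt, pent. simpl. unfold Pn. simpl.
      replace (cz 0) with (RtoC 0) by reflexivity.
      replace ((0 * 0 + 0 * (0 + 1) / 2) * tau) with (RtoC 0) by field.
      replace (0 * (3 * 0 + 1) / 2 * tau) with (RtoC 0) by field. field. }
    rewrite E. cring.
  - rewrite shanks_step, IH, !csum_S. cring.
Qed.

(** All terms of Shanks' sum other than the one with k = 0, which is the partial product
    itself, carry a factor t^n. *)
Lemma shanks_error n : (Cmod (csum (st n) n - Pn n) <= exp (1 / (1 - t)) / (1 - t) * t ^ n)%R.
Proof.
  assert (T := t_range).
  assert (E0 : st n 0 = Pn n).
  { unfold st. simpl. unfold Pn at 2. simpl. replace (cz 0) with (RtoC 0) by reflexivity.
    replace ((0 * cz (Z.of_nat n) + 0 * (0 + 1) / 2) * tau) with (RtoC 0) by field.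
    rewrite ce_0. unfold m1pow. simpl. field. }
  set (C0 := exp (1 / (1 - t))). assert (PC : (0 < C0)%R) by apply exp_pos.
  assert (B : forall k, (1 <= k <= n)%nat -> (Cmod (st n k) <= C0 * t ^ n * t ^ k)%R).
  { intros k Hk. unfold st. rewrite !Cmod_mult, Cmod_m1pow, Rmult_1_l, Rmult_assoc.
    apply Rmult_le_compat; try apply Cmod_ge_0; [apply Pn_ratio; lia|].
    replace ((cz (Z.of_nat k) * cz (Z.of_nat n) + cz (Z.of_nat k) * (cz (Z.of_nat k) + 1) / 2) * tau)
      with (RtoC (INR k * INR n + INR k * (INR k + 1) / 2) * tau).
    - rewrite Cmod_ce, Im_RtoC_mult. unfold t. rewrite !nome_pow, <- exp_plus. apply exp_le_compat.
      assert (P := PI_RGT_0).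
      replace (- (2 * PI * (INR n * Im tau)) + - (2 * PI * (INR k * Im tau)))%R
        with (- (2 * PI * ((INR n + INR k) * Im tau)))%R by ring.
      apply Ropp_le_contravar, Rmult_le_compat_l; [lra|]. apply Rmult_le_compat_r; [lra|].
      assert (1 <= INR k)%R by (apply (le_INR 1); lia).
      assert (0 <= INR n)%R by apply pos_INR. nra.
    - f_equal. rewrite <- !RtoC_INR, RtoC_plus, RtoC_div, !RtoC_mult, RtoC_plus by lra. reflexivity. }
  assert (G : forall m, (m <= n)%nat -> (Cmod (csum (st n) m - Pn n) <= C0 * t ^ n * ((1 - t ^ S m) / (1 - t) - 1))%R).
  { induction m as [|m IH]; intros Hm.
    - rewrite sum_O, E0. replace (Pn n - Pn n) with (RtoC 0) by ring. rewrite Cmod_0.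
      replace ((1 - t ^ 1) / (1 - t) - 1)%R with 0%R by (simpl; field; lra). lra.
    - rewrite csum_S. replace (csum (st n) m + st n (S m) - Pn n)
        with ((csum (st n) m - Pn n) + st n (S m)) by ring.
      eapply Rle_trans; [apply Cmod_triangle|].
      specialize (IH ltac:(lia)). specialize (B (S m) ltac:(lia)).
      replace ((1 - t ^ S (S m)) / (1 - t) - 1)%R
        with ((1 - t ^ S m) / (1 - t) - 1 + t ^ S m)%R by (simpl; field; lra).
      lra. }
  eapply Rle_trans; [apply (G n (le_n _))|].
  assert (Pn0 : (0 < t ^ n)%R) by (apply pow_lt; lra).
  assert (Pn1 : (0 < t ^ S n)%R) by (apply pow_lt; lra).
  replace (C0 / (1 - t) * t ^ n)%R with (C0 * t ^ n * (1 / (1 - t)))%R by (field; lra).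
  apply Rmult_le_compat_l; [apply Rmult_le_pos; lra|].
  apply Rmult_le_reg_r with (1 - t)%R; [lra|].
  replace (((1 - t ^ S n) / (1 - t) - 1) * (1 - t))%R with (t - t ^ S n)%R by (field; lra).
  replace (1 / (1 - t) * (1 - t))%R with 1%R by (field; lra). lra.
Qed.

Lemma Pn_limit eps : (0 < eps)%R -> exists N, forall n, (N <= n)%nat -> (Cmod (Pn n - euler tau) < eps)%R.
Proof.
  intros He. destruct (euler_zsum tau Htau) as [s1 [s2 [H1 [H2 E]]]].
  assert (T := t_range).
  set (D := (exp (1 / (1 - t)) / (1 - t))%R).
  assert (PD : (0 < D)%R) by (apply Rdiv_lt_0_compat; [apply exp_pos|lra]).
  destruct (proj1 (cseries_eps _ _) H1 (eps / 3)%R ltac:(lra)) as [N1 K1].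
  destruct (proj1 (cseries_eps _ _) H2 (eps / 3)%R ltac:(lra)) as [N2 K2].
  destruct (pow_lt_1_zero t ltac:(rewrite Rabs_right; lra) (eps / (3 * D))%R
              ltac:(apply Rdiv_lt_0_compat; lra)) as [N3 K3].
  exists (S (N1 + N2 + N3)). intros n Hn. destruct n as [|n]; [lia|].
  specialize (K1 (S n) ltac:(lia)). specialize (K2 n ltac:(lia)). specialize (K3 (S n) ltac:(lia)).
  assert (B := shanks_error (S n)). fold D in B. rewrite Rabs_right in K3 by (apply Rle_ge, pow_le; lra).
  rewrite shanks in B.
  set (X := csum (fun k => pt (Z.of_nat k)) (S n)) in *.
  set (Y := csum (fun k => pt (- Z.of_nat (S k))) n) in *.
  change (Cmod (X - s1) < eps / 3)%R in K1. change (Cmod (Y - s2) < eps / 3)%R in K2.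
  rewrite E. replace (Pn (S n) - (s1 + s2)) with (- (X + Y - Pn (S n)) + ((X - s1) + (Y - s2))) by ring.
  eapply Rle_lt_trans; [apply Cmod_triangle|].
  eapply Rle_lt_trans; [apply Rplus_le_compat_l, Cmod_triangle|]. rewrite Cmod_opp.
  assert (Q : (D * t ^ S n < eps / 3)%R).
  { apply Rlt_le_trans with (D * (eps / (3 * D)))%R; [apply Rmult_lt_compat_l; lra|].
    right. field. lra. }
  lra.
Qed.

Lemma qpoch_euler : qpoch tau = euler tau.
Proof.
  unfold qpoch, Climit.
  assert (L : filterlim (Cprod_1n (fun n => 1 - qpow (INR n) tau)) eventually
                (locally (T := C_NormedModule) (euler tau))).
  { apply (proj2 (filterlim_locally_ball_norm (U := C_NormedModule) (F := eventually) _ _)).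
    intros eps. destruct (Pn_limit eps (cond_pos eps)) as [N K]. exists N. intros n Hn.
    specialize (K n Hn).
    replace (Cprod_1n (fun n => 1 - qpow (INR n) tau) n) with (Pn n); [exact K|].
    unfold Pn. clear. induction n as [|n IH]; [reflexivity|].
    cbn [Cprod_1n]. rewrite IH, qpow_ce, RtoC_INR. reflexivity. }
  apply (iota_unique (V := C_CompleteNormedModule)
    (fun l => filterlim (Cprod_1n (fun n => 1 - qpow (INR n) tau)) eventually (locally l))).
  - intros y Hy. exact (filterlim_locally_unique (V := C_NormedModule) (F := eventually) _ _ _ Hy L).
  - exact L.
Qed.

Lemma euler_lower : (exp (- (4 / (1 - t))) <= Cmod (euler tau))%R.
Proof.
  apply le_epsilon. intros eps He. destruct (Pn_limit eps He) as [N K].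
  specialize (K N (le_n _)). assert (B := Pn_lower N).
  assert (X := Cmod_triangle_sub (Pn N) (euler tau)). lra.
Qed.

Lemma euler_neq0 : euler tau <> 0.
Proof. apply Cmod_gt_0. eapply Rlt_le_trans; [apply exp_pos|apply euler_lower]. Qed.
End Pentagonal.

(** * Holomorphy and poles of the Appell function *)

Ltac cnz N := apply Cminus_eq_contra; first [exact N | apply not_eq_sym; exact N].

Lemma Cseries_split (a : nat -> C) N (l : C) : cseries (fun n => a (S N + n)%nat) l ->
  Cseries a = csum a N + l.
Proof.
  intros H. apply Cseries_unique.
  apply (is_series_decr_n (V := C_NormedModule) a (S N)); [lia|].
  refine (eq_ind l (fun x => cseries (fun k => a (S N + k)%nat) x) H _ _).
  change (@eq C l (csum a N + l + - csum a N)). ring.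
Qed.

Lemma chol_csum (a : nat -> C -> C) s n : (forall k, chol (a k) s) ->
  chol (fun w => csum (fun k => a k w) n) s.
Proof.
  intros H. induction n as [|n IH].
  - eapply chol_ext; [|apply (H 0%nat)]. exists 1%R. split; [lra|]. intros w _.
    rewrite sum_O. reflexivity.
  - eapply chol_ext; [|apply (chol_plus _ _ _ IH (H (S n)))].
    exists 1%R. split; [lra|]. intros w _. rewrite csum_S. reflexivity.
Qed.

(** The M-test with finitely many exceptional terms: near a given point only the terms
    with small |n| can have a small denominator. *)
Lemma chol_series_eventually (a : nat -> C -> C) (M : nat -> R) N s :
  (forall n, chol (a n) s) ->
  cnear s (fun w => forall n, (N <= n)%nat -> chol (a n) w /\ (Cmod (a n w) <= M n)%R) ->
  ex_series M ->
  chol (fun w => Cseries (fun n => a n w)) s.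
Proof.
  intros Hh [d [Hd H]] E.
  assert (E' : ex_series (fun n => M (S N + n)%nat)) by (apply (ex_series_incr_n M (S N)), E).
  set (F := fun w => Cseries (fun n => a (S N + n)%nat w)).
  assert (HF : forall w, (Cmod (w - s) < d)%R -> cseries (fun n => a (S N + n)%nat w) (F w)).
  { intros w Hw. apply (Cseries_correct _ _ (fun n => proj2 (H w Hw (S N + n)%nat ltac:(lia)))). exact E'. }
  apply (chol_ext (fun w => csum (fun n => a n w) N + F w)).
  - exists d. split; [exact Hd|]. intros w Hw. symmetry. apply (Cseries_split (fun n => a n w) N (F w)), HF, Hw.
  - apply chol_plus; [apply chol_csum, Hh|].
    apply (weierstrass_series (fun n => a (S N + n)%nat) (fun n => M (S N + n)%nat) F s d Hd).
    + intros n w Hw. apply H; [exact Hw|lia].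
    + intros n w Hw. apply H; [exact Hw|lia].
    + exact E'.
    + exact HF.
Qed.

Lemma chol_bterm u tau n s : chol u s -> chol tau s -> ce (u s + cz n * tau s) <> 1 ->
  chol (fun w => bterm (u w) (tau w) n) s.
Proof.
  intros Hu Ht N. unfold bterm. apply chol_div.
  - apply chol_scal, chol_ce_comp, chol_scal, Ht.
  - apply chol_minus; [apply chol_const|]. apply chol_ce_comp, chol_plus; [exact Hu|apply chol_scal, Ht].
  - apply one_minus_neq0, N.
Qed.

Lemma cnear_Im_close f s r : ccont f s -> (0 < r)%R ->
  cnear s (fun w => (Rabs (Im (f w) - Im (f s)) < r)%R).
Proof.
  intros H Hr. refine (cnear_imp _ _ _ _ (H r Hr)). intros w Hw.
  replace (Im (f w) - Im (f s))%R with (Im (f w - f s)) by (destruct (f w), (f s); simpl; ring).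
  eapply Rle_lt_trans; [apply im_le_Cmod|exact Hw].
Qed.

Lemma chol_half_bterm u tau (sg : nat -> Z) s :
  chol u s -> chol tau s -> (0 < Im (tau s))%R ->
  (forall n, Z.abs_nat (sg n) = S n) ->
  (forall n, ce (u s + cz (sg n) * tau s) <> 1) ->
  chol (fun w => Cseries (fun n => bterm (u w) (tau w) (sg n))) s.
Proof.
  intros Hu Ht Hp Hs Hn. set (y0 := (Im (tau s) / 2)%R).
  assert (Py : (0 < y0)%R) by (unfold y0; lra).
  destruct (bterm_far y0 (Rabs (Im (u s)) + 1) Py) as [N HN].
  apply (chol_series_eventually _ (fun n => 2 * nome y0 * nome y0 ^ n)%R N).
  - intros n. apply chol_bterm; auto.
  - refine (cnear_imp _ _ _ _ (cnear_and _ _ _ (cnear_and _ _ _ (chol_near _ _ Hu) (chol_near _ _ Ht))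
      (cnear_and _ _ _ (cnear_Im_close u s 1 (chol_cont _ _ Hu) Rlt_0_1)
                       (cnear_Im_close tau s y0 (chol_cont _ _ Ht) Py)))).
    intros w [[Hu1 Ht1] [Bu Bt]] n Hnn.
    destruct (Rabs_def2 _ _ Bt) as [Bt1 Bt2].
    destruct (HN (sg n) (u w) (tau w)) as [A B].
    + rewrite Hs. lia.
    + assert (T := Rabs_triang (Im (u w) - Im (u s)) (Im (u s))).
      replace (Im (u w) - Im (u s) + Im (u s))%R with (Im (u w)) in T by ring. lra.
    + unfold y0 in *. lra.
    + split; [apply chol_bterm; assumption|].
      rewrite Hs in B. simpl in B. rewrite Rmult_assoc. exact B.
  - apply ex_series_geom_scal. split; [left; apply nome_pos|apply nome_lt1, Py].
Qed.

(** The Appell series without the term n = 0, which alone is singular at u = 0. *)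
Definition Btail (u tau : C) : C :=
  Cseries (fun n => bterm u tau (Z.of_nat (S n))) + Cseries (fun n => bterm u tau (- Z.of_nat (S n))).

Lemma appell_split u tau : (0 < Im tau)%R ->
  appell u tau = ce (u / 2) * (/ (1 - ce u)) + ce (u / 2) * Btail u tau.
Proof.
  intros H. destruct (bterm_zsum u tau H) as [s [s1 [s2 [H1 [H2 E]]]]].
  assert (Z0 : bterm u tau 0 = / (1 - ce u)).
  { unfold bterm, pent. change (cz 0) with (RtoC 0).
    replace (0 * (3 * 0 + 1) / 2 * tau) with (RtoC 0) by field.
    replace (u + 0 * tau) with u by ring. rewrite ce_0. unfold m1pow, Cdiv. simpl. ring. }
  unfold appell, CseriesZ, Btail. rewrite (Cseries_unique _ _ H1), (Cseries_unique _ _ H2).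
  rewrite (Cseries_unique _ _ (cseries_incr _ _ H1)). cbv beta.
  change (Z.of_nat 0) with 0%Z. rewrite Z0. ring.
Qed.

Lemma abs_nat_S n : Z.abs_nat (Z.of_nat (S n)) = S n.
Proof. apply Zabs2Nat.id. Qed.
Lemma abs_nat_opp_S n : Z.abs_nat (- Z.of_nat (S n)) = S n.
Proof. lia. Qed.

(** The Appell function is differentiated along arbitrary holomorphic curves
    (u(w), tau(w)), so that one lemma serves the elliptic variable, the modular variable,
    and arguments such as l z with p z. *)
Lemma chol_Btail u tau s : chol u s -> chol tau s -> (0 < Im (tau s))%R ->
  (forall n, n <> 0%Z -> ce (u s + cz n * tau s) <> 1) ->
  chol (fun w => Btail (u w) (tau w)) s.
Proof.
  intros Hu Ht Hp Hn. unfold Btail. apply chol_plus; apply chol_half_bterm; auto.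
  - apply abs_nat_S.
  - intros n. apply Hn. lia.
  - apply abs_nat_opp_S.
  - intros n. apply Hn. lia.
Qed.

Lemma Im_pos_near tau s : chol tau s -> (0 < Im (tau s))%R -> cnear s (fun w => (0 < Im (tau w))%R).
Proof.
  intros H Hp. refine (cnear_imp _ _ _ _ (cnear_Im_close tau s _ (chol_cont _ _ H) Hp)).
  intros w Hw. destruct (Rabs_def2 _ _ Hw). lra.
Qed.

Lemma chol_half u s : chol u s -> chol (fun w => ce (u w / 2)) s.
Proof. intros H. apply chol_ce_comp. apply chol_mult; [exact H|apply chol_const]. Qed.

Lemma chol_appell u tau s : chol u s -> chol tau s -> (0 < Im (tau s))%R -> reg (u s) (tau s) ->
  chol (fun w => appell (u w) (tau w)) s.
Proof.
  intros Hu Ht Hp Hr.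
  apply (chol_ext (fun w => ce (u w / 2) * (/ (1 - ce (u w))) + ce (u w / 2) * Btail (u w) (tau w))).
  - refine (cnear_imp _ _ _ _ (Im_pos_near tau s Ht Hp)). intros w Hw. symmetry. apply appell_split, Hw.
  - apply chol_plus; apply chol_mult; try (apply chol_half, Hu).
    + apply chol_inv; [apply chol_minus; [apply chol_const|apply chol_ce_comp, Hu]|].
      apply one_minus_neq0. specialize (Hr 0%Z). change (cz 0) with (RtoC 0) in Hr.
      replace (u s + 0 * tau s) with (u s) in Hr by ring. exact Hr.
    + apply chol_Btail; auto.
Qed.

Lemma chol_euler tau s : chol tau s -> (0 < Im (tau s))%R -> chol (fun w => euler (tau w)) s.
Proof.
  intros Ht Hp. set (y0 := (Im (tau s) / 2)%R).
  assert (Py : (0 < y0)%R) by (unfold y0; lra).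
  assert (K : forall sg : nat -> Z, (forall n, (n <= Z.abs_nat (sg n))%nat) ->
    chol (fun w => Cseries (fun n => m1pow (sg n) * ce (pent (sg n) * tau w))) s).
  { intros sg Hs. apply (chol_series_eventually _ (fun n => 1 * nome y0 ^ n)%R 0).
    - intros n. apply chol_scal, chol_ce_comp, chol_scal, Ht.
    - refine (cnear_imp _ _ _ _ (cnear_and _ _ _ (chol_near _ _ Ht)
                       (cnear_Im_close tau s y0 (chol_cont _ _ Ht) Py))).
      intros w [Ht1 Bt] n _. destruct (Rabs_def2 _ _ Bt) as [Bt1 Bt2].
      split; [apply chol_scal, chol_ce_comp, chol_scal, Ht1|].
      rewrite Cmod_mult, Cmod_m1pow, !Rmult_1_l.
      eapply Rle_trans; [apply (Cmod_ce_pent_le _ _ y0); unfold y0 in *; lra|].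
      assert (L := nome_lt1 y0 Py). assert (L0 := nome_pos y0).
      specialize (Hs n). replace (Z.abs_nat (sg n)) with (n + (Z.abs_nat (sg n) - n))%nat by lia.
      rewrite pow_add. rewrite <- (Rmult_1_r (nome y0 ^ n)) at 2.
      apply Rmult_le_compat_l; [apply pow_le; lra|].
      rewrite <- (pow1 (Z.abs_nat (sg n) - n)). apply pow_incr. lra.
    - apply ex_series_geom_scal. split; [left; apply nome_pos|apply nome_lt1, Py]. }
  unfold euler, CseriesZ. apply chol_plus.
  - apply (K Z.of_nat). intros n. lia.
  - apply (K (fun n => - Z.of_nat (S n))%Z). intros n. lia.
Qed.

(** A pole of order at most one with residue rho; rho = 0 expresses a removable
    singularity. *)
Definition has_pole (F : C -> C) (s rho : C) : Prop :=
  exists phi l, cderiv phi s l /\ phi s = rho /\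
    cnear s (fun w => w <> s -> F w = phi w / (w - s)).

Lemma pole_ext F G s rho : cnear s (fun w => w <> s -> F w = G w) -> has_pole F s rho -> has_pole G s rho.
Proof.
  intros E [phi [l [A [B D]]]]. exists phi, l. split; [exact A|]. split; [exact B|].
  refine (cnear_imp _ _ _ _ (cnear_and _ _ _ E D)). intros w [X Y] N. rewrite <- X by exact N. auto.
Qed.

Lemma pole_regular F s l : cderiv F s l -> has_pole F s 0.
Proof.
  intros H. exists (fun w => F w * (w - s)), (l * (s - s) + F s * 1). split; [|split].
  - apply (cderiv_mult F (fun w => w - s)); [exact H|].
    eapply cderiv_ext; [|apply (cderiv_affine 1 (- s))].
    exists 1%R. split; [lra|]. intros w _. ring.
  - ring.
  - exists 1%R. split; [lra|]. intros w _ N. field. cnz N.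
Qed.

Lemma pole_chol F s : chol F s -> has_pole F s 0.
Proof. intros H. destruct (chol_here _ _ H) as [l K]. eapply pole_regular, K. Qed.

Lemma pole_plus F G s a b : has_pole F s a -> has_pole G s b -> has_pole (fun w => F w + G w) s (a + b).
Proof.
  intros [f [l [A [B D]]]] [g [m [A' [B' D']]]]. exists (fun w => f w + g w), (l + m).
  split; [apply cderiv_plus; assumption|]. split; [rewrite B, B'; reflexivity|].
  refine (cnear_imp _ _ _ _ (cnear_and _ _ _ D D')). intros w [X Y] N.
  rewrite X, Y by exact N. field. cnz N.
Qed.

Lemma pole_mult F m s a l : has_pole F s a -> cderiv m s l -> has_pole (fun w => m w * F w) s (m s * a).
Proof.
  intros [f [k [A [B D]]]] H. exists (fun w => m w * f w), (l * f s + m s * k).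
  split; [apply cderiv_mult; assumption|]. split; [rewrite B; reflexivity|].
  refine (cnear_imp _ _ _ _ D). intros w X N.
  rewrite X by exact N. field. cnz N.
Qed.

Lemma pole_scal c F s a : has_pole F s a -> has_pole (fun w => c * F w) s (c * a).
Proof. intros H. apply (pole_mult F (fun _ => c) s a 0 H). apply cderiv_const. Qed.

Lemma pole_rescale F (c a : C) : c <> 0 -> has_pole F 0 a -> has_pole (fun w => F (c * w)) 0 (a / c).
Proof.
  intros Nc [f [k [A [B D]]]].
  assert (L : cderiv (fun w => c * w) 0 c).
  { eapply cderiv_ext; [|apply (cderiv_affine c 0)]. exists 1%R. split; [lra|]. intros w _. ring. }
  assert (Z : c * 0 = 0) by ring.
  exists (fun w => f (c * w) * / c), (c * k * / c + f (c * 0) * 0). split; [|split].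
  - apply (cderiv_mult (fun w => f (c * w)) (fun _ => / c)); [|apply cderiv_const].
    apply (cderiv_comp f (fun w => c * w)); [rewrite Z; exact A|exact L].
  - rewrite Z, B. reflexivity.
  - destruct D as [d [Hd D]].
    destruct (cderiv_cont _ _ _ L d Hd) as [e [He K]]. exists e. split; [exact He|].
    intros w Hw N. specialize (K w Hw). rewrite Z in K.
    assert (Nw : c * w <> 0).
    { apply Cmult_neq_0; [exact Nc|exact N]. }
    rewrite (D (c * w) K Nw). field. split; assumption.
Qed.

Lemma pole_removable F s : has_pole F s 0 ->
  exists v, forall eps, (0 < eps)%R -> cnear s (fun w => w <> s -> (Cmod (F w - v) < eps)%R).
Proof.
  intros [f [l [A [B D]]]]. exists l. intros eps He.
  refine (cnear_imp _ _ _ _ (cnear_and _ _ _ D (slope_cont f s l A B eps He))).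
  intros w [X Y] N. rewrite X by exact N. unfold slope in Y.
  destruct (excluded_middle_informative (s = s)) as [_|K]; [|now elim K].
  destruct (excluded_middle_informative (w = s)) as [K|_]; [now elim N|exact Y].
Qed.

(** The second-order Taylor estimate, from the mean value bound for
    f(v) - f'(s) (v - s) - m (v - s)^2 / 2. *)
Lemma slope_deriv (f f' : C -> C) (s m : C) : f s = 0 -> cnear s (fun w => cderiv f w (f' w)) -> cderiv f' s m ->
  cderiv (slope f s (f' s)) s (m / 2).
Proof.
  intros Z [d [Hd D]] H eps He.
  destruct (H (eps / 2)%R ltac:(lra)) as [e [Hpe E]].
  exists (Rmin d e). split; [apply Rmin_glb_lt; assumption|]. intros w Hw.
  assert (M1 := Rmin_l d e). assert (M2 := Rmin_r d e).
  unfold slope at 2. destruct (excluded_middle_informative (s = s)) as [_|K]; [|now elim K].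
  unfold slope. destruct (excluded_middle_informative (w = s)) as [->|N].
  - replace (f' s - f' s - m / 2 * (s - s)) with (RtoC 0) by ring. rewrite Cmod_0.
    apply Rmult_le_pos; [lra|apply Cmod_ge_0].
  - assert (N' : w - s <> 0) by (apply Cminus_eq_contra, N).
    assert (P := proj1 (Cmod_gt_0 _) N').
    set (g := fun v => f v - (f' s * (v - s) + m / 2 * ((v - s) * (v - s)))).
    assert (MV : (Cmod (g w - g s) <= 2 * (eps / 2 * Cmod (w - s)) * Cmod (w - s))%R).
    { apply mean_value_bound. intros t Ht. set (v := s + RtoC t * (w - s)).
      assert (Ev : v - s = RtoC t * (w - s)) by (unfold v; ring).
      assert (Bv : (Cmod (v - s) <= Cmod (w - s))%R).
      { rewrite Ev, Cmod_mult, Cmod_R, Rabs_right by lra. nra. }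
      exists (f' v - (f' s + m * (v - s))). split.
      - apply cderiv_plus; [apply D; lra|].
        eapply cderiv_eq.
        + eapply cderiv_ext.
          2:{ apply (cderiv_mult (fun _ => - (1)) (fun v => f' s * (v - s) + m / 2 * ((v - s) * (v - s))));
              [apply cderiv_const|].
              assert (I : cderiv (fun v => v - s) v 1).
              { eapply cderiv_ext; [|apply (cderiv_affine 1 (- s))]. exists 1%R. split; [lra|]. intros x _. ring. }
              apply cderiv_plus; apply cderiv_mult.
              - apply cderiv_const.
              - exact I.
              - apply cderiv_const.
              - apply cderiv_mult; exact I. }
          exists 1%R. split; [lra|]. intros x _. ring.
        + cbv beta. field.
      - replace (f' v - (f' s + m * (v - s))) with (f' v - f' s - m * (v - s)) by ring.
        eapply Rle_trans; [apply E; lra|]. apply Rmult_le_compat_l; lra. }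
    replace (g w - g s) with ((f w / (w - s) - f' s - m / 2 * (w - s)) * (w - s)) in MV.
    + rewrite Cmod_mult in MV. apply Rmult_le_reg_r with (Cmod (w - s)); [exact P|].
      eapply Rle_trans; [exact MV|]. right. field.
    + unfold g. rewrite Z. field. exact N'.
Qed.

(** The residue at 0 of 1 / (1 - e(u)). *)
Definition res0 : C := - / (RtoC (2 * PI) * Ci).

Lemma pole_csc : has_pole (fun u => ce (u / 2) * / (1 - ce u)) 0 res0.
Proof.
  set (k := RtoC (2 * PI) * Ci). assert (Nk : k <> 0) by exact two_pi_i_neq0.
  set (f := fun u => 1 - ce u). set (f' := fun u => - (1) * (k * ce u)).
  assert (D : forall w, cderiv f w (f' w)).
  { intros w. eapply cderiv_eq.
    - apply cderiv_plus; [apply cderiv_const|].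
      eapply cderiv_ext.
      2:{ apply (cderiv_mult (fun _ => - (1)) ce); [apply cderiv_const|apply cderiv_ce]. }
      exists 1%R. split; [lra|]. intros x _. ring.
    - unfold f', k. ring. }
  assert (D2 : exists m, cderiv f' 0 m).
  { eexists. apply cderiv_mult; [apply cderiv_const|].
    apply cderiv_mult; [apply cderiv_const|apply cderiv_ce]. }
  destruct D2 as [m D2].
  assert (Z : f 0 = 0) by (unfold f; rewrite ce_0; ring).
  assert (SD := slope_deriv f f' 0 m Z ltac:(exists 1%R; split; [lra|]; intros w _; apply D) D2).
  set (psi := slope f 0 (f' 0)) in *.
  assert (P0 : psi 0 = - k).
  { unfold psi, slope. destruct (excluded_middle_informative (RtoC 0 = 0)) as [_|N]; [|now elim N].
    unfold f'. rewrite ce_0. ring. }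
  assert (N0 : psi 0 <> 0).
  { rewrite P0. intros J. apply Nk. replace k with (- - k) by ring. rewrite J. ring. }
  assert (H2 : exists l, cderiv (fun u => ce (u / 2)) 0 l).
  { apply chol_here, chol_half, chol_id. }
  destruct H2 as [l2 H2].
  eexists (fun u => ce (u / 2) * / psi u), _. split; [|split].
  - exact (cderiv_mult (fun u => ce (u / 2)) (fun u => / psi u) 0 l2 _ H2 (cderiv_inv psi 0 _ SD N0)).
  - replace (0 / 2) with (RtoC 0) by field. rewrite ce_0, P0. unfold res0. fold k. field. exact Nk.
  - refine (cnear_imp _ _ _ _ (ccont_neq0 psi 0 (cderiv_cont _ _ _ SD) N0)).
    intros w Nw N. unfold psi, slope in *.
    destruct (excluded_middle_informative (w = 0)) as [J|_]; [now elim N|].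
    unfold f in *. assert (Nf : 1 - ce w <> 0).
    { intros J. apply Nw. rewrite J. unfold Cdiv. ring. }
    replace (w - 0) with w in * by ring. field. split; assumption.
Qed.

Lemma ce_tau_neq1 tau n : (0 < Im tau)%R -> n <> 0%Z -> ce (0 + cz n * tau) <> 1.
Proof.
  intros H N E. destruct (ce_eq_1 _ E) as [m Hm]. apply (f_equal Im) in Hm.
  unfold cz in Hm. destruct tau as [x y]. simpl in *.
  assert (A : (IZR n * y = 0)%R) by lra. apply Rmult_integral in A.
  destruct A as [A|A]; [|lra]. apply N, eq_IZR, A.
Qed.

Lemma pole_appell tau : (0 < Im tau)%R -> has_pole (fun u => appell u tau) 0 res0.
Proof.
  intros H. replace res0 with (res0 + 0) by ring.
  apply (pole_ext (fun u => ce (u / 2) * / (1 - ce u) + ce (u / 2) * Btail u tau)).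
  - exists 1%R. split; [lra|]. intros w _ _. symmetry. apply appell_split, H.
  - apply pole_plus; [apply pole_csc|]. apply pole_chol.
    apply chol_mult; [apply chol_half, chol_id|].
    apply (chol_Btail (fun u => u) (fun _ => tau)); [apply chol_id|apply chol_const|exact H|].
    intros n N. apply ce_tau_neq1; assumption.
Qed.

Lemma reg_near0 tau : (0 < Im tau)%R -> cnear 0 (fun v => v <> 0 -> reg v tau).
Proof.
  intros H. exists (Rmin 1 (Im tau)). split; [apply Rmin_glb_lt; lra|].
  intros v Hv N n E. assert (M1 := Rmin_l 1 (Im tau)). assert (M2 := Rmin_r 1 (Im tau)).
  replace (v - 0) with v in Hv by ring.
  destruct (ce_eq_1 _ E) as [m Hm].
  assert (I1 := im_le_Cmod v). assert (R1 := re_le_Cmod v).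
  assert (HI := f_equal Im Hm). assert (HR := f_equal Re Hm).
  destruct v as [x y], tau as [a b]. unfold cz in *. simpl in *.
  assert (n0 : n = 0%Z).
  { destruct (Z.lt_trichotomy n 0) as [L|[L|L]]; [|exact L|].
    - assert (IZR n <= -1)%R by (apply IZR_le; lia). destruct (Rabs_def2 y b ltac:(lra)). nra.
    - assert (1 <= IZR n)%R by (apply IZR_le; lia). destruct (Rabs_def2 y b ltac:(lra)). nra. }
  subst n. assert (Ex : x = IZR m) by lra. assert (Ey : y = 0%R) by lra.
  destruct (Rabs_def2 x 1 ltac:(lra)) as [X1 X2]. rewrite Ex in X1, X2.
  apply lt_IZR in X1. assert (X3 : (-1 < m)%Z) by (apply lt_IZR; exact X2).
  assert (m = 0)%Z by lia. subst. apply N. reflexivity.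
Qed.

Fixpoint bsum (n : nat) (f : nat -> C) : C :=
  match n with O => 0 | S k => bsum k f + f k end.

(** * Translates of the Appell function by multiples of tau *)

Lemma chi12_6 n : chi12 (n + 6) = (- chi12 n)%R.
Proof.
  unfold chi12. rewrite <- Zplus_mod_idemp_l.
  assert (H : (0 <= n mod 12 < 12)%Z) by (apply Z.mod_pos_bound; lia).
  set (r := (n mod 12)%Z) in *.
  assert (D : (r = 0 \/ r = 1 \/ r = 2 \/ r = 3 \/ r = 4 \/ r = 5 \/ r = 6 \/ r = 7 \/ r = 8
    \/ r = 9 \/ r = 10 \/ r = 11)%Z) by lia.
  repeat (destruct D as [->|D]; [simpl; lra|]). rewrite D. simpl. lra.
Qed.

Lemma chi12_opp n : chi12 (- n) = chi12 n.
Proof.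
  unfold chi12.
  assert (H : (0 <= n mod 12 < 12)%Z) by (apply Z.mod_pos_bound; lia).
  rewrite <- (Z.sub_0_l n), <- Zminus_mod_idemp_r. set (r := (n mod 12)%Z) in *.
  assert (D : (r = 0 \/ r = 1 \/ r = 2 \/ r = 3 \/ r = 4 \/ r = 5 \/ r = 6 \/ r = 7 \/ r = 8
    \/ r = 9 \/ r = 10 \/ r = 11)%Z) by lia.
  repeat (destruct D as [->|D]; [simpl; lra|]). rewrite D. simpl. lra.
Qed.

(** chi12 changes sign under n -> n + 6, which accounts for the signs (-1)^l in the
    translates of the Appell function. *)
Lemma chi12_6mul (l : nat) c : RtoC (chi12 (6 * Z.of_nat l + c)) = m1pow (Z.of_nat l) * RtoC (chi12 c).
Proof.
  induction l as [|l IH].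
  - change (6 * Z.of_nat 0 + c)%Z with c. unfold m1pow. simpl. ring.
  - replace (6 * Z.of_nat (S l) + c)%Z with (6 * Z.of_nat l + c + 6)%Z by lia.
    rewrite chi12_6, RtoC_opp, IH, m1pow_nat_S. ring.
Qed.

(** The exponentials that appear in translates of the Appell function. Indexed by t, with
    exponent a square of t, they become the terms of a theta function of character
    chi12. *)
Definition theta_term (tau v : C) (t : nat) : C :=
  RtoC (chi12 (Z.of_nat t)) *
  ce (- ((cz (Z.of_nat t) * cz (Z.of_nat t) - 1) / 24) * tau - cz (Z.of_nat t) / 2 * v).

(** The translation by l tau, normalised to have index -3/2. *)
Definition appell_shift (l : Z) (v tau : C) : C :=
  m1pow l * ce (- (3 / 2) * (cz l * cz l) * tau - 3 * cz l * v) * appell (v + cz l * tau) tau.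

Lemma reg_shift v tau l : reg v tau -> reg (v + cz l * tau) tau.
Proof.
  intros H n. specialize (H (l + n)%Z).
  replace (v + cz l * tau + cz n * tau) with (v + cz (l + n) * tau) by (rewrite cz_plus; ring). exact H.
Qed.

(** Each further translation by tau adds the two exponentials of [appell_add_tau]. In
    terms of t = 6 l + c they are the values c = 1 and c = 5, exactly the residues prime
    to 6. *)
Lemma appell_shift_nat (l : nat) v tau : (0 < Im tau)%R -> reg v tau ->
  appell_shift (Z.of_nat l) v tau = appell v tau + euler tau * bsum (6 * l) (theta_term tau v).
Proof.
  intros H Hr. induction l as [|l IH].
  - unfold appell_shift. simpl. change (cz 0) with (RtoC 0). replace (v + 0 * tau) with v by ring.
    replace (- (3 / 2) * (0 * 0) * tau - 3 * 0 * v) with (RtoC 0) by ring. rewrite ce_0.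
    unfold m1pow. simpl. ring.
  - replace (6 * S l)%nat with (S (S (S (S (S (S (6 * l))))))) by lia. cbn [bsum].
    rewrite !Cmult_plus_distr_l, !Cplus_assoc, <- IH.
    assert (X : forall c : nat, Z.of_nat (c + 6 * l) = (6 * Z.of_nat l + Z.of_nat c)%Z) by (intros; lia).
    assert (V : forall c : nat, theta_term tau v (c + 6 * l) = m1pow (Z.of_nat l) * RtoC (chi12 (Z.of_nat c)) *
       ce (- (((6 * cz (Z.of_nat l) + cz (Z.of_nat c)) * (6 * cz (Z.of_nat l) + cz (Z.of_nat c)) - 1) / 24) * tau
            - (6 * cz (Z.of_nat l) + cz (Z.of_nat c)) / 2 * v)).
    { intros c. unfold theta_term. rewrite X, chi12_6mul, cz_plus, cz_mult. reflexivity. }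
    assert (V0 := V 0%nat). assert (V1 := V 1%nat). assert (V2 := V 2%nat).
    assert (V3 := V 3%nat). assert (V4 := V 4%nat). assert (V5 := V 5%nat).
    clear V X. cbn [Nat.add] in V0, V1, V2, V3, V4, V5.
    rewrite V0, V1, V2, V3, V4, V5. clear V0 V1 V2 V3 V4 V5.
    change (chi12 (Z.of_nat 0)) with 0%R. change (chi12 (Z.of_nat 1)) with 1%R.
    change (chi12 (Z.of_nat 2)) with 0%R. change (chi12 (Z.of_nat 3)) with 0%R.
    change (chi12 (Z.of_nat 4)) with 0%R. change (chi12 (Z.of_nat 5)) with (-1)%R.
    change (cz (Z.of_nat 1)) with (RtoC 1). change (cz (Z.of_nat 5)) with (RtoC 5).
    unfold appell_shift. rewrite m1pow_nat_S, cz_S. set (L := cz (Z.of_nat l)).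
    replace (v + (L + 1) * tau) with (v + L * tau + tau) by ring.
    assert (Q := appell_add_tau _ _ H (reg_shift v tau (Z.of_nat l) Hr)). fold L in Q. rewrite Q.
    set (e0 := ce (- (3 / 2) * ((L + 1) * (L + 1)) * tau - 3 * (L + 1) * v)).
    assert (E1 : ce (- (3 / 2) * (L * L) * tau - 3 * L * v) =
                 e0 * ce (3 / 2 * tau + 3 * (v + L * tau)))
      by (unfold e0; rewrite <- ce_plus; f_equal; field).
    assert (E2 : ce (- (((6 * L + 1) * (6 * L + 1) - 1) / 24) * tau - (6 * L + 1) / 2 * v)
                 = e0 * ce (3 / 2 * tau + 5 / 2 * (v + L * tau)))
      by (unfold e0; rewrite <- ce_plus; f_equal; field).
    assert (E3 : ce (- (((6 * L + 5) * (6 * L + 5) - 1) / 24) * tau - (6 * L + 5) / 2 * v)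
                 = e0 * ce (1 / 2 * tau + 1 / 2 * (v + L * tau)))
      by (unfold e0; rewrite <- ce_plus; f_equal; field).
    rewrite E1, E2, E3. ring.
Qed.

(** * Entire quasi-periodic functions of negative index *)

Lemma RInt_period_shift (f : R -> R) s :
  (forall x, continuous f x) -> (forall x, f (x + 1)%R = f x) ->
  RInt (fun x => f (x + s)%R) 0 1 = RInt f 0 1.
Proof.
  intros Hc Hp.
  assert (E : forall a b, ex_RInt f a b).
  { intros a b. apply (ex_RInt_continuous (V := R_CompleteNormedModule)). intros; apply Hc. }
  assert (L : forall v a b, RInt (fun x => f (x + v)%R) a b = RInt f (a + v) (b + v)).
  { intros v a b.
    assert (Q := RInt_comp_lin (V := R_CompleteNormedModule) f 1 v a b (E _ _)).
    rewrite !Rmult_1_l in Q. rewrite <- Q. apply RInt_ext. intros x _.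
    unfold scal; simpl. unfold mult; simpl. rewrite !Rmult_1_l. reflexivity. }
  rewrite L, Rplus_0_l.
  assert (A := RInt_Chasles (V := R_CompleteNormedModule) f s 0 (1 + s) (E _ _) (E _ _)).
  assert (B := RInt_Chasles (V := R_CompleteNormedModule) f 0 1 (1 + s) (E _ _) (E _ _)).
  assert (D := L 1%R 0%R s). rewrite (RInt_ext _ f) in D by (intros x _; apply Hp).
  rewrite Rplus_0_l, (Rplus_comm s 1) in D.
  assert (F := opp_RInt_swap (V := R_CompleteNormedModule) f 0 s (E _ _)).
  unfold plus, opp in *; simpl in *. lra.
Qed.

Lemma cint_period_shift F y s : (forall x, ccont F (x, y)) -> (forall x, F ((x + 1)%R, y) = F (x, y)) ->
  cint (fun w => F (w + RtoC s)) y = cint F y.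
Proof.
  intros Hc Hp.
  assert (A : forall x, (x, y) + RtoC s = ((x + s)%R, y))
    by (intros x; unfold Cplus, RtoC; simpl; f_equal; ring).
  unfold cint. f_equal.
  - rewrite <- (RInt_period_shift (fun x => Re (F (x, y))) s).
    + apply RInt_ext. intros x _. rewrite A. reflexivity.
    + intros x. apply ccont_line, Hc.
    + intros x. rewrite Hp. reflexivity.
  - rewrite <- (RInt_period_shift (fun x => Im (F (x, y))) s).
    + apply RInt_ext. intros x _. rewrite A. reflexivity.
    + intros x. apply (continuous_ext (fun x => Re ((fun w => - Ci * F w) (x, y)))).
      * intros u. symmetry. apply Im_as_Re.
      * apply (ccont_line (fun w => - Ci * F w)). apply ccont_mult; [apply ccont_const|apply Hc].
    + intros x. rewrite Hp. reflexivity.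
Qed.

Lemma geometric_unbounded rho x M : (1 < rho)%R -> (0 <= x)%R ->
  (forall k : nat, (rho ^ k * x <= M)%R) -> x = 0%R.
Proof.
  intros Hr Hx H. destruct (Req_dec x 0) as [E|N]; [exact E|exfalso].
  destruct (Pow_x_infinity rho ltac:(rewrite Rabs_right; lra) ((M + 1) / x)%R) as [n Hn].
  specialize (Hn n (le_n _)). specialize (H n).
  rewrite Rabs_right in Hn by (apply Rle_ge, pow_le; lra).
  assert (Q : ((M + 1) / x * x <= rho ^ n * x)%R) by (apply Rmult_le_compat_r; lra).
  replace ((M + 1) / x * x)%R with (M + 1)%R in Q by (field; lra). lra.
Qed.

Section Liouville.
Variables (T : R -> Prop) (F : C -> C) (tau c : C).
Hypothesis T_isolated : isolated T.
Hypothesis Htau : (0 < Im tau)%R.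
Hypothesis F_cont : forall w, ccont F w.
Hypothesis F_hol : forall w, ~ T (Im w) -> chol F w.
Hypothesis F_period : forall w, ~ T (Im w) -> F (w + 1) = F w.
Hypothesis F_quasi : forall w, ~ T (Im w) ->
  F (w + tau) = - ce tau * (ce (3 * w) * F w) + c * (1 - ce (tau + 2 * w)).

Lemma liou_strip a b : strip_fun T a b F.
Proof. repeat split; intros w _; auto. Qed.

Let A (n : Z) : C := coef F n 0.

Lemma A_any n y : coef F n y = A n.
Proof.
  apply (coef_const T (Rmin y 0 - 1) (Rmax y 0 + 1) T_isolated F n y 0 (liou_strip _ _)).
  - assert (X := Rmin_l y 0). assert (Y := Rmax_l y 0). lra.
  - assert (X := Rmin_r y 0). assert (Y := Rmax_r y 0). lra.
Qed.

Lemma lcont_Fce n y : lcont (fun w => F w * ce (- cz n * w)) y.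
Proof. intros x _. apply ccont_mult; [apply F_cont|]. apply chol_cont, chol_ce_comp, chol_lin. Qed.

Lemma lcont_ce k y : lcont (fun w => ce (cz k * w)) y.
Proof. intros x _. apply chol_cont, chol_ce_comp, chol_lin. Qed.

Lemma cint_ce_delta k y : cint (fun w => ce (cz k * w)) y = if Z.eqb k 0 then 1 else 0.
Proof.
  destruct (Z.eqb_spec k 0) as [->|N]; [|apply cint_ce, N].
  rewrite (cint_ext _ (fun _ => 1)); [apply cint_const|].
  intros x _. rewrite <- ce_0. f_equal. change (cz 0) with (RtoC 0). ring.
Qed.

(** The n-th Fourier coefficient of F(w + tau) is e(n tau) times that of F, and the
    quasi-periodicity expresses it through the (n-3)-rd. *)
Lemma liou_recursion n : ce (cz n * tau) * A n =
  - ce tau * A (n - 3)%Z + c * ((if Z.eqb n 0 then 1 else 0) - (if Z.eqb n 2 then ce tau else 0)).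
Proof.
  destruct (T_isolated 0) as [d [Hd K]]. set (y0 := (d / 2)%R).
  assert (N0 : ~ T y0).
  { apply K. unfold y0. rewrite Rminus_0_r, Rabs_right; lra. }
  assert (N1 : forall x, ~ T (Im (x, y0))) by (intros x; exact N0).
  (* the line y0 + Im tau need not avoid T, so move F there by translation *)
  assert (L : coef (fun w => F (w + tau)) n y0 = ce (cz n * tau) * A n).
  { rewrite <- (A_any n (y0 + Im tau)).
    unfold coef.
    set (H := fun w => F (w + RtoC 0) * ce (- cz n * w)).
    rewrite <- cint_scal by apply lcont_Fce.
    set (Q := fun w => ce (cz n * tau) * (F w * ce (- cz n * w))).
    transitivity (cint (fun w => Q (w + RtoC (Re tau))) (y0 + Im tau)).
    - unfold cint.
      assert (E : forall x, F ((x, y0) + tau) * ce (- cz n * (x, y0)) =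
                            Q ((x, (y0 + Im tau)%R) + RtoC (Re tau))).
      { intros x. unfold Q.
        replace ((x, (y0 + Im tau)%R) + RtoC (Re tau)) with ((x, y0) + tau)
          by (destruct tau; unfold Cplus, RtoC; simpl; f_equal; ring).
        replace (- cz n * (x, y0)) with (cz n * tau + - cz n * ((x, y0) + tau)) by ring.
        rewrite ce_plus. ring. }
      f_equal; apply RInt_ext; intros x _; rewrite <- E; reflexivity.
    - apply cint_period_shift.
      + intros x. unfold Q. apply ccont_mult; [apply ccont_const|].
        apply ccont_mult; [apply F_cont|]. apply chol_cont, chol_ce_comp, chol_lin.
      + intros x. unfold Q.
        set (w := (x, (y0 + Im tau)%R)).
        replace ((x + 1)%R, (y0 + Im tau)%R) with (w + 1)
          by (unfold w, Cplus, RtoC; simpl; f_equal; ring).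
        (* periodicity on this line follows from the one on the line y0 *)
        assert (P : F (w + 1) = F w).
        { set (v := (x, y0) + - RtoC (Re tau)).
          assert (Nv : ~ T (Im v)) by (unfold v; simpl; replace (y0 + - 0)%R with y0 by ring; exact N0).
          assert (Ew : w = v + tau).
          { unfold v, w. destruct tau. unfold Cplus, Copp, RtoC; simpl. f_equal; ring. }
          rewrite Ew. replace (v + tau + 1) with ((v + 1) + tau) by ring.
          assert (Nv1 : ~ T (Im (v + 1))).
          { replace (Im (v + 1)) with (Im v) by (destruct v; simpl; ring). exact Nv. }
          rewrite !F_quasi, F_period by assumption.
          replace (3 * (v + 1)) with (3 * v + cz 3) by (change (cz 3) with (RtoC 3); ring).
          replace (tau + 2 * (v + 1)) with (tau + 2 * v + cz 2) by (change (cz 2) with (RtoC 2); ring).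
          rewrite !ce_add_cz. reflexivity. }
        rewrite P.
        replace (- cz n * (w + 1)) with (- cz n * w + cz (- n)) by (rewrite cz_opp; ring).
        rewrite ce_add_cz. reflexivity. }
  rewrite <- L. unfold coef.
  rewrite (cint_ext _ (fun w => - ce tau * (F w * ce (- cz (n - 3) * w))
     + (c * ce (cz (- n) * w) + (- c * ce tau) * ce (cz (2 - n) * w)))).
  - rewrite cint_plus, cint_plus, !cint_scal;
      try apply lcont_Fce; try apply lcont_ce; try apply lcont_scal; try apply lcont_Fce; try apply lcont_ce.
    + change (cint (fun w => F w * ce (- cz (n - 3) * w)) y0) with (coef F (n - 3) y0).
      rewrite A_any, !cint_ce_delta.
      replace (Z.eqb (- n) 0) with (Z.eqb n 0) by (destruct (Z.eqb_spec n 0), (Z.eqb_spec (- n) 0); lia).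
      replace (Z.eqb (2 - n) 0) with (Z.eqb n 2) by (destruct (Z.eqb_spec n 2), (Z.eqb_spec (2 - n) 0); lia).
      destruct (Z.eqb n 0), (Z.eqb n 2); ring.
    + intros x Hx. apply ccont_plus; apply lcont_scal; auto using lcont_ce.
  - intros x _. rewrite F_quasi by apply N1. set (w := (x, y0)).
    replace (ce (- cz (n - 3) * w)) with (ce (3 * w) * ce (- cz n * w)).
    2:{ rewrite <- ce_plus. f_equal. rewrite cz_sub. change (cz 3) with (RtoC 3). ring. }
    replace (ce (cz (2 - n) * w)) with (ce (2 * w) * ce (- cz n * w)).
    2:{ rewrite <- ce_plus. f_equal. rewrite cz_sub. change (cz 2) with (RtoC 2). ring. }
    rewrite cz_opp, ce_plus. ring.
Qed.

Lemma A_bounded : exists M, forall n, (Cmod (A n) <= M)%R.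
Proof.
  destruct (lcont_bounded F 0) as [M [PM HM]]; [intros x _; apply F_cont|].
  exists (2 * M)%R. intros n. unfold A, coef.
  apply (cint_bound (fun w => F w * ce (- cz n * w)) 0 M); [apply lcont_Fce|].
  intros x Hx. rewrite Cmod_mult, Cmod_ce.
  replace (- (2 * PI * Im (- cz n * (x, 0%R))))%R with 0%R by (unfold cz; simpl; ring).
  rewrite exp_0, Rmult_1_r. auto.
Qed.

Let rho := exp (4 * PI * Im tau).

Lemma rho_gt1 : (1 < rho)%R.
Proof. unfold rho. rewrite <- exp_0. apply exp_increasing. assert (P := PI_RGT_0). nra. Qed.

Lemma A_norm_rec n : n <> 0%Z -> n <> 2%Z ->
  (Cmod (A n) = exp (2 * PI * Im tau * (IZR n - 1)) * Cmod (A (n - 3)))%R.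
Proof.
  intros N0 N2. assert (H := liou_recursion n).
  apply Z.eqb_neq in N0, N2. rewrite N0, N2 in H.
  replace (- ce tau * A (n - 3)%Z + c * (0 - 0)) with (- ce tau * A (n - 3)%Z) in H by ring.
  apply (f_equal Cmod) in H. rewrite !Cmod_mult, Cmod_opp, !Cmod_ce in H.
  unfold cz in H. rewrite Im_RtoC_mult in H.
  replace (exp (2 * PI * Im tau * (IZR n - 1)))%R
    with (exp (2 * PI * (IZR n * Im tau)) * exp (- (2 * PI * Im tau)))%R
    by (rewrite <- exp_plus; f_equal; ring).
  rewrite Rmult_assoc, <- H, <- Rmult_assoc, <- exp_plus.
  replace (2 * PI * (IZR n * Im tau) + - (2 * PI * (IZR n * Im tau)))%R with 0%R by ring.
  rewrite exp_0. ring.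
Qed.

(** For n >= 3 the modulus grows by at least a fixed factor in each step n -> n + 3,
    although all coefficients are bounded. *)
Lemma A_zero_up n : (0 <= n)%Z -> A n = 0.
Proof.
  intros Hn. destruct A_bounded as [M HM]. apply Cmod_eq_0.
  apply (geometric_unbounded rho _ M rho_gt1 (Cmod_ge_0 _)). intros k.
  apply Rle_trans with (Cmod (A (n + 3 * Z.of_nat k))); [|apply HM].
  induction k as [|k IH].
  - replace (n + 3 * Z.of_nat 0)%Z with n by lia. simpl. lra.
  - rewrite (A_norm_rec (n + 3 * Z.of_nat (S k))) by lia.
    replace (n + 3 * Z.of_nat (S k) - 3)%Z with (n + 3 * Z.of_nat k)%Z by lia.
    simpl pow. rewrite Rmult_assoc. apply Rmult_le_compat; [left; apply exp_pos| |  |exact IH].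
    + apply Rmult_le_pos; [|apply Cmod_ge_0]. apply pow_le. assert (X := rho_gt1). lra.
    + unfold rho. apply exp_le_compat. assert (P := PI_RGT_0).
      assert (Q : (3 <= IZR (n + 3 * Z.of_nat (S k)))%R) by (apply IZR_le; lia).
      assert (0 < PI * Im tau)%R by (apply Rmult_lt_0_compat; lra). nra.
Qed.

(** Downwards the same recursion, read backwards, increases the modulus. *)
Lemma A_zero_down n : (n <= -1)%Z -> A n = 0.
Proof.
  intros Hn. destruct A_bounded as [M HM]. apply Cmod_eq_0.
  apply (geometric_unbounded rho _ M rho_gt1 (Cmod_ge_0 _)). intros k.
  apply Rle_trans with (Cmod (A (n - 3 * Z.of_nat k))); [|apply HM].
  induction k as [|k IH].
  - replace (n - 3 * Z.of_nat 0)%Z with n by lia. simpl. lra.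
  - assert (E := A_norm_rec (n - 3 * Z.of_nat k) ltac:(lia) ltac:(lia)).
    replace (n - 3 * Z.of_nat k - 3)%Z with (n - 3 * Z.of_nat (S k))%Z in E by lia.
    rewrite E in IH. set (m := Cmod (A (n - 3 * Z.of_nat (S k)))) in *.
    assert (Pm : (0 <= m)%R) by apply Cmod_ge_0.
    simpl pow. rewrite Rmult_assoc.
    apply Rle_trans with (rho * (exp (2 * PI * Im tau * (IZR (n - 3 * Z.of_nat k) - 1)) * m))%R.
    + apply Rmult_le_compat_l; [assert (X := rho_gt1); lra|exact IH].
    + rewrite <- Rmult_assoc. unfold rho. rewrite <- exp_plus.
      apply Rle_trans with (1 * m)%R; [|lra].
      apply Rmult_le_compat_r; [exact Pm|].
      apply Rle_trans with (exp 0); [|rewrite exp_0; lra]. apply exp_le_compat.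
      assert (P := PI_RGT_0).
      assert (Q : (IZR (n - 3 * Z.of_nat k) <= -1)%R) by (apply IZR_le; lia).
      assert (Q0 : (0 < PI * Im tau)%R) by (apply Rmult_lt_0_compat; lra).
      assert (Q1 : (0 <= PI * Im tau * - (IZR (n - 3 * Z.of_nat k) + 1))%R)
        by (apply Rmult_le_pos; lra). lra.
Qed.

(** With all Fourier coefficients 0 the recursion at n = 0 leaves c = 0: there is no
    solution even of the inhomogeneous equation. *)
Lemma liouville : c = 0 /\ forall w, ~ T (Im w) -> F w = 0.
Proof.
  assert (Z0 : forall n, A n = 0).
  { intros n. destruct (Z_le_gt_dec 0 n); [apply A_zero_up|apply A_zero_down]; lia. }
  split.
  - assert (H := liou_recursion 0). simpl in H. rewrite !Z0 in H.
    replace c with (- ce tau * 0 + c * (1 - 0)) by ring. rewrite <- H. ring.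
  - intros w N.
    apply (fourier_unique T (Im w - 1) (Im w + 1) T_isolated F w (Im w) (liou_strip _ _)); try lra.
    + exact N.
    + intros k. rewrite A_any. apply Z0.
Qed.
End Liouville.

(** * Removable singularities *)

(** The continuous extension across removable singularities. *)
Definition fill (F : C -> C) (w : C) : C :=
  epsilon (inhabits (RtoC 0)) (fun v => forall eps, (0 < eps)%R ->
     cnear w (fun x => x <> w -> (Cmod (F x - v) < eps)%R)).

Definition has_lim (F : C -> C) (w : C) : Prop := exists v, forall eps, (0 < eps)%R ->
     cnear w (fun x => x <> w -> (Cmod (F x - v) < eps)%R).

Lemma fill_spec F w : has_lim F w -> forall eps, (0 < eps)%R ->
     cnear w (fun x => x <> w -> (Cmod (F x - fill F w) < eps)%R).
Proof.
  intros H. unfold fill.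
  exact (epsilon_spec (inhabits (RtoC 0)) (fun v => forall eps, (0 < eps)%R ->
     cnear w (fun x => x <> w -> (Cmod (F x - v) < eps)%R)) H).
Qed.

Lemma lim_unique F w u v :
  (forall eps, (0 < eps)%R -> cnear w (fun x => x <> w -> (Cmod (F x - u) < eps)%R)) ->
  (forall eps, (0 < eps)%R -> cnear w (fun x => x <> w -> (Cmod (F x - v) < eps)%R)) -> u = v.
Proof.
  intros H K. assert (E : Cmod (u - v) = 0%R).
  { apply Rle_antisym; [|apply Cmod_ge_0]. apply le_epsilon. intros eps He. rewrite Rplus_0_l.
    destruct (cnear_and _ _ _ (H (eps / 2)%R ltac:(lra)) (K (eps / 2)%R ltac:(lra))) as [d [Hd D]].
    set (x := w + RtoC (d / 2)).
    assert (Ex : x - w = RtoC (d / 2)) by (unfold x; ring).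
    assert (N : x <> w).
    { intros J. rewrite J in Ex. replace (w - w) with (RtoC 0) in Ex by ring.
      apply RtoC_inj in Ex. lra. }
    destruct (D x) as [D1 D2].
    - rewrite Ex, Cmod_R, Rabs_right; lra.
    - specialize (D1 N). specialize (D2 N).
      assert (T := Cmod_triangle3 u (F x) v). rewrite (Cmod_minus_sym u (F x)) in T. lra. }
  apply Cmod_eq_0 in E. apply Ceq_minus. exact E.
Qed.

Lemma fill_ccont F w : (forall x, has_lim F x) -> ccont (fill F) w.
Proof.
  intros H eps He. destruct (fill_spec F w (H w) (eps / 2)%R ltac:(lra)) as [d [Hd D]].
  exists d. split; [exact Hd|]. intros x Hx.
  destruct (classic (x = w)) as [->|N].
  { replace (fill F w - fill F w) with (RtoC 0) by ring. rewrite Cmod_0. exact He. }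
  apply Rle_lt_trans with (eps / 2)%R; [|lra]. apply le_epsilon. intros e Hpe.
  assert (P : (0 < Cmod (x - w))%R) by (apply Cmod_gt_0, Cminus_eq_contra, N).
  destruct (fill_spec F x (H x) e Hpe) as [d' [Hd' D']].
  set (r := Rmin d' (Rmin (d - Cmod (x - w)) (Cmod (x - w)))).
  assert (Pr : (0 < r)%R) by (repeat apply Rmin_glb_lt; lra).
  assert (R1 : (r <= d')%R) by apply Rmin_l.
  assert (R2 : (r <= d - Cmod (x - w))%R) by (eapply Rle_trans; [apply Rmin_r|apply Rmin_l]).
  assert (R3 : (r <= Cmod (x - w))%R) by (eapply Rle_trans; [apply Rmin_r|apply Rmin_r]).
  set (y := x + RtoC (r / 2)).
  assert (Ey : y - x = RtoC (r / 2)) by (unfold y; ring).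
  assert (My : Cmod (y - x) = (r / 2)%R) by (rewrite Ey, Cmod_R, Rabs_right; lra).
  assert (Ny : y <> x).
  { intros J. rewrite J in My. replace (x - x) with (RtoC 0) in My by ring. rewrite Cmod_0 in My. lra. }
  assert (Nw : y <> w).
  { intros J. rewrite J, Cmod_minus_sym in My. lra. }
  assert (Q1 := D' y ltac:(lra) Ny).
  assert (T1 := Cmod_triangle3 y x w).
  assert (Q2 := D y ltac:(lra) Nw).
  assert (T := Cmod_triangle3 (fill F x) (F y) (fill F w)). rewrite (Cmod_minus_sym (fill F x) (F y)) in T. lra.
Qed.

Lemma has_lim_ccont F w : ccont F w -> has_lim F w.
Proof.
  intros H. exists (F w). intros eps He. refine (cnear_imp _ _ _ _ (H eps He)). auto.
Qed.

Lemma fill_eq F w : ccont F w -> fill F w = F w.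
Proof.
  intros H. apply (lim_unique F w).
  - apply fill_spec, has_lim_ccont, H.
  - intros eps He. refine (cnear_imp _ _ _ _ (H eps He)). auto.
Qed.

(** * Finite sums *)

Lemma Cinv_neq0 (x : C) : x <> 0 -> / x <> 0.
Proof.
  intros H J. apply C1_nz. rewrite <- (Cinv_r x H), J. ring.
Qed.

Lemma bsum_ext n f g : (forall k, (k < n)%nat -> f k = g k) -> bsum n f = bsum n g.
Proof.
  induction n as [|n IH]; intros H; [reflexivity|]. cbn [bsum].
  rewrite IH, H by (intros; try apply H; lia). reflexivity.
Qed.

Lemma bsum_plus n f g : bsum n (fun k => f k + g k) = bsum n f + bsum n g.
Proof. induction n as [|n IH]; cbn [bsum]; [ring|]. rewrite IH. ring. Qed.

Lemma bsum_scal n c f : bsum n (fun k => c * f k) = c * bsum n f.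
Proof. induction n as [|n IH]; cbn [bsum]; [ring|]. rewrite IH. ring. Qed.

Lemma bsum_zero n : bsum n (fun _ => 0) = 0.
Proof. induction n as [|n IH]; cbn [bsum]; [ring|]. rewrite IH. ring. Qed.

Lemma bsum_swap n m (f : nat -> nat -> C) :
  bsum n (fun i => bsum m (fun j => f i j)) = bsum m (fun j => bsum n (fun i => f i j)).
Proof.
  induction n as [|n IH]; cbn [bsum].
  - symmetry. apply bsum_zero.
  - rewrite IH, <- bsum_plus. reflexivity.
Qed.

Lemma bsum_delta n k (v : C) : (k < n)%nat -> bsum n (fun i => if Nat.eqb i k then v else 0) = v.
Proof.
  induction n as [|n IH]; intros H; [lia|]. cbn [bsum].
  destruct (Nat.eqb_spec n k) as [->|N].
  - rewrite (bsum_ext k _ (fun _ => 0)).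
    + rewrite bsum_zero. ring.
    + intros i Hi. destruct (Nat.eqb_spec i k); [lia|reflexivity].
  - rewrite IH by lia. ring.
Qed.

Lemma bsum_S_first n f : bsum (S n) f = f O + bsum n (fun k => f (S k)).
Proof.
  induction n as [|n IH]; [simpl; ring|].
  change (bsum (S (S n)) f) with (bsum (S n) f + f (S n)). rewrite IH. cbn [bsum]. ring.
Qed.

Lemma pole_bsum n (f : nat -> C -> C) (r : nat -> C) s :
  (forall k, (k < n)%nat -> has_pole (f k) s (r k)) ->
  has_pole (fun u => bsum n (fun k => f k u)) s (bsum n r).
Proof.
  induction n as [|n IH]; intros H.
  - cbn [bsum]. apply pole_chol, chol_const.
  - cbn [bsum]. apply (pole_plus (fun u => bsum n (fun k => f k u)) (f n)); auto.
Qed.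

Lemma chol_bsum n (f : nat -> C -> C) s :
  (forall k, (k < n)%nat -> chol (f k) s) -> chol (fun u => bsum n (fun k => f k u)) s.
Proof.
  induction n as [|n IH]; intros H.
  - cbn [bsum]. apply chol_const.
  - cbn [bsum]. apply (chol_plus (fun u => bsum n (fun k => f k u)) (f n)); auto.
Qed.

Lemma chi12_even k : chi12 (2 * k) = 0%R.
Proof.
  unfold chi12. assert (H : (0 <= (2 * k) mod 12 < 12)%Z) by (apply Z.mod_pos_bound; lia).
  assert (E := Z.div_mod (2 * k) 12 ltac:(lia)). set (r := ((2 * k) mod 12)%Z) in *.
  assert (D : (r = 0 \/ r = 2 \/ r = 4 \/ r = 6 \/ r = 8 \/ r = 10)%Z) by lia.
  repeat (destruct D as [->|D]; [reflexivity|]). rewrite D. reflexivity.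
Qed.

Lemma chi12_three k : chi12 (3 * k) = 0%R.
Proof.
  unfold chi12. assert (H : (0 <= (3 * k) mod 12 < 12)%Z) by (apply Z.mod_pos_bound; lia).
  assert (E := Z.div_mod (3 * k) 12 ltac:(lia)). set (r := ((3 * k) mod 12)%Z) in *.
  assert (D : (r = 0 \/ r = 3 \/ r = 6 \/ r = 9)%Z) by lia.
  repeat (destruct D as [->|D]; [reflexivity|]). rewrite D. reflexivity.
Qed.

Lemma chi12_five n : chi12 (5 * n) = (- chi12 n)%R.
Proof.
  unfold chi12. rewrite <- Zmult_mod_idemp_r.
  assert (H : (0 <= n mod 12 < 12)%Z) by (apply Z.mod_pos_bound; lia).
  set (r := (n mod 12)%Z) in *.
  assert (D : (r = 0 \/ r = 1 \/ r = 2 \/ r = 3 \/ r = 4 \/ r = 5 \/ r = 6 \/ r = 7 \/ r = 8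
    \/ r = 9 \/ r = 10 \/ r = 11)%Z) by lia.
  repeat (destruct D as [->|D]; [simpl; lra|]). rewrite D. simpl. lra.
Qed.

(** Each unit step changes the sign, in both directions. *)
Lemma appell_add_cz u tau m : appell (u + cz m) tau = m1pow m * appell u tau.
Proof.
  assert (P : forall k : nat, appell (u + cz (Z.of_nat k)) tau = m1pow (Z.of_nat k) * appell u tau /\
                              appell (u + cz (- Z.of_nat k)) tau = m1pow (Z.of_nat k) * appell u tau).
  { induction k as [|k [IH1 IH2]].
    - simpl. change (cz 0) with (RtoC 0). change (m1pow 0) with (RtoC 1).
      replace (u + 0) with u by ring. split; ring.
    - rewrite m1pow_nat_S. split.
      + rewrite cz_S. replace (u + (cz (Z.of_nat k) + 1)) with (u + cz (Z.of_nat k) + 1) by ring.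
        rewrite appell_add_one, IH1. ring.
      + assert (E := appell_add_one (u + cz (- Z.of_nat (S k))) tau).
        replace (u + cz (- Z.of_nat (S k)) + 1) with (u + cz (- Z.of_nat k)) in E
          by (rewrite !cz_opp, cz_S; ring).
        rewrite IH2 in E.
        replace (appell (u + cz (- Z.of_nat (S k))) tau) with (- - appell (u + cz (- Z.of_nat (S k))) tau) by ring.
        rewrite <- E. ring. }
  destruct (Z.le_gt_cases 0 m) as [L|L].
  - rewrite <- (Z2Nat.id m L). exact (proj1 (P _)).
  - replace m with (- Z.of_nat (Z.to_nat (- m)))%Z by lia. rewrite m1pow_opp. exact (proj2 (P _)).
Qed.

(** The translate differs from the Appell function by an entire function, so the residue
    does not depend on the lattice point. Negative translates reduce to positive ones
    because the Appell function is odd. *)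
Lemma pole_appell_shift tau l : (0 < Im tau)%R -> has_pole (fun v => appell_shift l v tau) 0 res0.
Proof.
  intros H.
  assert (CH : forall n (s : C), chol (fun v => bsum n (theta_term tau v)) s).
  { intros n s. apply (chol_bsum n (fun k v => theta_term tau v k)). intros k _. unfold theta_term.
    apply chol_scal, chol_ce_comp, chol_minus; [apply chol_const|apply chol_lin]. }
  destruct (Z.le_gt_cases 0 l) as [L|L].
  - rewrite <- (Z2Nat.id l L). set (k := Z.to_nat l).
    replace res0 with (res0 + 0) by ring.
    apply (pole_ext (fun v => appell v tau + euler tau * bsum (6 * k) (theta_term tau v))).
    + refine (cnear_imp _ _ _ _ (reg_near0 tau H)). intros v Hv N. symmetry.
      apply appell_shift_nat; [exact H|auto].
    + apply (pole_plus (fun v => appell v tau)); [apply pole_appell, H|]. apply pole_chol, chol_scal, CH.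
  - set (k := Z.to_nat (- l)). assert (El : l = (- Z.of_nat k)%Z) by (unfold k; lia).
    replace res0 with (res0 + 0) by ring.
    apply (pole_ext (fun v => appell v tau + - euler tau * bsum (6 * k) (theta_term tau (- v)))).
    + assert (R2 : cnear 0 (fun v => v <> 0 -> reg (- v) tau)).
      { destruct (reg_near0 tau H) as [d [Hd K]]. exists d. split; [exact Hd|].
        intros v Hv N. apply K.
        - replace (- v - 0) with (- (v - 0)) by ring. rewrite Cmod_opp. exact Hv.
        - intros J. apply N. replace v with (- - v) by ring. rewrite J. ring. }
      refine (cnear_imp _ _ _ _ (cnear_and _ _ _ (reg_near0 tau H) R2)). intros v [Hv Hv2] N.
      specialize (Hv N). specialize (Hv2 N).
      assert (V := appell_shift_nat k (- v) tau H Hv2).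
      rewrite (appell_neg v tau H Hv) in V.
      assert (E : appell_shift l v tau = - appell_shift (Z.of_nat k) (- v) tau).
      { unfold appell_shift. rewrite El, m1pow_opp, cz_opp.
        replace (v + - cz (Z.of_nat k) * tau) with (- (- v + cz (Z.of_nat k) * tau)) by ring.
        rewrite appell_neg; [|exact H|apply reg_shift, Hv2].
        replace (- (3 / 2) * (- cz (Z.of_nat k) * - cz (Z.of_nat k)) * tau - 3 * - cz (Z.of_nat k) * v)
          with (- (3 / 2) * (cz (Z.of_nat k) * cz (Z.of_nat k)) * tau - 3 * cz (Z.of_nat k) * - v) by ring.
        ring. }
      rewrite E, V. ring.
    + apply (pole_plus (fun v => appell v tau)); [apply pole_appell, H|]. apply pole_chol, chol_scal.
      apply (chol_comp (fun v => bsum (6 * k) (theta_term tau v)) (fun v => - v)); [apply CH|].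
      apply chol_opp, chol_id.
Qed.

Lemma bsum_add m n f : bsum (m + n) f = bsum m f + bsum n (fun k => f (m + k)%nat).
Proof.
  induction n as [|n IH].
  - rewrite Nat.add_0_r. cbn [bsum]. ring.
  - rewrite <- plus_n_Sm. cbn [bsum]. rewrite IH. ring.
Qed.
(** * Meromorphy at infinity from growth *)

Lemma fsum_bsum c K : fsum c (S K) = bsum (2 * K + 2) (fun n => c (Z.of_nat n - Z.of_nat K)%Z).
Proof.
  induction K as [|K IH]; [simpl; ring|].
  change (fsum c (S (S K))) with (fsum c (S K) + (c (Z.of_nat (S (S K))) + c (- Z.of_nat (S K))%Z)).
  rewrite IH. replace (2 * S K + 2)%nat with (S (S (2 * K + 2))) by lia.
  rewrite bsum_S_first. cbn [bsum].
  rewrite (bsum_ext (2 * K + 2) (fun n => c (Z.of_nat (S n) - Z.of_nat (S K))%Z)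
    (fun n => c (Z.of_nat n - Z.of_nat K)%Z)) by (intros n _; f_equal; lia).
  replace (Z.of_nat (S (2 * K + 2)) - Z.of_nat (S K))%Z with (Z.of_nat (S (S K))) by lia.
  replace (Z.of_nat 0 - Z.of_nat (S K))%Z with (- Z.of_nat (S K))%Z by lia. ring.
Qed.

Lemma bsum_csum f n : bsum (S n) f = csum f n.
Proof.
  induction n as [|n IH].
  - rewrite sum_O. simpl. ring.
  - rewrite csum_S, <- IH. reflexivity.
Qed.

(** Symmetric partial sums of a series without terms below -n0 are its ordinary partial
    sums. *)
Lemma fsum_half_line (c : Z -> C) n0 K : (forall k, (k < - Z.of_nat n0)%Z -> c k = 0) -> (n0 <= K)%nat ->
  fsum c (S K) = bsum (n0 + K + 2) (fun n => c (- Z.of_nat n0 + Z.of_nat n)%Z).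
Proof.
  intros H HK. rewrite fsum_bsum.
  replace (2 * K + 2)%nat with ((K - n0) + (n0 + K + 2))%nat by lia.
  rewrite bsum_add, (bsum_ext (K - n0) _ (fun _ => 0)), bsum_zero.
  - rewrite Cplus_0_l. apply bsum_ext. intros n _. cbv beta. f_equal. lia.
  - intros n Hn. apply H. lia.
Qed.

Lemma chol_strip F a b : (forall w, (a < Im w)%R -> chol F w) -> (forall w, (a < Im w)%R -> F (w + 1) = F w) ->
  strip_fun (fun _ => False) a b F.
Proof.
  intros H P. repeat split; intros w Hw; try intros _.
  - apply chol_cont, H, Hw.
  - apply H, Hw.
  - apply P, Hw.
Qed.

Section Expansion.
Variables (F : C -> C) (N : nat) (kappa : R).
Hypothesis N_pos : (1 <= N)%nat.
Hypothesis F_hol : forall z, (0 < Im z)%R -> chol F z.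
Hypothesis F_period : forall z, (0 < Im z)%R -> F (z + cz (Z.of_nat N)) = F z.
Hypothesis F_growth : forall z, (1 <= Im z)%R -> (0 <= Re z <= INR N)%R ->
  (Cmod (F z) <= exp (kappa * Im z))%R.

Let G (w : C) : C := F (RtoC (INR N) * w).
Let n0 : nat := Z.abs_nat (up (kappa * INR N)).

Lemma N_ge1 : (1 <= INR N)%R.
Proof. apply (le_INR 1). exact N_pos. Qed.

Lemma G_strip_expansion b : strip_fun (fun _ => False) 0 b G.
Proof.
  assert (Q := N_ge1). apply chol_strip; intros w Hw.
  - assert (Hi : (0 < Im (RtoC (INR N) * w))%R) by (rewrite Im_RtoC_mult; apply Rmult_lt_0_compat; lra).
    unfold G. apply (chol_comp F (fun w => RtoC (INR N) * w)); [apply F_hol, Hi|apply chol_lin].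
  - assert (Hi : (0 < Im (RtoC (INR N) * w))%R) by (rewrite Im_RtoC_mult; apply Rmult_lt_0_compat; lra).
    unfold G. rewrite <- (F_period _ Hi). f_equal. rewrite <- RtoC_INR. ring.
Qed.

Lemma coef_any_height k y : (0 < y)%R -> coef G k y = coef G k 1.
Proof.
  intros Hy. apply (coef_const _ 0 (y + 2) isolated_none G k y 1 (G_strip_expansion (y + 2))); lra.
Qed.

Lemma coef_bound k y : (1 <= y)%R ->
  (Cmod (coef G k 1) <= 2 * exp (y * (kappa * INR N + 2 * PI * IZR k)))%R.
Proof.
  intros Hy. rewrite <- (coef_any_height k y) by lra. assert (Q := N_ge1).
  unfold coef. apply cint_bound.
  - apply (strip_lcont _ 0 (y + 2) _ y (strip_mult_ce _ _ _ G k (G_strip_expansion (y + 2)))). lra.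
  - intros x Hx. rewrite Cmod_mult.
    replace (y * (kappa * INR N + 2 * PI * IZR k))%R with (kappa * (INR N * y) + 2 * PI * IZR k * y)%R by ring.
    rewrite exp_plus. apply Rmult_le_compat; try apply Cmod_ge_0.
    + unfold G. replace (RtoC (INR N) * (x, y)) with (((INR N * x)%R, (INR N * y)%R) : C)
        by (unfold RtoC, Cmult; simpl; f_equal; ring).
      apply (F_growth ((INR N * x)%R, (INR N * y)%R)); simpl; nra.
    + rewrite Cmod_ce. right. f_equal.
      replace (- cz k * (x, y)) with (RtoC (- IZR k) * (x, y)) by (rewrite RtoC_opp; reflexivity).
      rewrite Im_RtoC_mult. simpl. ring.
Qed.

(** At height y the integral is at most 2 exp(y (kappa N + 2 pi k)), and it does not
    depend on y; for k below -kappa N this tends to 0 as y grows. *)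
Lemma coef_zero k : (k < - Z.of_nat n0)%Z -> coef G k 1 = 0.
Proof.
  intros Hk. apply NNPP. intros NE. assert (P := proj1 (Cmod_gt_0 _) NE).
  set (v := Cmod (coef G k 1)) in *.
  assert (P3 : (3 < PI)%R) by (assert (Q := PI2_3_2); unfold PI2 in Q; lra).
  assert (B : (kappa * INR N + 2 * PI * IZR k <= - (1))%R).
  { destruct (archimed (kappa * INR N)) as [U _].
    assert (H1 : (up (kappa * INR N) <= - k - 1)%Z) by (unfold n0 in Hk; lia).
    apply IZR_le in H1. rewrite minus_IZR, opp_IZR in H1.
    assert (H2 : (k <= -1)%Z) by lia. apply IZR_le in H2. nra. }
  (* at this height the bound 2 exp(-y) < 2 / (1 + y) is below v *)
  set (y := (1 + 2 / v)%R).
  assert (Hv : (0 < 2 / v)%R) by (apply Rdiv_lt_0_compat; lra).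
  assert (C0 := coef_bound k y ltac:(unfold y; lra)). fold v in C0.
  assert (E1 : (exp (y * (kappa * INR N + 2 * PI * IZR k)) <= exp (- y))%R)
    by (apply exp_le_compat; unfold y in *; nra).
  assert (E2 : (exp (- y) * (1 + y) <= 1)%R).
  { apply Rle_trans with (exp (- y) * exp y)%R.
    - apply Rmult_le_compat_l; [left; apply exp_pos|apply exp_ineq1_le].
    - rewrite <- exp_plus. replace (- y + y)%R with 0%R by ring. rewrite exp_0. lra. }
  assert (E3 : (v * (1 + y) <= 2)%R) by (unfold y in *; nra).
  assert (E4 : (v * y = v + 2)%R) by (unfold y; field; lra). lra.
Qed.

(** The Fourier coefficients of w |-> F(N w) of large negative index vanish by the growth
    condition. *)
Theorem meromorphic_of_growth : meromorphic_at_infinity F.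
Proof.
  (* the coefficients may be read off at any height; 1 is one at which the growth bound holds *)
  exists N, (- Z.of_nat n0)%Z, (fun n => coef G (- Z.of_nat n0 + Z.of_nat n)%Z 1).
  split; [exact N_pos|]. intros z Hz. unfold upper_half in Hz. assert (Q := N_ge1).
  assert (NN : RtoC (INR N) <> 0) by (apply RtoC_neq0; lra).
  set (w0 := z / RtoC (INR N)).
  assert (Ew : RtoC (INR N) * w0 = z) by (unfold w0; field; exact NN).
  assert (Hw : (0 < Im w0)%R).
  { rewrite <- Ew, Im_RtoC_mult in Hz. nra. }
  destruct (fourier_expansion _ 0 (Im w0 + 2) isolated_none G w0 1 (G_strip_expansion (Im w0 + 2)))
    as [M [rho [Hr HM]]]; try lra; try tauto.
  replace (F z) with (G w0) by (unfold G; rewrite Ew; reflexivity).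
  apply (cseries_ext (fun n => coef G (- Z.of_nat n0 + Z.of_nat n)%Z 1 * ce (cz (- Z.of_nat n0 + Z.of_nat n) * w0))).
  { intros n. rewrite qpow_ce. do 2 f_equal. unfold w0, cz. rewrite RtoC_div by lra. field. exact NN. }
  apply cseries_eps. intros eps He.
  assert (MP : (0 <= Rabs M)%R) by apply Rabs_pos.
  destruct (pow_lt_1_zero rho ltac:(rewrite Rabs_pos_eq; lra) (eps / (Rabs M + 1))%R
     ltac:(apply Rdiv_lt_0_compat; lra)) as [K0 HK0].
  exists (n0 + (n0 + K0) + 1)%nat. intros n Hn.
  assert (Hn2 : exists K, n = (n0 + K + 1)%nat /\ (n0 <= K)%nat /\ (K0 <= K)%nat)
    by (exists (n - n0 - 1)%nat; lia).
  destruct Hn2 as [K [-> [HK1 HK2]]].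
  rewrite <- bsum_csum. replace (S (n0 + K + 1)) with (n0 + K + 2)%nat by lia.
  rewrite <- (fsum_half_line (fun k => coef G k 1 * ce (cz k * w0)) n0 K).
  - eapply Rle_lt_trans; [apply HM|].
    specialize (HK0 (S K) ltac:(lia)). rewrite Rabs_pos_eq in HK0 by (apply pow_le; lra).
    assert (P := pow_le rho (S K) ltac:(lra)).
    apply Rle_lt_trans with ((Rabs M + 1) * rho ^ S K)%R.
    + apply Rmult_le_compat_r; [exact P|]. assert (A := Rle_abs M). lra.
    + apply (Rmult_lt_compat_l (Rabs M + 1)) in HK0; [|lra].
      replace ((Rabs M + 1) * (eps / (Rabs M + 1)))%R with eps in HK0 by (field; lra). exact HK0.
  - intros k Hk. rewrite coef_zero by exact Hk. ring.
  - exact HK1.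
Qed.
End Expansion.
(** * Translations by the lattice at level p *)

Section Level.
Variable p : nat.
Hypothesis p_prime : prime (Z.of_nat p).
Hypothesis p_gt3 : (3 < p)%nat.

Definition pc : C := cz (Z.of_nat p).

Lemma pc_neq0 : pc <> 0.
Proof. apply cz_neq0. lia. Qed.

Lemma p_odd : Z.even (Z.of_nat p) = false.
Proof.
  destruct (Z.even (Z.of_nat p)) eqn:E; [|reflexivity]. exfalso.
  apply Z.even_spec in E. destruct E as [k Hk].
  assert (D : (2 | Z.of_nat p)%Z) by (exists k; lia).
  destruct (prime_divisors _ p_prime 2 D) as [A|[A|[A|A]]]; lia.
Qed.

Lemma p_not3 : ~ (3 | Z.of_nat p)%Z.
Proof. intros D. destruct (prime_divisors _ p_prime 3 D) as [A|[A|[A|A]]]; lia. Qed.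

(** p is odd, so multiplication by p preserves parity. *)
Lemma m1pow_pmul k : m1pow (Z.of_nat p * k) = m1pow k.
Proof. unfold m1pow. rewrite Z.even_mul, p_odd. reflexivity. Qed.

Lemma p_divides_double k : (Z.of_nat p | 2 * k)%Z -> (Z.of_nat p | k)%Z.
Proof.
  intros D. destruct (prime_mult _ p_prime _ _ D) as [A|A]; [|exact A].
  apply Z.divide_pos_le in A; lia.
Qed.

Lemma Im_div_pc z : Im (z / pc) = (Im z / INR p)%R.
Proof.
  unfold pc, cz. rewrite <- INR_IZR_INZ. unfold Cdiv.
  assert (N : INR p <> 0%R) by (apply not_0_INR; lia).
  rewrite <- RtoC_inv by exact N. rewrite Cmult_comm, Im_RtoC_mult. field. exact N.
Qed.

Lemma Im_mul_pc z : Im (pc * z) = (INR p * Im z)%R.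
Proof. unfold pc, cz. rewrite Im_RtoC_mult, <- INR_IZR_INZ. reflexivity. Qed.

Lemma p_pos : (0 < INR p)%R.
Proof. apply lt_0_INR. lia. Qed.

Lemma upper_div z : (0 < Im z)%R -> (0 < Im (z / pc))%R.
Proof. intros H. rewrite Im_div_pc. apply Rdiv_lt_0_compat; [exact H|apply p_pos]. Qed.

Lemma upper_mul z : (0 < Im z)%R -> (0 < Im (pc * z))%R.
Proof. intros H. rewrite Im_mul_pc. apply Rmult_lt_0_compat; [apply p_pos|exact H]. Qed.

(** Translation by l z + m with the factor of automorphy of index -3/2 / p relative to
    the lattice generated by 1 and z. *)
Definition heis (z : C) (l m : Z) (F : C -> C) (u : C) : C :=
  m1pow (l + m) * ce (- (3 / 2) * (cz l * cz l) * z / pc - 3 * cz l * u / pc)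
  * F (u + cz l * z + cz m).

(** The trace of B(.; z/p) over the p-torsion points on the real axis. *)
Definition torsion_sum (z u : C) : C :=
  bsum p (fun j => m1pow (Z.of_nat j) * appell ((u + cz (Z.of_nat j)) / pc) (z / pc)).

(** This quotient makes the theta terms of [torsion_sum] match those of B(.; pz); its
    invariance under Gamma(p) is a by-product of the argument. *)
Definition eta_quot (z : C) : C := eta (pc * z) / eta (z / pc).
Definition chip : C := RtoC (chi12 (Z.of_nat p)).

(** The function E of the introduction. *)
Definition lattice_form (z u : C) : C := eta_quot z * torsion_sum z u - pc * chip * appell u (pc * z).

(** All the functions of u at level p have their poles on the lattice Z z + Z only. *)
Definition off_lattice (z u : C) : Prop := forall l m, u <> cz l * z + cz m.

Lemma off_lattice_shift z u l m : off_lattice z u -> off_lattice z (u + cz l * z + cz m).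
Proof.
  intros H l' m' E. apply (H (l' - l)%Z (m' - m)%Z). rewrite !cz_sub.
  replace u with ((u + cz l * z + cz m) - cz l * z - cz m) by ring. rewrite E. ring.
Qed.

Lemma off_lattice_opp z u : off_lattice z u -> off_lattice z (- u).
Proof.
  intros H l m E. apply (H (- l)%Z (- m)%Z). rewrite !cz_opp.
  replace u with (- - u) by ring. rewrite E. ring.
Qed.

Lemma off_lattice_reg_big z u : off_lattice z u -> reg u (pc * z).
Proof.
  intros H n E. destruct (ce_eq_1 _ E) as [m Hm]. apply (H (- (n * Z.of_nat p))%Z m).
  rewrite cz_opp, cz_mult. fold pc.
  replace u with ((u + cz n * (pc * z)) - cz n * (pc * z)) by ring. rewrite Hm. unfold cz at 3. ring.
Qed.

Lemma off_lattice_reg_small z u j : off_lattice z u -> reg ((u + cz j) / pc) (z / pc).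
Proof.
  intros H n E. destruct (ce_eq_1 _ E) as [m Hm]. fold (cz m) in Hm.
  apply (H (- n)%Z (Z.of_nat p * m - j)%Z).
  rewrite cz_opp, cz_sub, cz_mult. fold pc.
  replace u with (pc * ((u + cz j) / pc + cz n * (z / pc)) - cz n * z - cz j) by (field; apply pc_neq0).
  rewrite Hm. ring.
Qed.

Lemma heis_ext z l m F G u : F (u + cz l * z + cz m) = G (u + cz l * z + cz m) ->
  heis z l m F u = heis z l m G u.
Proof. intros H. unfold heis. rewrite H. reflexivity. Qed.

(** These operators generate a Heisenberg group: they compose up to the factor
    e(-3 l2 m1 / p), which is 1 under the divisibility hypothesis. *)
Lemma heis_comp z l1 m1 l2 m2 F u : (Z.of_nat p | l2 * m1)%Z ->
  heis z l1 m1 (heis z l2 m2 F) u = heis z (l1 + l2) (m1 + m2) F u.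
Proof.
  intros [k Hk]. unfold heis.
  replace (u + cz l1 * z + cz m1 + cz l2 * z + cz m2) with (u + cz (l1 + l2) * z + cz (m1 + m2))
    by (rewrite !cz_plus; ring).
  replace (l1 + l2 + (m1 + m2))%Z with (l1 + m1 + (l2 + m2))%Z by lia.
  rewrite (m1pow_plus (l1 + m1)).
  assert (N := pc_neq0).
  assert (Ek : cz l2 * cz m1 = cz k * pc) by (unfold pc; rewrite <- !cz_mult, Hk; reflexivity).
  assert (E : ce (- (3 / 2) * (cz (l1 + l2) * cz (l1 + l2)) * z / pc - 3 * cz (l1 + l2) * u / pc) =
    ce (- (3 / 2) * (cz l1 * cz l1) * z / pc - 3 * cz l1 * u / pc) *
    ce (- (3 / 2) * (cz l2 * cz l2) * z / pc - 3 * cz l2 * (u + cz l1 * z + cz m1) / pc)).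
  { rewrite <- ce_plus.
    rewrite <- (ce_add_cz (- (3 / 2) * (cz (l1 + l2) * cz (l1 + l2)) * z / pc - 3 * cz (l1 + l2) * u / pc) (-3 * k)).
    f_equal. rewrite !cz_plus, cz_mult. change (cz (-3)) with (RtoC (-3)).
    replace (RtoC (-3) * cz k) with (RtoC (-3) * (cz l2 * cz m1) / pc) by (rewrite Ek; field; exact N).
    replace (RtoC (-3)) with (- RtoC 3) by (rewrite <- RtoC_opp; f_equal; lra). field. exact N. }
  rewrite E. ring.
Qed.

(** Orthogonality of the additive characters modulo p. *)
Lemma char_sum k : bsum p (fun j => ce (cz (Z.of_nat j) * cz k / pc)) =
  if excluded_middle_informative (Z.of_nat p | k)%Z then pc else 0.
Proof.
  assert (N := pc_neq0).
  destruct (excluded_middle_informative (Z.of_nat p | k)%Z) as [[q Hq]|D].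
  - rewrite (bsum_ext p _ (fun _ => 1)).
    + unfold pc. generalize p. intros n. induction n as [|n IH]; [reflexivity|].
      cbn [bsum]. rewrite IH, cz_S. reflexivity.
    + intros j _. rewrite Hq, cz_mult. fold pc.
      replace (cz (Z.of_nat j) * (cz q * pc) / pc) with (cz (Z.of_nat j * q))
        by (rewrite cz_mult; field; exact N). apply ce_cz.
  - set (x := ce (cz k / pc)).
    assert (Nx : x <> 1).
    { intros E. destruct (ce_eq_1 _ E) as [m Hm]. fold (cz m) in Hm. apply D. exists m.
      assert (E2 : cz k = cz (m * Z.of_nat p)).
      { rewrite cz_mult. fold pc. rewrite <- Hm. field. exact N. }
      unfold cz in E2. apply RtoC_inj in E2. apply eq_IZR. exact E2. }
    assert (T : forall n, bsum n (fun j => ce (cz (Z.of_nat j) * cz k / pc)) * (1 - x) =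
                     1 - ce (cz (Z.of_nat n) * cz k / pc)).
    { induction n as [|n IH].
      - cbn [bsum]. change (cz (Z.of_nat 0)) with (RtoC 0).
        replace (0 * cz k / pc) with (RtoC 0) by (field; exact N). rewrite ce_0. ring.
      - cbn [bsum]. rewrite Cmult_plus_distr_r, IH.
        replace (ce (cz (Z.of_nat (S n)) * cz k / pc)) with (ce (cz (Z.of_nat n) * cz k / pc) * x).
        + ring.
        + unfold x. rewrite <- ce_plus. f_equal. rewrite cz_S. field. exact N. }
    specialize (T p). fold pc in T.
    replace (pc * cz k / pc) with (cz k) in T by (field; exact N). rewrite ce_cz in T.
    assert (N1 := one_minus_neq0 _ Nx).
    set (S := bsum p (fun j => ce (cz (Z.of_nat j) * cz k / pc))) in *.
    replace S with (S * (1 - x) / (1 - x)) by (field; exact N1). rewrite T. field. exact N1.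
Qed.

(** Translating each summand by l (z/p) produces the exponentials of index t < 6 l; the
    dependence on j of the t-th one is an additive character. *)
Lemma heis_torsion_sum (l : nat) z u : (0 < Im z)%R -> off_lattice z u ->
  heis z (Z.of_nat l) 0 (torsion_sum z) u =
   bsum p (fun j => m1pow (Z.of_nat j) * ce (3 * cz (Z.of_nat l) * cz (Z.of_nat j) / pc)
                    * appell ((u + cz (Z.of_nat j)) / pc) (z / pc))
   + euler (z / pc) * bsum (6 * l) (fun t => theta_term (z / pc) (u / pc) t *
        bsum p (fun j => ce (cz (Z.of_nat j) *
            cz (Z.of_nat p + 6 * Z.of_nat l - Z.of_nat t) / (2 * pc)))).
Proof.
  intros Hz Hu. assert (N := pc_neq0).
  set (L := cz (Z.of_nat l)).
  transitivity (bsum p (fun j => m1pow (Z.of_nat j) * ce (3 * L * cz (Z.of_nat j) / pc)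
                    * appell_shift (Z.of_nat l) ((u + cz (Z.of_nat j)) / pc) (z / pc))).
  - unfold heis, torsion_sum. rewrite <- bsum_scal. apply bsum_ext. intros j _. unfold appell_shift. fold L.
    rewrite Z.add_0_r. change (cz 0) with (RtoC 0).
    replace ((u + L * z + 0 + cz (Z.of_nat j)) / pc) with ((u + cz (Z.of_nat j)) / pc + L * (z / pc))
      by (field; exact N).
    replace (ce (- (3 / 2) * (L * L) * z / pc - 3 * L * u / pc)) with
      (ce (3 * L * cz (Z.of_nat j) / pc) *
       ce (- (3 / 2) * (L * L) * (z / pc) - 3 * L * ((u + cz (Z.of_nat j)) / pc))).
    + ring.
    + rewrite <- ce_plus. f_equal. field. exact N.
  - rewrite (bsum_ext p _ (fun j => m1pow (Z.of_nat j) * ce (3 * L * cz (Z.of_nat j) / pc)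
                    * appell ((u + cz (Z.of_nat j)) / pc) (z / pc) +
        euler (z / pc) * bsum (6 * l) (fun t => theta_term (z / pc) (u / pc) t *
            ce (cz (Z.of_nat j) * cz (Z.of_nat p + 6 * Z.of_nat l - Z.of_nat t) / (2 * pc))))).
    + rewrite bsum_plus, bsum_scal, bsum_swap. f_equal. f_equal. apply bsum_ext. intros t _.
      apply bsum_scal.
    + intros j _. rewrite appell_shift_nat; [|apply upper_div, Hz|apply off_lattice_reg_small, Hu].
      rewrite Cmult_plus_distr_l. f_equal.
      rewrite Cmult_assoc, (Cmult_comm _ (euler _)), <- Cmult_assoc. f_equal.
      rewrite <- bsum_scal. apply bsum_ext. intros t _. unfold theta_term.
      rewrite m1pow_ce. set (J := cz (Z.of_nat j)). set (T := cz (Z.of_nat t)).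
      set (X := RtoC (chi12 (Z.of_nat t))).
      rewrite cz_sub, cz_plus, cz_mult. fold L T pc. change (cz 6) with (RtoC 6).
      replace (ce (J * (pc + 6 * L - T) / (2 * pc)))
        with (ce (J / 2) * ce (3 * L * J / pc) * ce (- (T / 2 * (J / pc))))
        by (rewrite <- !ce_plus; f_equal; field; exact N).
      replace (ce (- ((T * T - 1) / 24) * (z / pc) - T / 2 * ((u + J) / pc)))
        with (ce (- ((T * T - 1) / 24) * (z / pc) - T / 2 * (u / pc)) * ce (- (T / 2 * (J / pc))))
        by (rewrite <- !ce_plus; f_equal; field; exact N).
      ring.
Qed.

(** For even k the halved exponent is again an integer, and p is odd. *)
Lemma half_char_sum k : (Z.even k = true) ->
  bsum p (fun j => ce (cz (Z.of_nat j) * cz k / (2 * pc))) =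
  if excluded_middle_informative (Z.of_nat p | k)%Z then pc else 0.
Proof.
  intros E. apply Z.even_spec in E. destruct E as [h ->].
  rewrite (bsum_ext p _ (fun j => ce (cz (Z.of_nat j) * cz h / pc))).
  - rewrite char_sum.
    destruct (excluded_middle_informative (Z.of_nat p | h)%Z) as [D|D],
             (excluded_middle_informative (Z.of_nat p | 2 * h)%Z) as [D'|D']; try reflexivity.
    + elim D'. apply Z.divide_mul_r, D.
    + elim D. apply p_divides_double, D'.
  - intros j _. f_equal. rewrite cz_mult. change (cz 2) with (RtoC 2). field. apply pc_neq0.
Qed.

(** chi12 vanishes on even numbers, so that the half-integral characters of
    [heis_torsion_sum] occur with even numerators only. *)
Lemma theta_term_even tau v t : Z.even (Z.of_nat t) = true -> theta_term tau v t = 0.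
Proof.
  intros E. apply Z.even_spec in E. destruct E as [h E]. unfold theta_term. rewrite E, chi12_even. ring.
Qed.

Lemma inner_term z u (l t : nat) :
  theta_term (z / pc) (u / pc) t * bsum p (fun j => ce (cz (Z.of_nat j) *
            cz (Z.of_nat p + 6 * Z.of_nat l - Z.of_nat t) / (2 * pc))) =
  if excluded_middle_informative (Z.of_nat p | 6 * Z.of_nat l - Z.of_nat t)%Z
  then pc * theta_term (z / pc) (u / pc) t else 0.
Proof.
  destruct (Z.even (Z.of_nat t)) eqn:E.
  - rewrite theta_term_even by exact E.
    destruct (excluded_middle_informative (Z.of_nat p | 6 * Z.of_nat l - Z.of_nat t)%Z); ring.
  - rewrite half_char_sum.
    + destruct (excluded_middle_informative (Z.of_nat p | 6 * Z.of_nat l - Z.of_nat t)%Z) as [D|D],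
             (excluded_middle_informative (Z.of_nat p | Z.of_nat p + 6 * Z.of_nat l - Z.of_nat t)%Z) as [D'|D'];
        try ring.
      * elim D'. replace (Z.of_nat p + 6 * Z.of_nat l - Z.of_nat t)%Z
          with (Z.of_nat p + (6 * Z.of_nat l - Z.of_nat t))%Z by lia.
        apply Z.divide_add_r; [apply Z.divide_refl|exact D].
      * elim D. replace (6 * Z.of_nat l - Z.of_nat t)%Z
          with (Z.of_nat p + 6 * Z.of_nat l - Z.of_nat t - Z.of_nat p)%Z by lia.
        apply Z.divide_sub_r; [exact D'|apply Z.divide_refl].
    + rewrite Z.even_sub, Z.even_add, Z.even_mul, p_odd, E. reflexivity.
Qed.

(** The part of the quasi-period of B(.; pz) that obstructs invariance. *)
Definition quasi_defect (z u : C) : C := euler (pc * z) * (ce (- (1 / 2) * u) - ce (- (pc * z) - 5 / 2 * u)).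

Lemma eta_euler w : (0 < Im w)%R -> eta w = ce (w / 24) * euler w.
Proof.
  intros H. unfold eta. rewrite (qpoch_euler w H), qpow_ce. f_equal. f_equal.
  rewrite RtoC_div by lra. field.
Qed.

Lemma eta_neq0 w : (0 < Im w)%R -> eta w <> 0.
Proof. intros H. rewrite eta_euler by exact H. apply Cmult_neq_0; [apply ce_neq0|apply euler_neq0, H]. Qed.

Lemma eta_quot_neq0 z : (0 < Im z)%R -> eta_quot z <> 0.
Proof.
  intros H. unfold eta_quot. apply Cmult_neq_0; [apply eta_neq0, upper_mul, H|].
  apply Cinv_neq0, eta_neq0, upper_div, H.
Qed.

Lemma eta_quot_euler z : (0 < Im z)%R -> eta_quot z * euler (z / pc) = ce (pc * z / 24 - z / pc / 24) * euler (pc * z).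
Proof.
  intros H. unfold eta_quot. rewrite !eta_euler by (try apply upper_mul; try apply upper_div; exact H).
  unfold Cminus. rewrite ce_plus, ce_opp. field.
  split; [apply ce_neq0|apply euler_neq0, upper_div, H].
Qed.

(** Of the indices t < 6 p only the multiples of p survive the sum over j, and chi12
    leaves t = p and t = 5 p. *)
Lemma torsion_sum_quasi z u : (0 < Im z)%R -> off_lattice z u ->
  eta_quot z * heis z (Z.of_nat p) 0 (torsion_sum z) u = eta_quot z * torsion_sum z u + pc * chip * quasi_defect z u.
Proof.
  intros Hz Hu. assert (N := pc_neq0). rewrite heis_torsion_sum by assumption. fold pc.
  rewrite (bsum_ext (6 * p) _ (fun t => (if Nat.eqb t p then pc * theta_term (z / pc) (u / pc) p else 0)
     + (if Nat.eqb t (5 * p) then pc * theta_term (z / pc) (u / pc) (5 * p) else 0))).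
  - rewrite bsum_plus, !bsum_delta by lia.
    rewrite !Cmult_plus_distr_l. f_equal.
    + f_equal. unfold torsion_sum. apply bsum_ext. intros j _.
      replace (3 * pc * cz (Z.of_nat j) / pc) with (cz (3 * Z.of_nat j))
        by (rewrite cz_mult; change (cz 3) with (RtoC 3); field; exact N).
      rewrite ce_cz. ring.
    + rewrite !Cmult_assoc, eta_quot_euler by exact Hz.
      unfold quasi_defect, theta_term.
      replace (Z.of_nat (5 * p)) with (5 * Z.of_nat p)%Z by lia.
      rewrite chi12_five, RtoC_opp. fold chip. rewrite cz_mult. fold pc. change (cz 5) with (RtoC 5).
      set (e1 := ce (pc * z / 24 - z / pc / 24)).
      assert (E1 : e1 * ce (- ((pc * pc - 1) / 24) * (z / pc) - pc / 2 * (u / pc)) = ce (- (1 / 2) * u))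
        by (unfold e1; rewrite <- ce_plus; f_equal; field; exact N).
      assert (E2 : e1 * ce (- ((5 * pc * (5 * pc) - 1) / 24) * (z / pc) - 5 * pc / 2 * (u / pc))
                   = ce (- (pc * z) - 5 / 2 * u))
        by (unfold e1; rewrite <- ce_plus; f_equal; field; exact N).
      rewrite <- E1, <- E2. ring.
  - intros t Ht. rewrite inner_term.
    destruct (excluded_middle_informative (Z.of_nat p | 6 * Z.of_nat p - Z.of_nat t)%Z) as [D|D].
    + assert (D2 : (Z.of_nat p | Z.of_nat t)%Z).
      { replace (Z.of_nat t) with (6 * Z.of_nat p - (6 * Z.of_nat p - Z.of_nat t))%Z by lia.
        apply Z.divide_sub_r; [apply Z.divide_factor_r|exact D]. }
      destruct D2 as [s Hs].
      assert (Hs6 : (0 <= s < 6)%Z) by nia.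
      assert (Ds : (s = 0 \/ s = 1 \/ s = 2 \/ s = 3 \/ s = 4 \/ s = 5)%Z) by lia.
      destruct Ds as [->|[->|[->|[->|[->| ->]]]]].
      * destruct (Nat.eqb_spec t p), (Nat.eqb_spec t (5 * p)); try lia.
        rewrite theta_term_even; [ring|]. rewrite Hs. reflexivity.
      * assert (t = p) by lia. subst t. rewrite Nat.eqb_refl.
        destruct (Nat.eqb_spec p (5 * p)); [lia|]. ring.
      * destruct (Nat.eqb_spec t p), (Nat.eqb_spec t (5 * p)); try lia.
        rewrite theta_term_even; [ring|]. rewrite Hs, Z.even_mul. reflexivity.
      * destruct (Nat.eqb_spec t p), (Nat.eqb_spec t (5 * p)); try lia.
        unfold theta_term. rewrite Hs, chi12_three. ring.
      * destruct (Nat.eqb_spec t p), (Nat.eqb_spec t (5 * p)); try lia.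
        rewrite theta_term_even; [ring|]. rewrite Hs, Z.even_mul. reflexivity.
      * assert (t = 5 * p)%nat by lia. subst t. rewrite Nat.eqb_refl.
        destruct (Nat.eqb_spec (5 * p) p); [lia|]. ring.
    + destruct (Nat.eqb_spec t p) as [->|N1].
      * elim D. exists 5%Z. lia.
      * destruct (Nat.eqb_spec t (5 * p)) as [->|N2]; [|ring].
        elim D. exists 1%Z. lia.
Qed.

Lemma appell_quasi z u : (0 < Im z)%R -> off_lattice z u ->
  heis z (Z.of_nat p) 0 (fun u => appell u (pc * z)) u = appell u (pc * z) + quasi_defect z u.
Proof.
  intros Hz Hu. assert (N := pc_neq0).
  assert (V := appell_shift_nat 1 u (pc * z) (upper_mul z Hz) (off_lattice_reg_big z u Hu)).
  assert (E : heis z (Z.of_nat p) 0 (fun u => appell u (pc * z)) u = appell_shift (Z.of_nat 1) u (pc * z)).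
  { unfold heis, appell_shift. rewrite Z.add_0_r. replace (Z.of_nat p) with (Z.of_nat p * 1)%Z at 1 by lia.
    rewrite m1pow_pmul. fold pc. change (cz (Z.of_nat 1)) with (RtoC 1). change (cz 0) with (RtoC 0).
    replace (u + pc * z + 0) with (u + 1 * (pc * z)) by ring. f_equal. f_equal. f_equal.
    field. exact N. }
  rewrite E, V. f_equal. unfold quasi_defect. f_equal. simpl bsum. unfold theta_term.
  change (chi12 (Z.of_nat 0)) with 0%R. change (chi12 (Z.of_nat 1)) with 1%R.
  change (chi12 (Z.of_nat 2)) with 0%R. change (chi12 (Z.of_nat 3)) with 0%R.
  change (chi12 (Z.of_nat 4)) with 0%R. change (chi12 (Z.of_nat 5)) with (-1)%R.
  change (cz (Z.of_nat 1)) with (RtoC 1). change (cz (Z.of_nat 5)) with (RtoC 5).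
  replace (- ((1 * 1 - 1) / 24) * (pc * z) - 1 / 2 * u) with (- (1 / 2) * u) by field.
  replace (- ((5 * 5 - 1) / 24) * (pc * z) - 5 / 2 * u) with (- (pc * z) - 5 / 2 * u) by field.
  ring.
Qed.

(** A unit step permutes the torsion points cyclically; the sign picked up by the last
    one is (-1)^p = -1. *)
Lemma torsion_sum_one z u : heis z 0 1 (torsion_sum z) u = torsion_sum z u.
Proof.
  assert (N := pc_neq0).
  unfold heis. change (cz 0) with (RtoC 0). change (cz 1) with (RtoC 1).
  replace (- (3 / 2) * (0 * 0) * z / pc - 3 * 0 * u / pc) with (RtoC 0) by (field; exact N).
  rewrite ce_0. replace (u + 0 * z + 1) with (u + 1) by ring.
  change (m1pow (0 + 1)) with (- (1)).
  assert (Q : torsion_sum z (u + 1) = - torsion_sum z u); [|rewrite Q; ring].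
  set (g := fun j => m1pow (Z.of_nat j) * appell ((u + cz (Z.of_nat j)) / pc) (z / pc)).
  assert (E1 : torsion_sum z (u + 1) = - (1) * bsum p (fun j => g (S j))).
  { unfold torsion_sum, g. rewrite <- bsum_scal. apply bsum_ext. intros j _.
    rewrite m1pow_nat_S, cz_S.
    replace (u + 1 + cz (Z.of_nat j)) with (u + (cz (Z.of_nat j) + 1)) by ring. ring. }
  assert (E2 : g O + bsum p (fun j => g (S j)) = bsum p g + g p)
    by (rewrite <- bsum_S_first; reflexivity).
  assert (E3 : g p = g O).
  { unfold g. fold pc. change (cz (Z.of_nat 0)) with (RtoC 0). change (m1pow (Z.of_nat 0)) with (RtoC 1).
    replace ((u + pc) / pc) with ((u + 0) / pc + 1) by (field; exact N).
    rewrite appell_add_one. unfold m1pow. rewrite p_odd. ring. }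
  rewrite E1. replace (bsum p (fun j => g (S j))) with (bsum p g + g p - g O) by (rewrite <- E2; ring).
  rewrite E3. change (torsion_sum z u) with (bsum p g). ring.
Qed.

Lemma appell_one z u : heis z 0 1 (fun u => appell u (pc * z)) u = appell u (pc * z).
Proof.
  assert (N := pc_neq0).
  unfold heis. change (cz 0) with (RtoC 0). change (cz 1) with (RtoC 1).
  replace (- (3 / 2) * (0 * 0) * z / pc - 3 * 0 * u / pc) with (RtoC 0) by (field; exact N).
  rewrite ce_0. replace (u + 0 * z + 1) with (u + 1) by ring.
  change (m1pow (0 + 1)) with (- (1)). rewrite appell_add_one. ring.
Qed.

Definition heis_inv (z : C) (F : C -> C) (l m : Z) : Prop := forall u, off_lattice z u -> heis z l m F u = F u.

Lemma Inv_comp z F l1 m1 l2 m2 : (Z.of_nat p | l2 * m1)%Z ->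
  heis_inv z F l1 m1 -> heis_inv z F l2 m2 -> heis_inv z F (l1 + l2) (m1 + m2).
Proof.
  intros D H K u Hu. rewrite <- heis_comp by exact D.
  transitivity (heis z l1 m1 F u); [apply heis_ext, K, off_lattice_shift, Hu|apply H, Hu].
Qed.

Lemma heis_00 z F u : heis z 0 0 F u = F u.
Proof.
  unfold heis. change (cz 0) with (RtoC 0). change (m1pow (0 + 0)) with (RtoC 1).
  replace (- (3 / 2) * (0 * 0) * z / pc - 3 * 0 * u / pc) with (RtoC 0) by (field; apply pc_neq0).
  rewrite ce_0. replace (u + 0 * z + 0) with u by ring. ring.
Qed.

Lemma Inv_opp z F l m : (Z.of_nat p | l)%Z -> heis_inv z F l m -> heis_inv z F (- l) (- m).
Proof.
  intros D H u Hu.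
  rewrite <- (heis_ext z (- l) (- m) (heis z l m F) F u).
  - rewrite heis_comp by (apply Z.divide_mul_l, D).
    replace (- l + l)%Z with 0%Z by lia. replace (- m + m)%Z with 0%Z by lia. apply heis_00.
  - apply H, off_lattice_shift, Hu.
Qed.

Lemma heis_lattice_form z l m u : heis z l m (lattice_form z) u =
  eta_quot z * heis z l m (torsion_sum z) u - pc * chip * heis z l m (fun u => appell u (pc * z)) u.
Proof. unfold lattice_form, heis. ring. Qed.

(** The defects of the two constituents cancel for the generators p z and 1; the other
    translations are compositions and inverses. *)
Lemma lattice_form_inv z k m : (0 < Im z)%R -> heis_inv z (lattice_form z) (Z.of_nat p * k) m.
Proof.
  intros Hz.
  assert (A : heis_inv z (lattice_form z) (Z.of_nat p) 0).
  { intros u Hu. rewrite heis_lattice_form, torsion_sum_quasi, appell_quasi by assumption. unfold lattice_form. ring. }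
  assert (B : heis_inv z (lattice_form z) 0 1).
  { intros u Hu. rewrite heis_lattice_form, torsion_sum_one, appell_one. reflexivity. }
  assert (D0 : forall n, (Z.of_nat p | Z.of_nat p * n)%Z) by (intros n; apply Z.divide_factor_l).
  assert (I0 : heis_inv z (lattice_form z) 0 0) by (intros u _; apply heis_00).
  assert (A2 : forall n : nat, heis_inv z (lattice_form z) (Z.of_nat p * Z.of_nat n) 0).
  { induction n as [|n IH].
    - rewrite Z.mul_0_r. exact I0.
    - replace (Z.of_nat p * Z.of_nat (S n))%Z with (Z.of_nat p + Z.of_nat p * Z.of_nat n)%Z by lia.
      apply (Inv_comp z (lattice_form z) (Z.of_nat p) 0 _ 0); [|exact A|exact IH].
      rewrite Z.mul_0_r. apply Z.divide_0_r. }
  assert (B2 : forall n : nat, heis_inv z (lattice_form z) 0 (Z.of_nat n)).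
  { induction n as [|n IH]; [exact I0|].
    replace (Z.of_nat (S n)) with (1 + Z.of_nat n)%Z by lia.
    apply (Inv_comp z (lattice_form z) 0 1 0 (Z.of_nat n)); [apply Z.divide_0_r|exact B|exact IH]. }
  assert (A3 : heis_inv z (lattice_form z) (Z.of_nat p * k) 0).
  { destruct (Z.le_gt_cases 0 k) as [L|L].
    - rewrite <- (Z2Nat.id k L). apply A2.
    - replace (Z.of_nat p * k)%Z with (- (Z.of_nat p * Z.of_nat (Z.to_nat (- k))))%Z by lia.
      apply (Inv_opp z (lattice_form z) _ 0); [apply D0|apply A2]. }
  assert (B3 : heis_inv z (lattice_form z) 0 m).
  { destruct (Z.le_gt_cases 0 m) as [L|L].
    - rewrite <- (Z2Nat.id m L). apply B2.
    - replace m with (- Z.of_nat (Z.to_nat (- m)))%Z by lia.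
      apply (Inv_opp z (lattice_form z) 0); [apply Z.divide_0_r|apply B2]. }
  replace (Z.of_nat p * k)%Z with (Z.of_nat p * k + 0)%Z by lia.
  apply (Inv_comp z (lattice_form z) _ 0 0 m); [apply Z.divide_0_r|exact A3|exact B3].
Qed.

Lemma lattice_indep z a b : (0 < Im z)%R -> cz a * z + cz b = 0 -> a = 0%Z /\ b = 0%Z.
Proof.
  intros H E. destruct z as [x y]. unfold cz, Cmult, Cplus, RtoC in E. simpl in *.
  injection E as E1 E2. assert (Ia : IZR a = 0%R).
  { assert (K : (IZR a * y = 0)%R) by lra. apply Rmult_integral in K. destruct K; [assumption|lra]. }
  rewrite Ia in E1. split; apply eq_IZR; [exact Ia|lra].
Qed.

Lemma chol_div_pc f s : chol f s -> chol (fun w => f w / pc) s.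
Proof. intros H. apply chol_mult; [exact H|apply chol_const]. Qed.

Lemma chol_add_const f c s : chol f s -> chol (fun w => f w + c) s.
Proof. intros H. apply chol_plus; [exact H|apply chol_const]. Qed.

Lemma chol_heis_factor z l m s :
  chol (fun u => m1pow (l + m) * ce (- (3 / 2) * (cz l * cz l) * z / pc - 3 * cz l * u / pc)) s.
Proof.
  apply chol_scal, chol_ce_comp, chol_minus; [apply chol_const|].
  apply chol_div_pc, chol_lin.
Qed.

(** At each lattice point l z + m exactly one summand is singular, the one with
    j = -m modulo p. *)
Lemma pole_torsion_sum z l m : (0 < Im z)%R -> has_pole (heis z l m (torsion_sum z)) 0 (pc * res0).
Proof.
  intros Hz. assert (N := pc_neq0).
  set (P0 := Z.of_nat p) in *. assert (HP : (0 < P0)%Z) by (unfold P0; lia).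
  (* the one index j < p with j = -m modulo p *)
  set (j0 := Z.to_nat ((- m) mod P0)).
  assert (Hj0 : (Z.of_nat j0 = (- m) mod P0)%Z)
    by (unfold j0; apply Z2Nat.id, Z.mod_pos_bound, HP).
  assert (Bj0 := Z.mod_pos_bound (- m) P0 HP).
  assert (Dj : forall j, (j < p)%nat -> (P0 | m + Z.of_nat j)%Z -> j = j0).
  { intros j Hj [q Hq]. apply Nat2Z.inj. rewrite Hj0.
    apply (Z.mod_unique_pos _ _ (- q)); unfold P0 in *; lia. }
  assert (Dj0 : (P0 | m + Z.of_nat j0)%Z).
  { rewrite Hj0. exists (- ((- m) / P0))%Z. assert (Q := Z.div_mod (- m) P0 ltac:(lia)). lia. }
  apply (pole_ext (fun u => bsum p (fun j =>
     (m1pow (l + m) * ce (- (3 / 2) * (cz l * cz l) * z / pc - 3 * cz l * u / pc)) *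
     (m1pow (Z.of_nat j) * appell ((u + cz l * z + cz m + cz (Z.of_nat j)) / pc) (z / pc))))).
  { exists 1%R. split; [lra|]. intros u _ _. unfold heis, torsion_sum. apply bsum_scal. }
  rewrite <- (bsum_delta p j0 (pc * res0)) by (unfold P0 in *; lia).
  apply (pole_bsum p (fun j u =>
     (m1pow (l + m) * ce (- (3 / 2) * (cz l * cz l) * z / pc - 3 * cz l * u / pc)) *
     (m1pow (Z.of_nat j) * appell ((u + cz l * z + cz m + cz (Z.of_nat j)) / pc) (z / pc)))).
  intros j Hj. destruct (Nat.eqb_spec j j0) as [->|Nj].
  - destruct Dj0 as [q Hq].
    assert (Nc : / pc <> 0) by apply Cinv_neq0, N.
    replace (pc * res0) with (res0 / / pc) by (field; exact N).
    apply (pole_ext (fun u => appell_shift l (/ pc * u) (z / pc))).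
    2:{ apply (pole_rescale (fun v => appell_shift l v (z / pc))); [exact Nc|]. apply pole_appell_shift, upper_div, Hz. }
    exists 1%R. split; [lra|]. intros u _ _. unfold appell_shift.
    assert (E : cz m + cz (Z.of_nat j0) = cz q * pc).
    { unfold pc. rewrite <- cz_plus, <- cz_mult. f_equal. exact Hq. }
    replace ((u + cz l * z + cz m + cz (Z.of_nat j0)) / pc) with (/ pc * u + cz l * (z / pc) + cz q).
    2:{ replace (u + cz l * z + cz m + cz (Z.of_nat j0)) with (u + cz l * z + (cz m + cz (Z.of_nat j0))) by ring.
        rewrite E. field. exact N. }
    rewrite appell_add_cz.
    replace (- (3 / 2) * (cz l * cz l) * (z / pc) - 3 * cz l * (/ pc * u))
      with (- (3 / 2) * (cz l * cz l) * z / pc - 3 * cz l * u / pc) by (field; exact N).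
    assert (S : m1pow (l + m) * m1pow (Z.of_nat j0) * m1pow q = m1pow l).
    { rewrite <- !m1pow_plus. replace (l + m + Z.of_nat j0 + q)%Z with (l + (m + Z.of_nat j0) + q)%Z by lia.
      rewrite Hq, !m1pow_plus, Z.mul_comm. unfold P0. rewrite m1pow_pmul.
      replace (m1pow l * m1pow q * m1pow q) with (m1pow l * (m1pow q * m1pow q)) by ring.
      rewrite m1pow_sqr. ring. }
    rewrite <- S. ring.
  - apply pole_chol. apply chol_mult; [apply chol_heis_factor|]. apply chol_scal.
    apply (chol_appell (fun u => (u + cz l * z + cz m + cz (Z.of_nat j)) / pc) (fun _ => z / pc)).
    + apply chol_div_pc. repeat apply chol_add_const. apply chol_id.
    + apply chol_const.
    + apply upper_div, Hz.
    + intros n E. destruct (ce_eq_1 _ E) as [k Hk]. fold (cz k) in Hk. apply Nj. apply Dj; [exact Hj|].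
      assert (Q : cz (l + n) * z + cz (m + Z.of_nat j - P0 * k) = 0).
      { rewrite cz_plus, cz_sub, cz_plus, cz_mult. unfold P0. fold pc.
        replace ((cz l + cz n) * z + (cz m + cz (Z.of_nat j) - pc * cz k))
          with (pc * (((0 + cz l * z + cz m + cz (Z.of_nat j)) / pc + cz n * (z / pc)) - cz k))
          by (field; exact N). rewrite Hk. ring. }
      apply lattice_indep in Q; [|exact Hz]. exists k. lia.
Qed.

(** B(.; pz) has its poles only at the lattice points l z + m with p dividing l. *)
Definition ind_p (l : Z) (v : C) : C :=
  if excluded_middle_informative (Z.of_nat p | l)%Z then v else 0.

Lemma pole_appell_p z l m : (0 < Im z)%R ->
  has_pole (heis z l m (fun u => appell u (pc * z))) 0 (ind_p l res0).
Proof.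
  intros Hz. assert (N := pc_neq0). unfold ind_p.
  destruct (excluded_middle_informative (Z.of_nat p | l)%Z) as [[k Hk]|D].
  - apply (pole_ext (fun u => appell_shift k u (pc * z))).
    2:{ apply pole_appell_shift, upper_mul, Hz. }
    exists 1%R. split; [lra|]. intros u _ _. unfold heis, appell_shift.
    rewrite appell_add_cz, Hk, cz_mult. fold pc.
    replace (u + cz k * pc * z) with (u + cz k * (pc * z)) by ring.
    replace (- (3 / 2) * (cz k * pc * (cz k * pc)) * z / pc - 3 * (cz k * pc) * u / pc)
      with (- (3 / 2) * (cz k * cz k) * (pc * z) - 3 * cz k * u) by (field; exact N).
    assert (S : m1pow (k * Z.of_nat p + m) * m1pow m = m1pow k).
    { rewrite m1pow_plus, Z.mul_comm, m1pow_pmul.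
      replace (m1pow k * m1pow m * m1pow m) with (m1pow k * (m1pow m * m1pow m)) by ring.
      rewrite m1pow_sqr. ring. }
    rewrite <- S. ring.
  - apply pole_chol. apply chol_mult; [apply chol_heis_factor|].
    apply (chol_appell (fun u => u + cz l * z + cz m) (fun _ => pc * z)).
    + repeat apply chol_add_const. apply chol_id.
    + apply chol_const.
    + apply upper_mul, Hz.
    + intros n E. destruct (ce_eq_1 _ E) as [k Hk]. fold (cz k) in Hk. apply D.
      assert (Q : cz (l + n * Z.of_nat p) * z + cz (m - k) = 0).
      { rewrite cz_plus, cz_sub, cz_mult. fold pc.
        replace ((cz l + cz n * pc) * z + (cz m - cz k))
          with ((0 + cz l * z + cz m + cz n * (pc * z)) - cz k) by ring. rewrite Hk. ring. }
      apply lattice_indep in Q; [|exact Hz]. exists (- n)%Z. lia.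
Qed.

Lemma chol_torsion_sum_u z w : (0 < Im z)%R -> off_lattice z w -> chol (torsion_sum z) w.
Proof.
  intros Hz Hw. unfold torsion_sum.
  apply (chol_bsum p (fun j u => m1pow (Z.of_nat j) * appell ((u + cz (Z.of_nat j)) / pc) (z / pc))).
  intros j _. apply chol_scal.
  apply (chol_appell (fun u => (u + cz (Z.of_nat j)) / pc) (fun _ => z / pc)).
  - apply chol_div_pc, chol_add_const, chol_id.
  - apply chol_const.
  - apply upper_div, Hz.
  - apply off_lattice_reg_small, Hw.
Qed.

Lemma chol_lattice_form_u z w : (0 < Im z)%R -> off_lattice z w -> chol (lattice_form z) w.
Proof.
  intros Hz Hw. unfold lattice_form. apply chol_minus; apply chol_scal.
  - apply chol_torsion_sum_u; assumption.
  - apply (chol_appell (fun u => u) (fun _ => pc * z)).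
    + apply chol_id.
    + apply chol_const.
    + apply upper_mul, Hz.
    + apply off_lattice_reg_big, Hw.
Qed.

(** p is prime to 6. *)
Lemma chip_neq0 : chip <> 0.
Proof.
  unfold chip. apply RtoC_neq0. unfold chi12.
  assert (H : (0 <= Z.of_nat p mod 12 < 12)%Z) by (apply Z.mod_pos_bound; lia).
  assert (E := Z.div_mod (Z.of_nat p) 12 ltac:(lia)). assert (O := p_odd). assert (T := p_not3).
  set (r := (Z.of_nat p mod 12)%Z) in *. set (q := (Z.of_nat p / 12)%Z) in *.
  assert (R2 : forall s, (r = 2 * s)%Z -> False).
  { intros s Hs. assert (Ev : Z.even (Z.of_nat p) = true).
    { apply Z.even_spec. exists (6 * q + s)%Z. lia. }
    rewrite Ev in O. discriminate O. }
  assert (R3 : forall s, (r = 3 * s)%Z -> False).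
  { intros s Hs. apply T. exists (4 * q + s)%Z. lia. }
  assert (D : (r = 0 \/ r = 1 \/ r = 2 \/ r = 3 \/ r = 4 \/ r = 5 \/ r = 6 \/ r = 7 \/ r = 8
    \/ r = 9 \/ r = 10 \/ r = 11)%Z) by lia.
  destruct D as [D|[D|[D|[D|[D|[D|[D|[D|[D|[D|[D|D]]]]]]]]]]]; rewrite D; try (simpl; lra); exfalso.
  - apply (R2 0%Z); lia.
  - apply (R2 1%Z); lia.
  - apply (R3 1%Z); lia.
  - apply (R2 2%Z); lia.
  - apply (R2 3%Z); lia.
  - apply (R2 4%Z); lia.
  - apply (R3 3%Z); lia.
  - apply (R2 5%Z); lia.
Qed.

(** The heights of the lattice points; off these lines everything is holomorphic. *)
Definition heights (z : C) (y : R) : Prop := exists l, y = (IZR l * Im z)%R.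

Lemma heights_isolated z : (0 < Im z)%R -> isolated (heights z).
Proof.
  intros Hz y. set (Y := Im z) in *.
  assert (A := archimed (y / Y)). set (n := up (y / Y)) in *.
  assert (B : (IZR n - 1 <= y / Y < IZR n)%R) by lra.
  assert (E : (y / Y * Y = y)%R) by (field; lra).
  assert (Hgap : forall l d, (0 < Rabs (IZR l * Y - y))%R -> (Rabs (IZR l * Y - y) < d)%R ->
     (d <= IZR n * Y - y)%R -> (IZR n - 1 < y / Y -> d <= y - (IZR n - 1) * Y)%R ->
     (d <= Y)%R -> False).
  { intros l d P1 P2 D1 D2 D3. destruct (Rabs_def2 _ _ P2) as [Q1 Q2].
    destruct (Z_le_gt_dec n l) as [L|L].
    - apply IZR_le in L. assert (IZR n * Y <= IZR l * Y)%R by (apply Rmult_le_compat_r; lra). lra.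
    - assert (L2 : (l <= n - 1)%Z) by lia. apply IZR_le in L2. rewrite minus_IZR in L2.
      destruct (Req_dec (IZR n - 1) (y / Y)) as [F|F].
      + assert (Ey : y = ((IZR n - 1) * Y)%R) by (rewrite F; lra).
        destruct (Z.eq_dec l (n - 1)) as [->|Nl].
        * rewrite minus_IZR, Ey in P1. rewrite Rminus_diag, Rabs_R0 in P1. lra.
        * assert (L3 : (l <= n - 2)%Z) by lia. apply IZR_le in L3. rewrite minus_IZR in L3.
          assert (IZR l * Y <= (IZR n - 2) * Y)%R by (apply Rmult_le_compat_r; lra). lra.
      + specialize (D2 ltac:(lra)).
        assert (IZR l * Y <= (IZR n - 1) * Y)%R by (apply Rmult_le_compat_r; lra). lra. }
  assert (G1 : (0 < IZR n * Y - y)%R).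
  { rewrite <- E. assert (y / Y * Y < IZR n * Y)%R by (apply Rmult_lt_compat_r; lra). lra. }
  destruct (Req_dec (IZR n - 1) (y / Y)) as [F|F].
  - exists (Rmin Y (IZR n * Y - y)). split; [apply Rmin_glb_lt; assumption|].
    intros v [P1 P2] [l ->]. apply (Hgap l _ P1 P2); [apply Rmin_r|lra|apply Rmin_l].
  - assert (G2 : (0 < y - (IZR n - 1) * Y)%R).
    { rewrite <- E. assert ((IZR n - 1) * Y < y / Y * Y)%R by (apply Rmult_lt_compat_r; lra). lra. }
    exists (Rmin Y (Rmin (IZR n * Y - y) (y - (IZR n - 1) * Y))).
    split; [repeat apply Rmin_glb_lt; assumption|].
    intros v [P1 P2] [l ->]. apply (Hgap l _ P1 P2).
    + eapply Rle_trans; [apply Rmin_r|apply Rmin_l].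
    + intros _. eapply Rle_trans; [apply Rmin_r|apply Rmin_r].
    + apply Rmin_l.
Qed.

Lemma heights_off_lattice z w : ~ heights z (Im w) -> off_lattice z w.
Proof.
  intros H l m E. apply H. exists l. rewrite E. unfold cz. destruct z. simpl. ring.
Qed.

Lemma heights_shift z u l : ~ heights z (Im u) -> ~ heights z (Im (u + cz l * z)).
Proof.
  intros H [k Hk]. apply H. exists (k - l)%Z. rewrite minus_IZR.
  unfold cz in Hk. destruct u, z. simpl in *. lra.
Qed.

(** * Behaviour under the principal congruence subgroup *)

Section Transform.
Variables (z : C) (a b c d : Z).
Hypothesis Hz : (0 < Im z)%R.
Hypothesis det : (a * d - b * c = 1)%Z.
Hypothesis p_b : (Z.of_nat p | b)%Z.
Hypothesis p_c : (Z.of_nat p | c)%Z.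

(** The factor of automorphy. *)
Definition autj : C := cz c * z + cz d.
Definition mob : C := (cz a * z + cz b) / autj.

Lemma autj_neq0 : autj <> 0.
Proof. intros E. apply lattice_indep in E; [|exact Hz]. lia. Qed.

Lemma det_cz : cz a * cz d = 1 + cz b * cz c.
Proof. rewrite <- !cz_mult. change (RtoC 1) with (cz 1). rewrite <- cz_plus. f_equal. lia. Qed.

Lemma Im_mob : Im mob = (Im z / Cmod autj ^ 2)%R.
Proof.
  assert (N := autj_neq0). assert (P := proj1 (Cmod_gt_0 _) N).
  assert (D : (IZR a * IZR d - IZR b * IZR c = 1)%R).
  { rewrite <- !mult_IZR, <- minus_IZR, det. reflexivity. }
  assert (Q : (0 < Cmod autj ^ 2)%R) by (apply pow_lt, P).
  rewrite Cmod2_alt in *. unfold mob, Cdiv, Cinv, autj, cz in *. simpl in *.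
  set (x := fst z) in *. set (y := snd z) in *.
  transitivity (y * (IZR a * IZR d - IZR b * IZR c) /
    ((IZR c * x - 0 * y + IZR d) * ((IZR c * x - 0 * y + IZR d) * 1) +
      (IZR c * y + 0 * x + 0) * ((IZR c * y + 0 * x + 0) * 1)))%R.
  - field. lra.
  - rewrite D. unfold Im. fold y. f_equal. ring.
Qed.

Lemma mob_upper : (0 < Im mob)%R.
Proof.
  rewrite Im_mob. apply Rdiv_lt_0_compat; [exact Hz|]. apply pow_lt, Cmod_gt_0, autj_neq0.
Qed.

(** The action of the matrix on functions of u as Jacobi forms of weight 1 and index
    -3/2 / p. *)
Definition jacobi_slash (F : C -> C) (u : C) : C :=
  / autj * ce (3 / 2 * cz c * (u * u) / (pc * autj)) * F (u / autj).

(** The signs and the exponentials of both sides of [intertwine] differ by e of half of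
    this number. Since p is odd it is congruent to (a+1)(b+1) l + (c+1)(d+1) m modulo 2,
    and a d - b c = 1 prevents a, b as well as c, d from being both even. *)
Lemma parity_term b1 c1 l m : b = (b1 * Z.of_nat p)%Z -> c = (c1 * Z.of_nat p)%Z ->
  Z.even (a * l + c * m + (b * l + d * m) - l - m
    + 3 * (a * b1 * l * l + 2 * b1 * c * l * m + c1 * d * m * m)) = true.
Proof.
  intros Hb Hc. assert (O := p_odd).
  assert (Eb : Z.even b = Z.even b1) by (rewrite Hb, Z.even_mul, O; destruct (Z.even b1); reflexivity).
  assert (Ec : Z.even c = Z.even c1) by (rewrite Hc, Z.even_mul, O; destruct (Z.even c1); reflexivity).
  assert (Ed : Z.even (a * d - b * c) = false) by (rewrite det; reflexivity).
  rewrite Z.even_sub, !Z.even_mul in Ed.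
  repeat rewrite ?Z.even_sub, ?Z.even_add, ?Z.even_mul. rewrite Eb, Ec.
  rewrite Eb, Ec in Ed.
  destruct (Z.even a), (Z.even b1), (Z.even c1), (Z.even d), (Z.even l), (Z.even m);
    simpl in *; congruence.
Qed.

(** The Jacobi action normalises the Heisenberg group: it carries the translation by a
    lattice vector into the translation by its image under the matrix. *)
Lemma intertwine F l m u :
  heis z (a * l + c * m) (b * l + d * m) (jacobi_slash F) u = jacobi_slash (heis mob l m F) u.
Proof.
  destruct p_b as [b1 Hb]. destruct p_c as [c1 Hc].
  assert (N := pc_neq0). assert (NJ := autj_neq0).
  assert (Ev := parity_term b1 c1 l m Hb Hc). apply Z.even_spec in Ev. destruct Ev as [h Hh].
  unfold heis, jacobi_slash.
  set (lam := cz (a * l + c * m) * z + cz (b * l + d * m)).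
  assert (El : lam = cz l * (cz a * z + cz b) + cz m * autj).
  { unfold lam, autj. rewrite !cz_plus, !cz_mult. ring. }
  replace (u + cz (a * l + c * m) * z + cz (b * l + d * m)) with (u + lam) by (unfold lam; ring).
  assert (Ea : (u + lam) / autj = u / autj + cz l * mob + cz m).
  { rewrite El. unfold mob. field. exact NJ. }
  rewrite Ea.
  cut (m1pow (a * l + c * m + (b * l + d * m)) *
     ce (- (3 / 2) * (cz (a * l + c * m) * cz (a * l + c * m)) * z / pc - 3 * cz (a * l + c * m) * u / pc)
     * ce (3 / 2 * cz c * ((u + lam) * (u + lam)) / (pc * autj)) =
     ce (3 / 2 * cz c * (u * u) / (pc * autj)) *
     (m1pow (l + m) * ce (- (3 / 2) * (cz l * cz l) * mob / pc - 3 * cz l * (u / autj) / pc))).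
  { intros Q.
    transitivity (/ autj * (m1pow (a * l + c * m + (b * l + d * m)) *
     ce (- (3 / 2) * (cz (a * l + c * m) * cz (a * l + c * m)) * z / pc - 3 * cz (a * l + c * m) * u / pc)
     * ce (3 / 2 * cz c * ((u + lam) * (u + lam)) / (pc * autj))) * F (u / autj + cz l * mob + cz m)); [ring|].
    rewrite Q. ring. }
  rewrite !m1pow_ce, <- !ce_plus.
  rewrite <- (ce_add_cz (3 / 2 * cz c * (u * u) / (pc * autj) + _) h). f_equal.
  apply (f_equal cz) in Hh.
  repeat rewrite ?cz_sub, ?cz_plus, ?cz_mult in Hh.
  change (cz 2) with (RtoC 2) in Hh. change (cz 3) with (RtoC 3) in Hh.
  assert (Eb : cz b = cz b1 * pc) by (rewrite Hb, cz_mult; reflexivity).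
  assert (Ec : cz c = cz c1 * pc) by (rewrite Hc, cz_mult; reflexivity).
  assert (Eh : cz h = (cz a * cz l + cz c * cz m + (cz b * cz l + cz d * cz m) - cz l - cz m +
      3 * (cz a * cz b1 * cz l * cz l + 2 * cz b1 * cz c * cz l * cz m + cz c1 * cz d * cz m * cz m)) / 2)
    by (rewrite Hh; field).
  rewrite Eh, El. unfold mob. rewrite !cz_plus, !cz_mult.
  assert (D := det_cz).
  assert (Jz : autj = cz c * z + cz d) by reflexivity.
  unfold autj in *. rewrite Eb, Ec in *.
  generalize dependent pc. intros P0. intros.
  clear Hb Hc Hh Eh Jz El Ea Eb Ec lam.
  generalize dependent (cz a). generalize dependent (cz d). generalize dependent (cz b1).
  generalize dependent (cz c1). generalize (cz l) (cz m).
  intros l0 m0 c0 b0 d0 NJ a0 D.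
  field [D]. split; assumption.
Qed.

Lemma off_lattice_mob u : off_lattice z u -> off_lattice mob (u / autj).
Proof.
  intros H l m E. apply (H (a * l + c * m)%Z (b * l + d * m)%Z).
  replace u with (u / autj * autj) by (field; apply autj_neq0). rewrite E.
  unfold mob. rewrite !cz_plus, !cz_mult. unfold autj. field. apply autj_neq0.
Qed.

Lemma lattice_coords l m : (a * (d * l - c * m) + c * (- b * l + a * m) = l)%Z /\
  (b * (d * l - c * m) + d * (- b * l + a * m) = m)%Z.
Proof.
  split.
  - replace (a * (d * l - c * m) + c * (- b * l + a * m))%Z with ((a * d - b * c) * l)%Z by ring.
    rewrite det. ring.
  - replace (b * (d * l - c * m) + d * (- b * l + a * m))%Z with ((a * d - b * c) * m)%Z by ring.
    rewrite det. ring.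
Qed.

Lemma intertwine' F l m u :
  heis z l m (jacobi_slash F) u = jacobi_slash (heis mob (d * l - c * m) (- b * l + a * m) F) u.
Proof.
  rewrite <- intertwine. destruct (lattice_coords l m) as [E1 E2]. rewrite E1, E2. reflexivity.
Qed.

Lemma jacobi_slash_ext F G u : F (u / autj) = G (u / autj) -> jacobi_slash F u = jacobi_slash G u.
Proof. intros H. unfold jacobi_slash. rewrite H. reflexivity. Qed.

Lemma jacobi_slash_inv k m : heis_inv z (jacobi_slash (lattice_form mob)) (Z.of_nat p * k) m.
Proof.
  intros u Hu. rewrite intertwine'. apply jacobi_slash_ext.
  destruct p_c as [c1 Hc].
  replace (d * (Z.of_nat p * k) - c * m)%Z with (Z.of_nat p * (d * k - c1 * m))%Z
    by (rewrite Hc; ring).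
  apply lattice_form_inv; [apply mob_upper|apply off_lattice_mob, Hu].
Qed.

Lemma chol_jacobi_slash_factor s : chol (fun u => / autj * ce (3 / 2 * cz c * (u * u) / (pc * autj))) s.
Proof.
  apply chol_scal, chol_ce_comp. apply chol_mult; [|apply chol_const].
  apply chol_scal, chol_mult; apply chol_id.
Qed.

Lemma pole_jacobi_slash F rho : has_pole F 0 rho -> has_pole (jacobi_slash F) 0 rho.
Proof.
  intros H. assert (NJ := autj_neq0). assert (Nc : / autj <> 0) by apply Cinv_neq0, NJ.
  destruct (chol_here _ _ (chol_jacobi_slash_factor 0)) as [l Hl].
  assert (P := pole_mult _ _ _ _ _ (pole_rescale F (/ autj) rho Nc H) Hl).
  cbv beta in P.
  replace (/ autj * ce (3 / 2 * cz c * (0 * 0) / (pc * autj)) * (rho / / autj)) with rho in P.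
  - refine (pole_ext _ _ _ _ _ P). exists 1%R. split; [lra|]. intros u _ _. unfold jacobi_slash.
    replace (/ autj * u) with (u / autj) by (unfold Cdiv; ring). reflexivity.
  - replace (3 / 2 * cz c * (0 * 0) / (pc * autj)) with (RtoC 0)
      by (field; split; [exact NJ|apply pc_neq0]).
    rewrite ce_0. field. exact NJ.
Qed.

(** p divides c and is prime to d, so it divides d l - c m exactly when it divides l. *)
Lemma ind_p_coords l m : ind_p (d * l - c * m) res0 = ind_p l res0.
Proof.
  unfold ind_p.
  destruct (excluded_middle_informative (Z.of_nat p | d * l - c * m)%Z) as [D|D],
           (excluded_middle_informative (Z.of_nat p | l)%Z) as [E|E]; try reflexivity; exfalso.
  - apply E. destruct (lattice_coords l m) as [H _]. rewrite <- H.
    apply Z.divide_add_r; [apply Z.divide_mul_r, D|apply Z.divide_mul_l, p_c].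
  - apply D. apply Z.divide_sub_r; [apply Z.divide_mul_r, E|apply Z.divide_mul_l, p_c].
Qed.

Let delta : C := eta_quot mob - eta_quot z.
(** The difference between the transformed and the original function, corrected so that
    the residues cancel. *)
Let jump (u : C) : C := jacobi_slash (lattice_form mob) u - lattice_form z u - delta * torsion_sum z u.

Lemma heis_jump l m u : heis z l m jump u =
  jacobi_slash (heis mob (d * l - c * m) (- b * l + a * m) (lattice_form mob)) u + - (1) * heis z l m (lattice_form z) u
    + - delta * heis z l m (torsion_sum z) u.
Proof. rewrite <- intertwine'. unfold jump, heis. ring. Qed.

Lemma pole_heis_lattice_form w l m : (0 < Im w)%R ->
  has_pole (heis w l m (lattice_form w)) 0 (eta_quot w * (pc * res0) + - (pc * chip) * ind_p l res0).
Proof.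
  intros Hw. apply (pole_ext (fun u => eta_quot w * heis w l m (torsion_sum w) u
     + - (pc * chip) * heis w l m (fun u => appell u (pc * w)) u)).
  - exists 1%R. split; [lra|]. intros u _ _. rewrite heis_lattice_form. ring.
  - apply (pole_plus (fun u => eta_quot w * heis w l m (torsion_sum w) u)); apply pole_scal;
      [apply pole_torsion_sum, Hw|apply pole_appell_p, Hw].
Qed.

(** The residues at a lattice point are r(gamma z) p - p chi12(p) [p | l] and
    r(z) p - p chi12(p) [p | l], up to a common factor; the correction by G removes the
    difference. *)
Lemma pole_heis_jump l m : has_pole (heis z l m jump) 0 0.
Proof.
  replace (RtoC 0) with
    ((eta_quot mob * (pc * res0) + - (pc * chip) * ind_p (d * l - c * m) res0) +
     - (1) * (eta_quot z * (pc * res0) + - (pc * chip) * ind_p l res0) + - delta * (pc * res0)) at 2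
    by (rewrite ind_p_coords; unfold delta; ring).
  apply (pole_ext (fun u => jacobi_slash (heis mob (d * l - c * m) (- b * l + a * m) (lattice_form mob)) u +
      - (1) * heis z l m (lattice_form z) u + - delta * heis z l m (torsion_sum z) u)).
  { exists 1%R. split; [lra|]. intros u _ _. symmetry. apply heis_jump. }
  apply (pole_plus (fun u => jacobi_slash (heis mob (d * l - c * m) (- b * l + a * m) (lattice_form mob)) u +
      - (1) * heis z l m (lattice_form z) u)).
  - apply (pole_plus (jacobi_slash (heis mob (d * l - c * m) (- b * l + a * m) (lattice_form mob)))).
    + apply pole_jacobi_slash, pole_heis_lattice_form, mob_upper.
    + apply pole_scal, pole_heis_lattice_form, Hz.
  - apply pole_scal, pole_torsion_sum, Hz.
Qed.

Lemma chol_jump w : off_lattice z w -> chol jump w.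
Proof.
  intros Hw. unfold jump. apply chol_minus; [apply chol_minus|].
  - unfold jacobi_slash. apply chol_mult; [apply chol_jacobi_slash_factor|].
    apply (chol_comp (lattice_form mob) (fun u => u / autj)).
    + apply chol_lattice_form_u; [apply mob_upper|apply off_lattice_mob, Hw].
    + apply chol_mult; [apply chol_id|apply chol_const].
  - apply chol_lattice_form_u; assumption.
  - apply chol_scal, chol_torsion_sum_u; assumption.
Qed.

Lemma pole_translate F s rho : has_pole F 0 rho -> has_pole (fun w => F (w - s)) s rho.
Proof.
  intros [f [k [A [B [e [He D]]]]]]. exists (fun w => f (w - s)), (1 * k). split; [|split].
  - apply (cderiv_comp f (fun w => w - s)).
    + replace (s - s) with (RtoC 0) by ring. exact A.
    + eapply cderiv_ext; [|apply (cderiv_affine 1 (- s))]. exists 1%R. split; [lra|]. intros w _. ring.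
  - replace (s - s) with (RtoC 0) by ring. exact B.
  - exists e. split; [exact He|]. intros w Hw N.
    rewrite D.
    + f_equal. ring.
    + replace (w - s - 0) with (w - s) by ring. exact Hw.
    + apply Cminus_eq_contra, N.
Qed.

Lemma jump_has_lim w : has_lim jump w.
Proof.
  destruct (classic (off_lattice z w)) as [Hw|Hw].
  - apply has_lim_ccont, chol_cont, chol_jump, Hw.
  - assert (E : exists l m, w = cz l * z + cz m).
    { apply NNPP. intros K. apply Hw. intros l m E. apply K. exists l, m. exact E. }
    destruct E as [l [m E]]. apply pole_removable.
    set (fac := fun u => m1pow (l + m) * ce (- (3 / 2) * (cz l * cz l) * z / pc - 3 * cz l * u / pc)).
    assert (Nf : forall u, fac u <> 0).
    { intros u. apply Cmult_neq_0; [|apply ce_neq0]. apply Cmod_gt_0. rewrite Cmod_m1pow. lra. }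
    assert (CF : chol (fun u => / fac u) 0).
    { apply chol_inv; [apply chol_heis_factor|apply Nf]. }
    destruct (chol_here _ _ CF) as [k Hk].
    assert (P := pole_mult _ _ _ _ _ (pole_heis_jump l m) Hk).
    cbv beta in P. assert (Z0 : / fac 0 * 0 = 0) by ring. rewrite Z0 in P.
    apply (pole_translate _ w) in P. refine (pole_ext _ _ _ _ _ P).
    exists 1%R. split; [lra|]. intros x _ _. unfold heis. fold (fac (x - w)).
    replace (x - w + cz l * z + cz m) with x by (rewrite E; ring).
    field. apply Nf.
Qed.

Lemma jump_one w : off_lattice z w -> jump (w + 1) = - jump w.
Proof.
  intros Hw.
  assert (E : heis z 0 1 jump w = jump w).
  { assert (Q := jacobi_slash_inv 0 1 w Hw). rewrite Z.mul_0_r in Q.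
    assert (Q2 := lattice_form_inv z 0 1 Hz w Hw). rewrite Z.mul_0_r in Q2.
    rewrite heis_jump, <- intertwine', Q, Q2, torsion_sum_one. unfold jump. ring. }
  unfold heis in E. change (cz 0) with (RtoC 0) in E. change (cz 1) with (RtoC 1) in E.
  replace (- (3 / 2) * (0 * 0) * z / pc - 3 * 0 * w / pc) with (RtoC 0) in E by (field; apply pc_neq0).
  rewrite ce_0 in E. replace (w + 0 * z + 1) with (w + 1) in E by ring.
  change (m1pow (0 + 1)) with (- (1)) in E. rewrite <- E. ring.
Qed.

(** E and its transform are invariant, so the only failure of quasi-periodicity comes
    from the multiple of G. *)
Lemma jump_tau w : off_lattice z w ->
  jump (w + pc * z) = - ce (3 / 2 * (pc * z) + 3 * w) * (jump w - delta * pc * chip / eta_quot z * quasi_defect z w).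
Proof.
  intros Hw. assert (N := pc_neq0). assert (NR := eta_quot_neq0 z Hz).
  assert (E : heis z (Z.of_nat p) 0 jump w = jump w - delta * pc * chip / eta_quot z * quasi_defect z w).
  { assert (Q := jacobi_slash_inv 1 0 w Hw). rewrite Z.mul_1_r in Q.
    assert (Q2 := lattice_form_inv z 1 0 Hz w Hw). rewrite Z.mul_1_r in Q2.
    assert (Q3 : heis z (Z.of_nat p) 0 (torsion_sum z) w = torsion_sum z w + pc * chip / eta_quot z * quasi_defect z w).
    { assert (G := torsion_sum_quasi z w Hz Hw).
      replace (heis z (Z.of_nat p) 0 (torsion_sum z) w) with (eta_quot z * heis z (Z.of_nat p) 0 (torsion_sum z) w / eta_quot z)
        by (field; exact NR).
      rewrite G. field. exact NR. }
    rewrite heis_jump, <- intertwine', Q, Q2, Q3. unfold jump. field. exact NR. }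
  rewrite <- E. unfold heis. rewrite Z.add_0_r. fold pc. change (cz 0) with (RtoC 0).
  assert (M : m1pow (Z.of_nat p) = - (1)) by (unfold m1pow; rewrite p_odd; reflexivity).
  rewrite M. replace (w + pc * z + 0) with (w + pc * z) by ring.
  replace (- (3 / 2) * (pc * pc) * z / pc - 3 * pc * w / pc) with (- (3 / 2 * (pc * z) + 3 * w))
    by (field; exact N).
  rewrite ce_opp. field. apply ce_neq0.
Qed.

(** Apply the vanishing theorem to the continuous extension of the jump, multiplied by
    e(-u/2) to become periodic instead of antiperiodic. *)
Theorem lattice_form_transform : eta_quot mob = eta_quot z /\
  forall w, ~ heights z (Im w) -> lattice_form z w = jacobi_slash (lattice_form mob) w.
Proof.
  assert (N := pc_neq0). assert (NR := eta_quot_neq0 z Hz).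
  set (k := - (delta * pc * chip / eta_quot z * euler (pc * z))).
  (* k is the inhomogeneous constant, a nonzero multiple of r(gamma z) - r(z) *)
  set (F := fun w => fill jump w * ce (- (1 / 2) * w)).
  assert (Fh : forall w, ~ heights z (Im w) -> fill jump w = jump w).
  { intros w Hw. apply fill_eq, chol_cont, chol_jump, heights_off_lattice, Hw. }
  assert (near : forall w, ~ heights z (Im w) -> cnear w (fun v => ~ heights z (Im v))).
  { intros w Hw. destruct (isolated_ball _ _ (heights_isolated z Hz) Hw) as [e [He K]].
    refine (cnear_imp _ _ _ _ (cnear_Im_close (fun v => v) w e (chol_cont _ _ (chol_id w)) He)).
    intros v Hv. apply K, Hv. }
  destruct (liouville (heights z) F (pc * z) k (heights_isolated z Hz) (upper_mul z Hz)) as [K0 F0].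
  - intros w. unfold F. apply ccont_mult; [apply fill_ccont, jump_has_lim|].
    apply chol_cont, chol_ce_comp, chol_lin.
  - intros w Hw. unfold F. apply chol_mult; [|apply chol_ce_comp, chol_lin].
    apply (chol_ext jump); [|apply chol_jump, heights_off_lattice, Hw].
    refine (cnear_imp _ _ _ _ (near w Hw)). intros v Hv. symmetry. apply Fh, Hv.
  - intros w Hw. unfold F.
    assert (Hw1 : ~ heights z (Im (w + 1))).
    { replace (Im (w + 1)) with (Im w) by (destruct w; simpl; ring). exact Hw. }
    rewrite !Fh, jump_one by (try apply heights_off_lattice; assumption).
    replace (- (1 / 2) * (w + 1)) with (- (1 / 2) * w + - RtoC (1 / 2))
      by (rewrite RtoC_div by lra; field).
    rewrite ce_plus, ce_opp, ce_half. field.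
  - intros w Hw. unfold F.
    assert (Hw1 : ~ heights z (Im (w + pc * z))) by (apply heights_shift, Hw).
    rewrite !Fh, jump_tau by (try apply heights_off_lattice; assumption).
    unfold quasi_defect, k.
    set (x := ce (- (1 / 2) * w)). set (y := ce (- (1 / 2) * (pc * z))).
    assert (Nx : x <> 0) by apply ce_neq0. assert (Ny : y <> 0) by apply ce_neq0.
    assert (E1 : ce (- (1 / 2) * (w + pc * z)) = x * y)
      by (unfold x, y; rewrite <- ce_plus; f_equal; ring).
    assert (E2 : ce (3 / 2 * (pc * z) + 3 * w) = ce (pc * z) * ce (3 * w) / y).
    { unfold y, Cdiv. rewrite <- ce_opp, <- !ce_plus. f_equal. field. }
    assert (E3 : ce (- (pc * z) - 5 / 2 * w) = x / (ce (pc * z) * ce (2 * w))).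
    { unfold x, Cdiv. rewrite <- ce_plus, <- ce_opp, <- !ce_plus. f_equal. field. }
    assert (E4 : ce (pc * z + 2 * w) = ce (pc * z) * ce (2 * w)) by apply ce_plus.
    assert (E5 : ce (3 * w) = ce (2 * w) / (x * x)).
    { unfold x, Cdiv. rewrite <- ce_plus, <- ce_opp, <- !ce_plus. f_equal. field. }
    rewrite E1, E2, E3, E4, E5. field.
    repeat split; try assumption; apply ce_neq0.
  - assert (D0 : delta = 0).
    { assert (NP := euler_neq0 (pc * z) (upper_mul z Hz)). assert (NC := chip_neq0).
      replace delta with (- k * eta_quot z / (pc * chip * euler (pc * z))).
      - rewrite K0. field. repeat split; assumption.
      - unfold k. field. repeat split; assumption. }
    split.
    + unfold delta in D0. apply Ceq_minus. exact D0.
    + intros w Hw. assert (Z0 := F0 w Hw). unfold F in Z0. rewrite Fh in Z0 by exact Hw.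
      assert (H0 : jump w = 0).
      { replace (jump w) with (jump w * ce (- (1 / 2) * w) / ce (- (1 / 2) * w)) by (field; apply ce_neq0).
        rewrite Z0. field. apply ce_neq0. }
      unfold jump in H0. rewrite D0 in H0. symmetry. apply Ceq_minus.
      rewrite <- H0. ring.
Qed.
End Transform.

(** * The functions N and M as Appell functions *)

Definition zeta_p : C := ce (/ pc).

Lemma pc_INR : pc = RtoC (INR p).
Proof. unfold pc. symmetry. apply RtoC_INR. Qed.

Lemma ce_real x : ce (RtoC x) = RtoC (cos (2 * PI * x)) + Ci * RtoC (sin (2 * PI * x)).
Proof.
  unfold ce, Cexp, Re, Im; simpl.
  replace (((2 * PI) * 0 - 0 * 1) * x - (2 * PI * 1 + 0 * 0) * 0)%R with 0%R by ring.
  replace (((2 * PI) * 0 - 0 * 1) * 0 + (2 * PI * 1 + 0 * 0) * x)%R with (2 * PI * x)%R by ring.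
  rewrite exp_0. unfold Cplus, Cmult, Ci, RtoC; simpl. f_equal; ring.
Qed.

Lemma ce_real_neg x : ce (- RtoC x) = RtoC (cos (2 * PI * x)) - Ci * RtoC (sin (2 * PI * x)).
Proof.
  rewrite <- RtoC_opp, ce_real.
  replace (2 * PI * - x)%R with (- (2 * PI * x))%R by ring.
  rewrite cos_neg, sin_neg, RtoC_opp. ring.
Qed.

Lemma inv_pc_R : / pc = RtoC (/ INR p).
Proof. rewrite pc_INR. symmetry. apply RtoC_inv. assert (X := p_pos). lra. Qed.

(** By this the denominators of N factor. *)
Lemma two_cos : RtoC (2 * cos (2 * PI / INR p)) = zeta_p + / zeta_p.
Proof.
  unfold zeta_p. rewrite <- ce_opp, inv_pc_R, ce_real, ce_real_neg, RtoC_mult.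
  replace (2 * PI / INR p)%R with (2 * PI * / INR p)%R by reflexivity. ring.
Qed.

Lemma two_i_sin : - (2 * Ci * RtoC (sin (PI / INR p))) = ce (- (/ pc / 2)) - ce (/ pc / 2).
Proof.
  replace (/ pc / 2) with (RtoC (/ INR p / 2)) by (rewrite inv_pc_R, RtoC_div by lra; reflexivity).
  rewrite ce_real, ce_real_neg.
  replace (2 * PI * (/ INR p / 2))%R with (PI / INR p)%R by (assert (X := p_pos); field; lra).
  ring.
Qed.

Lemma sin_p_neq0 : sin (PI / INR p) <> 0%R.
Proof.
  assert (X := p_pos). assert (P := PI_RGT_0). apply Rgt_not_eq. apply sin_gt_0.
  - apply Rdiv_lt_0_compat; lra.
  - apply Rmult_lt_reg_r with (INR p); [exact X|]. replace (PI / INR p * INR p)%R with PI by (field; lra).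
    assert (1 < INR p)%R by (apply (lt_INR 1); lia). nra.
Qed.

Lemma reg_inv_pc z : (0 < Im z)%R -> reg (/ pc) (z / pc).
Proof.
  intros Hz n E. assert (N := pc_neq0). destruct (ce_eq_1 _ E) as [k Hk]. fold (cz k) in Hk.
  assert (Q : cz n * z + cz (1 - Z.of_nat p * k) = 0).
  { rewrite cz_sub, cz_mult. fold pc. change (cz 1) with (RtoC 1).
    replace (cz n * z + (1 - pc * cz k)) with (pc * ((/ pc + cz n * (z / pc)) - cz k)) by (field; exact N).
    rewrite Hk. ring. }
  apply lattice_indep in Q; [|exact Hz].
  assert (D : (Z.of_nat p | 1)%Z) by (exists k; lia). apply Z.divide_pos_le in D; lia.
Qed.

(** The denominator factors as (1 - zeta q^n)(1 - q^n / zeta); its partial fractions are the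
    terms n and -n of the Appell series at u = 1/p. The term n = 0 is the summand 1. *)
Lemma Nfun_appell w : (0 < Im w)%R -> reg (/ pc) w ->
  Nfun p w = - (2 * Ci) * (ce (- (w / 24)) / euler w) * appell (/ pc) w.
Proof.
  intros Hw Hr. unfold Nfun. cbv zeta.
  destruct (bterm_zsum (/ pc) w Hw) as [s [s1 [s2 [H1 [H2 E]]]]].
  assert (B0 : appell (/ pc) w = ce (/ pc / 2) * (s1 + s2)).
  { unfold appell. f_equal. unfold CseriesZ. rewrite (Cseries_unique _ _ H1), (Cseries_unique _ _ H2). reflexivity. }
  assert (Z0 : bterm (/ pc) w 0 = / (1 - zeta_p)).
  { unfold bterm, pent. change (cz 0) with (RtoC 0).
    replace (0 * (3 * 0 + 1) / 2 * w) with (RtoC 0) by field.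
    replace (/ pc + 0 * w) with (/ pc) by ring. rewrite ce_0. unfold m1pow, Cdiv, zeta_p. simpl. ring. }
  assert (Nz : 1 - zeta_p <> 0).
  { apply one_minus_neq0. specialize (Hr 0%Z). change (cz 0) with (RtoC 0) in Hr.
    replace (/ pc + 0 * w) with (/ pc) in Hr by ring. exact Hr. }
  assert (Nz0 : zeta_p <> 0) by apply ce_neq0.
  assert (HS := cseries_plus _ _ _ _ (cseries_incr _ _ H1) H2). cbv beta in HS.
  change (Z.of_nat 0) with 0%Z in HS. rewrite Z0 in HS.
  apply (cseries_scal (1 - zeta_p)) in HS.
  match goal with |- context [Cseries ?a] => set (ser := a) end.
  assert (SE : Cseries ser = (1 - zeta_p) * (s1 - / (1 - zeta_p) + s2)).
  { apply Cseries_unique. eapply cseries_ext; [|exact HS]. intros n. cbv beta. unfold ser.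
    rewrite RtoC_minus, two_cos, !qpow_ce.
    assert (En : RtoC (INR (S n)) = cz (Z.of_nat (S n))) by apply RtoC_INR.
    set (k := Z.of_nat (S n)) in *. unfold bterm. rewrite m1pow_opp, cz_opp.
    replace (RtoC (2 * INR (S n)) * w) with (cz k * w + cz k * w)
      by (rewrite RtoC_mult, En; ring).
    replace (RtoC (1 / 2 * INR (S n) * (3 * INR (S n) + 1)) * w) with (pent k * w).
    2:{ rewrite !RtoC_mult, RtoC_plus, RtoC_mult, En, RtoC_div by lra. unfold pent. field. }
    rewrite En, !ce_plus. fold zeta_p.
    replace (- cz k * w) with (- (cz k * w)) by ring.
    replace (ce (pent (- k) * w)) with (ce (pent k * w) * ce (- (cz k * w))).
    2:{ rewrite <- ce_plus. f_equal. unfold pent. rewrite cz_opp. field. }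
    rewrite ce_opp.
    assert (Nq := ce_neq0 (cz k * w)). set (q := ce (cz k * w)) in *.
    assert (N1 : 1 - zeta_p * q <> 0).
    { apply one_minus_neq0. unfold zeta_p, q. rewrite <- ce_plus. apply Hr. }
    assert (N2 : q - zeta_p <> 0).
    { intros J. specialize (Hr (- k)%Z). apply Hr. rewrite cz_opp, ce_plus. fold zeta_p.
      replace (- cz k * w) with (- (cz k * w)) by ring. rewrite ce_opp. fold q.
      replace zeta_p with q by (rewrite <- (Cplus_0_l zeta_p), <- J; ring). field. exact Nq. }
    assert (N3 : 1 - (zeta_p + / zeta_p) * q + q * q <> 0).
    { replace (1 - (zeta_p + / zeta_p) * q + q * q) with
        ((1 - zeta_p * q) * ((q - zeta_p) * (- / zeta_p))) by (field; exact Nz0).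
      apply Cmult_neq_0; [exact N1|]. apply Cmult_neq_0; [exact N2|].
      intros J. apply (Cinv_neq0 zeta_p Nz0). replace (/ zeta_p) with (- - / zeta_p) by ring. rewrite J. ring. }
    assert (N4 : zeta_p - (zeta_p * zeta_p + 1) * q + q * q * zeta_p <> 0).
    { replace (zeta_p - (zeta_p * zeta_p + 1) * q + q * q * zeta_p)
        with (zeta_p * (1 - (zeta_p + / zeta_p) * q + q * q)) by (field; exact Nz0).
      apply Cmult_neq_0; assumption. }
    field. repeat split; try assumption. }
  rewrite SE, B0. rewrite (qpoch_euler w Hw), qpow_ce.
  assert (SS : RtoC (/ sin (PI / INR p)) * RtoC (sin (PI / INR p)) = 1).
  { rewrite <- RtoC_mult. rewrite Rinv_l by apply sin_p_neq0. reflexivity. }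
  replace (RtoC (- (1 / 24)) * w) with (- (w / 24)) by (rewrite RtoC_opp, RtoC_div by lra; field).
  assert (T : 1 - zeta_p = - (2 * Ci * RtoC (sin (PI / INR p))) * ce (/ pc / 2)).
  { rewrite two_i_sin, ce_opp. unfold zeta_p.
    replace (ce (/ pc)) with (ce (/ pc / 2) * ce (/ pc / 2)) by (rewrite <- ce_plus; f_equal; field; apply pc_neq0).
    field. apply ce_neq0. }
  replace (1 + (1 - zeta_p) * (s1 - / (1 - zeta_p) + s2)) with ((1 - zeta_p) * (s1 + s2)) by (field; exact Nz).
  rewrite T.
  replace (RtoC (/ sin (PI / INR p)) * (ce (- (w / 24)) / euler w) *
    (- (2 * Ci * RtoC (sin (PI / INR p))) * ce (/ pc / 2) * (s1 + s2)))
  with ((RtoC (/ sin (PI / INR p)) * RtoC (sin (PI / INR p))) * (- (2 * Ci) * (ce (- (w / 24)) / euler w) *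
     (ce (/ pc / 2) * (s1 + s2)))) by ring.
  rewrite SS. ring.
Qed.

(** With X = e(u) q^n one has X^2 / (1 - X) = 1 / (1 - X) - 1 - X. The last two terms sum
    to Euler's series and to 0; the former is the exponential that eps_2 removes for
    l/p < 1/6. *)
Lemma Mfun_appell x w : (0 < Im w)%R -> reg (RtoC x * w) w ->
  Mfun x w = 2 * ce (- (3 / 2) * (RtoC x * RtoC x) * w - w / 24) *
             (appell (RtoC x * w) w / euler w - ce (RtoC x * w / 2)).
Proof.
  intros Hw Hr. unfold Mfun. assert (NP := euler_neq0 w Hw).
  set (u := RtoC x * w) in *.
  match goal with |- context [CseriesZ ?a] => set (ser := a) end.
  assert (SE : zsum ser (ce (- u) * (CseriesZ (bterm u w) + (- (1) * euler w + - ce u * 0)))).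
  { (* X^2/(1-X) = 1/(1-X) - 1 - X with X = e(u) q^n *)
    assert (H3 : zsum (fun n => m1pow n * ce ((pent n + cz n) * w)) 0).
    { assert (Q := zsum_scal (- (1)) _ _ (zsum_shift _ _ (zsum_pent_double w Hw))).
      replace (- (1) * 0) with (RtoC 0) in Q by ring.
      eapply zsum_ext; [|exact Q]. intros n. cbv beta. rewrite m1pow_S.
      replace ((pent n + cz n) * w) with ((pent (n + 1) - 2 * cz (n + 1)) * w); [ring|].
      unfold pent. rewrite cz_plus. change (cz 1) with (RtoC 1). field. }
    eapply zsum_ext; [|apply zsum_scal, zsum_plus; [apply (bterm_CseriesZ u w Hw)|
       apply zsum_plus; [apply zsum_scal, (euler_zsum w Hw)|apply zsum_scal, H3]]].
    intros n. cbv beta. unfold ser, bterm. rewrite !qpow_ce.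
    replace (RtoC (IZR n + x) * w) with (u + cz n * w) by (unfold u, cz; rewrite RtoC_plus; ring).
    replace (RtoC (3 / 2 * IZR n * (IZR n + 1)) * w) with ((pent n + cz n) * w).
    2:{ rewrite !RtoC_mult, RtoC_plus, RtoC_div by lra. fold (cz n). unfold pent. field. }
    assert (N1 := one_minus_neq0 _ (Hr n)).
    replace (ce ((pent n + cz n) * w)) with (ce (pent n * w) * (ce (- u) * ce (u + cz n * w))).
    2:{ rewrite <- !ce_plus. f_equal. ring. }
    set (X := ce (u + cz n * w)) in *.
    assert (Eu : ce u * ce (- u) = 1) by (rewrite <- ce_plus, <- ce_0; f_equal; ring).
    replace (- ce u * (m1pow n * (ce (pent n * w) * (ce (- u) * X))))
      with (- (ce u * ce (- u)) * (m1pow n * (ce (pent n * w) * X))) by ring.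
    rewrite Eu. field. exact N1. }
  rewrite (zsum_CseriesZ _ _ SE), (qpoch_euler w Hw), qpow_ce.
  unfold appell.
  replace (RtoC (3 * x / 2 * (1 - x) - 1 / 24) * w)
    with ((- (3 / 2) * (RtoC x * RtoC x) * w - w / 24) + (u + u / 2)).
  2:{ rewrite RtoC_minus, RtoC_mult, !RtoC_div, RtoC_minus, RtoC_mult by lra. unfold u. field. }
  rewrite !ce_plus.
  assert (Nu := ce_neq0 u). rewrite ce_opp. field. split; assumption.
Qed.

(** * The function J as a combination of Appell functions *)

Definition half_p : nat := ((p - 1) / 2)%nat.

Lemma p_half_p : p = (2 * half_p + 1)%nat.
Proof.
  unfold half_p. assert (O := p_odd).
  assert (E : Nat.odd p = true).
  { rewrite <- Nat.negb_even. destruct (Nat.even p) eqn:Ev; [|reflexivity].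
    apply Nat.even_spec in Ev. destruct Ev as [k Hk].
    rewrite Hk in O. replace (Z.of_nat (2 * k)) with (2 * Z.of_nat k)%Z in O by lia.
    rewrite Z.even_mul in O. discriminate O. }
  apply Nat.odd_spec in E. destruct E as [k Hk].
  assert (D : ((p - 1) / 2 = k)%nat).
  { replace (p - 1)%nat with (k * 2)%nat by lia. apply Nat.div_mul. lia. }
  lia.
Qed.

Definition sine6 (l : nat) : C := RtoC (sin (6 * INR l * PI / INR p)).

Lemma sine6_ce l : sine6 l = (ce (3 * cz (Z.of_nat l) / pc) - ce (- (3 * cz (Z.of_nat l) / pc))) / (2 * Ci).
Proof.
  assert (X := p_pos).
  replace (3 * cz (Z.of_nat l) / pc) with (RtoC (3 * INR l / INR p)).
  - rewrite ce_real, ce_real_neg. unfold sine6.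
    replace (2 * PI * (3 * INR l / INR p))%R with (6 * INR l * PI / INR p)%R by (field; lra).
    field. exact Ci_nz.
  - rewrite RtoC_div by lra. rewrite RtoC_mult, RtoC_INR, pc_INR. reflexivity.
Qed.

(** Half of eta(pz) (M + eps_2) at level l. The condition 6 l > p is l/p > 1/6, where
    eps_2 = 0 and the exponential in M stays. *)
Definition mock_part (l : nat) (z : C) : C :=
  ce (- (3 / 2) * (cz (Z.of_nat l) * cz (Z.of_nat l)) * z / pc) *
  (appell (cz (Z.of_nat l) * z) (pc * z)
   - (if Nat.ltb p (6 * l) then euler (pc * z) * ce (cz (Z.of_nat l) * z / 2) else 0)).

Lemma reg_lz z l : (0 < Im z)%R -> ~ (Z.of_nat p | l)%Z -> reg (cz l * z) (pc * z).
Proof.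
  intros Hz D n E. destruct (ce_eq_1 _ E) as [k Hk]. fold (cz k) in Hk. apply D.
  assert (Q : cz (l + n * Z.of_nat p) * z + cz (- k) = 0).
  { rewrite cz_plus, cz_mult, cz_opp. fold pc.
    replace ((cz l + cz n * pc) * z + - cz k) with ((cz l * z + cz n * (pc * z)) - cz k) by ring.
    rewrite Hk. ring. }
  apply lattice_indep in Q; [|exact Hz]. exists (- n)%Z. lia.
Qed.

Lemma small_not_div l : (1 <= l <= half_p)%nat -> ~ (Z.of_nat p | Z.of_nat l)%Z.
Proof. intros H D. assert (E := p_half_p). apply Z.divide_pos_le in D; lia. Qed.

Lemma p_neq_6l l : p <> (6 * l)%nat.
Proof. intros E. apply p_not3. exists (2 * Z.of_nat l)%Z. lia. Qed.

Lemma M_eps z l : (0 < Im z)%R -> (1 <= l <= half_p)%nat ->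
  eta (pc * z) * (Mfun (INR l / INR p) (pc * z) + epsilon2 (INR l / INR p) (pc * z)) = 2 * mock_part l z.
Proof.
  intros Hz Hl. assert (N := pc_neq0). assert (X := p_pos).
  assert (Hu := upper_mul z Hz). assert (NP := euler_neq0 _ Hu).
  assert (Ex : RtoC (INR l / INR p) = cz (Z.of_nat l) / pc).
  { rewrite RtoC_div by lra. rewrite RtoC_INR, <- pc_INR. reflexivity. }
  assert (Eu : RtoC (INR l / INR p) * (pc * z) = cz (Z.of_nat l) * z) by (rewrite Ex; field; exact N).
  rewrite Mfun_appell; [|exact Hu|rewrite Eu; apply reg_lz, small_not_div, Hl; exact Hz].
  rewrite Eu, Ex, eta_euler by exact Hu. unfold mock_part, epsilon2.
  set (L := cz (Z.of_nat l)) in *.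
  set (e0 := ce (- (3 / 2) * (L * L) * z / pc)).
  assert (E1 : ce (- (3 / 2) * (L / pc * (L / pc)) * (pc * z) - pc * z / 24) = e0 * / ce (pc * z / 24)).
  { unfold e0. rewrite <- ce_opp, <- ce_plus. f_equal. field. exact N. }
  rewrite E1. assert (N24 := ce_neq0 (pc * z / 24)).
  destruct (Rlt_dec (INR l / INR p) (1 / 6)) as [Q|Q].
  - assert (H6 : (6 * l < p)%nat).
    { apply INR_lt. rewrite mult_INR. simpl (INR 6).
      apply Rmult_lt_compat_r with (r := INR p) in Q; [|exact X].
      replace (INR l / INR p * INR p)%R with (INR l) in Q by (field; lra). lra. }
    destruct (Nat.ltb_spec p (6 * l)) as [B|B]; [lia|].
    replace (Cexp (- (RtoC (3 * PI) * Ci * (pc * z) * RtoC ((INR l / INR p - 1 / 6) ^ 2)%R)))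
      with (e0 * ce (L * z / 2) * / ce (pc * z / 24)).
    + field. split; assumption.
    + unfold e0. rewrite <- ce_opp, <- !ce_plus. unfold ce. f_equal.
      replace (RtoC ((INR l / INR p - 1 / 6) ^ 2)) with ((L / pc - 1 / 6) * (L / pc - 1 / 6)).
      * rewrite !RtoC_mult. field. exact N.
      * simpl pow. rewrite Rmult_1_r, RtoC_mult, RtoC_minus, Ex, RtoC_div by lra. reflexivity.
  - assert (H6 : (p < 6 * l)%nat).
    { assert (B := p_neq_6l l). destruct (Nat.lt_trichotomy p (6 * l)) as [A|[A|A]]; [exact A|contradiction|].
      exfalso. apply Q. apply lt_INR in A. rewrite mult_INR in A. simpl (INR 6) in A.
      apply Rmult_lt_reg_r with (INR p); [exact X|].
      replace (INR l / INR p * INR p)%R with (INR l) by (field; lra). lra. }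
    destruct (Nat.ltb_spec p (6 * l)) as [B|B]; [|lia].
    field. split; assumption.
Qed.

Lemma sum_n_m_bsum (f : nat -> C) n : sum_n_m (G := C_AbelianGroup) f 1 n = bsum n (fun k => f (S k)).
Proof.
  induction n as [|n IH].
  - rewrite sum_n_m_zero by lia. reflexivity.
  - rewrite sum_n_Sm by lia. rewrite IH. reflexivity.
Qed.

(** The function J(1/p; z/p), for which the translations by integers are the ones that
    define K. *)
Definition Jp (z : C) : C := Jfun p (z / pc).

Lemma Jp_formula z : (0 < Im z)%R ->
  Jp z = - (2 * Ci) * eta_quot z * appell (/ pc) (z / pc)
    - 4 * chip * bsum half_p (fun k => m1pow (Z.of_nat (S k)) * sine6 (S k) * mock_part (S k) z).
Proof.
  intros Hz. assert (N := pc_neq0). assert (Hd := upper_div z Hz). assert (Hu := upper_mul z Hz).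
  unfold Jp, Jfun. cbv zeta.
  assert (Ew : RtoC (INR p ^ 2) * (z / pc) = pc * z).
  { rewrite RtoC_pow, <- pc_INR. simpl. field. exact N. }
  rewrite Ew, Nfun_appell by (try apply reg_inv_pc; assumption).
  rewrite sum_n_m_bsum. fold half_p.
  unfold Cminus at 1. rewrite Cmult_plus_distr_l.
  assert (A1 : eta (pc * z) * (- (2 * Ci) * (ce (- (z / pc / 24)) / euler (z / pc)) * appell (/ pc) (z / pc)) =
               - (2 * Ci) * eta_quot z * appell (/ pc) (z / pc)).
  { unfold eta_quot. rewrite (eta_euler (z / pc) Hd), ce_opp. field.
    split; [apply euler_neq0, Hd|apply ce_neq0]. }
  rewrite A1. unfold Cminus. f_equal.
  match goal with |- _ * - (_ * ?s) = _ => set (sum := s) end.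
  replace (eta (pc * z) * - (RtoC (2 * chi12 (Z.of_nat p)) * sum)) with (- (2 * chip * (eta (pc * z) * sum)))
    by (rewrite RtoC_mult; unfold chip; ring).
  unfold sum. rewrite <- bsum_scal.
  rewrite (bsum_ext half_p _ (fun k => 2 * (m1pow (Z.of_nat (S k)) * sine6 (S k) * mock_part (S k) z))).
  - rewrite bsum_scal. ring.
  - intros k Hk. assert (M := M_eps z (S k) Hz ltac:(lia)). unfold sine6.
    match goal with |- eta ?w * (?a * ?b * ?c) = _ => replace (eta w * (a * b * c)) with (a * b * (eta w * c)) by ring end.
    rewrite M. ring.
Qed.

Lemma bsum_rev n f : bsum n f = bsum n (fun k => f (n - 1 - k)%nat).
Proof.
  induction n as [|n IH]; [reflexivity|].
  rewrite (bsum_S_first n (fun k => f (S n - 1 - k)%nat)). cbn [bsum]. rewrite IH.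
  replace (S n - 1 - 0)%nat with n by lia.
  rewrite (bsum_ext n (fun k => f (S n - 1 - S k)%nat) (fun k => f (n - 1 - k)%nat)).
  - ring.
  - intros k Hk. f_equal. lia.
Qed.

Lemma bsum_reflect f : bsum p f = f O + bsum (p - 1) (fun k => f (p - S k)%nat).
Proof.
  replace p with (S (p - 1)) at 1 by lia. rewrite bsum_S_first. f_equal.
  rewrite bsum_rev. apply bsum_ext. intros k Hk. f_equal. lia.
Qed.

Lemma bsum_first f : bsum p f = f O + bsum (p - 1) (fun k => f (S k)).
Proof. replace p with (S (p - 1)) at 1 by lia. apply bsum_S_first. Qed.

(** A function symmetric under l -> p - l and vanishing at 0 is summed twice over half the
    residues. *)
Lemma bsum_half (F : nat -> C) : F O = 0 ->
  (forall l, (0 < l < p)%nat -> F (p - l)%nat = F l) ->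
  bsum p F = 2 * bsum half_p (fun k => F (S k)).
Proof.
  intros H0 H. assert (E := p_half_p). rewrite bsum_first, H0.
  replace (p - 1)%nat with (half_p + half_p)%nat by lia. rewrite bsum_add.
  rewrite (bsum_rev half_p (fun k => F (S (half_p + k)))).
  rewrite (bsum_ext half_p (fun k => F (S (half_p + (half_p - 1 - k)))) (fun k => F (S k))).
  - ring.
  - intros k Hk. rewrite <- (H (S k)) by lia. f_equal. lia.
Qed.

(** Extend the sum over l to all residues, which doubles it by symmetry, and write the
    sine as a difference of exponentials. Orthogonality leaves j = 1 and j = p - 1. *)
Lemma sine_inversion (g : nat -> C) : g O = 0 ->
  (forall j, (0 < j < p)%nat -> g (p - j)%nat = - g j) ->
  bsum half_p (fun k => sine6 (S k) * bsum p (fun j => g j * ce (3 * cz (Z.of_nat (S k)) * cz (Z.of_nat j) / pc)))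
  = Ci * pc / 2 * g 1%nat.
Proof.
  intros G0 G. assert (N := pc_neq0).
  set (A := fun l : nat => bsum p (fun j => g j * ce (3 * cz (Z.of_nat l) * cz (Z.of_nat j) / pc))).
  set (F := fun l => sine6 l * A l).
  assert (czp : forall j, (j <= p)%nat -> cz (Z.of_nat (p - j)) = pc - cz (Z.of_nat j)).
  { intros j Hj. unfold pc. rewrite <- cz_sub. f_equal. lia. }
  assert (AS : forall l, (0 < l < p)%nat -> A (p - l)%nat = - A l).
  { intros l Hl. unfold A. rewrite bsum_first, G0, (bsum_reflect (fun j => g j * ce (3 * cz (Z.of_nat l) * cz (Z.of_nat j) / pc))), G0.
    rewrite (bsum_ext (p - 1) _ (fun k => - (1) * (g (p - S k)%nat * ce (3 * cz (Z.of_nat l) * cz (Z.of_nat (p - S k)) / pc)))).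
    - rewrite bsum_scal. ring.
    - intros k Hk. rewrite G, !czp by lia.
      replace (3 * (pc - cz (Z.of_nat l)) * cz (Z.of_nat (S k)) / pc)
        with (3 * cz (Z.of_nat l) * (pc - cz (Z.of_nat (S k))) / pc +
              cz (3 * (Z.of_nat (S k) - Z.of_nat l))).
      + rewrite ce_add_cz. ring.
      + rewrite cz_mult, cz_sub. change (cz 3) with (RtoC 3). field. exact N. }
  assert (SS : forall l, (0 < l < p)%nat -> sine6 (p - l)%nat = - sine6 l).
  { intros l Hl. rewrite !sine6_ce, czp by lia.
    replace (3 * (pc - cz (Z.of_nat l)) / pc) with (- (3 * cz (Z.of_nat l) / pc) + cz 3)
      by (change (cz 3) with (RtoC 3); field; exact N).
    replace (- (- (3 * cz (Z.of_nat l) / pc) + cz 3)) with (3 * cz (Z.of_nat l) / pc + cz (- 3))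
      by (change (cz (- 3)) with (cz (Z.opp 3)); rewrite cz_opp; ring).
    rewrite !ce_add_cz. field. exact Ci_nz. }
  assert (HF : bsum p F = 2 * bsum half_p (fun k => F (S k))).
  { apply bsum_half.
    - unfold F. rewrite sine6_ce. change (cz (Z.of_nat 0)) with (RtoC 0).
      replace (- (3 * 0 / pc)) with (3 * 0 / pc) by (field; exact N).
      replace (ce (3 * 0 / pc) - ce (3 * 0 / pc)) with (RtoC 0) by ring. unfold Cdiv. ring.
    - intros l Hl. unfold F. rewrite SS, AS by exact Hl. ring. }
  assert (FV : bsum p F = Ci * pc * g 1%nat).
  { unfold F, A.
    rewrite (bsum_ext p _ (fun l => bsum p (fun j => / (2 * Ci) * (g j *
       (ce (cz (Z.of_nat l) * cz (3 * (Z.of_nat j + 1)) / pc) - ce (cz (Z.of_nat l) * cz (3 * (Z.of_nat j - 1)) / pc)))))).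
    - rewrite bsum_swap.
      rewrite (bsum_ext p _ (fun j => (if Nat.eqb j (p - 1) then / (2 * Ci) * (g (p - 1)%nat * pc) else 0)
           + (if Nat.eqb j 1 then - (/ (2 * Ci) * (g 1%nat * pc)) else 0))).
      + rewrite bsum_plus, !bsum_delta by lia. rewrite G by lia.
        assert (I2 : Ci * Ci = - (1)) by (unfold Ci, Cmult, Copp, RtoC; simpl; f_equal; ring).
        field [I2]. exact Ci_nz.
      + intros j Hj.
        rewrite (bsum_ext p _ (fun l => / (2 * Ci) * g j * ce (cz (Z.of_nat l) * cz (3 * (Z.of_nat j + 1)) / pc)
            + - (/ (2 * Ci) * g j) * ce (cz (Z.of_nat l) * cz (3 * (Z.of_nat j - 1)) / pc))) by (intros; ring).
        rewrite bsum_plus, !bsum_scal, !char_sum.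
        assert (T3 : forall k, (Z.of_nat p | 3 * k)%Z -> (Z.of_nat p | k)%Z).
        { intros k D. destruct (prime_mult _ p_prime _ _ D) as [B|B]; [|exact B].
          apply Z.divide_pos_le in B; [|lia]. exfalso. lia. }
        assert (D1 : (Z.of_nat p | 3 * (Z.of_nat j + 1))%Z <-> j = (p - 1)%nat).
        { split.
          - intros D. apply T3 in D. apply Z.divide_pos_le in D; lia.
          - intros ->. replace (3 * (Z.of_nat (p - 1) + 1))%Z with (3 * Z.of_nat p)%Z by lia.
            apply Z.divide_factor_r. }
        assert (D2 : (Z.of_nat p | 3 * (Z.of_nat j - 1))%Z <-> j = 1%nat).
        { split.
          - intros D. apply T3 in D. destruct D as [q Hq]. assert (q = 0)%Z by nia. subst q. lia.
          - intros ->. simpl. apply Z.divide_0_r. }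
        destruct (excluded_middle_informative (Z.of_nat p | 3 * (Z.of_nat j + 1))%Z) as [E1|E1],
                 (excluded_middle_informative (Z.of_nat p | 3 * (Z.of_nat j - 1))%Z) as [E2|E2],
                 (Nat.eqb_spec j (p - 1)) as [E3|E3], (Nat.eqb_spec j 1) as [E4|E4];
          try (exfalso; tauto); subst; try (exfalso; lia); ring.
    - intros l _. rewrite <- bsum_scal. apply bsum_ext. intros j _. rewrite sine6_ce.
      rewrite !cz_mult, cz_plus, cz_sub. change (cz 3) with (RtoC 3). change (cz 1) with (RtoC 1).
      set (L := cz (Z.of_nat l)). set (J := cz (Z.of_nat j)).
      replace (ce (L * (3 * (J + 1)) / pc)) with (ce (3 * L / pc) * ce (3 * L * J / pc))
        by (rewrite <- ce_plus; f_equal; field; exact N).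
      replace (ce (L * (3 * (J - 1)) / pc)) with (ce (- (3 * L / pc)) * ce (3 * L * J / pc))
        by (rewrite <- ce_plus; f_equal; field; exact N).
      field. exact Ci_nz. }
  change (bsum half_p (fun k => F (S k)) = Ci * pc / 2 * g 1%nat).
  replace (bsum half_p (fun k => F (S k))) with (bsum p F / 2) by (rewrite HF; field).
  rewrite FV. field.
Qed.
(** * The function J as a limit *)

(** The terms j > 0 of the translate of G; they are regular at u = 0. *)
Definition torsion_part (l : nat) (z u : C) : C :=
  bsum p (fun j => if Nat.eqb j 0 then 0 else
    m1pow (Z.of_nat j) * ce (3 * cz (Z.of_nat l) * cz (Z.of_nat j) / pc)
    * appell ((u + cz (Z.of_nat j)) / pc) (z / pc)).

(** The one exponential of the translate of G that survives for l < p/2. *)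
Definition theta_part (l : nat) (z u : C) : C :=
  if Nat.ltb p (6 * l) then eta_quot z * euler (z / pc) * (pc * theta_term (z / pc) (u / pc) (6 * l - p)) else 0.

(** What remains of the translate of E by l z after removal of the term j = 0. *)
Definition reg_part (l : nat) (z u : C) : C :=
  eta_quot z * torsion_part l z u + theta_part l z u
  - pc * chip * (m1pow (Z.of_nat l) *
      ce (- (3 / 2) * (cz (Z.of_nat l) * cz (Z.of_nat l)) * z / pc - 3 * cz (Z.of_nat l) * u / pc))
    * appell (u + cz (Z.of_nat l) * z) (pc * z).

Lemma theta_term_sum l z u : (1 <= l <= half_p)%nat ->
  bsum (6 * l) (fun t => theta_term (z / pc) (u / pc) t * bsum p (fun j => ce (cz (Z.of_nat j) *
            cz (Z.of_nat p + 6 * Z.of_nat l - Z.of_nat t) / (2 * pc)))) =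
  if Nat.ltb p (6 * l) then pc * theta_term (z / pc) (u / pc) (6 * l - p) else 0.
Proof.
  intros Hl. assert (Ep := p_half_p).
  assert (W : forall t, (t < 6 * l)%nat -> (Z.of_nat p | 6 * Z.of_nat l - Z.of_nat t)%Z ->
     t <> (6 * l - p)%nat \/ (6 * l <= p)%nat -> theta_term (z / pc) (u / pc) t = 0).
  { intros t Ht [k Hk] H. apply theta_term_even.
    assert (k0 : (0 < k)%Z) by nia. assert (k3 : (k < 3)%Z) by nia.
    assert (k1 : k <> 1%Z) by (intros ->; assert (P6 := p_neq_6l l); destruct H; lia).
    assert (Hk2 : k = 2%Z) by lia. subst k.
    rewrite Z.even_spec. exists (3 * Z.of_nat l - Z.of_nat p)%Z. lia. }
  destruct (Nat.ltb_spec p (6 * l)) as [H|H].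
  - rewrite <- (bsum_delta (6 * l) (6 * l - p) (pc * theta_term (z / pc) (u / pc) (6 * l - p))) by lia.
    apply bsum_ext. intros t Ht. rewrite inner_term.
    destruct (Nat.eqb_spec t (6 * l - p)) as [->|E].
    + destruct (excluded_middle_informative _) as [_|F]; [reflexivity|].
      exfalso. apply F. exists 1%Z. lia.
    + destruct (excluded_middle_informative _) as [D|_]; [|reflexivity].
      rewrite (W t Ht D) by (left; exact E). ring.
  - rewrite <- (bsum_zero (6 * l)). apply bsum_ext. intros t Ht. rewrite inner_term.
    destruct (excluded_middle_informative _) as [D|_]; [|reflexivity].
    rewrite (W t Ht D) by (right; exact H). ring.
Qed.

(** The only term singular at u = 0 is the one with j = 0, and it does not depend on l. *)
Lemma heis_lattice_form_reg_part l z u : (0 < Im z)%R -> (1 <= l <= half_p)%nat -> off_lattice z u ->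
  heis z (Z.of_nat l) 0 (lattice_form z) u = eta_quot z * appell (u / pc) (z / pc) + reg_part l z u.
Proof.
  intros Hz Hl Hu. rewrite heis_lattice_form, heis_torsion_sum, theta_term_sum by assumption.
  unfold heis, reg_part, theta_part, torsion_part. rewrite Z.add_0_r. change (cz 0) with (RtoC 0).
  replace (u + cz (Z.of_nat l) * z + 0) with (u + cz (Z.of_nat l) * z) by ring.
  replace (bsum p (fun j => m1pow (Z.of_nat j) * ce (3 * cz (Z.of_nat l) * cz (Z.of_nat j) / pc)
                    * appell ((u + cz (Z.of_nat j)) / pc) (z / pc)))
  with (appell (u / pc) (z / pc) + bsum p (fun j => if Nat.eqb j 0 then 0 else
    m1pow (Z.of_nat j) * ce (3 * cz (Z.of_nat l) * cz (Z.of_nat j) / pc)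
    * appell ((u + cz (Z.of_nat j)) / pc) (z / pc))).
  - destruct (Nat.ltb p (6 * l)); ring.
  - rewrite !bsum_first. simpl Nat.eqb. cbv iota. rewrite Cplus_assoc, Cplus_0_r. f_equal.
    change (cz (Z.of_nat 0)) with (RtoC 0).
    replace (3 * cz (Z.of_nat l) * 0 / pc) with (RtoC 0) by (field; exact pc_neq0).
    rewrite ce_0. replace (u + 0) with u by ring. change (m1pow (Z.of_nat 0)) with (RtoC 1). ring.
Qed.

Lemma reg_j_pc z j : (0 < Im z)%R -> (0 < j < p)%nat -> reg (cz (Z.of_nat j) / pc) (z / pc).
Proof.
  intros Hz Hj n E. assert (N := pc_neq0). destruct (ce_eq_1 _ E) as [k Hk]. fold (cz k) in Hk.
  assert (Q : cz n * z + cz (Z.of_nat j - Z.of_nat p * k) = 0).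
  { rewrite cz_sub, cz_mult. fold pc.
    replace (cz n * z + (cz (Z.of_nat j) - pc * cz k))
      with (pc * ((cz (Z.of_nat j) / pc + cz n * (z / pc)) - cz k)) by (field; exact N).
    rewrite Hk. ring. }
  apply lattice_indep in Q; [|exact Hz].
  assert (D : (Z.of_nat p | Z.of_nat j)%Z) by (exists k; lia). apply Z.divide_pos_le in D; lia.
Qed.

Lemma chol_torsion_part l z : (0 < Im z)%R -> chol (torsion_part l z) 0.
Proof.
  intros Hz. unfold torsion_part. apply chol_bsum. intros j Hj.
  destruct (Nat.eqb_spec j 0) as [E|E]; [apply chol_const|].
  apply chol_scal. apply chol_appell.
  - apply chol_div_pc, chol_add_const, chol_id.
  - apply chol_const.
  - apply upper_div, Hz.
  - replace (0 + cz (Z.of_nat j)) with (cz (Z.of_nat j)) by ring. apply reg_j_pc; [exact Hz|lia].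
Qed.

Lemma chol_theta_part l z s : chol (theta_part l z) s.
Proof.
  unfold theta_part. destruct (Nat.ltb p (6 * l)); [|apply chol_const].
  apply chol_scal, chol_scal. unfold theta_term. apply chol_scal. apply chol_ce_comp.
  apply chol_minus; [apply chol_const|]. apply chol_scal, chol_div_pc, chol_id.
Qed.

Lemma chol_reg_part l z : (0 < Im z)%R -> (1 <= l <= half_p)%nat -> chol (reg_part l z) 0.
Proof.
  intros Hz Hl. unfold reg_part. apply chol_minus.
  - apply chol_plus; [apply chol_scal, chol_torsion_part, Hz|apply chol_theta_part].
  - apply chol_mult.
    + apply chol_scal. assert (Q := chol_heis_factor z (Z.of_nat l) 0 0).
      rewrite Z.add_0_r in Q. exact Q.
    + apply chol_appell; [apply chol_add_const, chol_id|apply chol_const|apply upper_mul, Hz|].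
      replace (0 + cz (Z.of_nat l) * z) with (cz (Z.of_nat l) * z) by ring.
      apply reg_lz; [exact Hz|apply small_not_div, Hl].
Qed.

Definition even_part (F : C -> C) (u : C) : C := (F u + F (- u)) / 2.

(** The weighted sum over l of the even parts of the translates of E. *)
Definition sine_comb (z u : C) : C :=
  bsum half_p (fun k => sine6 (S k) * even_part (heis z (Z.of_nat (S k)) 0 (lattice_form z)) u).

(** The same expression in terms of the regular parts, which makes sense at u = 0. *)
Definition sine_comb_reg (z u : C) : C :=
  bsum half_p (fun k => sine6 (S k) * even_part (reg_part (S k) z) u).

(** The singular term is odd in u and disappears in the even part. *)
Lemma sine_comb_sine_comb_reg z u : (0 < Im z)%R -> off_lattice z u -> sine_comb z u = sine_comb_reg z u.
Proof.
  intros Hz Hu. unfold sine_comb, sine_comb_reg. apply bsum_ext. intros k Hk. f_equal. unfold even_part.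
  rewrite !heis_lattice_form_reg_part by (try apply off_lattice_opp; try assumption; lia).
  assert (R := off_lattice_reg_small z u 0 Hu). change (cz 0) with (RtoC 0) in R.
  replace ((u + 0) / pc) with (u / pc) in R by (field; exact pc_neq0).
  replace (- u / pc) with (- (u / pc)) by (field; exact pc_neq0).
  rewrite appell_neg by (try apply upper_div; assumption). field.
Qed.

Lemma ccont_sine_comb_reg z : (0 < Im z)%R -> ccont (sine_comb_reg z) 0.
Proof.
  intros Hz. apply chol_cont. unfold sine_comb_reg. apply chol_bsum. intros k Hk. apply chol_scal.
  unfold even_part, Cdiv. apply chol_mult; [|apply chol_const].
  assert (Q := chol_reg_part (S k) z Hz ltac:(lia)). apply chol_plus; [exact Q|].
  apply (chol_comp (reg_part (S k) z) (fun w => - w)).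
  - replace (- (0)) with (RtoC 0) by ring. exact Q.
  - apply chol_opp, chol_id.
Qed.

(** The surviving exponential at u = 0 is, after multiplication by r(z), exactly the
    exponential in M for 6 l > p. *)
Lemma reg_part_0 l z : (0 < Im z)%R -> reg_part l z 0 =
  eta_quot z * torsion_part l z 0 - pc * chip * (m1pow (Z.of_nat l) * mock_part l z).
Proof.
  intros Hz. assert (N := pc_neq0). unfold reg_part, mock_part, theta_part.
  set (L := cz (Z.of_nat l)).
  replace (- (3 / 2) * (L * L) * z / pc - 3 * L * 0 / pc) with (- (3 / 2) * (L * L) * z / pc) by (field; exact N).
  replace (0 + L * z) with (L * z) by ring.
  destruct (Nat.ltb_spec p (6 * l)) as [H|H]; [|ring].
  rewrite eta_quot_euler by exact Hz. unfold theta_term.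
  assert (Ec : RtoC (chi12 (Z.of_nat (6 * l - p))) = m1pow (Z.of_nat l) * chip).
  { replace (Z.of_nat (6 * l - p)) with (6 * Z.of_nat l + - Z.of_nat p)%Z by lia.
    rewrite chi12_6mul, chi12_opp. reflexivity. }
  rewrite Ec.
  assert (Et : cz (Z.of_nat (6 * l - p)) = 6 * L - pc).
  { replace (Z.of_nat (6 * l - p)) with (6 * Z.of_nat l - Z.of_nat p)%Z by lia.
    rewrite cz_sub, cz_mult. reflexivity. }
  rewrite Et.
  assert (Ex : ce (pc * z / 24 - z / pc / 24) * ce (- (((6 * L - pc) * (6 * L - pc) - 1) / 24) * (z / pc) - (6 * L - pc) / 2 * (0 / pc))
     = ce (- (3 / 2) * (L * L) * z / pc) * ce (L * z / 2)).
  { rewrite <- !ce_plus. f_equal. field. exact N. }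
  match goal with |- _ + ?a * ?P * (pc * (?c * ?b)) - _ = _ =>
    replace (a * P * (pc * (c * b))) with (P * (pc * c) * (a * b)) by ring end.
  rewrite Ex. ring.
Qed.

(** The regular terms give the sum over M; the sine sum applied to the torsion terms
    gives N. *)
Lemma sine_comb_reg_0 z : (0 < Im z)%R -> sine_comb_reg z 0 = pc / 4 * Jp z.
Proof.
  intros Hz. assert (N := pc_neq0). rewrite Jp_formula by exact Hz. unfold sine_comb_reg.
  pose (g := fun j : nat => if Nat.eqb j 0 then RtoC 0 else m1pow (Z.of_nat j) * appell (cz (Z.of_nat j) / pc) (z / pc)).
  assert (EA : forall l, torsion_part l z 0 = bsum p (fun j => g j * ce (3 * cz (Z.of_nat l) * cz (Z.of_nat j) / pc))).
  { intros l. unfold torsion_part, g. apply bsum_ext. intros j _. destruct (Nat.eqb j 0); [ring|].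
    replace (0 + cz (Z.of_nat j)) with (cz (Z.of_nat j)) by ring. ring. }
  rewrite (bsum_ext half_p _ (fun k => eta_quot z * (sine6 (S k) * torsion_part (S k) z 0)
      + - (pc * chip) * (m1pow (Z.of_nat (S k)) * sine6 (S k) * mock_part (S k) z))).
  2:{ intros k Hk. unfold even_part. replace (- (0)) with (RtoC 0) by ring. rewrite reg_part_0 by exact Hz. field. }
  rewrite bsum_plus, !bsum_scal.
  rewrite (bsum_ext half_p (fun k => sine6 (S k) * torsion_part (S k) z 0)
    (fun k => sine6 (S k) * bsum p (fun j => g j * ce (3 * cz (Z.of_nat (S k)) * cz (Z.of_nat j) / pc))))
    by (intros k _; rewrite EA; reflexivity).
  rewrite sine_inversion.
  - unfold g. simpl Nat.eqb. cbv iota. change (cz (Z.of_nat 1)) with (RtoC 1).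
    change (m1pow (Z.of_nat 1)) with (- (1)). replace (1 / pc) with (/ pc) by (field; exact N).
    field.
  - reflexivity.
  - intros j Hj. unfold g. destruct (Nat.eqb_spec (p - j) 0) as [E|_]; [lia|].
    destruct (Nat.eqb_spec j 0) as [E|_]; [lia|].
    replace (Z.of_nat (p - j)) with (Z.of_nat p * 1 + - Z.of_nat j)%Z by lia.
    rewrite m1pow_plus, m1pow_opp, m1pow_pmul, cz_plus, cz_mult, cz_opp. fold pc.
    change (cz 1) with (RtoC 1).
    replace ((pc * 1 + - cz (Z.of_nat j)) / pc) with (- (cz (Z.of_nat j) / pc) + 1) by (field; exact N).
    rewrite appell_add_one, appell_neg by (try apply upper_div; try apply reg_j_pc; assumption).
    change (m1pow 1) with (- (1)). ring.
Qed.
(** * The function J under the principal congruence subgroup *)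

Lemma ccont_zero_on_ray f y : (0 < y)%R -> ccont f 0 ->
  (forall s, (0 < s < y)%R -> f (0%R, s) = 0) -> f 0 = 0.
Proof.
  intros Hy Hf H. apply NNPP. intros N. assert (P := proj1 (Cmod_gt_0 _) N).
  destruct (Hf _ P) as [d [Hd B]].
  set (s := (Rmin (d / 2) (y / 2))%R).
  assert (Hs : (0 < s < y)%R /\ (s < d)%R).
  { unfold s. assert (A1 := Rmin_l (d / 2) (y / 2)). assert (A2 := Rmin_r (d / 2) (y / 2)).
    assert (A3 : (0 < Rmin (d / 2) (y / 2))%R) by (apply Rmin_glb_lt; lra). lra. }
  assert (Q : (Cmod ((0%R, s) - 0) < d)%R).
  { replace ((0%R, s) - 0) with (RtoC s * Ci) by (unfold RtoC, Ci, Cminus, Cplus, Copp, Cmult; simpl; f_equal; ring).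
    rewrite Cmod_mult, Cmod_R. replace (Cmod Ci) with 1%R.
    - rewrite Rabs_pos_eq; lra.
    - unfold Cmod, Ci. simpl. replace (0 * (0 * 1) + 1 * (1 * 1))%R with 1%R by ring. symmetry. apply sqrt_1. }
  specialize (B _ Q). rewrite (H s) in B by apply Hs.
  replace (0 - f 0) with (- f 0) in B by ring. rewrite Cmod_opp in B. lra.
Qed.

Section Congruence.
Variables (z : C) (a b c d : Z).
Hypothesis Hz : (0 < Im z)%R.
Hypothesis det : (a * d - b * c = 1)%Z.
Hypothesis p_b : (Z.of_nat p | b)%Z.
Hypothesis p_c : (Z.of_nat p | c)%Z.
Hypothesis p_d : (Z.of_nat p | d - 1)%Z.

Let J := autj z c d.
Let Z' := mob z a b c d.

(** Since d = 1 modulo p and b, c are 0 modulo p, the matrix moves l z by a vector under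
    which E is invariant. *)
Lemma heis_lattice_form_transform l u : ~ heights z (Im u) ->
  heis z l 0 (lattice_form z) u = jacobi_slash z c d (heis Z' l 0 (lattice_form Z')) u.
Proof.
  intros Hu. destruct (lattice_form_transform z a b c d Hz det p_b p_c) as [_ HE].
  assert (Hup : (0 < Im Z')%R) by (apply mob_upper; assumption).
  rewrite (heis_ext z l 0 (lattice_form z) (jacobi_slash z c d (lattice_form Z')) u).
  2:{ apply HE. change (cz 0) with (RtoC 0). replace (u + cz l * z + 0) with (u + cz l * z) by ring.
      apply heights_shift, Hu. }
  rewrite (intertwine' z a b c d) by assumption. fold Z'.
  apply jacobi_slash_ext. fold J. destruct p_d as [k Hk].
  replace (d * l - c * 0)%Z with (l + Z.of_nat p * (k * l))%Z by (replace d with (k * Z.of_nat p + 1)%Z by lia; ring).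
  replace (- b * l + a * 0)%Z with (0 + - b * l)%Z by ring.
  rewrite <- heis_comp by (exists 0%Z; ring).
  apply heis_ext. apply lattice_form_inv; [exact Hup|].
  apply off_lattice_shift. unfold Z', J. apply off_lattice_mob; try assumption. apply heights_off_lattice, Hu.
Qed.

Lemma heights_between s : (0 < s < Im z)%R -> ~ heights z s /\ ~ heights z (- s).
Proof.
  intros Hs. split; intros [l E].
  - assert (H0 : (0 < IZR l < 1)%R) by (split; nra). destruct H0 as [H0 H1].
    apply lt_IZR in H0, H1. lia.
  - assert (H0 : (-1 < IZR l < 0)%R) by (split; nra). destruct H0 as [H0 H1].
    apply lt_IZR in H0, H1. lia.
Qed.

Lemma sine_comb_transform s : (0 < s < Im z)%R ->
  sine_comb z (0%R, s) = / J * ce (3 / 2 * cz c * ((0%R, s) * (0%R, s)) / (pc * J)) * sine_comb Z' ((0%R, s) / J).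
Proof.
  intros Hs. destruct (heights_between s Hs) as [H1 H2].
  assert (NJ : J <> 0) by (apply (autj_neq0 z a b c d); assumption).
  unfold sine_comb. rewrite <- bsum_scal. apply bsum_ext. intros k Hk. unfold even_part.
  rewrite !heis_lattice_form_transform by assumption. unfold jacobi_slash. fold J.
  set (u := (0%R, s) : C). replace (- u * - u) with (u * u) by ring.
  replace (- u / J) with (- (u / J)) by (field; exact NJ). field. exact NJ.
Qed.

(** The weighted sums for z and for the transformed point agree for small u on the
    positive imaginary axis, where there is no pole; their regular forms are continuous
    at u = 0. *)
Theorem Jp_transform : Jp z = / J * Jp Z'.
Proof.
  assert (NJ : J <> 0) by (apply (autj_neq0 z a b c d); assumption).
  assert (N := pc_neq0).
  assert (Hup : (0 < Im Z')%R) by (apply mob_upper; assumption).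
  assert (E : sine_comb_reg z 0 - / J * ce (3 / 2 * cz c * (0 * 0) / (pc * J)) * sine_comb_reg Z' (0 / J) = 0).
  { apply (ccont_zero_on_ray (fun u => sine_comb_reg z u - / J * ce (3 / 2 * cz c * (u * u) / (pc * J)) * sine_comb_reg Z' (u / J)) (Im z) Hz).
    - unfold Cminus. apply ccont_plus; [apply ccont_sine_comb_reg, Hz|].
      apply (ccont_ext (fun u => - (1) * (/ J * ce (3 / 2 * cz c * (u * u) / (pc * J)) * sine_comb_reg Z' (u / J)))).
      { exists 1%R. split; [lra|]. intros w _. ring. }
      apply ccont_mult; [apply ccont_const|]. apply ccont_mult.
      + apply chol_cont. apply chol_jacobi_slash_factor.
      + apply (ccont_comp (sine_comb_reg Z') (fun u => u / J)).
        * replace (0 / J) with (RtoC 0) by (field; exact NJ). apply ccont_sine_comb_reg, Hup.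
        * apply chol_cont. unfold Cdiv. apply chol_mult; [apply chol_id|apply chol_const].
    - intros s Hs. destruct (heights_between s Hs) as [H1 H2].
      assert (Hn : off_lattice z (0%R, s)) by (apply heights_off_lattice, H1).
      rewrite <- sine_comb_sine_comb_reg by assumption.
      rewrite <- (sine_comb_sine_comb_reg Z') by (try apply (off_lattice_mob z a b c d); assumption).
      rewrite sine_comb_transform by exact Hs. ring. }
  replace (0 / J) with (RtoC 0) in E by (field; exact NJ).
  replace (3 / 2 * cz c * (0 * 0) / (pc * J)) with (RtoC 0) in E by (field; split; assumption).
  rewrite ce_0, !sine_comb_reg_0 in E by assumption.
  replace (Jp z) with (/ J * Jp Z' + 4 / pc * (pc / 4 * Jp z - / J * 1 * (pc / 4 * Jp Z'))) by (field; split; assumption).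
  rewrite E. ring.
Qed.
End Congruence.
(** * Growth and holomorphy of J *)

Definition gauge (z : C) : R := (1 + Im z + / Im z)%R.

(** The class is closed under sums and products, which reduces the bound for J to its
    building blocks; exp(K / y) is allowed because near a real point the Euler product
    behaves in this way. *)
Definition moderate (f : C -> C) : Prop :=
  exists K, (0 <= K)%R /\ forall z, (0 < Im z)%R -> (Cmod (f z) <= exp (K * gauge z))%R.

Lemma gauge_ge z : (0 < Im z)%R -> (1 <= gauge z)%R /\ (Im z <= gauge z)%R /\ (/ Im z <= gauge z)%R.
Proof. intros H. assert (Q := Rinv_0_lt_compat _ H). unfold gauge. lra. Qed.

Lemma le_exp x : (x <= exp x)%R.
Proof. assert (Q := exp_ineq1_le x). lra. Qed.

Lemma moderate_ext f g : (forall z, (0 < Im z)%R -> f z = g z) -> moderate f -> moderate g.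
Proof. intros E [K [HK H]]. exists K. split; [exact HK|]. intros z Hz. rewrite <- E by exact Hz. apply H, Hz. Qed.

Lemma moderate_le f (b : C -> R) K : (0 <= K)%R ->
  (forall z, (0 < Im z)%R -> (b z <= K * gauge z)%R) ->
  (forall z, (0 < Im z)%R -> (Cmod (f z) <= exp (b z))%R) -> moderate f.
Proof.
  intros HK Hb H. exists K. split; [exact HK|]. intros z Hz.
  eapply Rle_trans; [apply H, Hz|]. apply exp_le_compat, Hb, Hz.
Qed.

Lemma moderate_linear f K : (0 <= K)%R ->
  (forall z, (0 < Im z)%R -> (Cmod (f z) <= K * gauge z)%R) -> moderate f.
Proof.
  intros HK H. apply (moderate_le f (fun z => K * gauge z)%R K HK); [intros; lra|].
  intros z Hz. eapply Rle_trans; [apply H, Hz|apply le_exp].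
Qed.

Lemma moderate_const c : moderate (fun _ => c).
Proof.
  apply (moderate_linear _ (Cmod c)); [apply Cmod_ge_0|]. intros z Hz.
  assert (Q := Cmod_ge_0 c). destruct (gauge_ge z Hz) as [H _]. nra.
Qed.

Lemma moderate_mult f g : moderate f -> moderate g -> moderate (fun z => f z * g z).
Proof.
  intros [K [HK H]] [L [HL G]]. exists (K + L)%R. split; [lra|]. intros z Hz.
  rewrite Cmod_mult, Rmult_plus_distr_r, exp_plus.
  apply Rmult_le_compat; try apply Cmod_ge_0; [apply H|apply G]; exact Hz.
Qed.

Lemma moderate_plus f g : moderate f -> moderate g -> moderate (fun z => f z + g z).
Proof.
  intros [K [HK H]] [L [HL G]]. exists (K + L + 1)%R. split; [lra|]. intros z Hz.
  destruct (gauge_ge z Hz) as [H1 _].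
  eapply Rle_trans; [apply Cmod_triangle|].
  assert (A : (exp (K * gauge z) <= exp ((K + L) * gauge z))%R) by (apply exp_le_compat; nra).
  assert (B : (exp (L * gauge z) <= exp ((K + L) * gauge z))%R) by (apply exp_le_compat; nra).
  specialize (H z Hz). specialize (G z Hz).
  rewrite Rmult_plus_distr_r, exp_plus.
  assert (D : (2 <= exp (1 * gauge z))%R) by (assert (Q := exp_ineq1_le (1 * gauge z)); lra).
  assert (P := exp_pos ((K + L) * gauge z)). nra.
Qed.

Lemma moderate_bsum n (f : nat -> C -> C) : (forall k, (k < n)%nat -> moderate (f k)) ->
  moderate (fun z => bsum n (fun k => f k z)).
Proof.
  induction n as [|n IH]; intros H; simpl; [apply moderate_const|].
  apply moderate_plus; [apply IH; intros; apply H; lia|apply H; lia].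
Qed.

Lemma moderate_ce r : moderate (fun z => ce (RtoC r * z)).
Proof.
  apply (moderate_le _ (fun z => - (2 * PI * (r * Im z)))%R (2 * PI * Rabs r)).
  - assert (Q := PI_RGT_0). assert (Q2 := Rabs_pos r). nra.
  - intros z Hz. destruct (gauge_ge z Hz) as [_ [H2 _]].
    assert (Q := PI_RGT_0). assert (Q2 := Rabs_maj2 r).
    assert (A : (- r * Im z <= Rabs r * gauge z)%R).
    { apply Rle_trans with (Rabs r * Im z)%R; [|assert (Q3 := Rabs_pos r); nra].
      apply Rmult_le_compat_r; lra. }
    replace (- (2 * PI * (r * Im z)))%R with (2 * PI * (- r * Im z))%R by ring.
    replace (2 * PI * Rabs r * gauge z)%R with (2 * PI * (Rabs r * gauge z))%R by ring.
    apply Rmult_le_compat_l; lra.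
  - intros z Hz. rewrite Cmod_ce, Im_RtoC_mult. apply Rle_refl.
Qed.

(** From exp(x) >= 1 + x. *)
Lemma nome_inv_bound y : (0 < y)%R -> (/ (1 - nome y) <= 1 + / y)%R.
Proof.
  intros Hy. assert (L := nome_lt1 y Hy). assert (P := nome_pos y).
  assert (P3 : (3 < PI)%R) by (assert (Q := PI2_3_2); unfold PI2 in Q; lra).
  assert (E : (nome y * (1 + y) <= 1)%R).
  { unfold nome. apply Rmult_le_reg_l with (exp (2 * PI * y)); [apply exp_pos|].
    rewrite <- Rmult_assoc, <- exp_plus. replace (2 * PI * y + - (2 * PI * y))%R with 0%R by ring.
    rewrite exp_0. assert (Q := exp_ineq1_le (2 * PI * y)). nra. }
  apply Rmult_le_reg_r with (1 - nome y)%R; [lra|]. rewrite Rinv_l by lra.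
  apply Rmult_le_reg_r with y; [exact Hy|].
  replace ((1 + / y) * (1 - nome y) * y)%R with ((1 + y) * (1 - nome y))%R by (field; lra).
  nra.
Qed.

Lemma zsum_norm a s D t : zsum a s -> (0 < t < 1)%R -> (0 <= D)%R ->
  (forall n, (Cmod (a n) <= D * t ^ Z.abs_nat n)%R) -> (Cmod s <= 2 * D * / (1 - t))%R.
Proof.
  intros [s1 [s2 [H1 [H2 ->]]]] Ht HD H.
  assert (SG : is_series (fun n => D * t ^ n)%R (D * / (1 - t))%R).
  { apply (is_series_scal (K := R_AbsRing) D (fun n => t ^ n)%R).
    apply is_series_geom. rewrite Rabs_pos_eq; lra. }
  assert (EX : ex_series (fun n => D * t ^ n)%R) by (eexists; exact SG).
  assert (A1 : (Cmod s1 <= D * / (1 - t))%R).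
  { rewrite <- (is_series_unique _ _ SG). eapply cseries_norm; [|exact EX|exact H1].
    intros n. cbv beta. eapply Rle_trans; [apply H|]. rewrite Zabs2Nat.id. lra. }
  assert (A2 : (Cmod s2 <= D * / (1 - t))%R).
  { rewrite <- (is_series_unique _ _ SG). eapply cseries_norm; [|exact EX|exact H2].
    intros n. cbv beta. eapply Rle_trans; [apply H|]. rewrite abs_nat_opp_S. simpl.
    assert (Q : (0 <= D * t ^ n)%R) by (apply Rmult_le_pos; [exact HD|apply pow_le; lra]). nra. }
  eapply Rle_trans; [apply Cmod_triangle|]. lra.
Qed.

Lemma euler_upper tau : (0 < Im tau)%R -> (Cmod (euler tau) <= 2 * (1 + / Im tau))%R.
Proof.
  intros H. assert (L := nome_lt1 _ H). assert (P := nome_pos (Im tau)).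
  eapply Rle_trans.
  - apply (zsum_norm _ _ 1 (nome (Im tau)) (euler_zsum tau H)); try lra.
    intros n. rewrite Cmod_mult, Cmod_m1pow. apply Rmult_le_compat_l; [lra|].
    apply Cmod_ce_pent_le. lra.
  - assert (Q := nome_inv_bound _ H). lra.
Qed.

(** The series is dominated by a geometric series as soon as all denominators are
    bounded below. *)
Lemma appell_upper u tau D : (0 < Im tau)%R -> (0 <= D)%R ->
  (forall n, (Cmod (/ (1 - ce (u + cz n * tau))) <= D)%R) ->
  (Cmod (appell u tau) <= Cmod (ce (u / 2)) * (2 * D * (1 + / Im tau)))%R.
Proof.
  intros H HD Hn. assert (L := nome_lt1 _ H). assert (P := nome_pos (Im tau)).
  unfold appell. rewrite Cmod_mult. apply Rmult_le_compat_l; [apply Cmod_ge_0|].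
  eapply Rle_trans.
  - apply (zsum_norm _ _ D (nome (Im tau)) (bterm_CseriesZ u tau H)); try lra.
    intros n. unfold bterm, Cdiv. rewrite !Cmod_mult, Cmod_m1pow, Rmult_1_l, Rmult_comm.
    apply Rmult_le_compat; try apply Cmod_ge_0; [apply Hn|]. apply Cmod_ce_pent_le. lra.
  - assert (Q := nome_inv_bound _ H). apply Rmult_le_compat_l; lra.
Qed.

(** Again from exp(x) >= 1 + x, applied to |X| or to 1/|X|. *)
Lemma inv_away X x e : Cmod X = exp x -> (0 < e)%R -> (e <= Rabs x)%R ->
  (Cmod (/ (1 - X)) <= 1 + / e)%R.
Proof.
  intros HX He Hx.
  assert (B : (e / (1 + e) <= Cmod (1 - X))%R).
  { assert (Q : (e / (1 + e) <= e)%R).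
    { apply Rmult_le_reg_r with (1 + e)%R; [lra|]. unfold Rdiv. rewrite Rmult_assoc, Rinv_l by lra. nra. }
    destruct (Rle_dec 0 x) as [S0|S0].
    - rewrite Rabs_pos_eq in Hx by exact S0. assert (A := Cmod_triangle_sub X 1).
      rewrite Cmod_minus_sym, Cmod_1, HX in A. assert (A2 := exp_ineq1_le x). lra.
    - rewrite Rabs_left in Hx by lra. assert (A := Cmod_triangle_sub 1 X).
      rewrite Cmod_1, HX in A.
      assert (A2 : (exp x * (1 + e) <= 1)%R).
      { apply Rle_trans with (exp x * exp (- x))%R.
        - apply Rmult_le_compat_l; [left; apply exp_pos|]. assert (A3 := exp_ineq1_le (- x)). lra.
        - rewrite <- exp_plus. replace (x + - x)%R with 0%R by ring. rewrite exp_0. lra. }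
      assert (A3 : (exp x <= / (1 + e))%R).
      { apply Rmult_le_reg_r with (1 + e)%R; [lra|]. rewrite Rinv_l by lra. exact A2. }
      replace (e / (1 + e))%R with (1 - / (1 + e))%R by (field; lra). lra. }
  assert (P : (0 < e / (1 + e))%R) by (apply Rdiv_lt_0_compat; lra).
  rewrite Cmod_inv.
  - replace (1 + / e)%R with (/ (e / (1 + e)))%R by (field; lra). apply Rinv_le_contravar; assumption.
  - intros E. rewrite E, Cmod_0 in B. lra.
Qed.

Lemma exp_arg_away n y : (0 < y)%R -> n <> 0%Z -> (y <= Rabs (- (2 * PI * (IZR n * y))))%R.
Proof.
  intros Hy Hn. assert (P3 : (3 < PI)%R) by (assert (Q := PI2_3_2); unfold PI2 in Q; lra).
  assert (A : (1 <= Rabs (IZR n))%R) by (rewrite <- abs_IZR; apply IZR_le; lia).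
  rewrite Rabs_Ropp, !Rabs_mult, (Rabs_pos_eq 2), (Rabs_pos_eq PI), (Rabs_pos_eq y) by lra.
  assert (B : (1 * y <= Rabs (IZR n) * y)%R) by (apply Rmult_le_compat_r; lra). nra.
Qed.

Lemma moderate_inv_im r : (0 < r)%R -> moderate (fun z => RtoC (1 + / (r * Im z))).
Proof.
  intros Hr. assert (Q := Rinv_0_lt_compat _ Hr).
  apply (moderate_linear _ (1 + / r)); [lra|]. intros z Hz.
  destruct (gauge_ge z Hz) as [H1 [_ H3]]. assert (Q2 := Rinv_0_lt_compat _ Hz).
  rewrite Cmod_R, Rinv_mult. assert (P := Rmult_lt_0_compat _ _ Q Q2).
  assert (P2 : (/ r * / Im z <= / r * gauge z)%R) by (apply Rmult_le_compat_l; lra).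
  rewrite Rabs_pos_eq by lra. lra.
Qed.

Lemma moderate_bound f g : moderate g ->
  (forall z, (0 < Im z)%R -> (Cmod (f z) <= Cmod (g z))%R) -> moderate f.
Proof.
  intros [K [HK H]] B. exists K. split; [exact HK|]. intros z Hz.
  eapply Rle_trans; [apply B|apply H]; exact Hz.
Qed.

Lemma moderate_euler r : (0 < r)%R -> moderate (fun z => euler (RtoC r * z)).
Proof.
  intros Hr. apply (moderate_bound _ (fun z => 2 * RtoC (1 + / (r * Im z)))).
  - apply moderate_mult; [apply moderate_const|apply moderate_inv_im, Hr].
  - intros z Hz. assert (H := Rmult_lt_0_compat _ _ Hr Hz). assert (Q := Rinv_0_lt_compat _ H).
    rewrite Cmod_mult, !Cmod_R, !Rabs_pos_eq by lra.
    assert (B := euler_upper (RtoC r * z)). rewrite Im_RtoC_mult in B. apply B, H.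
Qed.

(** This is where the lower bound for the Euler product is used. *)
Lemma moderate_inv_euler r : (0 < r)%R -> moderate (fun z => / euler (RtoC r * z)).
Proof.
  intros Hr. assert (Q := Rinv_0_lt_compat _ Hr).
  apply (moderate_le _ (fun z => 4 / (1 - nome (r * Im z)))%R (4 * (1 + / r))); [lra| |].
  - intros z Hz. assert (H := Rmult_lt_0_compat _ _ Hr Hz). assert (B := nome_inv_bound _ H).
    destruct (gauge_ge z Hz) as [H1 [_ H3]]. assert (Q2 := Rinv_0_lt_compat _ Hz).
    rewrite Rinv_mult in B. unfold Rdiv.
    assert (P2 : (/ r * / Im z <= / r * gauge z)%R) by (apply Rmult_le_compat_l; lra). lra.
  - intros z Hz. assert (H := Rmult_lt_0_compat _ _ Hr Hz).
    assert (Hi : (0 < Im (RtoC r * z))%R) by (rewrite Im_RtoC_mult; exact H).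
    rewrite Cmod_inv by (apply euler_neq0, Hi).
    assert (L := euler_lower _ Hi). rewrite Im_RtoC_mult in L.
    replace (4 / (1 - nome (r * Im z)))%R with (- - (4 / (1 - nome (r * Im z))))%R by ring.
    rewrite (exp_Ropp (- _)). apply Rinv_le_contravar; [apply exp_pos|exact L].
Qed.

Lemma pc_mul_R z : pc * z = RtoC (INR p) * z.
Proof. rewrite pc_INR. reflexivity. Qed.

Lemma pc_div_R z : z / pc = RtoC (/ INR p) * z.
Proof. rewrite <- inv_pc_R. unfold Cdiv. ring. Qed.

Lemma eta_quot_explicit z : (0 < Im z)%R ->
  eta_quot z = ce (pc * z / 24) * euler (pc * z) * (ce (- (z / pc / 24)) * / euler (z / pc)).
Proof.
  intros Hz. assert (Hd := upper_div z Hz). unfold eta_quot. rewrite !eta_euler by (try apply upper_mul; assumption).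
  rewrite ce_opp. field. split; [apply euler_neq0, Hd|apply ce_neq0].
Qed.

Lemma moderate_eta_quot : moderate eta_quot.
Proof.
  assert (X := p_pos). assert (X2 := Rinv_0_lt_compat _ X).
  apply (moderate_ext (fun z => ce (RtoC (INR p / 24) * z) * euler (RtoC (INR p) * z) *
      (ce (RtoC (- (/ INR p / 24)) * z) * / euler (RtoC (/ INR p) * z)))).
  - intros z Hz. rewrite eta_quot_explicit by exact Hz. rewrite !pc_mul_R, pc_div_R.
    replace (RtoC (INR p / 24) * z) with (RtoC (INR p) * z / 24) by (rewrite RtoC_div by lra; field).
    replace (RtoC (- (/ INR p / 24)) * z) with (- (RtoC (/ INR p) * z / 24))
      by (rewrite RtoC_opp, RtoC_div by lra; field).
    reflexivity.
  - repeat apply moderate_mult; try apply moderate_ce; [apply moderate_euler|apply moderate_inv_euler]; assumption.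
Qed.

(** The denominator with n = 0 is the constant 1 - e(1/p), the others stay away from 0
    by a multiple of y. *)
Lemma moderate_appell_torsion : moderate (fun z => appell (/ pc) (z / pc)).
Proof.
  assert (X := p_pos). assert (X2 := Rinv_0_lt_compat _ X). assert (N := pc_neq0).
  (* the term n = 0 *)
  pose (D0 := Cmod (/ (1 - ce (/ pc)))). assert (HD0 : (0 <= D0)%R) by apply Cmod_ge_0.
  apply (moderate_bound _ (fun z => ce (/ pc / 2) * (2 * (RtoC D0 + RtoC (1 + / (/ INR p * Im z))) * RtoC (1 + / (/ INR p * Im z))))).
  - repeat apply moderate_mult; try apply moderate_const; try apply moderate_inv_im; try assumption.
    apply moderate_plus; [apply moderate_const|apply moderate_inv_im; assumption].
  - intros z Hz. assert (Hd := upper_div z Hz).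
    assert (EI : Im (z / pc) = (/ INR p * Im z)%R) by (rewrite pc_div_R; apply Im_RtoC_mult).
    set (y := (/ INR p * Im z)%R) in *. rewrite EI in Hd. assert (Q := Rinv_0_lt_compat _ Hd).
    rewrite <- RtoC_plus, !Cmod_mult, !Cmod_R, !(Rabs_pos_eq) by lra.
    eapply Rle_trans; [apply (appell_upper _ _ (D0 + (1 + / y)))|rewrite EI; lra]; rewrite ?EI; try lra.
    intros n. destruct (Z.eq_dec n 0) as [->|Hn].
    + change (cz 0) with (RtoC 0). replace (/ pc + 0 * (z / pc)) with (/ pc) by ring.
      fold D0. lra.
    + assert (A : (Cmod (/ (1 - ce (/ pc + cz n * (z / pc)))) <= 1 + / y)%R); [|lra].
      apply (inv_away _ (- (2 * PI * (IZR n * y)))); [|exact Hd|].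
      * rewrite Cmod_ce. do 3 f_equal. rewrite inv_pc_R. unfold cz. rewrite <- EI.
        change (Im (RtoC (/ INR p) + RtoC (IZR n) * (z / pc))) with (0 + Im (RtoC (IZR n) * (z / pc)))%R.
        rewrite Im_RtoC_mult. ring.
      * apply exp_arg_away; assumption.
Qed.

(** No denominator has |e(u) q^n| = 1, because l is not divisible by p. *)
Lemma moderate_appell_lattice l : ~ (Z.of_nat p | l)%Z -> moderate (fun z => appell (cz l * z) (pc * z)).
Proof.
  intros Hl. assert (X := p_pos).
  apply (moderate_bound _ (fun z => ce (RtoC (IZR l / 2) * z) * (2 * RtoC (1 + / (1 * Im z)) * RtoC (1 + / (INR p * Im z))))).
  - repeat apply moderate_mult; try apply moderate_const; try apply moderate_ce; apply moderate_inv_im; lra.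
  - intros z Hz. assert (Hu := upper_mul z Hz). assert (EI := Im_mul_pc z). rewrite EI in Hu.
    assert (Q := Rinv_0_lt_compat _ Hu). assert (Q2 := Rinv_0_lt_compat _ Hz). rewrite Rmult_1_l.
    rewrite !Cmod_mult, !Cmod_R, !(Rabs_pos_eq) by lra.
    replace (RtoC (IZR l / 2) * z) with (cz l * z / 2) by (rewrite RtoC_div by lra; unfold cz; field).
    eapply Rle_trans; [apply (appell_upper _ _ (1 + / Im z))|rewrite EI; lra]; rewrite ?EI; try lra.
    intros n.
    apply (inv_away _ (- (2 * PI * (IZR (l + n * Z.of_nat p) * Im z)))); [|exact Hz|].
    + rewrite Cmod_ce. do 3 f_equal. replace (cz l * z + cz n * (pc * z)) with (cz (l + n * Z.of_nat p) * z)
        by (rewrite cz_plus, cz_mult; fold pc; ring).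
      unfold cz. rewrite Im_RtoC_mult. reflexivity.
    + apply exp_arg_away; [exact Hz|]. intros E. apply Hl. exists (- n)%Z. lia.
Qed.

Lemma moderate_mock_part l : (1 <= l <= half_p)%nat -> moderate (mock_part l).
Proof.
  intros Hl. assert (X := p_pos). unfold mock_part. set (L := cz (Z.of_nat l)).
  apply moderate_mult.
  - apply (moderate_ext (fun z => ce (RtoC (- (3 / 2) * (IZR (Z.of_nat l) * IZR (Z.of_nat l)) * / INR p) * z))).
    + intros z Hz. f_equal. rewrite !RtoC_mult, RtoC_opp, RtoC_div by lra. fold (cz (Z.of_nat l)). fold L.
      rewrite <- inv_pc_R. unfold Cdiv. ring.
    + apply moderate_ce.
  - apply (moderate_ext (fun z => appell (L * z) (pc * z) + - (1) * (if Nat.ltb p (6 * l) then euler (pc * z) * ce (L * z / 2) else 0))).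
    { intros z _. ring. }
    apply moderate_plus; [apply moderate_appell_lattice, small_not_div, Hl|].
    apply moderate_mult; [apply moderate_const|].
    destruct (Nat.ltb p (6 * l)); [|apply moderate_const].
    apply (moderate_ext (fun z => euler (RtoC (INR p) * z) * ce (RtoC (IZR (Z.of_nat l) / 2) * z))).
    + intros z _. rewrite pc_mul_R. do 2 f_equal. rewrite RtoC_div by lra. unfold L, cz. field.
    + apply moderate_mult; [apply moderate_euler, X|apply moderate_ce].
Qed.

Theorem moderate_Jp : moderate Jp.
Proof.
  apply (moderate_ext (fun z => - (2 * Ci) * eta_quot z * appell (/ pc) (z / pc)
    + - (4 * chip) * bsum half_p (fun k => m1pow (Z.of_nat (S k)) * sine6 (S k) * mock_part (S k) z))).
  { intros z Hz. rewrite Jp_formula by exact Hz. ring. }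
  apply moderate_plus.
  - apply moderate_mult; [apply moderate_mult; [apply moderate_const|apply moderate_eta_quot]|apply moderate_appell_torsion].
  - apply moderate_mult; [apply moderate_const|]. apply moderate_bsum. intros k Hk.
    apply moderate_mult; [apply moderate_const|apply moderate_mock_part; lia].
Qed.

Lemma chol_pc_mul s : chol (fun z => pc * z) s.
Proof. apply chol_scal, chol_id. Qed.

Lemma chol_eta_quot z : (0 < Im z)%R -> chol eta_quot z.
Proof.
  intros Hz. assert (N := pc_neq0). assert (Hd := upper_div z Hz).
  apply (chol_ext (fun z => ce (pc * z / 24) * euler (pc * z) * (ce (- (z / pc / 24)) * / euler (z / pc)))).
  { destruct (Im_pos_near (fun w => w) z (chol_id z) Hz) as [d [Hd0 B]]. exists d. split; [exact Hd0|].
    intros w Hw. symmetry. apply eta_quot_explicit, (B w Hw). }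
  apply chol_mult; apply chol_mult.
  - apply chol_ce_comp. unfold Cdiv. apply chol_mult; [apply chol_pc_mul|apply chol_const].
  - apply chol_euler; [apply chol_pc_mul|apply upper_mul, Hz].
  - apply chol_ce_comp, chol_opp. unfold Cdiv. repeat apply chol_mult; try apply chol_const. apply chol_id.
  - apply chol_inv; [apply chol_euler; [apply chol_div_pc, chol_id|exact Hd]|apply euler_neq0, Hd].
Qed.

Theorem chol_Jp z : (0 < Im z)%R -> chol Jp z.
Proof.
  intros Hz. assert (N := pc_neq0).
  apply (chol_ext (fun z => - (2 * Ci) * eta_quot z * appell (/ pc) (z / pc)
    - 4 * chip * bsum half_p (fun k => m1pow (Z.of_nat (S k)) * sine6 (S k) * mock_part (S k) z))).
  { destruct (Im_pos_near (fun w => w) z (chol_id z) Hz) as [d [Hd0 B]]. exists d. split; [exact Hd0|].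
    intros w Hw. symmetry. apply Jp_formula, (B w Hw). }
  apply chol_minus.
  - apply chol_mult; [apply chol_scal, chol_eta_quot, Hz|].
    apply chol_appell; [apply chol_const|apply chol_div_pc, chol_id|apply upper_div, Hz|apply reg_inv_pc, Hz].
  - apply chol_scal, chol_bsum. intros k Hk. apply chol_scal. unfold mock_part.
    apply chol_mult; [apply chol_ce_comp, chol_div_pc, chol_scal, chol_id|].
    apply chol_minus.
    + apply chol_appell; [apply chol_scal, chol_id|apply chol_pc_mul|apply upper_mul, Hz|].
      apply reg_lz; [exact Hz|apply small_not_div; lia].
    + destruct (Nat.ltb p (6 * S k)); [|apply chol_const].
      apply chol_mult; [apply chol_euler; [apply chol_pc_mul|apply upper_mul, Hz]|].
      apply chol_ce_comp. unfold Cdiv. apply chol_mult; [apply chol_scal, chol_id|apply chol_const].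
Qed.
(** * The functions K *)

Lemma Jp_period z : (0 < Im z)%R -> Jp (z + pc) = Jp z.
Proof.
  intros Hz. rewrite (Jp_transform z 1 (Z.of_nat p) 0 1 Hz); try (exists 1%Z; lia); try (exists 0%Z; lia); [|lia].
  unfold mob, autj. change (cz 0) with (RtoC 0). change (cz 1) with (RtoC 1). fold pc.
  replace ((1 * z + pc) / (0 * z + 1)) with (z + pc) by field.
  field.
Qed.

(** T^r A T^(-r-b) lies in Gamma(p) for A in Gamma_1(p). *)
Lemma Jp_gamma1 z a b c d r : (0 < Im z)%R -> (a * d - b * c = 1)%Z ->
  (Z.of_nat p | a - 1)%Z -> (Z.of_nat p | c)%Z -> (Z.of_nat p | d - 1)%Z ->
  Jp (mob z a b c d + cz r) = autj z c d * Jp (z + cz (r + b)).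
Proof.
  intros Hz det [ka Ha] [kc Hc] [kd Hd].
  assert (NJ : autj z c d <> 0) by (apply (autj_neq0 z a b c d); assumption).
  (* the matrix T^r A T^(-s) *)
  set (s := (r + b)%Z).
  assert (Hz' : (0 < Im (z + cz s))%R) by (rewrite Im_add_cz; exact Hz).
  assert (E1 : autj (z + cz s) c (d - s * c) = autj z c d).
  { unfold autj. rewrite cz_sub, cz_mult. ring. }
  rewrite (Jp_transform (z + cz s) (a + r * c) (- s * (a + r * c) + b + r * d) c (d - s * c) Hz').
  - rewrite E1. replace (mob (z + cz s) (a + r * c) (- s * (a + r * c) + b + r * d) c (d - s * c))
      with (mob z a b c d + cz r).
    + field. exact NJ.
    + unfold mob. rewrite E1. unfold autj in *. repeat rewrite ?cz_sub, ?cz_plus, ?cz_mult, ?cz_opp. field. exact NJ.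
  - transitivity (a * d - b * c)%Z; [ring|exact det].
  - exists (- r * ka - b * ka - (r + b) * r * kc + r * kd)%Z.
    replace ((- r * ka - b * ka - (r + b) * r * kc + r * kd) * Z.of_nat p)%Z
      with (- r * (ka * Z.of_nat p) - b * (ka * Z.of_nat p) - (r + b) * r * (kc * Z.of_nat p) + r * (kd * Z.of_nat p))%Z by ring.
    rewrite <- Ha, <- Hc, <- Hd. unfold s. ring.
  - exists kc. exact Hc.
  - exists (kd - s * kc)%Z. rewrite Z.mul_sub_distr_r, <- Z.mul_assoc, <- Hc, <- Hd. ring.
Qed.

(** A sum over all residues modulo p may start anywhere. *)
Lemma bsum_period_shift (f : Z -> C) s : (forall r, f (r + Z.of_nat p)%Z = f r) ->
  bsum p (fun r => f (Z.of_nat r + s)%Z) = bsum p (fun r => f (Z.of_nat r)).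
Proof.
  intros Hf.
  assert (St : forall s, bsum p (fun r => f (Z.of_nat r + (s + 1))%Z) = bsum p (fun r => f (Z.of_nat r + s)%Z)).
  { intros s'. assert (E := bsum_S_first p (fun r => f (Z.of_nat r + s')%Z)). cbn [bsum] in E.
    replace (Z.of_nat p + s')%Z with (s' + Z.of_nat p)%Z in E by ring. rewrite Hf in E.
    rewrite (bsum_ext p _ (fun k => f (Z.of_nat (S k) + s')%Z)) by (intros k _; f_equal; lia).
    change (Z.of_nat 0 + s')%Z with s' in E.
    match type of E with ?x + ?y = ?y + ?w => replace w with (y + w - y) by ring; rewrite <- E; ring end. }
  induction s as [|s IH|s IH] using Z.peano_ind.
  - apply bsum_ext. intros r _. f_equal. lia.
  - unfold Z.succ. rewrite St. exact IH.
  - rewrite <- St. unfold Z.pred. rewrite <- IH. apply bsum_ext. intros r _. f_equal. lia.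
Qed.

Section Component.
Variable m : nat.

Definition kconst : C := RtoC (sin (PI / INR p)) * RtoC (1 / INR p).

(** The r-th summand of K, for any integer r; it depends on r modulo p only. *)
Definition kterm (r : Z) (z : C) : C := ce (- (cz r * cz (Z.of_nat m) / pc)) * Jp (z + cz r).

Lemma Kfun_sum z : Kfun p m z = kconst * bsum p (fun r => kterm (Z.of_nat r) z).
Proof.
  assert (X := p_pos). unfold Kfun. fold kconst. f_equal.
  rewrite <- bsum_csum. replace (S (p - 1)) with p by lia.
  apply bsum_ext. intros r _. unfold kterm, Jp. rewrite <- pc_INR, <- RtoC_INR. f_equal.
  unfold ce. f_equal. unfold Rdiv. rewrite !RtoC_mult, <- inv_pc_R, <- !RtoC_INR. unfold Cdiv. ring.
Qed.

Lemma kterm_period r z : (0 < Im z)%R -> kterm (r + Z.of_nat p) z = kterm r z.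
Proof.
  intros Hz. unfold kterm. rewrite cz_plus. fold pc. f_equal.
  - replace (- ((cz r + pc) * cz (Z.of_nat m) / pc)) with (- (cz r * cz (Z.of_nat m) / pc) + cz (- Z.of_nat m)).
    + apply ce_add_cz.
    + rewrite cz_opp. field. exact pc_neq0.
  - rewrite Cplus_assoc. apply Jp_period. rewrite Im_add_cz. exact Hz.
Qed.

(** The matrix permutes the translates by r -> r + b, and the character shifts by
    e(bm/p). *)
Lemma Kfun_gamma1 z a b c d : (0 < Im z)%R -> (a * d - b * c = 1)%Z ->
  (Z.of_nat p | a - 1)%Z -> (Z.of_nat p | c)%Z -> (Z.of_nat p | d - 1)%Z ->
  Kfun p m (mob z a b c d) = autj z c d * (ce (cz b * cz (Z.of_nat m) / pc) * Kfun p m z).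
Proof.
  intros Hz det Ha Hc Hd. rewrite !Kfun_sum.
  rewrite (bsum_ext p _ (fun r => autj z c d * ce (cz b * cz (Z.of_nat m) / pc) * kterm (Z.of_nat r + b) z)).
  - rewrite bsum_scal, (bsum_period_shift (fun r => kterm r z)) by (intros r; apply kterm_period, Hz). ring.
  - intros r _. unfold kterm. rewrite (Jp_gamma1 z a b c d) by assumption.
    replace (- (cz (Z.of_nat r) * cz (Z.of_nat m) / pc))
      with (cz b * cz (Z.of_nat m) / pc + - (cz (Z.of_nat r + b) * cz (Z.of_nat m) / pc))
      by (rewrite cz_plus; field; exact pc_neq0).
    rewrite ce_plus. ring.
Qed.

Lemma Kfun_gamma z a b c d : (0 < Im z)%R -> (a * d - b * c = 1)%Z ->
  (Z.of_nat p | a - 1)%Z -> (Z.of_nat p | b)%Z -> (Z.of_nat p | c)%Z -> (Z.of_nat p | d - 1)%Z ->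
  Kfun p m (mob z a b c d) = autj z c d * Kfun p m z.
Proof.
  intros Hz det Ha [k Hb] Hc Hd. rewrite Kfun_gamma1 by assumption.
  replace (cz b * cz (Z.of_nat m) / pc) with (cz (k * Z.of_nat m)).
  - rewrite ce_cz. ring.
  - rewrite Hb, !cz_mult. fold pc. field. exact pc_neq0.
Qed.

Lemma chol_Kfun z : (0 < Im z)%R -> chol (Kfun p m) z.
Proof.
  intros Hz. apply (chol_ext (fun z => kconst * bsum p (fun r => kterm (Z.of_nat r) z))).
  { exists 1%R. split; [lra|]. intros w _. symmetry. apply Kfun_sum. }
  apply chol_scal, chol_bsum. intros r _. unfold kterm. apply chol_scal.
  apply (chol_comp Jp (fun z => z + cz (Z.of_nat r))).
  - apply chol_Jp. rewrite Im_add_cz. exact Hz.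
  - apply chol_add_const, chol_id.
Qed.

Lemma moderate_Kfun : moderate (Kfun p m).
Proof.
  apply (moderate_ext (fun z => kconst * bsum p (fun r => kterm (Z.of_nat r) z))).
  { intros z _. symmetry. apply Kfun_sum. }
  apply moderate_mult; [apply moderate_const|]. apply moderate_bsum. intros r _. unfold kterm.
  apply moderate_mult; [apply moderate_const|].
  destruct moderate_Jp as [K [HK H]]. exists K. split; [exact HK|]. intros z Hz.
  replace (gauge z) with (gauge (z + cz (Z.of_nat r))) by (unfold gauge; rewrite Im_add_cz; reflexivity).
  apply H. rewrite Im_add_cz. exact Hz.
Qed.

Section Cusp.
Variables a b c d : Z.
Hypothesis det : (a * d - b * c = 1)%Z.

Let K_at_cusp (z : C) : C := / autj z c d * Kfun p m (mob z a b c d).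

Lemma chol_K_at_cusp z : (0 < Im z)%R -> chol K_at_cusp z.
Proof.
  intros Hz. assert (NJ : autj z c d <> 0) by (apply (autj_neq0 z a b c d); assumption).
  assert (HJ : forall a b, chol (fun w => cz a * w + cz b) z) by (intros; apply chol_affine).
  unfold K_at_cusp. apply chol_mult.
  - apply chol_inv; [apply HJ|exact NJ].
  - apply (chol_comp (Kfun p m) (fun w => mob w a b c d)).
    + apply chol_Kfun. apply mob_upper; assumption.
    + unfold mob. apply chol_div; [apply HJ|apply HJ|exact NJ].
Qed.

(** A T^p A^(-1) = 1 + p (-ac, a^2; -c^2, ac) lies in Gamma(p). *)
Lemma K_at_cusp_period z : (0 < Im z)%R -> K_at_cusp (z + cz (Z.of_nat p)) = K_at_cusp z.
Proof.
  intros Hz. assert (Hz' : (0 < Im (z + cz (Z.of_nat p)))%R) by (rewrite Im_add_cz; exact Hz).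
  assert (NJ : autj z c d <> 0) by (apply (autj_neq0 z a b c d); assumption).
  assert (NJ' : autj (z + cz (Z.of_nat p)) c d <> 0) by (apply (autj_neq0 _ a b c d); assumption).
  set (w := mob z a b c d). assert (Hw : (0 < Im w)%R) by (apply mob_upper; assumption).
  set (P := Z.of_nat p) in *.
  assert (Ej : autj w (- (P * c * c)) (1 + P * a * c) = autj (z + cz P) c d / autj z c d).
  { unfold autj, w, mob in *. unfold autj in *. repeat rewrite ?cz_plus, ?cz_mult, ?cz_opp. change (cz 1) with (RtoC 1).
    transitivity ((cz c * (z + cz P) + cz d + cz P * cz c * (cz a * cz d - cz b * cz c - 1)) / (cz c * z + cz d)).
    - field. exact NJ.
    - replace (cz a * cz d - cz b * cz c - 1) with (RtoC 0).
      + field. exact NJ.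
      + rewrite <- !cz_mult, <- cz_sub, det. change (cz 1) with (RtoC 1). ring. }
  assert (Ez : mob w (1 - P * a * c) (P * a * a) (- (P * c * c)) (1 + P * a * c) = mob (z + cz P) a b c d).
  { unfold mob at 1. rewrite Ej. unfold w, mob. unfold autj in *.
    repeat rewrite ?cz_sub, ?cz_plus, ?cz_mult, ?cz_opp. change (cz 1) with (RtoC 1).
    transitivity ((cz a * (z + cz P) + cz b + cz P * cz a * (cz a * cz d - cz b * cz c - 1)) / (cz c * (z + cz P) + cz d)).
    - field. split; assumption.
    - replace (cz a * cz d - cz b * cz c - 1) with (RtoC 0).
      + field. exact NJ'.
      + rewrite <- !cz_mult, <- cz_sub, det. change (cz 1) with (RtoC 1). ring. }
  unfold K_at_cusp. rewrite <- Ez, Kfun_gamma; try exact Hw.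
  - rewrite Ej. fold w. field. split; assumption.
  - ring.
  - exists (- (a * c))%Z. unfold P. ring.
  - exists (a * a)%Z. unfold P. ring.
  - exists (- (c * c))%Z. unfold P. ring.
  - exists (a * c)%Z. unfold P. ring.
Qed.

(** High up, |c z + d| lies between 1 and a multiple of y. *)
Lemma autj_bounds z : (1 <= Im z)%R -> (0 <= Re z <= INR p)%R ->
  (1 <= Cmod (autj z c d))%R /\
  (Cmod (autj z c d) <= (Rabs (IZR c) * (INR p + 1) + Rabs (IZR d)) * Im z)%R.
Proof.
  intros Hy Hx. split.
  - destruct (Z.eq_dec c 0) as [E|E].
    + unfold autj. rewrite E in *. change (cz 0) with (RtoC 0). rewrite Cmult_0_l, Cplus_0_l. unfold cz.
      rewrite Cmod_R, <- abs_IZR. apply IZR_le. assert (d <> 0)%Z by (intros ->; lia). lia.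
    + apply Rle_trans with (Rabs (Im (autj z c d))); [|apply im_le_Cmod].
      unfold autj. rewrite Im_add_cz. unfold cz. rewrite Im_RtoC_mult, Rabs_mult.
      assert (A : (1 <= Rabs (IZR c))%R) by (rewrite <- abs_IZR; apply IZR_le; lia).
      rewrite (Rabs_pos_eq (Im z)) by lra. nra.
  - unfold autj. eapply Rle_trans; [apply Cmod_triangle|]. unfold cz. rewrite Cmod_mult, !Cmod_R.
    assert (A := Rabs_pos (IZR c)). assert (B := Rabs_pos (IZR d)).
    assert (Q := Cmod_le_sum z). rewrite (Rabs_pos_eq (Re z)), (Rabs_pos_eq (Im z)) in Q by lra.
    assert (Q2 : (Cmod z <= (INR p + 1) * Im z)%R) by nra.
    assert (Q3 : (Rabs (IZR c) * Cmod z <= Rabs (IZR c) * ((INR p + 1) * Im z))%R) by (apply Rmult_le_compat_l; assumption).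
    nra.
Qed.

(** Im(Az) = y / |cz + d|^2 is at most y and at least a multiple of 1/y, so the bound for
    J becomes exponential in y. *)
Lemma K_at_cusp_growth : exists kappa, forall z, (1 <= Im z)%R -> (0 <= Re z <= INR p)%R ->
  (Cmod (K_at_cusp z) <= exp (kappa * Im z))%R.
Proof.
  destruct moderate_Kfun as [K [HK H]].
  (* 1 <= |cz + d| <= L y *)
  set (L := (Rabs (IZR c) * (INR p + 1) + Rabs (IZR d))%R).
  exists (K * (2 + L ^ 2))%R. intros z Hy Hx.
  assert (Hz : (0 < Im z)%R) by lra.
  destruct (autj_bounds z Hy Hx) as [B1 B2]. fold L in B2.
  assert (EI := Im_mob z a b c d Hz det). assert (HI := mob_upper z a b c d Hz det).
  set (j := Cmod (autj z c d)) in *. set (y := Im z) in *.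
  assert (NJ : autj z c d <> 0) by (apply (autj_neq0 z a b c d); assumption).
  unfold K_at_cusp. rewrite Cmod_mult, Cmod_inv by exact NJ. fold j.
  apply Rle_trans with (1 * exp (K * gauge (mob z a b c d)))%R.
  - apply Rmult_le_compat; [left; apply Rinv_0_lt_compat; lra|apply Cmod_ge_0| |apply H, HI].
    rewrite <- Rinv_1. apply Rinv_le_contravar; lra.
  - rewrite Rmult_1_l. apply exp_le_compat. rewrite Rmult_assoc. apply Rmult_le_compat_l; [exact HK|].
    unfold gauge. rewrite EI.
    assert (J2 : (1 <= j ^ 2)%R) by nra.
    assert (Q1 : (y / j ^ 2 <= y)%R).
    { apply Rmult_le_reg_r with (j ^ 2)%R; [lra|]. unfold Rdiv. rewrite Rmult_assoc, Rinv_l by lra. nra. }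
    assert (Q2 : (/ (y / j ^ 2) <= L ^ 2 * y)%R).
    { replace (/ (y / j ^ 2))%R with (j ^ 2 / y)%R by (field; split; lra).
      apply Rmult_le_reg_r with y; [lra|]. unfold Rdiv. rewrite Rmult_assoc, Rinv_l by lra.
      assert (Q3 : (j ^ 2 <= (L * y) ^ 2)%R) by (apply pow_incr; lra).
      rewrite Rpow_mult_distr in Q3. nra. }
    lra.
Qed.

Lemma K_at_cusp_meromorphic : meromorphic_at_infinity K_at_cusp.
Proof.
  destruct K_at_cusp_growth as [kappa H].
  apply (meromorphic_of_growth K_at_cusp p kappa); [lia|apply chol_K_at_cusp|apply K_at_cusp_period|exact H].
Qed.
End Cusp.

Lemma slash_eq A z : slash 1 (Kfun p m) A z =
  / autj z (mc A) (md A) * Kfun p m (mob z (ma A) (mb A) (mc A) (md A)).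
Proof. unfold slash, moebius, mob, autj, cz. f_equal. simpl. f_equal. cring. Qed.

Lemma Kfun_weakly_holomorphic (Gr : SL2Z -> Prop) :
  (forall A z, Gr A -> upper_half z -> slash 1 (Kfun p m) A z = Kfun p m z) ->
  weakly_holomorphic_modular_form 1 Gr (Kfun p m).
Proof.
  intros HG. repeat split.
  - intros z Hz. destruct (chol_here _ _ (chol_Kfun z Hz)) as [l Hl].
    exists l. apply cderiv_is_derive, Hl.
  - intros A HA z Hz. apply HG; assumption.
  - intros A. destruct (K_at_cusp_meromorphic (ma A) (mb A) (mc A) (md A) (det1 A)) as [N [n0 [cf [HN H]]]].
    exists N, n0, cf. split; [exact HN|]. intros z Hz. rewrite slash_eq. apply H, Hz.
Qed.

Lemma slash_gamma1 A z : Gamma1 (Z.of_nat p) A -> upper_half z ->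
  slash 1 (Kfun p m) A z = ce (cz (mb A) * cz (Z.of_nat m) / pc) * Kfun p m z.
Proof.
  intros [Ha [Hc Hd]] Hz. unfold congr in *. rewrite Z.sub_0_r in Hc. rewrite slash_eq.
  assert (NJ : autj z (mc A) (md A) <> 0) by (apply (autj_neq0 z (ma A) (mb A) (mc A) (md A)); [exact Hz|apply det1]).
  rewrite Kfun_gamma1 by (try assumption; apply det1). field. exact NJ.
Qed.
End Component.
End Level.

Theorem theorem6p3 (p : nat) (p_prime : prime (Z.of_nat p)) (p_gt3 : (3 < p)%nat) :
  weakly_holomorphic_modular_form 1 (Gamma1 (Z.of_nat p)) (Kfun p 0) /\
  (forall m : nat, (1 <= m <= p - 1)%nat ->
     weakly_holomorphic_modular_form 1 (Gamma (Z.of_nat p)) (Kfun p m) /\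
     (forall A : SL2Z, Gamma1 (Z.of_nat p) A ->
        forall z : C, upper_half z ->
          slash 1 (Kfun p m) A z =
          Cexp (RtoC (2 * PI * IZR (mb A) * INR m / INR p) * Ci) * Kfun p m z)).
Proof.
  assert (N := pc_neq0 p p_gt3).
  split.
  - apply Kfun_weakly_holomorphic; try assumption. intros A z HA Hz.
    rewrite (slash_gamma1 p p_prime p_gt3) by assumption.
    change (cz (Z.of_nat 0)) with (RtoC 0).
    replace (cz (mb A) * 0 / pc p) with (RtoC 0) by (field; exact N). rewrite ce_0. ring.
  - intros m Hm. split.
    + apply Kfun_weakly_holomorphic; try assumption. intros A z [Ha [Hb [Hc Hd]]] Hz.
      rewrite (slash_gamma1 p p_prime p_gt3) by first [exact Hz | exact (conj Ha (conj Hc Hd))].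
      destruct Hb as [k Hk]. rewrite Z.sub_0_r in Hk. rewrite Hk.
      replace (cz (k * Z.of_nat p) * cz (Z.of_nat m) / pc p) with (cz (k * Z.of_nat m)).
      * rewrite ce_cz. ring.
      * rewrite !cz_mult. change (cz (Z.of_nat p)) with (pc p). field. exact N.
    + intros A HA z Hz. rewrite (slash_gamma1 p p_prime p_gt3) by assumption. f_equal.
      unfold ce. f_equal. unfold Rdiv. rewrite !RtoC_mult, RtoC_INR, <- inv_pc_R by assumption.
      unfold cz, Cdiv. ring.
Qed.
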